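(* Let $1<p<\infty$ and suppose $T(a)+H(b)\in\mathcal F_{TH}^p(\kappa_1,\kappa_2)$ is invertible on $H^p$. Then: (i) if $\kappa_1\ge\kappa_2$ or $\kappa_1\kappa_2\ge0$, then $|\kappa_1|\le1$ and $|\kappa_2|\le1$; (ii) if $\kappa_1<0$ and $\kappa_2>0$, then: (a) if $\kappa_1,\kappa_2$ are both even, $\kappa_2=-\kappa_1$; (b) if $\kappa_1$ is odd and $\kappa_2$ even, $\kappa_2=-\kappa_1+\boldsymbol\sigma(c)$; (c) if $\kappa_1$ is even and $\kappa_2$ odd, $\kappa_2=-\kappa_1-\boldsymbol\sigma(d)$; (d) if $\kappa_1,\kappa_2$ are both odd, $\kappa_2=-\kappa_1+\boldsymbol\sigma(c)-\boldsymbol\sigma(d)$.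
   Context: $\mathbb T$ is the unit circle, $1<p<\infty$, $1/p+1/q=1$; $H^p=\{f\in L^p(\mathbb T):\hat f_n=0\ \forall n<0\}$, $\overline{H^p}=\{f\in L^p:\hat f_n=0\ \forall n>0\}$; $P$ is the Riesz projection onto $H^p$, $Q=I-P$, $(Jf)(t)=t^{-1}f(t^{-1})$, $\tilde a(t)=a(1/t)$. On $H^p$: $T(a)f=P(af)$, $H(a)f=P(aQJf)$. A pair $(a,b)$ with $a\in GL^\infty(\mathbb T)$ (invertible in $L^\infty$) and $b\in L^\infty(\mathbb T)$ is a matching pair if $a\tilde a=b\tilde b$; the subordinated pair is $(c,d)$, $c:=a/b$, $d:=a/\tilde b$, with $c\tilde c=d\tilde d=1$. We write $T(a)+H(b)\in\mathcal F_{TH}^p(\kappa_1,\kappa_2)$ if $(a,b)$ is a matching pair whose subordinated operators $T(c),T(d)$ are Fredholm on $H^p$ with $\operatorname{ind}T(c)=\kappa_1$, $\operatorname{ind}T(d)=\kappa_2$. A Wiener–Hopf factorization of $a\in L^\infty$ in $L^p$ is $a=a_-t^ma_+$ with $m\in\mathbb Z$, $a_+\in H^q$, $a_+^{-1}\in H^p$, $a_-\in\overline{H^p}$, $a_-^{-1}\in\overline{H^q}$, and $\|a_+^{-1}P(a_+\varphi)\|_p\le c_p\|\varphi\|_p$ for all trigonometric polynomials $\varphi$. If $g$ satisfies $g\tilde g=1$ and $T(g)$ is Fredholm on $H^p$ with index $n$, its Wiener–Hopf factorization normalized by $g_-(\infty)=1$ has the form $g=\boldsymbol\sigma(g)g_+t^{-n}\tilde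 g_+^{-1}$ with $\boldsymbol\sigma(g)=g_+(0)\in\{-1,1\}$, called the factorization signature. *)

(* Defs.v *)
(* Functions on the unit circle T are represented
   as functions f : R -> R[i] of the angle theta, t = e^{i theta}, and only
   their values on [0, 2 pi] matter; everything is modulo a.e. equality on
   [0, 2 pi] w.r.t. Lebesgue measure. *)
From HB Require Import structures.
From mathcomp Require Import all_boot all_algebra.
From mathcomp Require Import all_classical all_reals all_analysis.
From mathcomp Require Import complex.
From Stdlib Require Import ClassicalEpsilon.
Set Implicit Arguments. Unset Strict Implicit. Unset Printing Implicit Defensive.
Import GRing.Theory Num.Theory.
Local Open Scope ring_scope.
Local Open Scope classical_set_scope.

Section Defs.
Variable R : realType.
Local Notation C := R[i].
Local Notation mu := (@lebesgue_measure R).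

Definition circ : set R := `[0, 2 * pi]%classic.

Definition cabs (z : C) : R := Num.sqrt (complex.Re z ^+ 2 + complex.Im z ^+ 2).

Definition cexp (x : R) : C := (cos x +i* sin x)%C.

Definition tpow (m : int) : R -> C := fun th => cexp (m%:~R * th).

Definition cint (f : R -> C) : C :=
  (Rintegral mu circ (fun x => complex.Re (f x)) +i*
   Rintegral mu circ (fun x => complex.Im (f x)))%C.

Definition fhat (f : R -> C) (n : int) : C :=
  ((2 * pi)^-1)%:C%C * cint (fun th => f th * cexp (- (n%:~R * th))).

Definition cmeas (f : R -> C) : Prop :=
  measurable_fun circ (fun x => complex.Re (f x)) /\
  measurable_fun circ (fun x => complex.Im (f x)).

Definition lpint (p : R) (f : R -> C) : \bar R :=
  (\int[mu]_(x in circ) ((cabs (f x)) `^ p)%:E)%E.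

Definition aeq (f g : R -> C) : Prop := {ae mu, forall x, circ x -> f x = g x}.

Definition inLp (p : R) (f : R -> C) : Prop := cmeas f /\ (lpint p f < +oo)%E.

Definition inLinf (f : R -> C) : Prop :=
  cmeas f /\ exists M : R, {ae mu, forall x, circ x -> cabs (f x) <= M}.

Definition inGLinf (f : R -> C) : Prop :=
  inLinf f /\ exists2 delta : R, 0 < delta &
    {ae mu, forall x, circ x -> delta <= cabs (f x)}.

Definition inHp (p : R) (f : R -> C) : Prop :=
  inLp p f /\ forall n : int, n < 0 -> fhat f n = 0.
Definition inHpbar (p : R) (f : R -> C) : Prop :=
  inLp p f /\ forall n : int, 0 < n -> fhat f n = 0.

(* tilde a (t) = a (1/t) *)
Definition tilde (a : R -> C) : R -> C := fun th => a (2 * pi - th).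

(* (J f)(t) = t^{-1} f(t^{-1}) *)
Definition Jop (f : R -> C) : R -> C := fun th => cexp (- th) * f (2 * pi - th).

(* Riesz projection: P h is the (a.e. unique) integrable function with vanishing
   negative Fourier coefficients and the same nonnegative coefficients as h *)
Definition rieszP (h : R -> C) : R -> C :=
  epsilon (inhabits (fun _ => 0 : C))
    (fun g => inLp 1 g /\ (forall n : int, n < 0 -> fhat g n = 0) /\
              (forall n : int, 0 <= n -> fhat (fun x => h x - g x) n = 0)).

Definition Qop (h : R -> C) : R -> C := fun x => h x - rieszP h x.

Definition Top (a : R -> C) (f : R -> C) : R -> C := rieszP (fun x => a x * f x).
Definition Hop (b : R -> C) (f : R -> C) : R -> C :=
  rieszP (fun x => b x * Qop (Jop f) x).
Definition THop (a b : R -> C) (f : R -> C) : R -> C :=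
  fun x => Top a f x + Hop b f x.

Definition lincomb (k : nat) (e : 'I_k -> R -> C) (c : 'I_k -> C) : R -> C :=
  fun x => \sum_(i < k) c i * e i x.

Definition kernel_dim (p : R) (A : (R -> C) -> R -> C) (k : nat) : Prop :=
  exists e : 'I_k -> R -> C,
    (forall i, inHp p (e i) /\ aeq (A (e i)) (fun _ => 0)) /\
    (forall c, aeq (lincomb e c) (fun _ => 0) -> forall i, c i = 0) /\
    (forall f, inHp p f -> aeq (A f) (fun _ => 0) -> exists c, aeq f (lincomb e c)).

Definition cokernel_dim (p : R) (A : (R -> C) -> R -> C) (m : nat) : Prop :=
  exists g : 'I_m -> R -> C,
    (forall i, inHp p (g i)) /\
    (forall f c, inHp p f -> aeq (fun x => A f x + lincomb g c x) (fun _ => 0) ->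
       forall i, c i = 0) /\
    (forall h, inHp p h -> exists f c,
       inHp p f /\ aeq h (fun x => A f x + lincomb g c x)).

Definition closed_range (p : R) (A : (R -> C) -> R -> C) : Prop :=
  forall (u : nat -> R -> C) (h : R -> C),
    (forall n, inHp p (u n)) -> inHp p h ->
    (lpint p (fun x => A (u n) x - h x) @[n --> \oo] --> 0%E) ->
    exists2 f, inHp p f & aeq (A f) h.

Definition fredholm (p : R) (A : (R -> C) -> R -> C) (kappa : int) : Prop :=
  closed_range p A /\
  exists k m, kernel_dim p A k /\ cokernel_dim p A m /\ kappa = k%:Z - m%:Z.

Definition invertible_Hp (p : R) (A : (R -> C) -> R -> C) : Prop :=
  (forall h, inHp p h -> exists2 f, inHp p f & aeq (A f) h) /\
  (forall f, inHp p f -> aeq (A f) (fun _ => 0) -> aeq f (fun _ => 0)).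

Definition matching (a b : R -> C) : Prop :=
  inGLinf a /\ inLinf b /\
  aeq (fun x => a x * tilde a x) (fun x => b x * tilde b x).
Definition subc (a b : R -> C) : R -> C := fun x => a x / b x.
Definition subd (a b : R -> C) : R -> C := fun x => a x / tilde b x.

Definition in_FTH (p : R) (a b : R -> C) (kappa1 kappa2 : int) : Prop :=
  matching a b /\ fredholm p (Top (subc a b)) kappa1 /\
  fredholm p (Top (subd a b)) kappa2.

Definition trigpol (N : nat) (c : int -> C) : R -> C :=
  fun th => \sum_(k < (2 * N).+1) c (k%:Z - N%:Z) * tpow (k%:Z - N%:Z) th.

Definition conj_exp (p : R) : R := p / (p - 1).

Definition wh_fact (p : R) (g gm : R -> C) (m : int) (gp : R -> C) : Prop :=
  aeq g (fun x => gm x * tpow m x * gp x) /\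
  inHp (conj_exp p) gp /\ inHp p (fun x => (gp x)^-1) /\
  inHpbar p gm /\ inHpbar (conj_exp p) (fun x => (gm x)^-1) /\
  exists2 cp : R, 0 <= cp & forall (N : nat) (c : int -> C),
    (lpint p (fun x => (gp x)^-1 * rieszP (fun y => gp y * trigpol N c y) x)%R
      <= (cp `^ p)%:E * lpint p (trigpol N c))%E.

(* factorization signature: sigma(g) = g_+(0) for the Wiener-Hopf factorization
   normalized by g_-(infty) = 1 (values at 0 / infty are the 0-th Fourier
   coefficients) *)
Definition fsig (p : R) (g : R -> C) : C :=
  let t := epsilon (inhabits ((fun _ => 0 : C), 0%R : int, (fun _ => 0 : C)))
             (fun t => wh_fact p g t.1.1 t.1.2 t.2 /\ fhat t.1.1 0 = 1) in
  fhat t.2 0.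

End Defs.

(* Main.v *)
(* Every identity T(g) f = y in H^p is read as g f - y \in J H^p, and T(a)f + H(b)f = y as a f + b J f - y \in J H^p.
   Since L^p = H^p + J H^p with bounded projections (M. Riesz), a symbol g with g g~ = 1 and ind T(g) = n makes
   T(g t^n) invertible; phi = T(g t^n)^-1 1 satisfies g t^n phi = sg phi~ with sg = phi^(0) = 1 or -1, and 1/phi lies
   in H^q, which is the Wiener-Hopf factorization g = sg t^-n phi~ / phi, of signature sg. Hence the solutions of
   g f = ep J f, ep = 1 or -1, are the products phi s with s a polynomial of degree < n such that
   s_j = ep sg s_(n-1-j).
   The function v = a f + b J f always satisfies d J v = v. If T(c) is onto, this identifies the kernel of T(a) + H(b)
   with {c f = - J f} + {d h = J h}, so that injectivity forces kappa1, kappa2 <= 1 when kappa1 >= 0. If kappa2 <= 0,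
   the same relation yields explicit functions outside the range unless kappa1, kappa2 >= -1. If kappa1 < 0 < kappa2,
   write T(a) + H(b) = (T(a t^-n) + H(b t^n)) T(t^n) with kappa1 + 2n equal to 0 or 1: invertibility makes the kernel
   of the left factor n-dimensional, while the description above computes this dimension from kappa1 + 2n, kappa2 and
   the two signatures. *)
Require Import Defs.
From HB Require Import structures.
From mathcomp Require Import all_boot all_order all_algebra.
From mathcomp Require Import all_classical all_reals all_analysis measurable_realfun.
From mathcomp Require Import complex ring lra zify.
From Stdlib Require Import ClassicalEpsilon.
Set Implicit Arguments. Unset Strict Implicit. Unset Printing Implicit Defensive.
Import Order.TTheory GRing.Theory Num.Theory.
Import numFieldNormedType.Exports.
Local Open Scope ring_scope.
Local Open Scope classical_set_scope.

(** * Complex numbers and exponentials *)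
Section Basics.
Variable R : realType.
Local Notation C := R[i].
Local Notation mu := (@lebesgue_measure R).
Implicit Types (z w : C) (p q : R) (f g h : R -> C).

(** The change a -> a t^-n, b -> b t^n keeps the matching relation, moves the index of T(c) by 2n
    and leaves d alone; hence the parity of kappa1 persists. The signatures enter because symmetric
    polynomials of odd length k form a space of dimension (k + 1)/2 or (k - 1)/2, according to the
    sign of the symmetry. Two facts are less direct than they look. Fredholmness is given by
    dimensions alone, and T(g t^n) must be shown bijective: a kernel of dimension k is determined by
    its first k coefficients, so t^k removes it without changing the range, while no nonzero
    polynomial of degree < m lies in a range of codimension m, as otherwise the range and fewer than
    m monomials would contain all polynomials and, by the open mapping theorem and density,
    everything. And nothing in g phi = sg phi~ controls 1/phi: it is obtained as the limit almost
    everywhere of polynomials s for which T(g)(phi s) tends to T(g)1, bounded in L^q by duality. *)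

Lemma cabsE z : cabs z = ComplexField.Normc.normc z.
Proof. by case: z. Qed.
Lemma cabs_ge0 z : 0 <= cabs z. Proof. exact: sqrtr_ge0. Qed.
Lemma cabsM z w : cabs (z * w) = cabs z * cabs w.
Proof. by rewrite !cabsE ComplexField.Normc.normcM. Qed.
Lemma cabsV z : cabs z^-1 = (cabs z)^-1.
Proof. by rewrite !cabsE ComplexField.Normc.normcV. Qed.
Lemma cabsD z w : cabs (z + w) <= cabs z + cabs w.
Proof. by rewrite !cabsE le_normcD. Qed.
Lemma cabsN z : cabs (- z) = cabs z.
Proof. by rewrite !cabsE normcN. Qed.
Lemma cabs0 : cabs (0 : C) = 0.
Proof. by rewrite !cabsE ComplexField.Normc.normc0. Qed.
Lemma cabs1 : cabs (1 : C) = 1.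
Proof. by rewrite !cabsE ComplexField.Normc.normc1. Qed.
Lemma cabs_eq0 z : (cabs z == 0) = (z == 0).
Proof.
apply/eqP/eqP => [|->]; last exact: cabs0.
by rewrite cabsE => /ComplexField.Normc.eq0_normc.
Qed.
Lemma cabsB z w : cabs (z - w) <= cabs z + cabs w.
Proof. by rewrite -(cabsN w) cabsD. Qed.
Lemma cabs_gt0 z : (0 < cabs z) = (z != 0).
Proof. by rewrite lt_neqAle cabs_ge0 andbT eq_sym cabs_eq0. Qed.
Lemma cabs_sum (I : Type) (r : seq I) (P : pred I) (F : I -> C) :
  cabs (\sum_(i <- r | P i) F i) <= \sum_(i <- r | P i) cabs (F i).
Proof.
elim/big_rec2: _ => [|i y x _ h]; first by rewrite cabs0.
by rewrite (le_trans (cabsD _ _)) // lerD2l.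
Qed.
Lemma cabs_sqr z : cabs z ^+ 2 = complex.Re z ^+ 2 + complex.Im z ^+ 2.
Proof. by rewrite sqr_sqrtr // addr_ge0 // sqr_ge0. Qed.
Lemma Re_le_cabs z : `|complex.Re z| <= cabs z.
Proof.
by rewrite -ler_sqr ?nnegrE ?cabs_ge0 // cabs_sqr real_normK ?num_real // lerDl sqr_ge0.
Qed.
Lemma Im_le_cabs z : `|complex.Im z| <= cabs z.
Proof.
by rewrite -ler_sqr ?nnegrE ?cabs_ge0 // cabs_sqr real_normK ?num_real // lerDr sqr_ge0.
Qed.
Lemma cabs_real (x : R) : cabs x%:C%C = `|x|.
Proof. by rewrite /cabs /= expr0n addr0 sqrtr_sqr. Qed.
Lemma cabs_i : cabs ('i%C : C) = 1.
Proof. by rewrite /cabs /= expr0n add0r expr1n sqrtr1. Qed.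
Lemma cabs_conj z : cabs (z^*)%C = cabs z.
Proof. by case: z => a b; rewrite /cabs /= sqrrN. Qed.
Lemma complexRI z : z = (complex.Re z)%:C%C + 'i%C * (complex.Im z)%:C%C.
Proof. by case: z => a b; simpc. Qed.
Lemma cabs_le z : cabs z <= `|complex.Re z| + `|complex.Im z|.
Proof.
by rewrite {1}[z]complexRI (le_trans (cabsD _ _)) // cabsM cabs_i mul1r !cabs_real.
Qed.
Lemma ReD z w : complex.Re (z + w) = complex.Re z + complex.Re w.
Proof. by case: z w => ? ? [? ?]. Qed.
Lemma ImD z w : complex.Im (z + w) = complex.Im z + complex.Im w.
Proof. by case: z w => ? ? [? ?]. Qed.
Lemma ReN z : complex.Re (- z) = - complex.Re z.
Proof. by case: z. Qed.
Lemma ImN z : complex.Im (- z) = - complex.Im z.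
Proof. by case: z. Qed.
Lemma ReM z w : complex.Re (z * w) = complex.Re z * complex.Re w - complex.Im z * complex.Im w.
Proof. by case: z w => ? ? [? ?]. Qed.
Lemma ImM z w : complex.Im (z * w) = complex.Re z * complex.Im w + complex.Im z * complex.Re w.
Proof. by case: z w => ? ? [? ?] //=; rewrite addrC. Qed.
Lemma ReV z : complex.Re z^-1 = complex.Re z / (cabs z ^+ 2).
Proof. by rewrite cabs_sqr; case: z => a b. Qed.
Lemma ImV z : complex.Im z^-1 = - complex.Im z / (cabs z ^+ 2).
Proof. by rewrite cabs_sqr; case: z => a b /=; rewrite mulNr. Qed.

Lemma cexpD x y : cexp (x + y) = cexp x * cexp y :> C.
Proof. by rewrite /cexp; simpc; rewrite cosD sinD; congr (_ +i* _)%C; ring. Qed.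
Lemma cexp0 : cexp 0 = 1 :> C.
Proof. by rewrite /cexp cos0 sin0. Qed.
Lemma cabs_cexp x : cabs (cexp x : C) = 1.
Proof. by rewrite /cabs /= cos2Dsin2 sqrtr1. Qed.
Lemma cexp_neq0 x : cexp x != 0 :> C.
Proof. by rewrite -cabs_eq0 cabs_cexp oner_eq0. Qed.
Lemma cexpN x : cexp (- x) = (cexp x)^-1 :> C.
Proof.
apply: (mulIf (cexp_neq0 x)); rewrite -cexpD addNr cexp0 mulVf //; exact: cexp_neq0.
Qed.
Lemma cexp_conj x : ((cexp x : C)^*)%C = (cexp x)^-1 :> C.
Proof. by rewrite -cexpN /cexp cosN sinN. Qed.
Lemma cexp2pi : cexp (2 * pi) = 1 :> C.
Proof. by rewrite /cexp mulr_natl cos2pi sin2pi. Qed.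
Lemma cexpMn n x : cexp (n%:R * x) = cexp x ^+ n :> C.
Proof.
elim: n => [|n IH]; first by rewrite mul0r cexp0.
by rewrite -addn1 natrD mulrDl cexpD IH mul1r exprD expr1.
Qed.
Lemma tpowE (m : int) x : tpow m x = cexp x ^ m :> C.
Proof.
case: m => n; rewrite /tpow; first exact: cexpMn.
by rewrite NegzE mulrNz mulNr cexpN cexpMn.
Qed.
Lemma cexp2piB x : cexp (2 * pi - x) = (cexp x)^-1 :> C.
Proof. by rewrite cexpD cexp2pi mul1r cexpN. Qed.
End Basics.

(** * Measurability on the circle *)
Section Meas.
Variable R : realType.
Local Notation C := R[i].
Local Notation mu := (@lebesgue_measure R).
Local Notation TT := (@circ R).
Implicit Types (z w : C) (p q : R) (f g h : R -> C).

Lemma measurable_circ : measurable TT.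
Proof. exact: measurable_itv. Qed.
Hint Resolve measurable_circ : core.

Lemma pi2_gt0 : 0 < 2 * pi :> R.
Proof. by rewrite mulr_gt0 // pi_gt0. Qed.

Lemma mu_circ : mu TT = (2 * pi)%:E.
Proof.
rewrite lebesgue_measure_itv /= lte_fin pi2_gt0 oppr0 adde0 //.
Qed.

(** Inversion of nonnegative values is the power -1, also at 0, where both conventions give 0. *)
Lemma measurable_inv_ge0 (D : set R) (g : R -> R) : measurable_fun D g ->
  (forall x, 0 <= g x) -> measurable_fun D (fun x => (g x)^-1).
Proof.
move=> mg g0; rewrite (_ : (fun x => _) = (fun x => g x `^ (-1))).
  by apply: (@measurableT_comp _ _ _ _ _ _ (fun x => x `^ (-1))) => //; exact: measurable_powR.
by apply/funext => x; rewrite powR_inv1.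
Qed.

Lemma measurable_powR_fun (D : set R) (g : R -> R) p : measurable_fun D g ->
  measurable_fun D (fun x => g x `^ p).
Proof. by move=> mg; apply: (@measurableT_comp _ _ _ _ _ _ (fun x => x `^ p)) => //; exact: measurable_powR. Qed.

Lemma measurable_sqrt_fun (D : set R) (g : R -> R) : measurable_fun D g ->
  measurable_fun D (fun x => Num.sqrt (g x)).
Proof.
move=> mg; apply: (@measurableT_comp _ _ _ _ _ _ (fun x : R => Num.sqrt x)) => //.
apply: continuous_measurable_fun; exact: sqrt_continuous.
Qed.

Lemma cmeas_cabs f : cmeas f -> measurable_fun TT (fun x => cabs (f x)).
Proof.
move=> [m1 m2]; apply: measurable_sqrt_fun.
by apply: measurable_funD; apply: measurable_funX.
Qed.

Lemma cmeas_cst z : cmeas (fun _ => z).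
Proof. by split; exact: measurable_cst. Qed.

Lemma cmeasD f g : cmeas f -> cmeas g -> cmeas (fun x => f x + g x).
Proof.
move=> [f1 f2] [g1 g2]; split.
  by under eq_fun do rewrite ReD; exact: measurable_funD.
by under eq_fun do rewrite ImD; exact: measurable_funD.
Qed.

Lemma cmeasN f : cmeas f -> cmeas (fun x => - f x).
Proof.
move=> [f1 f2]; split.
  by under eq_fun do rewrite ReN; exact: measurable_funN.
by under eq_fun do rewrite ImN; exact: measurable_funN.
Qed.

Lemma cmeasB f g : cmeas f -> cmeas g -> cmeas (fun x => f x - g x).
Proof. by move=> mf mg; apply: cmeasD => //; exact: cmeasN. Qed.

Lemma cmeasM f g : cmeas f -> cmeas g -> cmeas (fun x => f x * g x).
Proof.
move=> [f1 f2] [g1 g2]; split.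
  by under eq_fun do rewrite ReM; apply: measurable_funB; exact: measurable_funM.
by under eq_fun do rewrite ImM; apply: measurable_funD; exact: measurable_funM.
Qed.

Lemma cmeasV f : cmeas f -> cmeas (fun x => (f x)^-1).
Proof.
move=> mf; have mV : measurable_fun TT (fun x => (cabs (f x) ^+ 2)^-1).
  apply: measurable_inv_ge0; last by move=> x; exact: sqr_ge0.
  by apply: measurable_funX; exact: cmeas_cabs.
case: mf => f1 f2; split.
  by under eq_fun do rewrite ReV; exact: measurable_funM.
under eq_fun do rewrite ImV; apply: measurable_funM => //; exact: measurable_funN.
Qed.

Lemma cmeas_conj f : cmeas f -> cmeas (fun x => (f x)^*%C).
Proof.
move=> [f1 f2]; split.
  by rewrite (_ : (fun x => _) = (fun x => complex.Re (f x))) //; apply/funext => x; case: (f x).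
rewrite (_ : (fun x => _) = (fun x => - complex.Im (f x))) //; last by apply/funext => x; case: (f x).
exact: measurable_funN.
Qed.

Lemma cmeas_real (g : R -> R) : measurable_fun TT g -> cmeas (fun x => (g x)%:C%C).
Proof. by move=> mg; split => //=; exact: measurable_cst. Qed.

Lemma cmeas_sum (I : Type) (r : seq I) (P : pred I) (F : I -> R -> C) :
  (forall i, P i -> cmeas (F i)) -> cmeas (fun x => \sum_(i <- r | P i) F i x).
Proof.
move=> h; elim: r => [|i r IH].
  by under eq_fun do rewrite big_nil; exact: cmeas_cst.
under eq_fun do rewrite big_cons.
case: (boolP (P i)) => Pi; last exact: IH.
by apply: cmeasD => //; exact: h.
Qed.

Lemma cmeas_cexp (k : R) : cmeas (fun x => cexp (k * x) : C).
Proof.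
split => /=; apply: measurable_funTS; apply: continuous_measurable_fun => x;
  apply: continuous_comp; try exact: mulrl_continuous; [exact: continuous_cos|exact: continuous_sin].
Qed.

Lemma cmeas_tpow m : cmeas (tpow m : R -> C).
Proof. exact: cmeas_cexp. Qed.

(** The closed interval is symmetric about pi, so t -> 1/t acts on it as theta -> 2 pi - theta and
    no periodic extension of functions is involved. *)
Lemma reflect_circ : (fun x : R => 2 * pi - x) @^-1` TT = TT.
Proof.
apply/seteqP; split => x; rewrite /circ /= !in_itv /= => /andP[h1 h2]; apply/andP; split; lra.
Qed.

Lemma cmeas_comp_reflect f : cmeas f -> cmeas (fun x => f (2 * pi - x)).
Proof.
have mr : measurable_fun TT (fun x : R => 2 * pi - x).
  by apply: measurable_funB => //; exact: measurable_cst.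
have H (g : R -> R) : measurable_fun TT g -> measurable_fun TT (fun x => g (2 * pi - x)).
  move=> mg; apply: (@measurable_comp _ _ _ _ _ _ TT g TT (fun x : R => 2 * pi - x)) => //.
  by move=> _ [x cx <-]; move: cx; rewrite -{1}reflect_circ.
by move=> [f1 f2]; split; [exact: (H (fun x => complex.Re (f x)))|exact: (H (fun x => complex.Im (f x)))].
Qed.

Lemma cmeas_tilde f : cmeas f -> cmeas (tilde f).
Proof. exact: cmeas_comp_reflect. Qed.

Lemma cmeas_Jop f : cmeas f -> cmeas (Jop f).
Proof.
move=> mf; apply: cmeasM; last exact: cmeas_comp_reflect.
by under eq_fun do rewrite -mulN1r; exact: cmeas_cexp.
Qed.

Lemma ae_forall (P : R -> Prop) : (forall x, TT x -> P x) -> {ae mu, forall x, TT x -> P x}.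
Proof. by move=> h; apply: aeW. Qed.

Lemma ae_imp (P Q : R -> Prop) : (forall x, TT x -> P x -> Q x) ->
  {ae mu, forall x, TT x -> P x} -> {ae mu, forall x, TT x -> Q x}.
Proof. move=> h; apply: filterS; first exact: (ae_filter_ringOfSetsType mu).
by move=> x Px cx; apply: h => //; exact: Px. Qed.

Lemma ae_imp2 (P P' Q : R -> Prop) : (forall x, TT x -> P x -> P' x -> Q x) ->
  {ae mu, forall x, TT x -> P x} -> {ae mu, forall x, TT x -> P' x} ->
  {ae mu, forall x, TT x -> Q x}.
Proof. move=> h; apply: filterS2; first exact: (ae_filter_ringOfSetsType mu).
by move=> x Px P'x cx; apply: h; [|exact: Px|exact: P'x]. Qed.
Lemma ae_and (P Q : R -> Prop) : {ae mu, forall x, TT x -> P x} -> {ae mu, forall x, TT x -> Q x} ->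
  {ae mu, forall x, TT x -> P x /\ Q x}.
Proof. exact: ae_imp2. Qed.

Lemma aeq_refl f : aeq f f.
Proof. by apply: aeW. Qed.
Lemma aeq_eq f g : (forall x, f x = g x) -> aeq f g.
Proof. by move=> h; apply: aeW. Qed.
Lemma aeq_sym f g : aeq f g -> aeq g f.
Proof. by apply: ae_imp. Qed.
Lemma aeq_trans g f h : aeq f g -> aeq g h -> aeq f h.
Proof. by apply: ae_imp2 => x _ -> ->. Qed.

Lemma measurable_reflect : measurable_fun [set: measurableTypeR R] (fun x : R => 2 * pi - x : measurableTypeR R).
Proof. by apply: measurable_funB => //; exact: measurable_cst. Qed.

(** By uniqueness of Lebesgue measure it suffices to compare on half-open intervals; their
    reflections are closed at the other end, which does not affect the length. *)
Lemma mu_reflect (A : set R) : measurable A ->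
  mu ((fun x : R => 2 * pi - x) @^-1` A) = mu A.
Proof.
move=> mA.
rewrite -[LHS]/(pushforward mu (fun x : R => 2 * pi - x : measurableTypeR R) A).
apply/esym; apply: (@lebesgue_measure_unique R
  (pushforward mu (fun x : R => 2 * pi - x : measurableTypeR R))) => //=.
  exact: measurable_reflect.
move=> mphi X [[a b]] _ <-; rewrite /pushforward.
rewrite (_ : _ @^-1` _ = `[2 * pi - b, 2 * pi - a[%classic); last first.
  apply/seteqP; split => x /=; rewrite !in_itv /= => /andP[h1 h2]; apply/andP; split; lra.
rewrite !lebesgue_measure_itv /= !lte_fin.
have -> : (2 * pi - b < 2 * pi - a) = (a < b) by lra.
case: ifP => // _; rewrite -!EFinD; congr (_%:E); lra.
Qed.

Lemma ge0_integral_reflect (g : R -> \bar R) : measurable_fun TT g ->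
  (forall x, TT x -> (0 <= g x)%E) ->
  (\int[mu]_(x in TT) g (2 * pi - x)%R = \int[mu]_(x in TT) g x)%E.
Proof.
move=> mg g0; rewrite -{1}reflect_circ.
have /= <- := @ge0_integral_pushforward _ _ (measurableTypeR R) (measurableTypeR R) R _ measurable_reflect mu TT g measurable_circ mg.
  apply: eq_measure_integral => [|mphi A mA _]; first exact: measurable_reflect.
  exact: mu_reflect.
by move=> x; rewrite inE; exact: g0.
Qed.

Lemma ae_reflect (P : R -> Prop) : {ae mu, forall x, TT x -> P x} ->
  {ae mu, forall x, TT x -> P (2 * pi - x)}.
Proof.
move=> [N [mN N0 sN]].
exists ((fun x : R => 2 * pi - x) @^-1` N); split.
- by rewrite -[X in measurable X]setTI; exact: measurable_reflect.
- by rewrite mu_reflect.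
- move=> x /= h; apply: sN => /= h'; apply: h => cx; apply: h'.
  by rewrite -reflect_circ /= (_ : 2 * pi - (2 * pi - x) = x) //; lra.
Qed.

Lemma aeq_tilde f g : aeq f g -> aeq (tilde f) (tilde g).
Proof. exact: (@ae_reflect (fun x => f x = g x)). Qed.

Lemma aeq_Jop f g : aeq f g -> aeq (Jop f) (Jop g).
Proof. by move/aeq_tilde; apply: ae_imp => x _; rewrite /tilde /Jop => ->. Qed.

Lemma tildeK f : tilde (tilde f) = f.
Proof. by apply/funext => x; rewrite /tilde; congr f; lra. Qed.

Lemma JopK f : Jop (Jop f) = f.
Proof.
apply/funext => x; rewrite /Jop mulrA -cexpD.
rewrite (_ : - x + _ = - (2 * pi)); last by lra.
by rewrite cexpN cexp2pi invr1 mul1r; congr f; lra.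
Qed.

Lemma JopE f x : Jop f x = (cexp x)^-1 * tilde f x.
Proof. by rewrite /Jop cexpN. Qed.

End Meas.

(** * The spaces L^p *)
Section Norms.
Variable R : realType.
Local Notation C := R[i].
Local Notation mu := (@lebesgue_measure R).
Local Notation TT := (@circ R).
Implicit Types (z w : C) (p q : R) (f g h : R -> C).

(* [Lp] is [inLp], [lpi] is [lpint], and below [ci] is [cint] and [fc] is [fhat]; they are locked because the
   conversion test would otherwise unfold integrals. *)
Fact lp_key : unit. Proof. exact: tt. Qed.
Definition Lp : R -> (R -> C) -> Prop := locked_with lp_key (@inLp R).
Definition lpi : R -> (R -> C) -> \bar R := locked_with lp_key (@lpint R).
Definition nrm : R -> (R -> C) -> R :=
  locked_with lp_key (fun p f => (fine (lpi p f)) `^ p^-1).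

Lemma LpE p f : Lp p f = inLp p f.
Proof. by rewrite /Lp unlock. Qed.
Lemma nrm_def p f : nrm p f = (fine (lpi p f)) `^ p^-1.
Proof. by rewrite /nrm unlock. Qed.
Lemma lpi_lpint p f : lpi p f = lpint p f.
Proof. by rewrite /lpi unlock. Qed.
Lemma lpi_def p f : (lpi p f = \int[mu]_(x in TT) ((cabs (f x)) `^ p)%:E)%E.
Proof. by rewrite lpi_lpint. Qed.
Lemma Lp_meas p f : Lp p f -> cmeas f. Proof. by rewrite LpE => -[]. Qed.
Lemma Lp_lty p f : Lp p f -> (lpi p f < +oo)%E. Proof. by rewrite LpE lpi_lpint => -[]. Qed.
Lemma LpI p f : cmeas f -> (lpi p f < +oo)%E -> Lp p f. Proof. by rewrite LpE lpi_lpint. Qed.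

Lemma nrm_ge0 p f : 0 <= nrm p f. Proof. rewrite nrm_def; exact: powR_ge0. Qed.

Lemma lpi_ge0 p f : (0 <= lpi p f)%E.
Proof. by rewrite lpi_def; apply: integral_ge0 => x _; rewrite lee_fin powR_ge0. Qed.

Lemma lpi_fin p f : Lp p f -> lpi p f \is a fin_num.
Proof. by move=> /Lp_lty h; rewrite ge0_fin_numE // lpi_ge0. Qed.

Lemma lpiE p f : 0 < p -> Lp p f -> lpi p f = (nrm p f `^ p)%:E.
Proof.
move=> p0 hf; rewrite nrm_def -powRrM mulVf ?gt_eqF // powRr1 ?fineK ?lpi_fin //.
by rewrite fine_ge0 ?lpi_ge0.
Qed.

Lemma measurable_lp p f : cmeas f -> measurable_fun TT (fun x => (cabs (f x) `^ p)%:E).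
Proof. by move=> mf; apply/measurable_EFinP; apply: measurable_powR_fun; exact: cmeas_cabs. Qed.

Lemma ae_lpi_le p (K : R) f g : 0 < p -> 0 <= K -> cmeas g -> cmeas f ->
  {ae mu, forall x, TT x -> cabs (g x) <= K * cabs (f x)} ->
  (lpi p g <= (K `^ p)%:E * lpi p f)%E.
Proof.
move=> p0 K0 mg mf h; rewrite !lpi_def -ge0_integralZl; last 4 first.
- exact: measurable_circ.
- exact: measurable_lp.
- by move=> x _; rewrite lee_fin powR_ge0.
- by rewrite lee_fin powR_ge0.
apply: ae_ge0_le_integral.
- exact: measurable_circ.
- by move=> x _; rewrite lee_fin powR_ge0.
- exact: measurable_lp.
- by move=> x _; rewrite mule_ge0 // lee_fin powR_ge0.
- under eq_fun do rewrite -EFinM.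
  apply/measurable_EFinP; apply: measurable_funM => //; apply: measurable_powR_fun; exact: cmeas_cabs.
apply: ae_imp h => x _ h; rewrite -EFinM lee_fin -powRM ?cabs_ge0 //.
by apply: ge0_ler_powR => //; rewrite ?nnegrE ?mulr_ge0 ?cabs_ge0 // ltW.
Qed.

Lemma nrm_le_ae p (K : R) f g : 0 < p -> 0 <= K -> cmeas g -> Lp p f ->
  {ae mu, forall x, TT x -> cabs (g x) <= K * cabs (f x)} ->
  Lp p g /\ nrm p g <= K * nrm p f.
Proof.
move=> p0 K0 mg hf h; have mf := Lp_meas hf.
have le := ae_lpi_le p0 K0 mg mf h.
have hg : Lp p g.
  by apply: LpI => //; rewrite (le_lt_trans le) // (lpiE p0 hf) -EFinM ltry.
split=> //; move: le; rewrite !lpiE // -EFinM lee_fin -powRM ?nrm_ge0 // => le.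
rewrite leNgt; apply/negP => lt.
have := @gt0_ltr_powR R p p0 (K * nrm p f) (nrm p g).
rewrite !nnegrE mulr_ge0 ?nrm_ge0 // => /(_ isT isT lt).
by rewrite ltNge le.
Qed.

Lemma Lp_le p (K : R) f g : 0 < p -> cmeas g -> Lp p f ->
  (forall x, TT x -> cabs (g x) <= K * cabs (f x)) -> Lp p g.
Proof.
move=> p0 mg hf h; refine (@nrm_le_ae p `|K| f g p0 (normr_ge0 _) mg hf _).1.
apply: ae_forall => x cx; apply: (le_trans (h _ cx)); apply: ler_wpM2r; [exact: cabs_ge0|exact: ler_norm].
Qed.

Lemma Lp_ext p f g : 0 < p -> cmeas g -> aeq f g -> Lp p f -> Lp p g.
Proof.
move=> p0 mg fg hf; refine (@nrm_le_ae p 1 f g p0 ler01 mg hf _).1.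
by apply: ae_imp fg => x _ ->; rewrite mul1r.
Qed.

Lemma nrm_ext p f g : 0 < p -> cmeas f -> cmeas g -> aeq f g -> nrm p f = nrm p g.
Proof.
move=> p0 mf mg fg; rewrite !nrm_def; suff -> : lpi p f = lpi p g by [].
rewrite !lpi_def; apply: ae_eq_integral; [exact: measurable_circ|exact: measurable_lp|exact: measurable_lp|].
by apply: ae_imp fg => x _ ->.
Qed.

Lemma eq_nrm p f g : (forall x, cabs (f x) = cabs (g x)) -> nrm p f = nrm p g.
Proof.
by move=> h; rewrite !nrm_def !lpi_def; under eq_integral do rewrite h.
Qed.

Lemma nrm_eq0 p f : 0 < p -> Lp p f -> nrm p f = 0 -> aeq f (fun=> 0).
Proof.
move=> p0 hf f0; have := lpiE p0 hf; rewrite f0 powR0 ?gt_eqF //.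
rewrite lpi_def (_ : 0%:E = 0%E) // => h.
have mf := (Lp_meas hf).
have /(ae_eq_integral_abs mu (@measurable_circ R) (measurable_lp p mf)) : 
  (\int[mu]_(x in TT) `|(cabs (f x) `^ p)%:E| = 0)%E.
  by rewrite -h; apply: eq_integral => x _; rewrite gee0_abs // lee_fin powR_ge0.
apply: ae_imp => x _ [] /eqP; rewrite powR_eq0 cabs_eq0 => /andP[/eqP -> _] //.
Qed.

(** Dictionary with the norm on the whole line: a function on [0, 2 pi] is extended by 0, and
    Minkowski and Hoelder are imported through this identity. *)
Lemma nrmE p (g : R -> R) f : 0 < p -> (forall x, TT x -> cabs (f x) = g x) ->
  ('N[mu]_(p%:E)[EFin \o (g \_ TT)] = (lpi p f) `^ p^-1)%E.
Proof.
move=> p0 fg; rewrite unlock lpi_def; congr (_ `^ _)%E.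
rewrite [RHS]integral_mkcond; apply: eq_integral => x _ /=.
rewrite !patchE; case: ifPn => [/set_mem cx|_] /=.
  by rewrite -fg // ger0_norm // cabs_ge0.
by rewrite normr0 powR0 // gt_eqF.
Qed.

Lemma lpi_poweR p f : 0 < p -> Lp p f -> ((lpi p f) `^ p^-1)%E = (nrm p f)%:E.
Proof. by move=> p0 hf; rewrite nrm_def -[X in (X `^ _)%E]fineK ?lpi_fin. Qed.

Lemma Lp_poweR p f : 0 < p -> cmeas f -> ((lpi p f) `^ p^-1 < +oo)%E -> Lp p f.
Proof.
move=> p0 mf h; apply: LpI => //; rewrite ltNge leye_eq; apply/negP => /eqP e.
by move: h; rewrite e /= invr_eq0 gt_eqF.
Qed.

Lemma cmeas_cut f : cmeas f -> measurable_fun [set: R] ((fun x => cabs (f x)) \_ TT).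
Proof. by move=> mf; apply/(measurable_restrictT _ (@measurable_circ R)); exact: cmeas_cabs. Qed.

Lemma minkowski_Lp p f g : 1 <= p -> Lp p f -> Lp p g ->
  Lp p (fun x => f x + g x) /\ nrm p (fun x => f x + g x) <= nrm p f + nrm p g.
Proof.
move=> p1 hf hg; have p0 : 0 < p by apply: lt_le_trans p1.
have mf := (Lp_meas hf); have mg := (Lp_meas hg).
have mfg : cmeas (fun x => f x + g x) by exact: cmeasD.
(* Minkowski is applied to the real functions |f| and |g|; the triangle inequality compares |f + g|
   with their sum. *)
pose F x := (cabs (f x))%:C%C : C; pose G x := (cabs (g x))%:C%C : C.
have le1 : (lpi p (fun x => f x + g x)%R <= lpi p (fun x => F x + G x)%R)%E.
  have mFG : cmeas (fun x => F x + G x).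
    by apply: cmeasD; apply: cmeas_real; exact: cmeas_cabs.
  have := @ae_lpi_le p 1 (fun x => F x + G x) _ p0 ler01 mfg mFG.
  rewrite powR1 mul1e; apply; apply: ae_forall => x _; rewrite mul1r /F /G -rmorphD cabs_real.
  by rewrite ger0_norm ?addr_ge0 ?cabs_ge0 // cabsD.
have := minkowski_EFin mu (cmeas_cut mf) (cmeas_cut mg) p1.
rewrite (_ : (_ \+ _) = (fun x => cabs (f x) + cabs (g x)) \_ TT); last first.
  by apply/funext => x /=; rewrite !patchE; case: ifP => //; rewrite addr0.
rewrite (@nrmE p _ (fun x => F x + G x) p0); last first.
  by move=> x _; rewrite /F /G -rmorphD cabs_real ger0_norm ?addr_ge0 ?cabs_ge0.
rewrite (@nrmE p _ f p0 (fun _ _ => erefl)) (@nrmE p _ g p0 (fun _ _ => erefl)).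
rewrite (lpi_poweR p0 hf) (lpi_poweR p0 hg) -EFinD => mk.
have le2 : ((lpi p (fun x => f x + g x)%R) `^ p^-1 <= (nrm p f + nrm p g)%:E)%E.
  apply: le_trans mk; apply: gt0_ler_poweR; rewrite ?in_itv /= ?andbT ?lpi_ge0 ?leey ?invr_ge0 ?(ltW p0) //.
have hfg : Lp p (fun x => f x + g x).
  by apply: Lp_poweR => //; apply: le_lt_trans le2 (ltry _).
by split=> //; move: le2; rewrite lpi_poweR // lee_fin.
Qed.

Lemma LpD p f g : 1 <= p -> Lp p f -> Lp p g -> Lp p (fun x => f x + g x).
Proof. by move=> p1 hf hg; have [] := minkowski_Lp p1 hf hg. Qed.
Lemma nrmD p f g : 1 <= p -> Lp p f -> Lp p g ->
  nrm p (fun x => f x + g x) <= nrm p f + nrm p g.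
Proof. by move=> p1 hf hg; have [] := minkowski_Lp p1 hf hg. Qed.

Lemma LpZ p z f : 0 < p -> Lp p f -> Lp p (fun x => z * f x).
Proof.
move=> p0 hf; apply: (@Lp_le p (cabs z) f) => //.
  by apply: cmeasM; [exact: cmeas_cst|exact: (Lp_meas hf)].
by move=> x _; rewrite cabsM.
Qed.
Lemma Lp0 p : Lp p (fun=> 0).
Proof.
apply: LpI; first exact: cmeas_cst.
rewrite lpi_def cabs0 integral_cst; [|exact: measurable_circ]; rewrite [X in (_ * X)%E]mu_circ -EFinM; exact: ltry.
Qed.
Lemma nrm0 p : 0 < p -> nrm p (fun=> 0) = 0.
Proof.
move=> p0; rewrite nrm_def lpi_def cabs0 powR0 ?gt_eqF // integral_cst; [|exact: measurable_circ]; rewrite mul0e /= powR0 // invr_eq0 gt_eqF //.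
Qed.
Lemma nrmZ p z f : 0 < p -> Lp p f -> nrm p (fun x => z * f x) = cabs z * nrm p f.
Proof.
move=> p0 hf.
have H w g : Lp p g -> nrm p (fun x => w * g x) <= cabs w * nrm p g.
  move=> hg; have [] // := @nrm_le_ae p (cabs w) g (fun x => w * g x) p0 (cabs_ge0 _) _ hg.
    by apply: cmeasM; [exact: cmeas_cst|exact: (Lp_meas hg)].
  by apply: ae_forall => x _; rewrite cabsM.
apply/le_anti/andP; split; first exact: H.
have [->|z0] := eqVneq z 0; first by rewrite cabs0 mul0r nrm_ge0.
have := H z^-1 _ (LpZ z p0 hf).
rewrite (_ : (fun x => _) = f); last by apply/funext => x; rewrite mulrA mulVf // mul1r.
by rewrite cabsV -ler_pdivrMl ?invr_gt0 ?cabs_gt0 // invrK.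
Qed.
Lemma LpN p f : 0 < p -> Lp p f -> Lp p (fun x => - f x).
Proof. by move=> p0 hf; under eq_fun do rewrite -mulN1r; exact: LpZ. Qed.
Lemma nrmN p f : nrm p (fun x => - f x) = nrm p f.
Proof. by apply: eq_nrm => x; rewrite cabsN. Qed.
Lemma LpB p f g : 1 <= p -> Lp p f -> Lp p g -> Lp p (fun x => f x - g x).
Proof. by move=> p1 hf hg; apply: LpD => //; apply: LpN => //; apply: lt_le_trans p1. Qed.
Lemma nrmB p f g : 1 <= p -> Lp p f -> Lp p g ->
  nrm p (fun x => f x - g x) <= nrm p f + nrm p g.
Proof.
move=> p1 hf hg; rewrite -(nrmN p g); apply: nrmD => //; apply: LpN => //; exact: lt_le_trans p1.
Qed.

Lemma Lp_bnd p (M : R) f : 0 < p -> cmeas f ->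
  {ae mu, forall x, TT x -> cabs (f x) <= M} ->
  Lp p f /\ nrm p f <= `|M| * (2 * pi) `^ p^-1.
Proof.
move=> p0 mf h.
have h1 : Lp p (fun=> 1 : C).
  apply: LpI; first exact: cmeas_cst.
  rewrite lpi_def cabs1 powR1 integral_cst; [|exact: measurable_circ]; rewrite [X in (_ * X)%E]mu_circ -EFinM; exact: ltry.
have := @nrm_le_ae p `|M| (fun=> 1) f p0 (normr_ge0 _) mf h1.
rewrite (nrm_def p (fun=> 1)) lpi_def cabs1 powR1 integral_cst; [|exact: measurable_circ]; rewrite [X in (_ * X)%E]mu_circ mul1e /=; apply.
by apply: ae_imp h => x _ h; rewrite mulr1 (le_trans h) // ler_norm.
Qed.

Lemma hoelder_Lp p q f g : 0 < p -> 0 < q -> p^-1 + q^-1 = 1 -> Lp p f -> Lp q g ->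
  Lp 1 (fun x => f x * g x) /\ nrm 1 (fun x => f x * g x) <= nrm p f * nrm q g.
Proof.
move=> p0 q0 pq hf hg; have mf := (Lp_meas hf); have mg := (Lp_meas hg).
have mfg : cmeas (fun x => f x * g x) by exact: cmeasM.
have := hoelder mu (cmeas_cut mf) (cmeas_cut mg) p0 q0 pq.
rewrite (_ : (_ \* _) = (fun x => cabs (f x) * cabs (g x)) \_ TT); last first.
  by apply/funext => x /=; rewrite !patchE; case: ifP => //; rewrite mulr0.
rewrite (@nrmE p _ f p0 (fun _ _ => erefl)) (@nrmE q _ g q0 (fun _ _ => erefl)).
rewrite (@nrmE 1 _ (fun x => f x * g x) ltr01); last by move=> x _; rewrite cabsM.
rewrite (lpi_poweR p0 hf) (lpi_poweR q0 hg) -EFinM => h.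
have hfg : Lp 1 (fun x => f x * g x).
  by apply: Lp_poweR => //; apply: le_lt_trans h (ltry _).
by split=> //; move: h; rewrite lpi_poweR // lee_fin.
Qed.

(** Hoelder against the constant 1, whose norm for the conjugate exponent is (2 pi) to the power 1 -
    1/p. For p = 1 that exponent is infinite, hence the separate case. *)
Lemma Lp_inL1 p f : 1 <= p -> Lp p f -> Lp 1 f /\ nrm 1 f <= (2 * pi) `^ (1 - p^-1) * nrm p f.
Proof.
rewrite le_eqVlt => /predU1P[<-|p1] hf.
  by rewrite invr1 subrr powRr0 mul1r.
have p0 : 0 < p by apply: lt_trans p1.
have q0 : 0 < (1 - p^-1)^-1 by rewrite invr_gt0 subr_gt0 invf_lt1.
have [||h1 h2] := @Lp_bnd (1 - p^-1)^-1 1 (fun=> 1) q0; first exact: cmeas_cst.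
  by apply: ae_forall => x _; rewrite cabs1.
have := hoelder_Lp p0 q0 _ hf h1; rewrite invrK (addrC p^-1) subrK => /(_ erefl).
rewrite (_ : (fun x => _) = f); last by apply/funext => x; rewrite mulr1.
move=> [h3 h4]; split=> //; apply: (le_trans h4); rewrite mulrC; apply: ler_wpM2r.
  exact: nrm_ge0.
by apply: (le_trans h2); rewrite normr1 mul1r invrK.
Qed.

Lemma lpi_tilde p f : cmeas f -> lpi p (tilde f) = lpi p f.
Proof.
move=> mf; rewrite !lpi_def /tilde /=.
have := @ge0_integral_reflect R (fun x => (cabs (f x) `^ p)%:E) (measurable_lp p mf).
by apply => x _; rewrite lee_fin powR_ge0.
Qed.
Lemma Lp_tilde p f : Lp p f -> Lp p (tilde f).
Proof. by move=> hf; have mf := Lp_meas hf; apply: LpI; [exact: cmeas_tilde|rewrite lpi_tilde // Lp_lty]. Qed.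
Lemma nrm_tilde p f : cmeas f -> nrm p (tilde f) = nrm p f.
Proof. by move=> mf; rewrite !nrm_def lpi_tilde. Qed.
Lemma cabs_Jop f x : cabs (Jop f x) = cabs (tilde f x).
Proof. by rewrite JopE cabsM cabsV cabs_cexp invr1 mul1r. Qed.
Lemma lpi_Jop p f : cmeas f -> lpi p (Jop f) = lpi p f.
Proof.
move=> mf; rewrite -(lpi_tilde p mf) (lpi_def p (Jop f)) (lpi_def p (tilde f)).
by apply: eq_integral => x _; rewrite cabs_Jop.
Qed.
Lemma Lp_Jop p f : Lp p f -> Lp p (Jop f).
Proof. by move=> hf; have mf := Lp_meas hf; apply: LpI; [exact: cmeas_Jop|rewrite lpi_Jop // Lp_lty]. Qed.
Lemma nrm_Jop p f : cmeas f -> nrm p (Jop f) = nrm p f.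
Proof. by move=> mf; rewrite !nrm_def lpi_Jop. Qed.
End Norms.

(** * Fourier coefficients *)
Section Fourier.
Variable R : realType.
Local Notation C := R[i].
Local Notation mu := (@lebesgue_measure R).
Local Notation TT := (@circ R).
Implicit Types (z w : C) (p q : R) (f g h : R -> C).
Lemma cexpE (x : R) : cexp x = (cos x +i* sin x)%C. Proof. by []. Qed.
Local Opaque cabs cexp powR lebesgue_measure circ.

Definition ci : (R -> C) -> C := locked_with lp_key (@cint R).
Definition fc : (R -> C) -> int -> C := locked_with lp_key (@fhat R).
Lemma fcE f n : fc f n = fhat f n. Proof. by rewrite /fc unlock. Qed.
Lemma ci_def f : ci f = ((Rintegral mu TT (fun x => complex.Re (f x))) +i*
  (Rintegral mu TT (fun x => complex.Im (f x))))%C.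
Proof. by rewrite /ci unlock. Qed.
Lemma fc_def f n : fc f n = ((2 * pi)^-1)%:C%C * ci (fun x => f x * tpow (- n) x).
Proof.
rewrite fcE /fhat /ci unlock; congr (_ * cint _); apply/funext => x.
by rewrite /tpow mulrNz mulNr.
Qed.

Lemma L1_Re f : Lp 1 f -> mu.-integrable TT (EFin \o (fun x => complex.Re (f x))).
Proof.
move=> hf; apply/integrableP; split.
  by apply/measurable_EFinP; exact: (Lp_meas hf).1.
have := Lp_lty hf; rewrite lpi_def; apply: le_lt_trans.
apply: ge0_le_integral; first exact: measurable_circ.
- by [].
- apply/measurable_EFinP; apply: measurableT_comp => //; exact: (Lp_meas hf).1.
- by apply: measurable_lp; exact: Lp_meas hf.
- by move=> x _ /=; rewrite lee_fin powRr1 ?cabs_ge0 // Re_le_cabs.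
Qed.
Lemma L1_Im f : Lp 1 f -> mu.-integrable TT (EFin \o (fun x => complex.Im (f x))).
Proof.
move=> hf; apply/integrableP; split.
  by apply/measurable_EFinP; exact: (Lp_meas hf).2.
have := Lp_lty hf; rewrite lpi_def; apply: le_lt_trans.
apply: ge0_le_integral; first exact: measurable_circ.
- by [].
- apply/measurable_EFinP; apply: measurableT_comp => //; exact: (Lp_meas hf).2.
- by apply: measurable_lp; exact: Lp_meas hf.
- by move=> x _ /=; rewrite lee_fin powRr1 ?cabs_ge0 // Im_le_cabs.
Qed.

Lemma ciD f g : Lp 1 f -> Lp 1 g -> ci (fun x => f x + g x) = ci f + ci g.
Proof.
move=> hf hg; rewrite !ci_def; apply/eqP; rewrite eq_complex /=; apply/andP; split; apply/eqP.
  rewrite -RintegralD; [|exact: measurable_circ|exact: L1_Re|exact: L1_Re].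
  by apply: eq_Rintegral => x _; rewrite ReD.
rewrite -RintegralD; [|exact: measurable_circ|exact: L1_Im|exact: L1_Im].
by apply: eq_Rintegral => x _; rewrite ImD.
Qed.

Lemma ciZ z f : Lp 1 f -> ci (fun x => z * f x) = z * ci f.
Proof.
move=> hf; rewrite !ci_def [z in RHS]complexE.
have m := @measurable_circ R.
have iR := L1_Re hf; have iI := L1_Im hf.
have iZ (k : R) (u : R -> R) : mu.-integrable TT (EFin \o u) ->
   mu.-integrable TT (EFin \o (fun x => k * u x)).
  move=> iu; rewrite (_ : _ \o _ = (fun x => k%:E * (EFin \o u) x)%E); last by apply/funext.
  exact: integrableZl.
apply/eqP; rewrite eq_complex; apply/andP; split; apply/eqP.
  under eq_Rintegral do rewrite ReM.
  rewrite RintegralB //; [|exact: iZ|exact: iZ].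
  rewrite !RintegralZl //; case: (z) => a b /=; ring.
rewrite [LHS]/= [LHS](_ : _ = Rintegral mu TT (fun x => complex.Re z * complex.Im (f x) + complex.Im z * complex.Re (f x))); last first.
  by apply: eq_Rintegral => x _; rewrite ImM.
rewrite RintegralD //; [|exact: iZ|exact: iZ].
rewrite !RintegralZl //; case: (z) => a b /=; ring.
Qed.

Lemma ci_ext f g : cmeas f -> cmeas g -> aeq f g -> ci f = ci g.
Proof.
move=> [f1 f2] [g1 g2] fg; rewrite !ci_def /Rintegral; congr (fine _ +i* fine _)%C;
  (apply: ae_eq_integral; [exact: measurable_circ|exact/measurable_EFinP|exact/measurable_EFinP|]);
  by apply: ae_imp fg => x _ ->.
Qed.

Lemma nrm1E f : Lp 1 f -> nrm 1 f = Rintegral mu TT (fun x => cabs (f x)).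
Proof.
move=> hf; rewrite nrm_def invr1 powRr1; last by rewrite fine_ge0 // lpi_ge0.
rewrite lpi_def /Rintegral; congr fine; apply: eq_integral => x _.
by rewrite powRr1 ?cabs_ge0.
Qed.

Lemma cabs_ci_le f : Lp 1 f -> cabs (ci f) <= nrm 1 f.
Proof.
move=> hf.
(* Rotating by a unimodular w makes the integral real and nonnegative, so that only its real part
   has to be estimated. *)
have [w [w1 wE]] : exists w : C, cabs w = 1 /\ w * ci f = (cabs (ci f))%:C%C.
  have [e|e] := eqVneq (ci f) 0; first by exists 1; rewrite cabs1 e cabs0 mulr0.
  exists ((cabs (ci f))%:C%C / ci f); split; last by rewrite -mulrA mulVf // mulr1.
  by rewrite cabsM cabs_real cabsV ger0_norm ?cabs_ge0 // divff // cabs_eq0.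
have hwf : Lp 1 (fun x => w * f x) by exact: LpZ.
have -> : cabs (ci f) = complex.Re (ci (fun x => w * f x)) by rewrite ciZ // wE.
rewrite ci_def /=.
have -> : nrm 1 f = nrm 1 (fun x => w * f x) by rewrite nrmZ // w1 mul1r.
rewrite nrm1E //; apply: le_Rintegral.
- exact: measurable_circ.
- exact: L1_Re.
- apply/integrableP; split.
    by apply/measurable_EFinP; apply: cmeas_cabs; exact: Lp_meas hwf.
  have := Lp_lty hwf; rewrite lpi_def; congr (_ < _)%E; apply: eq_integral => x _ /=.
  by rewrite powRr1 ?cabs_ge0 // ger0_norm // cabs_ge0.
- by move=> x _; rewrite (le_trans (ler_norm _)) // Re_le_cabs.
Qed.

Lemma ciN f : Lp 1 f -> ci (fun x => - f x) = - ci f.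
Proof. by move=> hf; under eq_fun do rewrite -mulN1r; rewrite ciZ // mulN1r. Qed.

Lemma ciB f g : Lp 1 f -> Lp 1 g -> ci (fun x => f x - g x) = ci f - ci g.
Proof. by move=> hf hg; rewrite ciD ?ciN //; exact: LpN. Qed.

Lemma cabs_tpow (n : int) (x : R) : cabs (tpow n x : C) = 1.
Proof. exact: cabs_cexp. Qed.

Lemma LpM_bnd p (M : R) f g : 0 < p -> cmeas g -> {ae mu, forall x, TT x -> cabs (g x) <= M} ->
  Lp p f -> Lp p (fun x => g x * f x) /\ nrm p (fun x => g x * f x) <= `|M| * nrm p f.
Proof.
move=> p0 mg hM hf; apply: nrm_le_ae => //.
  by apply: cmeasM => //; exact: Lp_meas hf.
apply: ae_imp hM => x _ hx; rewrite cabsM; apply: ler_wpM2r; first exact: cabs_ge0.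
by rewrite (le_trans hx) // ler_norm.
Qed.

Lemma Lp_tpowM p n f : 0 < p -> Lp p f -> Lp p (fun x => f x * tpow n x).
Proof.
move=> p0 hf; under eq_fun do rewrite mulrC.
refine (@LpM_bnd p 1 f (tpow n) p0 (cmeas_tpow _ _) _ hf).1.
by apply: ae_forall => x _; rewrite cabs_tpow.
Qed.
Lemma Lp_Mtpow p n f : 0 < p -> Lp p f -> Lp p (fun x => tpow n x * f x).
Proof. by move=> p0 hf; under eq_fun do rewrite mulrC; exact: Lp_tpowM. Qed.
Lemma nrm_tpowM p n f : nrm p (fun x => f x * tpow n x) = nrm p f.
Proof. by apply: eq_nrm => x; rewrite cabsM cabs_tpow mulr1. Qed.

Lemma tpowD m n x : tpow (m + n) x = tpow m x * tpow n x :> C.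
Proof. by rewrite /tpow intrD mulrDl cexpD. Qed.
Lemma tpow0 x : tpow 0 x = 1 :> C.
Proof. by rewrite /tpow mul0r cexp0. Qed.
Lemma tpowN m x : tpow (- m) x = (tpow m x)^-1 :> C.
Proof. by rewrite /tpow mulrNz mulNr cexpN. Qed.
Lemma tpow_neq0 m x : tpow m x != 0 :> C.
Proof. exact: cexp_neq0. Qed.
Lemma tpow_reflect m x : tpow m (2 * pi - x) = tpow (- m) x :> C.
Proof. by rewrite !tpowE cexp2piB exprz_inv. Qed.

Lemma fcD f g n : Lp 1 f -> Lp 1 g -> fc (fun x => f x + g x) n = fc f n + fc g n.
Proof.
move=> hf hg; rewrite !fc_def -mulrDr -ciD; try exact: Lp_tpowM.
by congr (_ * ci _); apply/funext => x; rewrite mulrDl.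
Qed.
Lemma fcZ z f n : Lp 1 f -> fc (fun x => z * f x) n = z * fc f n.
Proof.
move=> hf; rewrite !fc_def [RHS]mulrCA -(ciZ z (Lp_tpowM (- n) ltr01 hf)).
by congr (_ * ci _); apply/funext => x; rewrite mulrA.
Qed.
Lemma fcN f n : Lp 1 f -> fc (fun x => - f x) n = - fc f n.
Proof. by move=> hf; under eq_fun do rewrite -mulN1r; rewrite fcZ // mulN1r. Qed.
Lemma fcB f g n : Lp 1 f -> Lp 1 g -> fc (fun x => f x - g x) n = fc f n - fc g n.
Proof. by move=> hf hg; rewrite fcD ?fcN //; exact: LpN. Qed.
Lemma fc_ext f g n : cmeas f -> cmeas g -> aeq f g -> fc f n = fc g n.
Proof.
move=> mf mg fg; rewrite !fc_def; congr (_ * _); apply: ci_ext.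
- by apply: cmeasM => //; exact: cmeas_tpow.
- by apply: cmeasM => //; exact: cmeas_tpow.
- by apply: ae_imp fg => x _ ->.
Qed.
Lemma cabs_fc_le f n : Lp 1 f -> cabs (fc f n) <= (2 * pi)^-1 * nrm 1 f.
Proof.
move=> hf; rewrite fc_def cabsM cabs_real ger0_norm ?invr_ge0 ?(ltW (@pi2_gt0 R)) //.
rewrite ler_pM2l ?invr_gt0 ?pi2_gt0 // -(nrm_tpowM 1 (- n) f); apply: cabs_ci_le.
exact: Lp_tpowM.
Qed.
Lemma fc_Mtpow f m n : fc (fun x => tpow m x * f x) n = fc f (n - m).
Proof.
rewrite !fc_def; congr (_ * ci _); apply/funext => x.
by rewrite opprB tpowD; ring.
Qed.
Lemma Rintegral_reflect (u : R -> R) : mu.-integrable TT (EFin \o u) ->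
  Rintegral mu TT (fun x => u (2 * pi - x)) = Rintegral mu TT u.
Proof.
move=> /integrableP[mu_ _]; rewrite /Rintegral; congr fine.
rewrite integralE [RHS]integralE; congr (_ - _)%E.
  rewrite -(@ge0_integral_reflect R ((EFin \o u)^\+)%E (measurable_funepos mu_)); last first.
    by move=> x _; exact: funepos_ge0.
  by apply: eq_integral => x _; rewrite !funeposE.
rewrite -(@ge0_integral_reflect R ((EFin \o u)^\-)%E (measurable_funeneg mu_)); last first.
  by move=> x _; exact: funeneg_ge0.
by apply: eq_integral => x _; rewrite !funenegE.
Qed.
Lemma ci_tilde f : Lp 1 f -> ci (tilde f) = ci f.
Proof.
move=> hf; rewrite !ci_def; congr (_ +i* _)%C.
  exact: (@Rintegral_reflect (fun x => complex.Re (f x)) (L1_Re hf)).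
exact: (@Rintegral_reflect (fun x => complex.Im (f x)) (L1_Im hf)).
Qed.
Lemma fc_tilde f n : Lp 1 f -> fc (tilde f) n = fc f (- n).
Proof.
move=> hf; rewrite !fc_def -[in RHS]ci_tilde; last exact: Lp_tpowM.
congr (_ * ci _); apply/funext => x.
by rewrite /tilde tpow_reflect opprK.
Qed.
Lemma Jop_tpow f : Jop f = (fun x => tpow (-1) x * tilde f x).
Proof. by apply/funext => x; rewrite JopE /tpow mulN1r cexpN. Qed.
(** The involution n -> -1 - n exchanges the nonnegative and the negative integers; this is why J
    H^p is the complement of H^p. *)
Lemma fc_Jop f n : Lp 1 f -> fc (Jop f) n = fc f (- 1 - n).
Proof. by move=> hf; rewrite Jop_tpow fc_Mtpow fc_tilde // opprK opprD addrC. Qed.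

Lemma dcst (c x : R) : is_derive x (1 : R) (fun _ : R => c) 0.
Proof. exact: is_derive_cst. Qed.
Lemma did (x : R) : is_derive x (1 : R) (fun y : R => y) 1.
Proof. exact: is_derive_id. Qed.
Lemma dD (u v : R -> R) (x a b : R) : is_derive x (1 : R) u a -> is_derive x (1 : R) v b ->
  is_derive x (1 : R) (fun y => u y + v y) (a + b).
Proof. exact: is_deriveD. Qed.
Lemma dM (u v : R -> R) (x a b : R) : is_derive x (1 : R) u a -> is_derive x (1 : R) v b ->
  is_derive x (1 : R) (fun y => u y * v y) (a * v x + u x * b).
Proof.
move=> ua vb; apply: (is_derive_eq (is_deriveM ua vb)).
by rewrite -[_ *: _]/(_ * _) -[X in _ + X]/(_ * _); ring.
Qed.
Lemma dZ (k : R) (u : R -> R) (x a : R) : is_derive x (1 : R) u a ->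
  is_derive x (1 : R) (fun y => k * u y) (k * a).
Proof. by move=> ua; apply: (is_derive_eq (dM (dcst k x) ua)); rewrite mul0r add0r. Qed.
Lemma dcomp (u v : R -> R) (x a b : R) : is_derive (v x) (1 : R) u a -> is_derive x (1 : R) v b ->
  is_derive x (1 : R) (fun y => u (v y)) (a * b).
Proof. exact: is_derive1_comp. Qed.
Lemma dcontinuous (f f' : R -> R) : (forall x, is_derive x (1 : R) f (f' x)) -> continuous f.
Proof.
move=> h x; apply: differentiable_continuous; apply/derivable1_diffP; have := h x => hx; exact: ex_derive.
Qed.

Lemma FTC_Rintegral (a b : R) (f F : R -> R) : a < b -> continuous f ->
  (forall x : R, is_derive x (1 : R) F (f x)) ->
  Rintegral mu `[a, b]%classic f = F b - F a.
Proof.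
move=> ab cf dF; rewrite /Rintegral (@continuous_FTC2 _ f F) //.
- by apply: continuous_subspaceT.
- have cF := dcontinuous dF; split.
  + by move=> x _; have := dF x => dFx; exact: ex_derive.
  + by apply: cvg_at_right_filter; exact: cF.
  + by apply: cvg_at_left_filter; exact: cF.
- by move=> x _; rewrite derive1E; have := dF x => dFx; exact: derive_val.
Qed.

Lemma integral_cos_period (k : int) : k != 0 ->
  Rintegral mu TT (fun x => cos (k%:~R * x)) = 0 /\ Rintegral mu TT (fun x => sin (k%:~R * x)) = 0.
Proof.
move=> k0; pose K : R := k%:~R; have K0 : K != 0 by rewrite intr_eq0.
have dl (x : R) : is_derive x (1 : R) (fun y => K * y) K.
  by apply: (is_derive_eq (dZ K (did x))); rewrite mulr1.
have : tpow k (2 * pi) = 1 :> C by rewrite tpowE cexp2pi exp1rz.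
rewrite /tpow cexpE [TT](_ : _ = `[0, 2 * pi]%classic) // => -[c1 s0].
have cK : continuous (fun x : R => K * x) by exact: mulrl_continuous.
split.
- apply: (etrans (@FTC_Rintegral 0 (2 * pi) _ (fun x => K^-1 * sin (K * x)) _ _ _)); first exact: pi2_gt0; last first.
  + by rewrite mulr0 sin0 s0 subrr.
  + move=> x; apply: (is_derive_eq (dZ _ (dcomp (is_derive_sin _) (dl x)))).
    by field.
  + by move=> x; apply: continuous_comp; [exact: cK|exact: continuous_cos].
- apply: (etrans (@FTC_Rintegral 0 (2 * pi) _ (fun x => - K^-1 * cos (K * x)) _ _ _)); first exact: pi2_gt0; last first.
  + by rewrite mulr0 cos0 c1 subrr.
  + move=> x; apply: (is_derive_eq (dZ _ (dcomp (is_derive_cos _) (dl x)))).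
    by field.
  + by move=> x; apply: continuous_comp; [exact: cK|exact: continuous_sin].
Qed.
Lemma fc_tpow m n : fc (tpow m : R -> C) n = (m == n)%:R.
Proof.
rewrite fc_def; have -> : (fun x => tpow m x * tpow (- n) x) = (tpow (m - n) : R -> C).
  by apply/funext => x; rewrite tpowD.
have [->|mn] := eqVneq m n.
  rewrite subrr ci_def.
  have m' := @measurable_circ R.
  rewrite (@eq_Rintegral _ _ _ _ _ (fun=> 1)); last by move=> x _; rewrite tpow0.
  rewrite [X in (_ +i* X)%C](_ : _ = Rintegral mu TT (fun=> 0)); last by apply: eq_Rintegral => x _; rewrite tpow0.
  rewrite !Rintegral_cst // [X in fine X]mu_circ /= mul0r mul1r.
  by simpc; rewrite mulVf // gt_eqF // pi2_gt0.
have [c s] := @integral_cos_period (m - n) ltac:(by rewrite subr_eq0).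
have -> : tpow (m - n) = (fun x => cos ((m - n)%:~R * x) +i* sin ((m - n)%:~R * x))%C :> (R -> C).
  by apply/funext => x; rewrite /tpow cexpE.
by rewrite ci_def /= c s mulr0.
Qed.
End Fourier.

(** * Completeness of L^p *)
Section Complete.
Variable R : realType.
Local Notation C := R[i].
Local Notation mu := (@lebesgue_measure R).
Local Notation TT := (@circ R).
Implicit Types (z w : C) (p q : R) (f g h : R -> C).
Local Opaque cabs cexp powR lebesgue_measure circ.

Definition aecvg (v : nat -> R -> C) g : Prop :=
  {ae mu, forall x, TT x -> (fun n => cabs (v n x - g x)) @ \oo --> (0 : R)}.

Lemma cabs_lipschitz z w : `|cabs z - cabs w| <= cabs (z - w).
Proof.
have h1 := cabsD (z - w) w; have h2 := cabsD (w - z) z.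
rewrite subrK in h1; rewrite subrK -(cabsN (w - z)) opprB in h2.
by rewrite ler_norml; apply/andP; split; lra.
Qed.

Lemma cvg_abs_sub (s : nat -> R) (l : R) : s @ \oo --> l -> (fun n => `|s n - l|) @ \oo --> (0 : R).
Proof.
move=> h; have : (fun n => s n - l) @ \oo --> (0 : R).
  by rewrite -(subrr l); apply: cvgB => //; exact: cvg_cst.
by move/cvg_norm; rewrite normr0.
Qed.

Lemma squeeze0 (s t : nat -> R) : (forall n, 0 <= s n <= t n) -> t @ \oo --> (0 : R) -> s @ \oo --> (0 : R).
Proof.
move=> h; apply: (@squeeze_cvgr _ _ _ _ (fun=> 0)); last exact: cvg_cst.
by apply: nearW => n; exact: h.
Qed.

Lemma cvg_of_abs_sub (s : nat -> R) (l : R) : (fun n => `|s n - l|) @ \oo --> (0 : R) -> s @ \oo --> l.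
Proof.
move=> h; have {}h : (fun n => s n - l) @ \oo --> (0 : R) by apply: norm_cvg0.
have : (fun n => (s n - l) + l) @ \oo --> (0 + l) by apply: cvgD => //; exact: cvg_cst.
by rewrite add0r; under eq_fun do rewrite subrK.
Qed.

(** Differentiability of the power gives continuity at l > 0; at l = 0, where p may be below 1, the
    estimate is direct. *)
Lemma powR_seq_cvg p (s : nat -> R) (l : R) : 0 < p -> (forall n, 0 <= s n) -> 0 <= l ->
  s @ \oo --> l -> (fun n => s n `^ p) @ \oo --> l `^ p.
Proof.
move=> p0 s0; rewrite le_eqVlt => /predU1P[<-|l0] sl; last first.
  have d := is_derive1_powR p l0.
  have c : {for l, continuous (fun x : R => x `^ p)}.
    by apply: differentiable_continuous; apply/derivable1_diffP; exact: ex_derive.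
  exact: (cvg_comp _ _ sl c).
rewrite powR0 ?gt_eqF //; apply/cvgr0Pnorm_lt => e e0.
move/cvgr0Pnorm_lt: sl => /(_ (e `^ p^-1)); rewrite powR_gt0 // => /(_ isT).
apply: filterS => n; rewrite !ger0_norm ?powR_ge0 // => h.
rewrite -[ltRHS](powRr1 (ltW e0)) -(mulVf (lt0r_neq0 p0)) powRrM.
by apply: gt0_ltr_powR => //; rewrite nnegrE // powR_ge0.
Qed.

Lemma lpi_le p f (B : R) : 0 < p -> Lp p f -> nrm p f <= B -> (lpi p f <= (B `^ p)%:E)%E.
Proof.
move=> p0 hf hB; rewrite (lpiE p0 hf) lee_fin ge0_ler_powR ?(ltW p0) // nnegrE ?nrm_ge0 //.
exact: le_trans (nrm_ge0 _ _) hB.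
Qed.

Lemma lpi_le_inv p f (B : R) : 0 < p -> 0 <= B -> cmeas f -> (lpi p f <= (B `^ p)%:E)%E ->
  Lp p f /\ nrm p f <= B.
Proof.
move=> p0 B0 mf h; have hf : Lp p f by apply: LpI => //; rewrite (le_lt_trans h) // ltry.
split=> //; move: h; rewrite (lpiE p0 hf) lee_fin => h.
rewrite leNgt; apply/negP => lt.
have := @gt0_ltr_powR R p p0 B (nrm p f).
by rewrite !nnegrE B0 nrm_ge0 => /(_ isT isT lt); rewrite ltNge h.
Qed.

(** Serves where no norm limit is available in advance: for the tails of a series in L^p and for
    1/phi. *)
Lemma fatou_Lp p (v : nat -> R -> C) g (B : R) : 0 < p -> 0 <= B ->
  (forall n, Lp p (v n)) -> (forall n, nrm p (v n) <= B) -> cmeas g -> aecvg v g ->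
  Lp p g /\ nrm p g <= B.
Proof.
move=> p0 B0 hv hB mg hcv; apply: lpi_le_inv => //.
have mE n : measurable_fun TT (fun x => (cabs (v n x) `^ p)%:E).
  by apply: measurable_lp; exact: Lp_meas (hv n).
have F := fatou mu (@measurable_circ R) mE (fun n x _ => powR_ge0 (cabs (v n x)) p).
have -> : lpi p g = (\int[mu]_(x in TT) limn_einf (fun n => (cabs (v n x) `^ p)%:E))%E.
  rewrite lpi_def; apply: ae_eq_integral.
  - exact: measurable_circ.
  - exact: measurable_lp.
  - under eq_fun do rewrite limn_einf_lim.
    rewrite (_ : (fun x => _) = (fun x => limn_einf (fun n => (cabs (v n x) `^ p)%:E))); last first.
      by apply/funext => x; rewrite limn_einf_lim.
    apply: (@emeasurable_fun_cvg _ _ _ _ (fun n x => einfs (fun k => (cabs (v k x) `^ p)%:E) n)).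
      by move=> n; exact: measurable_fun_einfs.
    by move=> x _; rewrite limn_einf_lim; exact: is_cvg_einfs.
  - apply: ae_imp hcv => x _ hx.
    apply/esym; apply: (cvg_limn_einf_sup _).1.
    apply: cvg_EFin; first by near=> n.
    have hc : (fun n => cabs (v n x)) @ \oo --> cabs (g x).
      apply: cvg_of_abs_sub; apply: squeeze0 hx => n.
      by rewrite normr_ge0 cabs_lipschitz.
    by apply: powR_seq_cvg => // [n|]; exact: cabs_ge0.
apply: (le_trans F); apply: le_trans (limn_einf_sup _) _.
rewrite limn_esup_lim; apply: lime_le; first exact: is_cvg_esups.
near=> n; apply: ub_ereal_sup => _ [k _ <-].
by rewrite -lpi_def; exact: lpi_le.
Unshelve. all: by end_near. Qed.

Lemma geo_sum (K : R) n : \sum_(k < n) K / 2 ^+ k = 2 * K - 2 * K / 2 ^+ n.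
Proof.
elim: n => [|n IH]; first by rewrite big_ord0 expr0 divr1 subrr.
rewrite big_ord_recr /= IH exprS; field; exact: expf_neq0.
Qed.

(** The norms are summable, so by monotone convergence the sum of the moduli is integrable, hence
    finite almost everywhere. *)
Lemma ae_series (u : nat -> R -> C) (K : R) :
  (forall n, Lp 1 (u n)) -> (forall n, nrm 1 (u n) <= K / 2 ^+ n) ->
  measurable_fun TT (fun x => \sum_(k <oo) (cabs (u k x))%:E)%E /\
  {ae mu, forall x, TT x -> (\sum_(k <oo) (cabs (u k x))%:E < +oo)%E}.
Proof.
move=> hu hK.
have mu_ k : measurable_fun TT (fun x => (cabs (u k x))%:E).
  by apply/measurable_EFinP; apply: cmeas_cabs; exact: Lp_meas (hu k).
have c0 k x : TT x -> (0 <= (cabs (u k x))%:E)%E by move=> _; rewrite lee_fin cabs_ge0.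
have mG : measurable_fun TT (fun x => \sum_(k <oo) (cabs (u k x))%:E)%E.
  apply: (@emeasurable_fun_cvg _ _ _ _ (fun n x => \sum_(0 <= k < n) (cabs (u k x))%:E)%E).
    by move=> n; apply: emeasurable_sum => k; exact: mu_.
  by move=> x cx; apply: is_cvg_nneseries => k _ _; exact: c0.
split=> //.
have E : (\int[mu]_(x in TT) (\sum_(k <oo) (cabs (u k x))%:E) = \sum_(k <oo) (nrm 1 (u k))%:E)%E.
  rewrite (integral_nneseries mu (@measurable_circ R) mu_ c0).
  apply: eq_eseriesr => k _.
  have := lpiE ltr01 (hu k); rewrite powRr1 ?nrm_ge0 // => <-; rewrite lpi_def.
  by apply: eq_integral => x _; rewrite powRr1 ?cabs_ge0.
have G0 x : TT x -> (0 <= \sum_(k <oo) (cabs (u k x))%:E)%E.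
  by move=> cx; apply: nneseries_ge0 => k _ _; exact: c0.
have iG : mu.-integrable TT (fun x => \sum_(k <oo) (cabs (u k x))%:E)%E.
  apply/integrableP; split=> //.
  have -> : (\int[mu]_(x in TT) `|\sum_(k <oo) (cabs (u k x))%:E| = \int[mu]_(x in TT) (\sum_(k <oo) (cabs (u k x))%:E))%E.
    by apply: eq_integral => x /set_mem cx; rewrite gee0_abs // G0.
  rewrite E; apply: (@le_lt_trans _ _ (2 * K)%:E); last exact: ltry.
  apply: lime_le; first by apply: is_cvg_nneseries => k _ _; rewrite lee_fin nrm_ge0.
  near=> n; rewrite sumEFin lee_fin big_mkord.
  apply: le_trans (_ : \sum_(k < n) K / 2 ^+ k <= _); first by apply: ler_sum => k _.
  have K0 : 0 <= K by have := le_trans (nrm_ge0 1 (u 0%N)) (hK 0%N); rewrite expr0 divr1.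
  rewrite geo_sum lerBlDr lerDl divr_ge0 ?mulr_ge0 // exprn_ge0 //.
have := @integrable_ae _ _ R mu TT (@measurable_circ R) _ iG; apply: ae_imp => x cx.
by rewrite ge0_fin_numE // G0.
Unshelve. all: by end_near. Qed.

Lemma series_cvg_of_ereal (w : nat -> R) (a : nat -> R) : (forall n, `|w n| <= a n) ->
  (\sum_(k <oo) (a k)%:E < +oo)%E -> cvgn (series w).
Proof.
move=> wa fin; apply: normed_cvg; apply: nondecreasing_is_cvgn.
  by apply/nondecreasing_seqP => n; rewrite [leRHS]big_nat_recr //= lerDl normr_ge0.
have a0 n : 0 <= a n by exact: le_trans (wa n).
exists (fine (\sum_(k <oo) (a k)%:E)%E) => _ [n _ <-].
rewrite -lee_fin fineK; last first.
  by rewrite ge0_fin_numE //; apply: nneseries_ge0 => k _ _; rewrite lee_fin.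
apply: le_trans (nneseries_lim_ge n _); last by move=> k _ _; rewrite lee_fin.
rewrite /series /= sumEFin lee_fin; apply: ler_sum => k _; exact: wa.
Qed.

Lemma aecvg_fast (v : nat -> R -> C) g (K : R) : (forall n, Lp 1 (v n)) -> Lp 1 g ->
  (forall n, nrm 1 (fun x => v n x - g x) <= K / 2 ^+ n) -> aecvg v g.
Proof.
move=> hv hg h; have [_] := @ae_series (fun n x => v n x - g x) K (fun n => LpB (lexx 1) (hv n) hg) h.
apply: ae_imp => x _ fin.
apply: cvg_series_cvg_0; apply: series_cvg_of_ereal fin => n.
by rewrite ger0_norm ?cabs_ge0.
Qed.

Lemma sumC_Re (I : Type) (r : seq I) (F : I -> C) :
  complex.Re (\sum_(i <- r) F i) = \sum_(i <- r) complex.Re (F i).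
Proof. by elim/big_rec2: _ => // i y x _; rewrite ReD => ->. Qed.
Lemma sumC_Im (I : Type) (r : seq I) (F : I -> C) :
  complex.Im (\sum_(i <- r) F i) = \sum_(i <- r) complex.Im (F i).
Proof. by elim/big_rec2: _ => // i y x _; rewrite ImD => ->. Qed.

Lemma Lp_sum p (I : Type) (r : seq I) (F : I -> R -> C) : 1 <= p -> (forall i, Lp p (F i)) ->
  Lp p (fun x => \sum_(i <- r) F i x) /\
  nrm p (fun x => \sum_(i <- r) F i x) <= \sum_(i <- r) nrm p (F i).
Proof.
move=> p1 hF; have p0 : 0 < p by exact: lt_le_trans p1.
elim: r => [|i r [IH1 IH2]].
  have -> : (fun x => \sum_(i <- [::]) F i x) = (fun=> 0) by apply/funext => x; rewrite big_nil.
  by rewrite big_nil nrm0 //; split=> //; exact: Lp0.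
have -> : (fun x => \sum_(j <- i :: r) F j x) = (fun x => F i x + \sum_(j <- r) F j x).
  by apply/funext => x; rewrite big_cons.
rewrite big_cons; split; first exact: LpD.
by rewrite (le_trans (nrmD p1 (hF i) IH1)) // lerD2l.
Qed.

(** Completeness of L^p. Geometric majorants stand in for Cauchy sequences throughout, so that every
    limit comes with an explicit rate. *)
Lemma Lp_series p (u : nat -> R -> C) (K : R) : 1 <= p ->
  (forall n, Lp p (u n)) -> (forall n, nrm p (u n) <= K / 2 ^+ n) ->
  exists f, [/\ Lp p f, forall n, nrm p (fun x => f x - \sum_(k < n) u k x) <= 2 * K / 2 ^+ n &
    aecvg (fun n x => \sum_(k < n) u k x) f].
Proof.
move=> p1 hu hK; have p0 : 0 < p by exact: lt_le_trans p1.
have K0 : 0 <= K by have := le_trans (nrm_ge0 p (u 0%N)) (hK 0%N); rewrite expr0 divr1.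
pose L : R := (2 * pi) `^ (1 - p^-1).
have [n||mG aeG] := @ae_series u (L * K); first exact: (Lp_inL1 p1 (hu n)).1.
  move=> n; rewrite (le_trans (Lp_inL1 p1 (hu n)).2) // -mulrA ler_wpM2l ?powR_ge0 //.
pose G x := (\sum_(k <oo) (cabs (u k x))%:E)%E.
(* Off A the terms are replaced by 0: the real and imaginary series then converge at every point and
   their sums are measurable. *)
pose A := TT `&` [set x | (G x < +oo)%E].
have mA : measurable A by exact: (emeasurable_fun_infty_o (@measurable_circ R) mG).
pose w (P : C -> R) n x := P (u n x) * \1_A x.
have cw (P : C -> R) x : (forall z, `|P z| <= cabs z) -> cvgn (series (w P ^~ x)).
  move=> hP; have [Ax|nAx] := pselect (A x).
    apply: (@series_cvg_of_ereal _ (fun k => cabs (u k x))); last exact: Ax.2.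
    by move=> n; rewrite /w indicE mem_set // mulr1 hP.
  rewrite (_ : series _ = (fun=> 0)); first exact: is_cvg_cst.
  by apply/funext => n; rewrite /series /= big1 // => k _; rewrite /w indicE memNset // mulr0.
pose f x := (limn (series (w (@complex.Re R) ^~ x)) +i* limn (series (w (@complex.Im R) ^~ x)))%C.
have mlim (P : C -> R) : (forall z, `|P z| <= cabs z) -> (forall k, measurable_fun TT (fun x => P (u k x))) ->
    measurable_fun TT (fun x => limn (series (w P ^~ x))).
  move=> hP mP; apply: (@measurable_fun_cvg _ _ _ _ (fun n x => series (w P ^~ x) n)).
    move=> n; rewrite /series /=.
    have : measurable_fun TT (fun x => \sum_(0 <= k < n) w P k x).
      apply: measurable_sum => k; apply: measurable_funM; first exact: mP.
      by apply: measurable_funTS; exact: measurable_indic.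
    by [].
  by move=> x _; exact: cw.
have mf : cmeas f.
  split; first exact: (mlim _ (@Re_le_cabs R) (fun k => (Lp_meas (hu k)).1)).
  exact: (mlim _ (@Im_le_cabs R) (fun k => (Lp_meas (hu k)).2)).
have cv : aecvg (fun n x => \sum_(k < n) u k x) f.
  apply: ae_imp aeG => x cx Gx; have Ax : A x by split.
  have cR := cw _ x (@Re_le_cabs R); have cI := cw _ x (@Im_le_cabs R).
  have E (P : C -> R) n : series (w P ^~ x) n = \sum_(k < n) P (u k x).
    by rewrite /series /= big_mkord; apply: eq_bigr => k _; rewrite /w indicE mem_set // mulr1.
  have cR0 := cvg_abs_sub cR.
  have cI0 := cvg_abs_sub cI.
  have : (fun n => `|series (w (@complex.Re R) ^~ x) n - limn (series (w (@complex.Re R) ^~ x))| +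
      `|series (w (@complex.Im R) ^~ x) n - limn (series (w (@complex.Im R) ^~ x))|) @ \oo --> (0 + 0 : R).
    exact: cvgD.
  rewrite addr0; apply: squeeze0 => n.
  rewrite cabs_ge0 /=; apply: le_trans (cabs_le _) _.
  by rewrite ReD ImD ReN ImN /f /= sumC_Re sumC_Im !E.
have hs n : Lp p (fun x => \sum_(k < n) u k x) by exact: (Lp_sum _ p1 (fun k : 'I_n => hu k)).1.
(* Fatou, applied to the partial sums of the series that starts at n, bounds the error by the
   geometric tail 2 K / 2^n. *)
have hB n : Lp p (fun x => f x - \sum_(k < n) u k x) /\
    nrm p (fun x => f x - \sum_(k < n) u k x) <= 2 * K / 2 ^+ n.
  apply: (@fatou_Lp p (fun m x => \sum_(k < m) u (n + k)%N x)) => //.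
  - by rewrite divr_ge0 ?mulr_ge0 // exprn_ge0.
  - by move=> m; exact: (Lp_sum _ p1 (fun k : 'I_m => hu (n + k)%N)).1.
  - move=> m; apply: le_trans (Lp_sum _ p1 (fun k : 'I_m => hu (n + k)%N)).2 _.
    apply: le_trans (_ : \sum_(k < m) (K / 2 ^+ n) / 2 ^+ k <= _).
      by apply: ler_sum => k _; rewrite -mulrA -invfM -exprD addnC.
    rewrite geo_sum mulrA lerBlDr lerDl !divr_ge0 ?mulr_ge0 ?invr_ge0 ?exprn_ge0 //.
  - by apply: cmeasB => //; exact: Lp_meas (hs n).
  - apply: ae_imp cv => x _ hx.
    have -> : (fun m => cabs (\sum_(k < m) u (n + k)%N x - (f x - \sum_(k < n) u k x))) =
      (fun m => cabs (\sum_(k < m + n) u k x - f x)).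
      apply/funext => m; congr cabs; rewrite addnC big_split_ord /= opprB addrA; congr (_ - _).
      by rewrite addrC.
    by have := hx; rewrite -(cvg_shiftn n).
have hf : Lp p f.
  by have := (hB 0%N).1; under eq_fun do rewrite big_ord0 subr0.
by exists f; split => // n; exact: (hB n).2.
Unshelve. all: by end_near. Qed.

End Complete.

(** * Trigonometric polynomials and Fejer means *)
Section Fejer.
Variable R : realType.
Local Notation C := R[i].
Local Notation mu := (@lebesgue_measure R).
Local Notation TT := (@circ R).
Implicit Types (z w : C) (p q : R) (f g h : R -> C).
Local Opaque cabs cexp powR lebesgue_measure circ.

Lemma dominated_Lp p (v : nat -> R -> C) g : 0 < p -> (forall n, cmeas (v n)) -> Lp p g ->
  (forall n x, TT x -> cabs (v n x) <= cabs (g x)) -> aecvg v (fun=> 0) ->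
  (fun n => nrm p (v n)) @ \oo --> (0 : R).
Proof.
move=> p0 mv hg vg cv.
have mE n : measurable_fun TT (fun x => (cabs (v n x) `^ p)%:E) by exact: measurable_lp.
have ig : mu.-integrable TT (fun x => (cabs (g x) `^ p)%:E).
  apply/integrableP; split; first exact: measurable_lp (Lp_meas hg).
  have := Lp_lty hg; rewrite lpi_def; apply: le_lt_trans; apply: ge0_le_integral.
  - exact: measurable_circ.
  - by [].
  - by apply: measurableT_comp => //; exact: measurable_lp (Lp_meas hg).
  - exact: measurable_lp (Lp_meas hg).
  - by move=> x _; rewrite gee0_abs // lee_fin powR_ge0.
have hv n : Lp p (v n).
  by apply: (@Lp_le _ p 1 g) => // x cx; rewrite mul1r; exact: vg.
have [||||_ _ H] := @dominated_convergence _ _ _ mu TT (@measurable_circ R)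
   (fun n x => (cabs (v n x) `^ p)%:E) (fun=> 0%E) (fun x => (cabs (g x) `^ p)%:E) mE.
- exact: measurable_cst.
- apply: ae_imp cv => x _ hx; apply: cvg_EFin; first by near=> n.
  have := @powR_seq_cvg R p (fun n => cabs (v n x)) 0 p0.
  rewrite powR0 ?gt_eqF //; apply => // [n|]; first exact: cabs_ge0.
  by move: hx; under eq_fun do rewrite subr0.
- exact: ig.
- apply: measure_negligible.aeW => x n cx; rewrite gee0_abs ?lee_fin ?powR_ge0 //.
  by rewrite ge0_ler_powR ?nnegrE ?cabs_ge0 ?(ltW p0) // vg.
have {}H : (fun n => fine (lpi p (v n))) @ \oo --> (0 : R).
  have : (fun n => lpi p (v n)) @ \oo --> 0%:E.
    by move: H; rewrite integral0; apply: cvg_trans; apply: near_eq_cvg; apply: nearW => n; rewrite lpi_def.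
  by move/fine_cvgP => [_].
under eq_fun do rewrite nrm_def.
have := @powR_seq_cvg R p^-1 (fun n => fine (lpi p (v n))) 0.
rewrite powR0 ?invr_eq0 ?gt_eqF //; apply; rewrite ?invr_gt0 // => n.
by rewrite fine_ge0 // lpi_ge0.
Unshelve. all: by end_near. Qed.

Lemma cvg0_lt (s : nat -> R) (e : R) : (forall n, 0 <= s n) -> 0 < e -> s @ \oo --> (0 : R) -> exists n, s n < e.
Proof.
move=> s0 e0 /cvgr0Pnorm_lt /(_ e e0) [n _ h]; exists n.
by have := h n (leqnn n); rewrite /= ger0_norm.
Qed.

(** Trigonometric polynomials are lists of pairs (coefficient, frequency), repetitions allowed:
    sums, products, conjugates and spectral cut-offs become list operations, with no normal form to
    maintain. *)
Definition tp (s : seq (C * int)) : R -> C := fun x => \sum_(u <- s) u.1 * tpow u.2 x.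

Lemma cmeas_tp s : cmeas (tp s).
Proof. by apply: cmeas_sum => u _; apply: cmeasM; [exact: cmeas_cst|exact: cmeas_tpow]. Qed.
Lemma tp_bnd s x : cabs (tp s x) <= \sum_(u <- s) cabs u.1.
Proof.
by apply: le_trans (cabs_sum _ _ _) _; apply: ler_sum => u _; rewrite cabsM cabs_tpow mulr1.
Qed.
Lemma Lp_tp p s : 0 < p -> Lp p (tp s).
Proof. by move=> p0; apply: (Lp_bnd p0 (cmeas_tp s) (ae_forall (fun x _ => tp_bnd s x))).1. Qed.
Lemma tp_cons u s x : tp (u :: s) x = u.1 * tpow u.2 x + tp s x.
Proof. by rewrite /tp big_cons. Qed.
Lemma tp_nil x : tp [::] x = 0. Proof. by rewrite /tp big_nil. Qed.
Lemma tp_cat s t x : tp (s ++ t) x = tp s x + tp t x.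
Proof. by rewrite /tp big_cat. Qed.
Definition tpZ z (s : seq (C * int)) := [seq (z * u.1, u.2) | u <- s].
Lemma tpZE z s x : tp (tpZ z s) x = z * tp s x.
Proof. by rewrite /tp big_map big_distrr; apply: eq_bigr => u _ /=; rewrite mulrA. Qed.
Definition tpJ (s : seq (C * int)) := [seq (u.1, - u.2) | u <- s].
Lemma tpJE s : tp (tpJ s) = tilde (tp s).
Proof. by apply/funext => x; rewrite /tp /tilde big_map; apply: eq_bigr => u _; rewrite tpow_reflect. Qed.
Definition tpM (s t : seq (C * int)) := [seq (u.1 * v.1, u.2 + v.2) | u <- s, v <- t].
Lemma tpME s t x : tp (tpM s t) x = tp s x * tp t x.
Proof.
rewrite /tp big_allpairs_dep big_distrl; apply: eq_bigr => u _; rewrite big_distrr; apply: eq_bigr => v _ /=.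
by rewrite tpowD; ring.
Qed.
Definition tpC (s : seq (C * int)) := [seq ((u.1)^*%C, - u.2) | u <- s].
Lemma tpow_conj n (x : R) : ((tpow n x)^*)%C = tpow (- n) x :> C.
Proof. by rewrite tpowN /tpow cexp_conj. Qed.
Lemma tpCE s x : tp (tpC s) x = ((tp s x)^*)%C.
Proof.
by rewrite /tp big_map rmorph_sum; apply: eq_bigr => u _; rewrite rmorphM /= tpow_conj.
Qed.
Lemma fc_tp s n : fc (tp s) n = \sum_(u <- s) u.1 * (u.2 == n)%:R.
Proof.
elim: s => [|u s IH].
  have -> : tp [::] = (fun x => 0 * tp [::] x) by apply/funext => x; rewrite tp_nil mul0r.
  by rewrite fcZ ?mul0r ?big_nil //; exact: Lp_tp.
have -> : tp (u :: s) = (fun x => u.1 * tpow u.2 x + tp s x) by apply/funext => x; rewrite tp_cons.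
have h1 : Lp 1 (tpow u.2 : R -> C).
  have -> : tpow u.2 = tp [:: (1, u.2)] by apply/funext => x; rewrite tp_cons tp_nil mul1r addr0.
  exact: Lp_tp.
by rewrite fcD ?fcZ ?fc_tpow ?IH ?big_cons //; [exact: LpZ|exact: Lp_tp].
Qed.
Lemma ci_Mtp f s : Lp 1 f -> ci (fun x => f x * tp s x) = (2 * pi)%:C%C * \sum_(u <- s) u.1 * fc f (- u.2).
Proof.
move=> hf; elim: s => [|u s IH].
  rewrite big_nil mulr0; have -> : (fun x => f x * tp [::] x) = (fun x => 0 * f x).
    by apply/funext => x; rewrite tp_nil mulr0 mul0r.
  by rewrite ciZ // mul0r.
have -> : (fun x => f x * tp (u :: s) x) = (fun x => u.1 * (f x * tpow u.2 x) + f x * tp s x).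
  by apply/funext => x; rewrite tp_cons; ring.
have h1 := Lp_tpowM u.2 ltr01 hf.
have h2 : Lp 1 (fun x => f x * tp s x).
  under eq_fun do rewrite mulrC.
  exact: (LpM_bnd ltr01 (cmeas_tp s) (ae_forall (fun x _ => tp_bnd s x)) hf).1.
rewrite ciD ?ciZ ?IH ?big_cons //; last exact: LpZ.
rewrite fc_def opprK [RHS]mulrDr; congr (_ + _).
rewrite mulrCA mulrA mulrA; congr (_ * _); rewrite -mulrA -rmorphM /= mulfV ?mulr1 // gt_eqF // pi2_gt0 //.
Qed.

(** As a double sum over 0 <= k, j <= n the frequency m = k - j occurs n + 1 - |m| times, which
    gives the Fejer weights; this form matches the square in [fkernel]. *)
Definition fejer n f : R -> C :=
  tp [seq (n.+1%:R^-1 * fc f (k%:Z - j%:Z), k%:Z - j%:Z) | k <- iota 0 n.+1, j <- iota 0 n.+1].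
Definition fkernel n (x y : R) : R := n.+1%:R^-1 * cabs (\sum_(k <- iota 0 n.+1) tpow k (x - y)) ^+ 2.

Lemma fkernel_ge0 n x y : 0 <= fkernel n x y.
Proof. by rewrite mulr_ge0 ?invr_ge0 ?ler0n ?sqr_ge0. Qed.

Lemma cabs_sqrC z : (cabs z ^+ 2)%:C%C = z * (z^*)%C.
Proof.
rewrite cabs_sqr; case: z => a b /=; simpc; congr (_ +i* _)%C; ring.
Qed.

Definition fkseq n (x : R) := [seq (n.+1%:R^-1 * tpow (k%:Z - j%:Z) x, - (k%:Z - j%:Z)) | k <- iota 0 n.+1, j <- iota 0 n.+1] : seq (C * int).

Lemma tpow_sub (m : int) (x y : R) : tpow m (x - y) = tpow m x * tpow (- m) y :> C.
Proof. by rewrite /tpow mulrBr cexpD mulrNz -mulNr. Qed.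

Lemma fkernelE n x y : (fkernel n x y)%:C%C = tp (fkseq n x) y.
Proof.
rewrite /fkernel rmorphM /= cabs_sqrC rmorph_sum /tp big_allpairs_dep /=.
rewrite fmorphV /= rmorph_nat mulr_suml mulr_sumr; apply: eq_bigr => k _.
rewrite !mulr_sumr; apply: eq_bigr => j _ /=.
by rewrite tpow_conj -tpowD tpow_sub mulrA.
Qed.

Lemma fejer_ci n f x : Lp 1 f -> ci (fun y => f y * (fkernel n x y)%:C%C) = (2 * pi)%:C%C * fejer n f x.
Proof.
move=> hf; under eq_fun do rewrite fkernelE.
rewrite ci_Mtp // /fejer /tp !big_allpairs_dep /=; congr (_ * _).
by apply: eq_bigr => k _; apply: eq_bigr => j _ /=; rewrite opprK; ring.
Qed.

Lemma fejer_tpow n (m : int) x : (`|m| <= 1)%N ->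
  fejer n (tpow m) x = (1 - `|m|%N%:R / n.+1%:R) * tpow m x.
Proof.
move=> m1; rewrite /fejer /tp big_allpairs_dep /=.
transitivity (n.+1%:R^-1 * tpow m x * \sum_(k <- iota 0 n.+1) \sum_(j <- iota 0 n.+1) (m == k%:Z - j%:Z)%:R).
  rewrite mulr_sumr; apply: eq_bigr => k _; rewrite mulr_sumr; apply: eq_bigr => j _ /=.
  by rewrite fc_tpow; have [->|_] := eqVneq m (k%:Z - j%:Z); rewrite ?mulr1 ?mulr0 ?mul0r.
(* For each k the only candidate is j = k - m, and it counts when 0 <= k - m <= n. *)
have cnt : \sum_(k <- iota 0 n.+1) \sum_(j <- iota 0 n.+1) (m == k%:Z - j%:Z)%:R = (n.+1 - `|m|)%:R :> C.
  rewrite (eq_big_seq (fun k : nat => ((0 <= k%:Z - m) && (k%:Z - m <= n%:Z))%R%:R)); last first.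
    move=> k; rewrite mem_iota add0n => /andP[_ kn].
    case: ifPn => // h || idtac.
    have [/andP[h1 h2]|h] := boolP ((0 <= k%:Z - m) && (k%:Z - m <= n%:Z)).
      rewrite (bigD1_seq `|k%:Z - m|%N) ?iota_uniq ?mem_iota //=; last by lia.
      rewrite (_ : m == _) ?big1 ?addr0 //; last by apply/eqP; lia.
      by move=> j /eqP jn; rewrite (_ : m == _ = false) //; apply/eqP; lia.
    by rewrite big_seq big1 // => j; rewrite mem_iota => jn; rewrite (_ : m == _ = false) //; apply/eqP; lia.
  rewrite -natr_sum; congr _%:R.
  rewrite -[iota 0 n.+1]/(index_iota 0 n.+1) -[X in _ = X]/(n.+1 - `|m|)%N.
  have [m0|[m0|m0]] : m = 0 \/ m = 1 \/ m = -1 by lia.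
  - rewrite m0 (eq_big_nat _ _ (F2 := fun=> 1%N)) ?sum_nat_const_nat ?muln1 ?subn0 //.
    by move=> k kn; rewrite (_ : (_ && _)) //; lia.
  - rewrite m0 big_nat_recl // (eq_big_nat _ _ (F2 := fun=> 1%N)) ?sum_nat_const_nat ?muln1 //=.
    by move=> k kn; rewrite (_ : (k.+1%:Z - 1 <= n%:Z)%R = true) //; lia.
  - rewrite m0 big_nat_recr //= (eq_big_nat _ _ (F2 := fun=> 1%N)) ?sum_nat_const_nat ?muln1 //=.
      by rewrite (_ : (n%:Z - -1 <= n%:Z)%R = false) ?addn0 ?subn0 ?subn1 //; lia.
    by move=> k kn; rewrite (_ : (k%:Z - -1 <= n%:Z)%R = true) //; lia.
rewrite cnt natrB; last by lia.
have n0 : n.+1%:R != 0 :> C by rewrite pnatr_eq0.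
by field.
Qed.

Lemma nrm1_pos f : Lp 1 f -> (forall x, f x = (cabs (f x))%:C%C) -> (nrm 1 f)%:C%C = ci f.
Proof.
move=> hf pf; rewrite nrm1E // ci_def; apply/eqP; rewrite eq_complex /=; apply/andP; split; apply/eqP.
  by apply: eq_Rintegral => x _; rewrite [in RHS]pf.
rewrite [RHS](_ : _ = Rintegral mu TT (fun=> 0)); last by apply: eq_Rintegral => x _; rewrite pf.
by rewrite /Rintegral integral0.
Qed.

Lemma Lp_bndT p (M : R) f : 0 < p -> cmeas f -> (forall x, TT x -> cabs (f x) <= M) -> Lp p f.
Proof. by move=> p0 mf h; exact: (Lp_bnd p0 mf (ae_forall h)).1. Qed.

Lemma cmeas_fkernel n x : cmeas (fun y => (fkernel n x y)%:C%C : C).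
Proof. by under eq_fun do rewrite fkernelE; exact: cmeas_tp. Qed.

Lemma fkernel_bnd n x y : (fkernel n x y) <= \sum_(u <- fkseq n x) cabs u.1.
Proof.
by rewrite -(ger0_norm (fkernel_ge0 n x y)) -cabs_real fkernelE tp_bnd.
Qed.

Lemma Lp_fkernelM p n x f : 0 < p -> Lp p f -> Lp p (fun y => f y * (fkernel n x y)%:C%C).
Proof.
move=> p0 hf; under eq_fun do rewrite mulrC.
apply: (LpM_bnd p0 (cmeas_fkernel n x) (M := \sum_(u <- fkseq n x) cabs u.1) _ hf).1.
apply: ae_forall => y _; rewrite cabs_real ger0_norm ?fkernel_ge0 //; exact: fkernel_bnd.
Qed.

Lemma fejer1 n x : fejer n (fun=> 1) x = 1.
Proof.
have -> : (fun=> 1) = tpow 0 :> (R -> C) by apply/funext => y; rewrite tpow0.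
by rewrite fejer_tpow // mul0r subr0 mul1r tpow0.
Qed.

Lemma Lp_tpow p m : 0 < p -> Lp p (tpow m : R -> C).
Proof. by move=> p0; apply: (@Lp_bndT p 1) => //; [exact: cmeas_tpow|move=> x _; rewrite cabs_tpow]. Qed.
Lemma Lp_cst p z : 0 < p -> Lp p (fun=> z).
Proof. by move=> p0; apply: (@Lp_bndT p (cabs z)) => //; exact: cmeas_cst. Qed.

(* Korovkin: the test functions 1, cos and sin control the convergence of the positive operators fejer n *)
Lemma fejer_dist n f x (e M : R) : Lp 1 f ->
  (forall y, TT y -> cabs (f y - f x) <= e + M * (1 - cos (x - y))) ->
  cabs (fejer n f x - f x) <= e + M / n.+1%:R.
Proof.
move=> hf hM.
have hd : Lp 1 (fun y => f y - f x) by apply: LpB => //; exact: Lp_cst.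
have E : ci (fun y => (f y - f x) * (fkernel n x y)%:C%C) = (2 * pi)%:C%C * (fejer n f x - f x).
  under eq_fun do rewrite mulrBl.
  rewrite ciB; [|exact: Lp_fkernelM|]; last by apply: (@Lp_fkernelM 1 n x (fun=> f x)) => //; exact: Lp_cst.
  rewrite fejer_ci //.
  have -> : (fun y => f x * (fkernel n x y)%:C%C) = (fun y => f x * (1 * (fkernel n x y)%:C%C)) by apply/funext => y; rewrite mul1r.
  rewrite ciZ; last by apply: Lp_fkernelM => //; exact: Lp_cst.
  by rewrite fejer_ci ?fejer1; [ring|exact: Lp_cst].
(* The majorant e + M (1 - cos (x - y)) is written with the frequencies -1, 0, 1, whose Fejer means
   are explicit. *)
pose G y : C := ((e + M)%:C%C + (- M / 2)%:C%C * (tpow 1 x * tpow (-1) y + tpow (-1) x * tpow 1 y)).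
have GE y : G y = (e + M * (1 - cos (x - y)))%:C%C.
  rewrite /G -(opprK 1) -!tpow_sub opprK /tpow mul1r mulN1r !cexpE cosN sinN; simpc.
  by congr (_ +i* _)%C; field.
have hG : Lp 1 G.
  apply: LpD => //; first exact: Lp_cst.
  by apply: LpZ => //; apply: LpD => //; apply: LpZ => //; exact: Lp_tpow.
have hGK := Lp_fkernelM n x ltr01 hG.
have GK0 y : TT y -> 0 <= e + M * (1 - cos (x - y)) by move=> cy; exact: le_trans (cabs_ge0 _) (hM y cy).
have ciG : ci (fun y => G y * (fkernel n x y)%:C%C) = (2 * pi)%:C%C * (e + M / n.+1%:R)%:C%C.
  have -> : (fun y => G y * (fkernel n x y)%:C%C) = (fun y => (e + M)%:C%C * (1 * (fkernel n x y)%:C%C) +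
     ((- M / 2)%:C%C * tpow 1 x * (tpow (-1) y * (fkernel n x y)%:C%C) +
      (- M / 2)%:C%C * tpow (-1) x * (tpow 1 y * (fkernel n x y)%:C%C))).
    by apply/funext => y; rewrite /G; ring.
  have h1 := Lp_fkernelM n x ltr01 (Lp_cst 1 ltr01).
  have h2 := Lp_fkernelM n x ltr01 (Lp_tpow (-1) ltr01).
  have h3 := Lp_fkernelM n x ltr01 (Lp_tpow 1 ltr01).
  rewrite ciD; [|exact: LpZ|by apply: LpD => //; exact: LpZ].
  rewrite ciD; [|exact: LpZ|exact: LpZ].
  rewrite (ciZ _ h1) (ciZ _ h2) (ciZ _ h3) (fejer_ci n x (Lp_cst 1 ltr01)).
  rewrite (fejer_ci n x (Lp_tpow 1 ltr01)) (fejer_ci n x (Lp_tpow (-1) ltr01)).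
  rewrite fejer1 !fejer_tpow //=.
  have t1 : tpow 1 x * tpow (-1) x = 1 :> C by rewrite -tpowD subrr tpow0.
  have n0 : n.+1%:R != 0 :> C by rewrite pnatr_eq0.
  have -> : (e + M / n.+1%:R)%:C%C = e%:C%C + M%:C%C / n.+1%:R by rewrite rmorphD rmorphM /= fmorphV rmorph_nat.
  have -> : (- M / 2)%:C%C = - M%:C%C / 2 :> C by rewrite rmorphM rmorphN /= fmorphV rmorph_nat.
  rewrite rmorphD /=.
  transitivity ((2 * pi)%:C%C * (e%:C%C + M%:C%C - M%:C%C * (1 - 1 / n.+1%:R) * (tpow 1 x * tpow (-1) x))).
    by field.
  by rewrite t1; field.
have pi2C : 0 < 2 * pi :> R := pi2_gt0 R.
rewrite -(ler_pM2l pi2C).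
have -> : 2 * pi * cabs (fejer n f x - f x) = cabs (ci (fun y => (f y - f x) * (fkernel n x y)%:C%C)).
  by rewrite E cabsM cabs_real ger0_norm // ltW.
have hdK := Lp_fkernelM n x ltr01 hd.
apply: (le_trans (cabs_ci_le hdK)).
pose G' y : C := (cabs (G y * (fkernel n x y)%:C%C))%:C%C.
have mG' : cmeas G' by apply: cmeas_real; apply: cmeas_cabs; exact: Lp_meas hGK.
have hG' : Lp 1 G'.
  by apply: (@Lp_le _ 1 1 _ G') hGK _ => // y _; rewrite mul1r /G' cabs_real ger0_norm ?cabs_ge0.
have EG : aeq G' (fun y => G y * (fkernel n x y)%:C%C).
  apply: ae_forall => y cy; rewrite /G' cabsM GE !cabs_real !ger0_norm ?fkernel_ge0 ?GK0 // rmorphM //.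
have nG : nrm 1 G' = 2 * pi * (e + M / n.+1%:R).
  have : (nrm 1 G')%:C%C = ((2 * pi) * (e + M / n.+1%:R))%:C%C :> C.
    rewrite nrm1_pos //; last by move=> y; rewrite /G' cabs_real [in RHS]ger0_norm ?cabs_ge0.
    by rewrite (ci_ext mG' (Lp_meas hGK) EG) ciG -rmorphM.
  by move/(congr1 (@complex.Re R)).
rewrite -nG -[leRHS]mul1r; apply: (@nrm_le_ae _ 1 1 G' _ _ _ _ hG' _).2 => //.
  exact: Lp_meas hdK.
apply: ae_forall => y cy; rewrite mul1r /G' cabs_real (ger0_norm (cabs_ge0 _)) !cabsM.
apply: ler_wpM2r; first exact: cabs_ge0.
by rewrite GE cabs_real (le_trans (hM y cy)) // ler_norm.
Qed.

(** The mean is an average of f against a nonnegative kernel of total mass 2 pi. *)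
Lemma fejer_bnd n f x (M : R) : cmeas f -> (forall y, TT y -> cabs (f y) <= M) -> cabs (fejer n f x) <= M.
Proof.
move=> mf hM; have hf := Lp_bndT ltr01 mf hM.
have pi2C : 0 < 2 * pi :> R := pi2_gt0 R.
rewrite -(ler_pM2l pi2C).
have -> : 2 * pi * cabs (fejer n f x) = cabs (ci (fun y => f y * (fkernel n x y)%:C%C)).
  by rewrite fejer_ci // cabsM cabs_real ger0_norm // ltW.
have hfK := Lp_fkernelM n x ltr01 hf.
apply: (le_trans (cabs_ci_le hfK)).
have h1 := Lp_fkernelM n x ltr01 (Lp_cst 1 ltr01).
have T0 : TT 0 by rewrite -[TT]/(`[0, 2 * pi]%classic) /= in_itv /= lexx ltW.
have M0 : 0 <= M := le_trans (cabs_ge0 _) (hM 0 T0).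
have nK : nrm 1 (fun y => 1 * (fkernel n x y)%:C%C : C) = 2 * pi.
  have : (nrm 1 (fun y => 1 * (fkernel n x y)%:C%C : C))%:C%C = (2 * pi)%:C%C :> C.
    rewrite nrm1_pos //; last by move=> y; rewrite mul1r cabs_real ger0_norm ?fkernel_ge0.
    by rewrite fejer_ci ?fejer1 ?mulr1 //; exact: Lp_cst.
  by move/(congr1 (@complex.Re R)).
rewrite -nK mulrC; apply: (nrm_le_ae _ _ _ h1 _).2 => //.
  exact: Lp_meas hfK.
apply: ae_forall => y cy; rewrite mul1r cabsM; apply: ler_wpM2r; [exact: cabs_ge0|exact: hM].
Qed.
End Fejer.

(** * Density of trigonometric polynomials and uniqueness of Fourier coefficients *)

Section Density.
Variable R : realType.
Local Notation C := R[i].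
Local Notation mu := (@lebesgue_measure R).
Local Notation TT := (@circ R).
Implicit Types (z w : C) (p q : R) (f g h : R -> C).
Local Opaque cabs cexp powR lebesgue_measure.

Lemma circP (x : R) : TT x <-> 0 <= x <= 2 * pi.
Proof. by rewrite /circ /= in_itv /=. Qed.
Local Opaque circ.

Definition trunc (M t : R) : R := Num.max (- M) (Num.min M t).
Lemma trunc_bnd (M t : R) : 0 <= M -> `|trunc M t| <= M.
Proof. move=> M0; rewrite /trunc ler_norml le_max lexx ge_max ge_min lexx /=; lra. Qed.
Lemma trunc_id (M t : R) : `|t| <= M -> trunc M t = t.
Proof. rewrite ler_norml /trunc => /andP[h1 h2]; case: (leP M t) => h; case: (leP (- M) _) => h'; lra. Qed.
Lemma trunc_lip (M a b : R) : 0 <= M -> `|trunc M a - trunc M b| <= `|a - b|.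
Proof.
move=> M0; rewrite /trunc ler_normr !ler_norml.
by case: (leP M a) => ha; case: (leP M b) => hb; case: (leP (- M) M) => hM; try lra;
  case: (leP (- M) a) => ha'; try case: (leP (- M) b) => hb'; apply/orP; case: (leP a b) => hab; ((left; apply/andP; split; lra) || (right; apply/andP; split; lra)).
Qed.

Lemma cos_gap (d t : R) : 0 < d -> d <= `|t| <= 2 * pi - d -> 0 < 1 - cos d <= 1 - cos t.
Proof.
move=> d0 /andP[h1 h2]; have dpi : d <= pi by lra.
have pi0 := pi_gt0 R.
have c1 : cos d < 1.
  rewrite -cos0 ltr_cos ?in_itv /= ?lexx ?(ltW d0) ?(ltW pi0) ?dpi //.
rewrite subr_gt0 c1 /= lerD2l lerN2 -[leLHS]cos_norm.
have [h|h] := leP `|t| pi.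
  by rewrite leNgt ltr_cos -?leNgt ?in_itv /= ?normr_ge0 ?h ?(ltW d0) ?dpi.
have -> : cos `|t| = cos (2 * pi - `|t|).
  have : cexp (2 * pi - `|t|) = (cexp `|t|)^-1 :> C by rewrite cexp2piB.
  by rewrite -cexpN !cexpE cosN => -[->].
rewrite leNgt ltr_cos -?leNgt ?in_itv /= ?(ltW d0) ?dpi //; first lra.
by apply/andP; split; lra.
Qed.

(** Near x the oscillation of f is controlled by that of g; away from x the quantity 1 - cos (x - y)
    is bounded below, and M absorbs the bound 2 B. The point is interior because f need not match at
    the two ends of the interval. *)
Lemma fejer_pointwise (f : R -> C) (g : R -> R) (B x : R) : cmeas f ->
  (forall y, TT y -> cabs (f y) <= B) ->
  (forall y z : R, cabs (f y - f z) <= `|g y - g z|) -> {for x, continuous g} -> 0 < x < 2 * pi ->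
  (fun n => cabs (fejer n f x - f x)) @ \oo --> (0 : R).
Proof.
move=> mf hB fg cg /andP[x0 x1].
have cx : TT x by apply/circP; rewrite !ltW.
have B0 : 0 <= B := le_trans (cabs_ge0 _) (hB x cx).
apply/cvgr0Pnorm_le => e e0.
have /cvgrPdist_le /(_ (e / 2)) : g y @[y --> x] --> g x by exact: cg.
rewrite divr_gt0 // => /(_ isT) [d /= d0 hd].
(* Besides continuity, d' <= x and d' <= 2 pi - x keep |x - y| at most 2 pi - d', away from the
   second zero of 1 - cos. *)
pose d' := Num.min (Num.min (d / 2) x) (2 * pi - x).
have d'0 : 0 < d' by rewrite /d' !lt_min x0 subr_gt0 x1 divr_gt0.
have [d'1 d'2 d'3] : [/\ d' <= d / 2, d' <= x & d' <= 2 * pi - x].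
  by rewrite /d' !ge_min !lexx !orbT.
pose M := 2 * B / (1 - cos d').
have piR := pi_gt0 R.
have gap t : d' <= `|t| <= 2 * pi - d' -> 0 < 1 - cos d' <= 1 - cos t by exact: cos_gap.
have gap0 : 0 < 1 - cos d' by have /andP[] := gap d' ltac:(rewrite ger0_norm ?lexx /=; lra).
have M0 : 0 <= M by rewrite divr_ge0 ?mulr_ge0 // ltW.
have key n : cabs (fejer n f x - f x) <= e / 2 + M / n.+1%:R.
  apply: fejer_dist; first exact: (Lp_bndT ltr01 mf hB).
  move=> y cy; have /circP/andP[y0 y1] := cy.
  have [h|h] := ltP `|x - y| d'.
    apply: (le_trans (fg y x)); rewrite distrC; apply: (@le_trans _ _ (e / 2)).
      by apply: hd => /=; rewrite (lt_le_trans h) // (le_trans d'1) //; lra.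
    by rewrite lerDl mulr_ge0 // subr_ge0 cos_le1.
  have hxy : d' <= `|x - y| <= 2 * pi - d'.
    by rewrite h /= ler_norml; apply/andP; split; lra.
  have /andP[_ g2] := gap _ hxy.
  apply: (@le_trans _ _ (2 * B)).
    by apply: le_trans (cabsB _ _) _; rewrite mulr_natl mulr2n lerD // hB.
  apply: (@le_trans _ _ (M * (1 - cos (x - y)))); last by rewrite lerDr divr_ge0 // ltW.
  by rewrite /M mulrAC ler_pdivlMr // ler_wpM2l // mulr_ge0.
near=> n; rewrite ger0_norm ?cabs_ge0 //; apply: (le_trans (key n)).
rewrite [leRHS](splitr e) lerD2l.
rewrite ler_pdivrMr ?ltr0n // mulrC -ler_pdivrMr ?divr_gt0 //.
near: n; exists (Num.bound (M / (e / 2))) => // n /= hn.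
have q0 : 0 <= M / (e / 2) := divr_ge0 M0 (ltW (divr_gt0 e0 (ltr0n _ 2))).
by rewrite ltW // (lt_le_trans (archi_boundP q0)) // ler_nat (leq_trans hn).
Unshelve. all: by end_near. Qed.

Lemma circ_ae_interior (P : R -> Prop) : (forall x, 0 < x < 2 * pi -> P x) -> {ae mu, forall x, TT x -> P x}.
Proof.
move=> h; exists [set 0; 2 * pi]; split.
- by apply: measurableU; exact: measurable_set1.
- apply: countable_lebesgue_measure0; exact: finite_set_countable.
- move=> x /= /not_implyP [/circP /andP[h1 h2] nP].
  have [->|x0] := eqVneq x 0; first by left.
  have [->|x1] := eqVneq x (2 * pi); first by right.
  by exfalso; apply: nP; apply: h; rewrite !lt_neqAle eq_sym x0 h1 x1 h2.
Qed.

(** A continuous L^1 approximation is truncated at M, which takes it no farther from h, and then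
    replaced by a Fejer mean; the truncation bounds these means uniformly, so that dominated
    convergence applies to them. *)
Lemma approx_real (h : R -> R) (M e : R) : measurable_fun TT h -> 
  (forall x, TT x -> `|h x| <= M) -> 0 < e ->
  exists s, (forall x, cabs (tp s x : C) <= M) /\ nrm 1 (fun x => (h x)%:C%C - tp s x) < e.
Proof.
move=> mh hM e0.
have T0 : TT 0 by apply/circP; rewrite lexx ltW // pi2_gt0.
have M0 : 0 <= M by exact: le_trans (hM 0 T0).
have hC : Lp 1 (fun x => (h x)%:C%C).
  by apply: (@Lp_bndT _ 1 M) => // x cx; rewrite cabs_real hM.
have [||g [cg ig Hg]] := @approximation_continuous_integrable R TT h (@measurable_circ R).
- by rewrite [X in (X < _)%E]mu_circ ltry.
- exact: (L1_Re hC).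
have [n hn] : exists n, (\int[mu]_(x in TT) `|(h x - g n x)%:E| < (e / 2)%:E)%E.
  have /fine_cvgP [[N1 _ H1] H2] := Hg.
  have /(@cvgr0Pnorm_lt) /(_ (e / 2)) := H2; rewrite divr_gt0 // => /(_ isT) [N2 _ H3].
  exists (maxn N1 N2); have f1 := H1 (maxn N1 N2) (leq_maxl _ _); have f2 := H3 (maxn N1 N2) (leq_maxr _ _).
  by rewrite -[X in (X < _)%E]fineK // lte_fin (le_lt_trans (ler_norm _)).
pose g' x := trunc M (g n x); pose G x : C := (g' x)%:C%C.
have mg' : measurable_fun TT g'.
  apply: measurable_maxr; first exact: measurable_cst.
  apply: measurable_minr; first exact: measurable_cst.
  apply: measurable_funTS; apply: continuous_measurable_fun; exact: cg.
have mG : cmeas G by exact: cmeas_real.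
have GM y : TT y -> cabs (G y) <= M by move=> _; rewrite cabs_real trunc_bnd.
have hG : Lp 1 G := Lp_bndT ltr01 mG GM.
have n1 : nrm 1 (fun x => (h x)%:C%C - G x) < e / 2.
  have hh : Lp 1 (fun x => (h x)%:C%C - G x) by exact: LpB.
  rewrite -lte_fin; have := lpiE ltr01 hh; rewrite powRr1 ?nrm_ge0 // => <-.
  apply: le_lt_trans hn; rewrite lpi_def; apply: ge0_le_integral.
  - exact: measurable_circ.
  - by move=> x _; rewrite lee_fin powR_ge0.
  - exact: measurable_lp (Lp_meas hh).
  - apply/measurable_EFinP; apply: measurableT_comp => //; apply: measurable_funB => //.
    apply: measurable_funTS; apply: continuous_measurable_fun; exact: cg.
  - move=> x cx; rewrite powRr1 ?cabs_ge0 // lee_fin /G -rmorphB /= cabs_real /g'.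
    by rewrite -{1}(trunc_id (hM x cx)) trunc_lip.
have Hfej : (fun k => nrm 1 (fun x => fejer k G x - G x)) @ \oo --> (0 : R).
  apply: (@dominated_Lp _ 1 _ (fun=> (2 * M)%:C%C)) => //.
  - by move=> k; apply: cmeasB => //; exact: cmeas_tp.
  - exact: Lp_cst.
  - move=> k x cx; rewrite cabs_real ger0_norm ?mulr_ge0 //.
    by apply: le_trans (cabsB _ _) _; rewrite mulr_natl mulr2n lerD ?GM // fejer_bnd.
  - apply: circ_ae_interior => x hx; under eq_fun do rewrite subr0.
    apply: (@fejer_pointwise G (g n) M) => //; last exact: cg.
    by move=> y z; rewrite /G -rmorphB /= cabs_real; exact: trunc_lip.
have [k hk] := cvg0_lt (fun k => nrm_ge0 1 _) (divr_gt0 e0 (ltr0n _ 2)) Hfej.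
exists [seq (k.+1%:R^-1 * fc G (a%:Z - j%:Z), a%:Z - j%:Z) | a <- iota 0 k.+1, j <- iota 0 k.+1].
rewrite -/(fejer k G); split; first by move=> x; exact: fejer_bnd.
have -> : (fun x => (h x)%:C%C - fejer k G x) = (fun x => ((h x)%:C%C - G x) - (fejer k G x - G x)).
  by apply/funext => x; ring.
apply: le_lt_trans (nrmB _ _ _) _ => //; [exact: LpB|apply: LpB => //; exact: Lp_tp|lra].
Qed.

Lemma approx_bnd h (M e : R) : cmeas h -> (forall x, TT x -> cabs (h x) <= M) -> 0 < e ->
  exists s, (forall x, cabs (tp s x : C) <= 2 * M) /\ nrm 1 (fun x => h x - tp s x) < e.
Proof.
move=> [m1 m2] hM e0.
have [|s1 [b1 n1]] := @approx_real (fun x => complex.Re (h x)) M (e / 2) m1 _ (divr_gt0 e0 (ltr0n _ 2)).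
  by move=> x cx; rewrite (le_trans (Re_le_cabs _)) // hM.
have [|s2 [b2 n2]] := @approx_real (fun x => complex.Im (h x)) M (e / 2) m2 _ (divr_gt0 e0 (ltr0n _ 2)).
  by move=> x cx; rewrite (le_trans (Im_le_cabs _)) // hM.
exists (s1 ++ tpZ 'i%C s2); split.
  move=> x; rewrite tp_cat tpZE (le_trans (cabsD _ _)) // mulr_natl mulr2n lerD //.
  by rewrite cabsM cabs_i mul1r.
have -> : (fun x => h x - tp (s1 ++ tpZ 'i%C s2) x) = (fun x => ((complex.Re (h x))%:C%C - tp s1 x) +
    'i%C * ((complex.Im (h x))%:C%C - tp s2 x)).
  by apply/funext => x; rewrite tp_cat tpZE {1}(complexRI (h x)); ring.
have L1 (u : R -> R) s : measurable_fun TT u -> (forall x, TT x -> `|u x| <= M) -> Lp 1 (fun x => (u x)%:C%C - tp s x).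
  move=> mu_ hu; apply: LpB => //; last exact: Lp_tp.
  by apply: (@Lp_bndT _ 1 M) => // x cx; rewrite cabs_real hu.
have l1 := L1 _ s1 m1 (fun x cx => le_trans (Re_le_cabs _) (hM x cx)).
have l2 := L1 _ s2 m2 (fun x cx => le_trans (Im_le_cabs _) (hM x cx)).
apply: le_lt_trans (nrmD _ _ _) _ => //; first exact: LpZ.
by rewrite nrmZ // cabs_i mul1r; lra.
Qed.

(** From |f|^p <= B^(p-1) |f|. With it, L^1 approximation by uniformly bounded polynomials becomes
    L^p approximation. *)
Lemma nrm_interp p f (B : R) : 1 <= p -> 0 <= B -> cmeas f -> (forall x, TT x -> cabs (f x) <= B) ->
  nrm p f `^ p <= B `^ (p - 1) * nrm 1 f.
Proof.
move=> p1 B0 mf hB; have p0 : 0 < p by exact: lt_le_trans p1.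
have hf := Lp_bndT p0 mf hB; have hf1 := Lp_bndT ltr01 mf hB.
have E := lpiE ltr01 hf1; rewrite powRr1 ?nrm_ge0 // in E.
rewrite -lee_fin -(lpiE p0 hf) EFinM -E !lpi_def.
have m1 : measurable_fun TT (fun x => (cabs (f x) `^ 1)%:E) by exact: measurable_lp.
rewrite -ge0_integralZl; last 4 first.
- exact: measurable_circ.
- exact: m1.
- by move=> x _; rewrite lee_fin powR_ge0.
- by rewrite lee_fin powR_ge0.
apply: ge0_le_integral.
- exact: measurable_circ.
- by move=> x _; rewrite lee_fin powR_ge0.
- exact: measurable_lp.
- apply/measurable_EFinP; apply: measurable_funM => //; apply: measurable_powR_fun; exact: cmeas_cabs.
move=> x cx; rewrite -EFinM lee_fin powRr1 ?cabs_ge0 //.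
rewrite -(mulr_powRB1 (cabs_ge0 _) p0) mulrC ler_wpM2r ?cabs_ge0 //.
by rewrite ge0_ler_powR ?subr_ge0 ?nnegrE ?cabs_ge0 // hB.
Qed.

Lemma dense_bnd p h (M e : R) : 1 <= p -> cmeas h -> (forall x, TT x -> cabs (h x) <= M) -> 0 < e ->
  exists s, (forall x, cabs (tp s x : C) <= 2 * M) /\ nrm p (fun x => h x - tp s x) < e.
Proof.
move=> p1 mh hM e0; have p0 : 0 < p by exact: lt_le_trans p1.
have T0 : TT 0 by apply/circP; rewrite lexx ltW // pi2_gt0.
have M0 : 0 <= M := le_trans (cabs_ge0 _) (hM 0 T0).
(* Since |h - s| <= M + 2 M, the interpolation asks for (3 M)^(p-1) d < e^p; the added 1 keeps the
   denominator positive. *)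
pose d := e `^ p / ((3 * M) `^ (p - 1) + 1).
have D0 : 0 < (3 * M) `^ (p - 1) + 1 by rewrite ltr_wpDl ?powR_ge0.
have d0 : 0 < d by rewrite divr_gt0 // powR_gt0.
have [s [b n]] := approx_bnd mh hM d0.
exists s; split=> //.
have mhs : cmeas (fun x => h x - tp s x) by apply: cmeasB => //; exact: cmeas_tp.
have hb x : TT x -> cabs (h x - tp s x) <= 3 * M.
  move=> cx; apply: le_trans (cabsB _ _) _.
  have := hM x cx; have := b x; lra.
have := @nrm_interp p _ (3 * M) p1 _ mhs hb; rewrite mulr_ge0 // => /(_ isT) H.
have {}H : nrm p (fun x => h x - tp s x) `^ p < e `^ p.
  apply: le_lt_trans H _; apply: (@lt_le_trans _ _ (((3 * M) `^ (p - 1) + 1) * d)).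
    apply: (@le_lt_trans _ _ (((3 * M) `^ (p - 1) + 1) * nrm 1 (fun x => h x - tp s x))).
      by rewrite ler_wpM2r ?nrm_ge0 // lerDl.
    by rewrite ltr_pM2l.
  by rewrite /d mulrCA mulfV ?mulr1 // gt_eqF.
rewrite ltNge; apply/negP => le; move: H; rewrite ltNge => /negP; apply.
by rewrite ge0_ler_powR ?nnegrE ?nrm_ge0 ?(ltW e0) ?(ltW p0).
Qed.

Lemma measurable_cabs_le f (M : R) : cmeas f -> measurable (TT `&` [set x | cabs (f x) <= M]).
Proof.
move=> mf; have := emeasurable_fun_infty_c (@measurable_circ R) (f := EFin \o (fun x => cabs (f x))).
have mE : measurable_fun TT (EFin \o (fun x => cabs (f x))) by apply/measurable_EFinP; exact: cmeas_cabs.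
move=> /(_ mE M%:E); set D := (X in _ -> measurable X).
by rewrite (_ : TT `&` _ = D) //; apply/seteqP; split => x /= []; rewrite ?lee_fin => ? ?; split; rewrite /= ?lee_fin.
Qed.

Lemma dense_Lp p f (e : R) : 1 <= p -> Lp p f -> 0 < e -> exists s, nrm p (fun x => f x - tp s x) < e.
Proof.
move=> p1 hf e0; have p0 : 0 < p by exact: lt_le_trans p1.
have mf := Lp_meas hf.
pose A k := TT `&` [set x | cabs (f x) <= k%:R].
have mA k : measurable (A k) by exact: measurable_cabs_le.
pose F k x := f x * (\1_(A k) x)%:C%C.
have mF k : cmeas (F k).
  apply: cmeasM => //; apply: cmeas_real; apply: measurable_funTS; exact: measurable_indic.
have FE k x : TT x -> F k x = if cabs (f x) <= k%:R then f x else 0.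
  move=> cx; rewrite /F indicE; case: ifPn => h.
    by rewrite mem_set ?mulr1.
  by rewrite memNset ?mulr0 // => -[_]; rewrite /= (negbTE h).
have H : (fun k => nrm p (fun x => F k x - f x)) @ \oo --> (0 : R).
  apply: (@dominated_Lp _ p _ f) => //.
  - by move=> k; exact: cmeasB.
  - move=> k x cx; rewrite FE //; case: ifPn => _; first by rewrite subrr cabs0 cabs_ge0.
    by rewrite sub0r cabsN.
  - apply: ae_forall => x cx; apply: cvg_near_cst; exists (Num.bound (cabs (f x))) => // k /= hk.
    rewrite FE // ifT ?subrr ?subr0 ?cabs0 //.
    by rewrite ltW // (lt_le_trans (archi_boundP (cabs_ge0 _))) // ler_nat.
have [k hk] := cvg0_lt (fun k => nrm_ge0 p _) (divr_gt0 e0 (ltr0n _ 2)) H.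
have [|s [_ hs]] := @dense_bnd p (F k) k%:R (e / 2) p1 (mF k) _ (divr_gt0 e0 (ltr0n _ 2)).
  by move=> x cx; rewrite FE //; case: ifPn => //; rewrite cabs0.
exists s.
have hF : Lp p (F k) by apply: (@Lp_bndT _ p k%:R) => // x cx; rewrite FE //; case: ifPn => //; rewrite cabs0.
have -> : (fun x => f x - tp s x) = (fun x => (F k x - tp s x) - (F k x - f x)) by apply/funext => x; ring.
apply: le_lt_trans (nrmB _ _ _) _ => //; [apply: LpB => //; exact: Lp_tp|exact: LpB|lra].
Qed.

(** The function h = |f| / f, read as 0 where f = 0, is bounded and f h = |f|. Polynomials bounded
    by 2 converge to h almost everywhere and integrate to 0 against f, so dominated convergence
    gives f norm 0. *)
Lemma L1_uniq f : Lp 1 f -> (forall n, fc f n = 0) -> aeq f (fun=> 0).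
Proof.
move=> hf f0; apply: (@nrm_eq0 _ 1) => //.
have mf := Lp_meas hf.
pose h x := (cabs (f x))%:C%C / f x.
have mh : cmeas h by apply: cmeasM; [apply: cmeas_real; exact: cmeas_cabs|exact: cmeasV].
have h1 x : cabs (h x) <= 1.
  rewrite cabsM cabs_real cabsV ger0_norm ?cabs_ge0 //.
  by have [->|c0] := eqVneq (cabs (f x)) 0; rewrite ?mul0r ?divff.
have fh x : f x * h x = (cabs (f x))%:C%C.
  have [->|c0] := eqVneq (f x) 0; first by rewrite cabs0 mul0r.
  by rewrite mulrC divfK.
(* The rate 1 / 2^n turns L^1 convergence into convergence almost everywhere. *)
have ex n : exists s, (forall x, cabs (tp s x : C) <= 2 * 1) /\ nrm 1 (fun x => h x - tp s x) < 1 / 2 ^+ n.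
  apply: approx_bnd => //; by rewrite divr_gt0 // exprn_gt0.
pose s n := projT1 (cid (ex n)).
have [sb sn] : (forall n x, cabs (tp (s n) x : C) <= 2 * 1) /\ (forall n, nrm 1 (fun x => h x - tp (s n) x) < 1 / 2 ^+ n).
  by split=> n; have [] := projT2 (cid (ex n)).
have hh : Lp 1 h by apply: (@Lp_bndT _ 1 1).
have cv : aecvg (fun n => tp (s n)) h.
  apply: (@aecvg_fast _ _ _ 1) => // [n|n]; first exact: Lp_tp.
  by rewrite -nrmN; under eq_fun do rewrite opprB; exact: ltW (sn n).
have hfh : Lp 1 (fun x => f x * h x).
  by under eq_fun do rewrite mulrC; exact: (LpM_bnd ltr01 mh (ae_forall (fun x _ => h1 x)) hf).1.
have hfs n : Lp 1 (fun x => f x * tp (s n) x).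
  by under eq_fun do rewrite mulrC; exact: (LpM_bnd ltr01 (cmeas_tp _) (ae_forall (fun x _ => sb n x)) hf).1.
have H : (fun n => nrm 1 (fun x => f x * h x - f x * tp (s n) x)) @ \oo --> (0 : R).
  apply: (@dominated_Lp _ 1 _ (fun x => 3%:R * f x)) => //.
  - by move=> n; exact: Lp_meas (LpB (lexx 1) hfh (hfs n)).
  - exact: LpZ.
  - move=> n x _; rewrite -mulrBr mulrC !cabsM; apply: ler_wpM2r; first exact: cabs_ge0.
    have -> : cabs (3%:R : C) = 3 by rewrite -(rmorph_nat (real_complex R)) cabs_real ger0_norm.
    apply: le_trans (cabsB _ _) _; have := h1 x; have := sb n x; lra.
  - apply: ae_imp cv => x _ hx.
    have : (fun n => cabs (f x) * cabs (tp (s n) x - h x)) @ \oo --> (cabs (f x) * 0 : R).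
      by apply: cvgM => //; exact: cvg_cst.
    rewrite mulr0; apply: squeeze0 => n; rewrite cabs_ge0 /= subr0 -mulrBr cabsM -(cabsN (h x - _)) opprB //.
have E : (nrm 1 f)%:C%C = ci (fun x => f x * h x).
  have -> : nrm 1 f = nrm 1 (fun x => f x * h x) by apply: eq_nrm => x; rewrite fh cabs_real ger0_norm ?cabs_ge0.
  by apply: nrm1_pos => // x; rewrite fh cabs_real ger0_norm ?cabs_ge0.
apply/eqP/negPn/negP => n0.
have npos : 0 < nrm 1 f by rewrite lt_neqAle eq_sym n0 nrm_ge0.
have [n hn] := cvg0_lt (fun k => nrm_ge0 1 _) npos H.
move: hn; rewrite ltNge => /negP; apply.
apply: le_trans (cabs_ci_le _); last exact: LpB.
rewrite ciB // -E ci_Mtp // big1 ?mulr0 ?subr0; last by move=> u _; rewrite f0 mulr0.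
by rewrite cabs_real ler_norm.
Qed.

End Density.

(** * The inequality of M. Riesz *)
(** Complements Fubini's formula: the inner integral, later [GG], has to be compared under the
    integral sign with another function of y. *)
Lemma integrable_inner d1 d2 (T1 : measurableType d1) (T2 : measurableType d2) (R : realType)
  (m1 : {sigma_finite_measure set T1 -> \bar R}) (m2 : {sigma_finite_measure set T2 -> \bar R})
  (f : T1 * T2 -> \bar R) : (m1 \x m2)%E.-integrable setT f ->
  m2.-integrable setT (fun y => \int[m1]_x f (x, y))%E.
Proof.
move=> iff; have mf := measurable_int _ iff.
have ma : measurable_fun setT (abse \o f) by exact: measurableT_comp.
apply/integrableP; split; first exact: (measurable_fubini_G iff).
apply: (le_lt_trans _ ((integrable21ltyP _ _ mf).1 iff)).
apply: ge0_le_integral.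
- exact: measurableT.
- by move=> y _; exact: abse_ge0.
- by apply: measurableT_comp; [|exact: (measurable_fubini_G iff)].
- exact: (@measurable_fun_fubini_tonelli_G _ _ _ _ R m1 (abse \o f) ma (fun z => abse_ge0 _)).
- move=> y _; apply: le_abse_integral; first exact: measurableT.
  by apply: measurableT_comp; [exact: mf|exact: measurable_pair2].
Qed.

(** * Stein's subharmonic function in logarithmic polar coordinates *)

Section Stein.
Variable R : realType.
Local Notation C := R[i].
Local Notation mu := (@lebesgue_measure R).
Local Notation TT := (@circ R).
Local Opaque cabs cexp powR lebesgue_measure circ.

Lemma dsum_seq (T : Type) (s : seq T) (h : T -> R -> R) (x : R) (dh : T -> R) :
  (forall i, is_derive x (1 : R) (h i) (dh i)) ->
  is_derive x (1 : R) (fun y => \sum_(i <- s) h i y) (\sum_(i <- s) dh i).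
Proof.
move=> H; elim: s => [|i s IH].
  by rewrite big_nil; under eq_fun do rewrite big_nil; exact: dcst.
by rewrite big_cons; under eq_fun do rewrite big_cons; exact: dD.
Qed.
Lemma dpow (a : R) (w : R -> R) (x w' : R) : 0 < w x -> is_derive x (1 : R) w w' ->
  is_derive x (1 : R) (fun y => w y `^ a) (a * w x `^ (a - 1) * w').
Proof. by move=> w0 dw; exact: (dcomp (is_derive1_powR a w0) dw). Qed.
Lemma dlin (k x : R) : is_derive x (1 : R) (fun y => k * y) k.
Proof. by apply: (is_derive_eq (dZ k (did x))); rewrite mulr1. Qed.

Lemma ctsD (f g : R -> R) : continuous f -> continuous g -> continuous (fun x => f x + g x).
Proof. by move=> cf cg x; apply: continuousD; [exact: cf|exact: cg]. Qed.
Lemma ctsM (f g : R -> R) : continuous f -> continuous g -> continuous (fun x => f x * g x).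
Proof. by move=> cf cg x; apply: continuousM; [exact: cf|exact: cg]. Qed.
Lemma ctsC (k : R) : continuous (fun _ : R => k).
Proof. by move=> x; exact: cvg_cst. Qed.
Lemma cts_pow (a : R) (w : R -> R) : (forall x, 0 < w x) -> continuous w -> continuous (fun x => w x `^ a).
Proof.
move=> w0 cw x.
have d := is_derive1_powR a (w0 x).
have c : {for w x, continuous (fun y : R => y `^ a)}.
  by apply: differentiable_continuous; apply/derivable1_diffP; exact: ex_derive.
exact: (continuous_comp (cw x) c).
Qed.
Lemma cts_integrable (a b : R) (f : R -> R) : continuous f -> mu.-integrable `[a, b]%classic (EFin \o f).
Proof.
move=> cf; apply: continuous_compact_integrable; first exact: segment_compact.
exact: continuous_subspaceT.
Qed.

Section Harmonic.
Variable s : seq (C * int).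
Hypothesis s_pos : forall u, u \in s -> 0 < u.2.

(** The coordinate x is log r: the circle is x = 0, the centre of the disc is x = -oo, and the
    Laplacian of the disc is, up to a factor r^2, the plain one in x and y. *)
Definition tU (j : nat) (x y : R) (u : C * int) : R := u.2%:~R ^+ j * expR (u.2%:~R * x) *
  (complex.Re u.1 * cos (u.2%:~R * y) + - complex.Im u.1 * sin (u.2%:~R * y)).
Definition tV (j : nat) (x y : R) (u : C * int) : R := u.2%:~R ^+ j * expR (u.2%:~R * x) *
  (complex.Re u.1 * sin (u.2%:~R * y) + complex.Im u.1 * cos (u.2%:~R * y)).
Definition U j x y := \sum_(u <- s) tU j x y u.
Definition V j x y := \sum_(u <- s) tV j x y u.

Lemma dexp (k c a x : R) : is_derive x (1 : R) (fun x => a * expR (k * x) * c) (k * a * expR (k * x) * c).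
Proof.
apply: (is_derive_eq (dM (dZ a (dcomp (is_derive_expR _) (dlin k x))) (dcst c x))); ring.
Qed.
Lemma dU1 j y x : is_derive x (1 : R) (fun x => U j x y) (U j.+1 x y).
Proof. by apply: dsum_seq => u; apply: (is_derive_eq (dexp _ _ _ _)); rewrite /tU exprS. Qed.
Lemma dV1 j y x : is_derive x (1 : R) (fun x => V j x y) (V j.+1 x y).
Proof. by apply: dsum_seq => u; apply: (is_derive_eq (dexp _ _ _ _)); rewrite /tV exprS. Qed.
Lemma dU2 j x y : is_derive y (1 : R) (fun y => U j x y) (- V j.+1 x y).
Proof.
rewrite /V -sumrN; apply: dsum_seq => u.
apply: (is_derive_eq (dZ _ (dD (dZ _ (dcomp (is_derive_cos _) (dlin _ y))) (dZ _ (dcomp (is_derive_sin _) (dlin _ y)))))).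
by rewrite /tV exprS; ring.
Qed.
Lemma dV2 j x y : is_derive y (1 : R) (fun y => V j x y) (U j.+1 x y).
Proof.
apply: dsum_seq => u.
apply: (is_derive_eq (dZ _ (dD (dZ _ (dcomp (is_derive_sin _) (dlin _ y))) (dZ _ (dcomp (is_derive_cos _) (dlin _ y)))))).
by rewrite /tU exprS; ring.
Qed.
Lemma cU1 j y : continuous (fun x => U j x y). Proof. exact: dcontinuous (dU1 j y). Qed.
Lemma cV1 j y : continuous (fun x => V j x y). Proof. exact: dcontinuous (dV1 j y). Qed.
Lemma cU2 j x : continuous (fun y => U j x y). Proof. exact: dcontinuous (dU2 j x). Qed.
Lemma cV2 j x : continuous (fun y => V j x y). Proof. exact: dcontinuous (dV2 j x). Qed.

Lemma sin_int (m : int) : sin (m%:~R * (2 * pi)) = 0 :> R /\ cos (m%:~R * (2 * pi)) = 1 :> R.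
Proof.
have : tpow m (2 * pi) = 1 :> C by rewrite tpowE cexp2pi exp1rz.
by rewrite /tpow cexpE => -[-> ->].
Qed.
Lemma U_per j x : U j x (2 * pi) = U j x 0.
Proof. by apply: eq_bigr => u _; rewrite /tU !(sin_int _).1 !(sin_int _).2 !mulr0 sin0 cos0 ?mulr0. Qed.
Lemma V_per j x : V j x (2 * pi) = V j x 0.
Proof. by apply: eq_bigr => u _; rewrite /tV !(sin_int _).1 !(sin_int _).2 !mulr0 sin0 cos0 ?mulr0. Qed.

Lemma UV_tp y : tp s y = (U 0 0 y +i* V 0 0 y)%C.
Proof.
rewrite /tp; apply/eqP; rewrite eq_complex /= sumC_Re sumC_Im; apply/andP; split; apply/eqP.
  by apply: eq_bigr => u _; rewrite ReM /tpow cexpE /= /tU expr0 mulr0 expR0; ring.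
by apply: eq_bigr => u _; rewrite ImM /tpow cexpE /= /tV expr0 mulr0 expR0; ring.
Qed.

Definition BB (j : nat) : R := \sum_(u <- s) u.2%:~R ^+ j * (`|complex.Re u.1| + `|complex.Im u.1|).
Lemma BB_ge0 j : 0 <= BB j.
Proof.
rewrite /BB big_seq; apply: sumr_ge0 => u us; rewrite mulr_ge0 ?addr_ge0 // exprn_ge0 // ler0z ltW //; exact: s_pos.
Qed.
(** Positive integers are at least 1, so each term, and with it F, decays at least like exp x
    towards the centre. *)
Lemma exp_le (u : C * int) (x : R) : u \in s -> x <= 0 -> expR (u.2%:~R * x) <= expR x.
Proof.
move=> us x0; rewrite ler_expR -subr_ge0 -{1}(mul1r x) -mulrBl mulr_le0 // subr_le0.
by rewrite -[1]/(1%:~R) ler_int -gtz0_ge1 s_pos.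
Qed.
Lemma trig_bnd (a b c d : R) : `|c| <= 1 -> `|d| <= 1 -> `|a * c + b * d| <= `|a| + `|b|.
Proof.
move=> hc hd; apply: (le_trans (ler_normD _ _)); rewrite !normrM.
by rewrite lerD // ler_piMr.
Qed.
Lemma U_bnd j x y : x <= 0 -> `|U j x y| <= BB j * expR x.
Proof.
move=> x0; rewrite /U /BB big_seq mulr_suml [leRHS]big_seq; apply: (le_trans (ler_norm_sum _ _ _)).
apply: ler_sum => u us; have n0 : 0 <= u.2%:~R ^+ j :> R by rewrite exprn_ge0 // ler0z ltW //; exact: s_pos.
rewrite /tU !normrM (ger0_norm n0) (ger0_norm (expR_ge0 _)) -!mulrA ler_wpM2l // mulrC.
apply: ler_pM; rewrite ?expR_ge0 //; last exact: exp_le.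
by rewrite -(normrN (complex.Im u.1)); apply: trig_bnd; [exact: cos_max|exact: sin_max].
Qed.
Lemma V_bnd j x y : x <= 0 -> `|V j x y| <= BB j * expR x.
Proof.
move=> x0; rewrite /V /BB big_seq mulr_suml [leRHS]big_seq; apply: (le_trans (ler_norm_sum _ _ _)).
apply: ler_sum => u us; have n0 : 0 <= u.2%:~R ^+ j :> R by rewrite exprn_ge0 // ler0z ltW //; exact: s_pos.
rewrite /tV !normrM (ger0_norm n0) (ger0_norm (expR_ge0 _)) -!mulrA ler_wpM2l // mulrC.
apply: ler_pM; rewrite ?expR_ge0 //; last exact: exp_le.
by apply: trig_bnd; [exact: sin_max|exact: cos_max].
Qed.

Let RR := (measurableTypeR R * measurableTypeR R)%type.
Lemma mjoint_U j : measurable_fun [set: RR] (fun z : RR => U j z.1 z.2).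
Proof.
apply: measurable_sum => u; apply: measurable_funM.
  apply: measurable_funM; first exact: measurable_cst.
  apply: (measurableT_comp (@measurable_expR R)).
  by apply: measurable_funM; [exact: measurable_cst|exact: measurable_fst].
have mc : measurable_fun [set: R] (@cos R) by apply: continuous_measurable_fun; exact: continuous_cos.
have ms : measurable_fun [set: R] (@sin R) by apply: continuous_measurable_fun; exact: continuous_sin.
by apply: measurable_funD; apply: measurable_funM; (try exact: measurable_cst);
  [apply: (measurableT_comp mc)|apply: (measurableT_comp ms)];
  apply: measurable_funM; (try exact: measurable_cst); exact: measurable_snd.
Qed.
Lemma mjoint_V j : measurable_fun [set: RR] (fun z : RR => V j z.1 z.2).
Proof.
apply: measurable_sum => u; apply: measurable_funM.
  apply: measurable_funM; first exact: measurable_cst.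
  apply: (measurableT_comp (@measurable_expR R)).
  by apply: measurable_funM; [exact: measurable_cst|exact: measurable_fst].
have mc : measurable_fun [set: R] (@cos R) by apply: continuous_measurable_fun; exact: continuous_cos.
have ms : measurable_fun [set: R] (@sin R) by apply: continuous_measurable_fun; exact: continuous_sin.
by apply: measurable_funD; apply: measurable_funM; (try exact: measurable_cst);
  [apply: (measurableT_comp ms)|apply: (measurableT_comp mc)];
  apply: measurable_funM; (try exact: measurable_cst); exact: measurable_snd.
Qed.

Variables (q A e : R).
Hypotheses (q2 : 2^-1 < q) (q1 : q <= 1) (AE : A * (4 * q - 2) = 4) (e0 : 0 < e).

Definition X x y := U 0 x y * U 0 x y + e.
Definition Y x y := U 0 x y * U 0 x y + V 0 x y * V 0 x y + e.
(* Stein's function A |Re F|^p - |F|^p, p = 2 q, regularized by [e], at exp (x + i y): [U j] and [V j] are the real and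
   imaginary parts of the j-th derivative of F in the direction x. Below, [Ps], [Pt], [Pss], [Ptt] are its partial
   derivatives. *)
Definition Psi x y := A * X x y `^ q + (-1) * Y x y `^ q.
Definition Ps x y := A * (q * X x y `^ (q - 1) * (2 * (U 0 x y * U 1 x y))) +
  (-1) * (q * Y x y `^ (q - 1) * (2 * (U 0 x y * U 1 x y + V 0 x y * V 1 x y))).
Definition Pt x y := A * (q * X x y `^ (q - 1) * (2 * (U 0 x y * (- V 1 x y)))) +
  (-1) * (q * Y x y `^ (q - 1) * (2 * (U 0 x y * (- V 1 x y) + V 0 x y * U 1 x y))).
Definition Pss x y := A * (q * ((q - 1) * X x y `^ (q - 1 - 1) * (2 * (U 0 x y * U 1 x y)) ^+ 2 +
     X x y `^ (q - 1) * (2 * (U 1 x y ^+ 2 + U 0 x y * U 2 x y)))) +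
  (-1) * (q * ((q - 1) * Y x y `^ (q - 1 - 1) * (2 * (U 0 x y * U 1 x y + V 0 x y * V 1 x y)) ^+ 2 +
     Y x y `^ (q - 1) * (2 * (U 1 x y ^+ 2 + U 0 x y * U 2 x y + V 1 x y ^+ 2 + V 0 x y * V 2 x y)))).
Definition Ptt x y := A * (q * ((q - 1) * X x y `^ (q - 1 - 1) * (2 * (U 0 x y * (- V 1 x y))) ^+ 2 +
     X x y `^ (q - 1) * (2 * (V 1 x y ^+ 2 - U 0 x y * U 2 x y)))) +
  (-1) * (q * ((q - 1) * Y x y `^ (q - 1 - 1) * (2 * (U 0 x y * (- V 1 x y) + V 0 x y * U 1 x y)) ^+ 2 +
     Y x y `^ (q - 1) * (2 * (V 1 x y ^+ 2 - U 0 x y * U 2 x y + U 1 x y ^+ 2 - V 0 x y * V 2 x y)))).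

Lemma X_ge x y : e <= X x y. Proof. by rewrite lerDr -expr2 sqr_ge0. Qed.
Lemma Y_ge x y : X x y <= Y x y. Proof. by rewrite /X /Y; have := sqr_ge0 (V 0 x y); rewrite expr2; lra. Qed.
Lemma X_gt0 x y : 0 < X x y. Proof. exact: lt_le_trans e0 (X_ge x y). Qed.
Lemma Y_gt0 x y : 0 < Y x y. Proof. exact: lt_le_trans (X_gt0 x y) (Y_ge x y). Qed.

Lemma dX1 y x : is_derive x (1 : R) (fun x => X x y) (2 * (U 0 x y * U 1 x y)).
Proof. by apply: (is_derive_eq (dD (dM (dU1 0 y x) (dU1 0 y x)) (dcst e x))); ring. Qed.
Lemma dX2 x y : is_derive y (1 : R) (fun y => X x y) (2 * (U 0 x y * (- V 1 x y))).
Proof. by apply: (is_derive_eq (dD (dM (dU2 0 x y) (dU2 0 x y)) (dcst e y))); ring. Qed.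
Lemma dY1 y x : is_derive x (1 : R) (fun x => Y x y) (2 * (U 0 x y * U 1 x y + V 0 x y * V 1 x y)).
Proof.
by apply: (is_derive_eq (dD (dD (dM (dU1 0 y x) (dU1 0 y x)) (dM (dV1 0 y x) (dV1 0 y x))) (dcst e x))); ring.
Qed.
Lemma dY2 x y : is_derive y (1 : R) (fun y => Y x y) (2 * (U 0 x y * (- V 1 x y) + V 0 x y * U 1 x y)).
Proof.
by apply: (is_derive_eq (dD (dD (dM (dU2 0 x y) (dU2 0 x y)) (dM (dV2 0 x y) (dV2 0 x y))) (dcst e y))); ring.
Qed.
Lemma dPsi1 y x : is_derive x (1 : R) (fun x => Psi x y) (Ps x y).
Proof. exact: (dD (dZ A (dpow (w := X^~ y) q (X_gt0 x y) (dX1 y x))) (dZ (-1) (dpow (w := Y^~ y) q (Y_gt0 x y) (dY1 y x)))). Qed.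
Lemma dPs1 y x : is_derive x (1 : R) (fun x => Ps x y) (Pss x y).
Proof.
have d1 := dZ A (dM (dZ q (dpow (w := X^~ y) (q - 1) (X_gt0 x y) (dX1 y x))) (dZ 2 (dM (dU1 0 y x) (dU1 1 y x)))).
have d2 := dZ (-1) (dM (dZ q (dpow (w := Y^~ y) (q - 1) (Y_gt0 x y) (dY1 y x)))
  (dZ 2 (dD (dM (dU1 0 y x) (dU1 1 y x)) (dM (dV1 0 y x) (dV1 1 y x))))).
by apply: (is_derive_eq (dD d1 d2)); rewrite /Pss; ring.
Qed.
Lemma dPt2 x y : is_derive y (1 : R) (fun y => Pt x y) (Ptt x y).
Proof.
have dNV : is_derive y (1 : R) (fun y => - V 1 x y) (- U 2 x y).
  by have := dZ (-1) (dV2 1 x y); under eq_fun do rewrite mulN1r; rewrite mulN1r.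
have d1 := dZ A (dM (dZ q (dpow (q - 1) (X_gt0 x y) (dX2 x y))) (dZ 2 (dM (dU2 0 x y) dNV))).
have d2 := dZ (-1) (dM (dZ q (dpow (q - 1) (Y_gt0 x y) (dY2 x y)))
  (dZ 2 (dD (dM (dU2 0 x y) dNV) (dM (dV2 0 x y) (dU2 1 x y))))).
by apply: (is_derive_eq (dD d1 d2)); rewrite /Ptt; ring.
Qed.

Lemma powS (a t : R) : 0 < t -> t `^ (a - 1) * t = t `^ a.
Proof.
by move=> t0; rewrite -{2}(powRr1 (ltW t0)) -powRD ?subrK //; apply/implyP => _; rewrite gt_eqF.
Qed.

(** By the Cauchy-Riemann equations the second derivatives cancel and |F'|^2 factors out. As u^2 = X
    - e, the choice A (4 q - 2) = 4 makes the first term at least 4 X^(q-1). As q <= 1, the second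
    is at most 4 Y^(q-1), and Y >= X with a nonpositive exponent gives Y^(q-1) <= X^(q-1). *)
Lemma laplacian_ge0 x y : 0 <= Pss x y + Ptt x y.
Proof.
have X0 := X_gt0 x y; have Y0 := Y_gt0 x y.
have q0 : 0 < q by apply: lt_trans q2; rewrite invr_gt0.
pose x1 := X x y `^ (q - 1); pose x2 := X x y `^ (q - 1 - 1).
pose y1 := Y x y `^ (q - 1); pose y2 := Y x y `^ (q - 1 - 1).
have Ex : x2 * X x y = x1 by exact: powS.
have y20 : 0 <= y2 by exact: powR_ge0.
have x20 : 0 <= x2 by exact: powR_ge0.
have yx : y1 <= x1.
  rewrite /y1 /x1 -(opprB 1 q) !powRN lef_pV2 ?posrE ?powR_gt0 //.
  by apply: ge0_ler_powR; [rewrite subr_ge0|rewrite nnegrE ltW|rewrite nnegrE ltW|exact: Y_ge].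
set u := U 0 x y; set v := V 0 x y; set u1 := U 1 x y; set v1 := V 1 x y.
have -> : Pss x y + Ptt x y = q * (u1 ^+ 2 + v1 ^+ 2) *
   (A * (4 * (q - 1) * x2 * u ^+ 2 + 2 * x1) - (4 * (q - 1) * y2 * (u ^+ 2 + v ^+ 2) + 4 * y1)).
  by rewrite /Pss /Ptt -/x1 -/x2 -/y1 -/y2 -/u -/v -/u1 -/v1; ring.
apply: mulr_ge0; first by rewrite mulr_ge0 ?addr_ge0 ?sqr_ge0 // ltW.
have A0 : 0 < A.
  have h4 : 0 < 4 * q - 2 by have := q2; lra.
  by rewrite -(pmulr_lgt0 A h4) AE.
have E1 : A * (4 * (q - 1) * x2 * u ^+ 2 + 2 * x1) = 4 * x1 + A * x2 * (4 * (1 - q)) * e.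
  transitivity (A * (4 * q - 2) * x1 + A * x2 * (4 * (1 - q)) * e); last by rewrite AE.
  by rewrite -Ex /X -/u; ring.
have h1 : 0 <= A * x2 * (4 * (1 - q)) * e.
  by rewrite !mulr_ge0 // ?subr_ge0 // ltW.
have h2 : 0 <= (1 - q) * (y2 * (u ^+ 2 + v ^+ 2)) by rewrite !mulr_ge0 ?subr_ge0 // addr_ge0 ?sqr_ge0.
have -> : 4 * (q - 1) * y2 * (u ^+ 2 + v ^+ 2) = - (4 * ((1 - q) * (y2 * (u ^+ 2 + v ^+ 2)))) by ring.
rewrite E1; lra.
Qed.

Lemma Psi_cts x : continuous (fun y => Psi x y).
Proof.
by apply: ctsD; apply: ctsM; try exact: ctsC; apply: cts_pow;
  [exact: X_gt0|exact: dcontinuous (dX2 x)|exact: Y_gt0|exact: dcontinuous (dY2 x)].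
Qed.
Lemma cX1 y : continuous (fun x => X x y). Proof. exact: dcontinuous (dX1 y). Qed.
Lemma cX2 x : continuous (fun y => X x y). Proof. exact: dcontinuous (dX2 x). Qed.
Lemma cY1 y : continuous (fun x => Y x y). Proof. exact: dcontinuous (dY1 y). Qed.
Lemma cY2 x : continuous (fun y => Y x y). Proof. exact: dcontinuous (dY2 x). Qed.
Lemma cXp1 a y : continuous (fun x => X x y `^ a).
Proof. by apply: cts_pow; [move=> x; exact: X_gt0|exact: cX1]. Qed.
Lemma cXp2 a x : continuous (fun y => X x y `^ a).
Proof. by apply: cts_pow; [move=> y; exact: X_gt0|exact: cX2]. Qed.
Lemma cYp1 a y : continuous (fun x => Y x y `^ a).
Proof. by apply: cts_pow; [move=> x; exact: Y_gt0|exact: cY1]. Qed.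
Lemma cYp2 a x : continuous (fun y => Y x y `^ a).
Proof. by apply: cts_pow; [move=> y; exact: Y_gt0|exact: cY2]. Qed.
Lemma ctsN (f : R -> R) : continuous f -> continuous (fun x => - f x).
Proof. by move=> cf x; apply: continuousN; exact: cf. Qed.
Lemma ctsX (f : R -> R) n : continuous f -> continuous (fun x => f x ^+ n).
Proof.
move=> cf; elim: n => [|n IH]; first by under eq_fun do rewrite expr0; exact: ctsC.
by under eq_fun do rewrite exprS; exact: ctsM.
Qed.
Lemma cid_ : continuous (fun x : R => x). Proof. by move=> x; exact: cvg_id. Qed.

Ltac cts := lazymatch goal with
  | |- continuous (fun _ => ?k) => exact: ctsC
  | |- continuous (fun x => x) => exact: cid_
  | |- continuous (fun x => (@?f x + @?g x)%R) => apply: (@ctsD f g); cts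
  | |- continuous (fun x => (@?f x * @?g x)%R) => apply: (@ctsM f g); cts
  | |- continuous (fun x => (- @?f x)%R) => apply: (@ctsN f); cts
  | |- continuous (fun x => (@?f x ^+ ?n)%R) => apply: (@ctsX f n); cts
  | |- continuous (fun x => U ?j x ?y) => exact: cU1
  | |- continuous (fun y => U ?j ?x y) => exact: cU2
  | |- continuous (fun x => V ?j x ?y) => exact: cV1
  | |- continuous (fun y => V ?j ?x y) => exact: cV2
  | |- continuous (fun x => X x ?y `^ ?a) => exact: cXp1
  | |- continuous (fun y => X ?x y `^ ?a) => exact: cXp2
  | |- continuous (fun x => Y x ?y `^ ?a) => exact: cYp1
  | |- continuous (fun y => Y ?x y `^ ?a) => exact: cYp2
  end.

Lemma Pss_cts1 y : continuous (fun x => Pss x y).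
Proof. rewrite /Pss; cts. Qed.
Lemma Ptt_cts1 y : continuous (fun x => Ptt x y).
Proof. rewrite /Ptt; cts. Qed.
Lemma Ps_cts2 x : continuous (fun y => Ps x y).
Proof. rewrite /Ps; cts. Qed.
Lemma Ptt_cts2 x : continuous (fun y => Ptt x y).
Proof. rewrite /Ptt; cts. Qed.

Definition bdd (f : R -> R -> R) := exists K, 0 <= K /\ forall x y, x <= 0 -> `|f x y| <= K.
Lemma bddC k : bdd (fun _ _ => k). Proof. by exists `|k|. Qed.
Lemma bddD f g : bdd f -> bdd g -> bdd (fun x y => f x y + g x y).
Proof.
move=> [K [K0 hK]] [L [L0 hL]]; exists (K + L); split; first exact: addr_ge0.
by move=> x y x0; rewrite (le_trans (ler_normD _ _)) // lerD // ?hK ?hL.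
Qed.
Lemma bddM f g : bdd f -> bdd g -> bdd (fun x y => f x y * g x y).
Proof.
move=> [K [K0 hK]] [L [L0 hL]]; exists (K * L); split; first exact: mulr_ge0.
by move=> x y x0; rewrite normrM ler_pM // ?hK ?hL.
Qed.
Lemma bddN f : bdd f -> bdd (fun x y => - f x y).
Proof. by move=> [K [K0 hK]]; exists K; split=> // x y x0; rewrite normrN hK. Qed.
Lemma bddX f n : bdd f -> bdd (fun x y => f x y ^+ n).
Proof.
move=> [K [K0 hK]]; exists (K ^+ n); split; first exact: exprn_ge0.
by move=> x y x0; rewrite normrX lerXn2r ?nnegrE ?normr_ge0 // hK.
Qed.
Lemma exp_le1 (x : R) : x <= 0 -> expR x <= 1.
Proof. by move=> x0; rewrite -expR0 ler_expR. Qed.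
Lemma bddU j : bdd (U j).
Proof.
exists (BB j); split; first exact: BB_ge0; move=> x y x0; apply: (le_trans (U_bnd j y x0)).
by rewrite ler_piMr ?BB_ge0 // exp_le1.
Qed.
Lemma bddV j : bdd (V j).
Proof.
exists (BB j); split; first exact: BB_ge0; move=> x y x0; apply: (le_trans (V_bnd j y x0)).
by rewrite ler_piMr ?BB_ge0 // exp_le1.
Qed.
Lemma npow_le (a t : R) : a <= 0 -> e <= t -> t `^ a <= e `^ a.
Proof.
move=> a0 et; have t0 := lt_le_trans e0 et.
rewrite -(opprK a) (powRN _ (- a)) (powRN e (- a)) lef_pV2 ?posrE ?powR_gt0 //.
by apply: ge0_ler_powR; [rewrite oppr_ge0|rewrite nnegrE ltW|rewrite nnegrE ltW|exact: et].
Qed.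
Lemma bddXp (a : R) : a <= 0 -> bdd (fun x y => X x y `^ a).
Proof.
move=> a0; exists (e `^ a); split; first exact: powR_ge0.
by move=> x y _; rewrite ger0_norm ?powR_ge0 // npow_le // X_ge.
Qed.
Lemma bddYp (a : R) : a <= 0 -> bdd (fun x y => Y x y `^ a).
Proof.
move=> a0; exists (e `^ a); split; first exact: powR_ge0.
by move=> x y _; rewrite ger0_norm ?powR_ge0 // npow_le // (le_trans (X_ge x y)) // Y_ge.
Qed.
Lemma q1_le0 : q - 1 <= 0. Proof. by rewrite subr_le0. Qed.
Lemma q2_le0 : q - 1 - 1 <= 0. Proof. by have := q1_le0; lra. Qed.
Lemma Ptt_bdd : bdd Ptt.
Proof.
rewrite /Ptt; repeat lazymatch goal with
  | |- bdd (fun _ _ => ?k) => exact: (bddC k)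
  | |- bdd (fun x y => (@?f x y + @?g x y)%R) => apply: (@bddD f g)
  | |- bdd (fun x y => (@?f x y * @?g x y)%R) => apply: (@bddM f g)
  | |- bdd (fun x y => (- @?f x y)%R) => apply: (@bddN f)
  | |- bdd (fun x y => (@?f x y ^+ ?n)%R) => apply: (@bddX f n)
  | |- bdd (fun x y => U ?j x y) => exact: (bddU j)
  | |- bdd (fun x y => V ?j x y) => exact: (bddV j)
  | |- bdd (fun x y => X x y `^ (q - 1 - 1)) => exact: (bddXp q2_le0)
  | |- bdd (fun x y => Y x y `^ (q - 1 - 1)) => exact: (bddYp q2_le0)
  | |- bdd (fun x y => X x y `^ (q - 1)) => exact: (bddXp q1_le0)
  | |- bdd (fun x y => Y x y `^ (q - 1)) => exact: (bddYp q1_le0)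
  end.
Qed.
Lemma mX : measurable_fun [set: RR] (fun z : RR => X z.1 z.2).
Proof.
apply: measurable_funD; last exact: measurable_cst.
by apply: measurable_funM; exact: mjoint_U.
Qed.
Lemma mY : measurable_fun [set: RR] (fun z : RR => Y z.1 z.2).
Proof.
apply: measurable_funD; last exact: measurable_cst.
by apply: measurable_funD; apply: measurable_funM; first [exact: mjoint_U|exact: mjoint_V].
Qed.
Lemma mpow (a : R) (w : RR -> R) : measurable_fun [set: RR] w -> measurable_fun [set: RR] (fun z => w z `^ a).
Proof. exact: (measurableT_comp (measurable_powR a)). Qed.
Lemma mPtt : measurable_fun [set: RR] (fun z : RR => Ptt z.1 z.2).
Proof.
have mXp a := mpow a mX; have mYp a := mpow a mY.
rewrite /Ptt; repeat lazymatch goal with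
  | |- measurable_fun _ (fun _ => ?k) => exact: measurable_cst
  | |- measurable_fun _ (fun z => (@?f z + @?g z)%R) => apply: (@measurable_funD _ _ _ _ f g)
  | |- measurable_fun _ (fun z => (@?f z * @?g z)%R) => apply: (@measurable_funM _ _ _ _ f g)
  | |- measurable_fun _ (fun z => (- @?f z)%R) => apply: (@measurable_funN _ _ _ _ f)
  | |- measurable_fun _ (fun z => (@?f z ^+ ?n)%R) => apply: (@measurable_funX _ _ _ _ f n)
  | |- measurable_fun _ (fun z => U ?j _ _) => exact: (mjoint_U j)
  | |- measurable_fun _ (fun z => V ?j _ _) => exact: (mjoint_V j)
  | |- measurable_fun _ (fun z => X _ _ `^ ?a) => exact: (mXp a)
  | |- measurable_fun _ (fun z => Y _ _ `^ ?a) => exact: (mYp a)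
  end.
Qed.

Lemma int_Ptt x : Rintegral mu TT (fun y => Ptt x y) = 0.
Proof.
rewrite [TT](_ : _ = `[0, 2 * pi]%classic) //.
apply: (etrans (@FTC_Rintegral R 0 (2 * pi) _ (fun y => Pt x y) _ _ _)); first exact: pi2_gt0.
- exact: Ptt_cts2.
- by move=> y; exact: dPt2.
- by rewrite /Pt /X /Y !U_per !V_per subrr.
Qed.

Variable S : R.
Hypothesis S0 : S < 0.

(** Integration by parts in x. The weight -x = log (1/r) is the Green function of the disc with pole
    at the centre. *)
Lemma green y : Psi 0 y - (- S * Ps S y + Psi S y) = Rintegral mu `[S, 0]%classic (fun x => - x * Pss x y).
Proof.
apply/esym; apply: (etrans (@FTC_Rintegral R S 0 _ (fun x => - x * Ps x y + Psi x y) S0 _ _)).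
- by apply: ctsM; [exact: ctsN cid_|exact: Pss_cts1].
- move=> x; have dNx : is_derive x (1 : R) (fun x : R => - x) (-1).
    by have := dlin (-1) x; under eq_fun do rewrite mulN1r.
  by apply: (is_derive_eq (dD (dM dNx (dPs1 y x)) (dPsi1 y x))); ring.
- by rewrite oppr0 mul0r add0r.
Qed.

Definition GG y := Rintegral mu `[S, 0]%classic (fun x => x * Ptt x y).

(** For x <= 0 the sign of the Laplacian allows Pss to be traded for -Ptt, whose integral over y
    vanishes. *)
Lemma green_le y : GG y <= Psi 0 y - (- S * Ps S y + Psi S y).
Proof.
rewrite green; apply: le_Rintegral.
- exact: measurable_itv.
- by apply: cts_integrable; apply: ctsM; [exact: cid_|exact: Ptt_cts1].
- by apply: cts_integrable; apply: ctsM; [exact: ctsN cid_|exact: Pss_cts1].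
move=> x /=; rewrite in_itv /= => /andP[_ x0].
rewrite -subr_ge0 (_ : _ - _ = - x * (Pss x y + Ptt x y)); last by ring.
by rewrite mulr_ge0 ?oppr_ge0 // laplacian_ge0.
Qed.

Let hh (z : RR) : R := z.1 * Ptt z.1 z.2.
Let AA : set RR := `[S, 0]%classic `*` TT.
Let ff : RR -> \bar R := (EFin \o hh) \_ AA.

Lemma measurable_AA : measurable AA.
Proof. by apply: measurableX; [exact: measurable_itv|exact: measurable_circ]. Qed.

Lemma integrable_ff : (mu \x mu)%E.-integrable [set: RR] ff.
Proof.
apply/(integrable_mkcond _ measurable_AA).
apply: measurable_bounded_integrable.
- exact: measurable_AA.
- rewrite [X in (X < _)%E]product_measure1E; [|exact: measurable_itv|exact: measurable_circ].
  rewrite [X in (_ * X)%E]mu_circ [X in (X * _)%E]lebesgue_measure_itv /= lte_fin S0 -EFinD -EFinM; exact: ltry.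
- apply: measurable_funTS; apply: measurable_funM; [exact: measurable_fst|exact: mPtt].
- have [K [K0 hK]] := Ptt_bdd; exists (- S * K); split; first exact: num_real.
  move=> L hL [x y] [/= + _]; rewrite in_itv /= => /andP[x1 x2].
  rewrite (le_trans _ (ltW hL)) // /hh normrM ler_pM // ?hK //= ler0_norm // lerN2 //.
Qed.

Lemma Rintegral_E (D : set R) (g : R -> R) : measurable D -> mu.-integrable D (EFin \o g) ->
  (\int[mu]_(x in D) (g x)%:E = (Rintegral mu D g)%:E)%E.
Proof. by move=> mD ig; rewrite /Rintegral fineK //; exact: integrable_fin_num. Qed.

Lemma cts_TT (g : R -> R) : continuous g -> mu.-integrable TT (EFin \o g).
Proof. by move=> cg; rewrite [TT](_ : _ = `[0, 2 * pi]%classic) //; exact: cts_integrable. Qed.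

(** After exchanging the integrals, the inner one is that of the y-derivative of the periodic
    function [Pt] over a period. *)
Lemma int_GG : mu.-integrable TT (EFin \o GG) /\ Rintegral mu TT GG = 0.
Proof.
have mT := @measurable_circ R.
have GE : (fun y => \int[mu]_x ff (x, y))%E = (EFin \o GG) \_ TT.
  apply/funext => y; rewrite patchE; case: ifPn => yT.
    transitivity (\int[mu]_(x in `[S, 0%R]%classic) (hh (x, y))%:E)%E.
      rewrite [RHS]integral_mkcond; apply: eq_integral => x _; rewrite /ff !patchE.
      by rewrite /AA in_setX /= yT andbT.
    apply: Rintegral_E; first exact: measurable_itv.
    by apply: cts_integrable; apply: ctsM; [exact: cid_|exact: Ptt_cts1].
  rewrite -[RHS](integral0 mu setT); apply: eq_integral => x _.
  by rewrite /ff patchE in_setX /= (negbTE yT) andbF.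
have F0 x : (\int[mu]_y ff (x, y) = 0)%E.
  have [xI|xI] := boolP (x \in `[S, 0]%classic); last first.
    rewrite -[RHS](integral0 mu setT); apply: eq_integral => y _.
    by rewrite /ff patchE in_setX /= (negbTE xI).
  transitivity (\int[mu]_(y in TT) (hh (x, y))%:E)%E.
    rewrite [RHS]integral_mkcond; apply: eq_integral => y _; rewrite /ff !patchE.
    by rewrite in_setX /= xI.
  have iP := cts_TT (@Ptt_cts2 x).
  rewrite (@Rintegral_E TT (fun y => x * Ptt x y)) //; last first.
    by apply: cts_TT; apply: ctsM; [exact: ctsC|exact: Ptt_cts2].
  by rewrite RintegralZl // int_Ptt mulr0.
have Fub := Fubini integrable_ff.
have iG := integrable_inner integrable_ff.
rewrite GE in iG.
split; first by apply: (@integrable_mkcond _ _ _ mu TT (EFin \o GG) mT).2; exact: iG.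
rewrite /Rintegral integral_mkcond -GE -Fub.
by rewrite (eq_integral (fun=> 0%E)) ?integral0 // => x _; exact: F0.
Qed.

Lemma green_int : 0 <= Rintegral mu TT (fun y => Psi 0 y - (- S * Ps S y + Psi S y)).
Proof.
have [iG G0] := int_GG; rewrite -[leLHS]G0; apply: le_Rintegral => //.
- exact: measurable_circ.
- apply: cts_TT; apply: ctsD; first exact: Psi_cts.
  by apply: ctsN; apply: ctsD; [apply: ctsM; [exact: ctsC|exact: Ps_cts2]|exact: Psi_cts].
by move=> y _; exact: green_le.
Qed.

(** At x = S the derivatives of F up to order 1 are of size exp S, since F vanishes at the centre.
    The first hypothesis controls -S Ps; the second makes Y at most 2 e, so that Psi >= -(2 e)^q
    once its nonnegative term is dropped. *)
Lemma boundary_ge (eta : R) y : 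
  - S * expR (2 * S) * ((2 * A * q + 4 * q) * e `^ (q - 1) * (BB 0 * BB 1 + 1)) <= eta ->
  2 * BB 0 ^+ 2 * expR (2 * S) <= e ->
  - (eta + (2 * e) `^ q) <= - S * Ps S y + Psi S y.
Proof.
move=> h1 h2.
have q0 : 0 < q by apply: lt_trans q2; rewrite invr_gt0.
have A0 : 0 < A.
  have h4 : 0 < 4 * q - 2 by have := q2; lra.
  by rewrite -(pmulr_lgt0 A h4) AE.
have E2 : expR (2 * S) = expR S * expR S by rewrite -expRD; congr expR; ring.
have B0 := BB_ge0 0; have B1 := BB_ge0 1.
have SS := ltW S0.
have pr f g (K L : R) : 0 <= K -> 0 <= L -> `|f| <= K * expR S -> `|g| <= L * expR S -> `|f * g| <= K * L * expR (2 * S).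
  move=> K0 L0 hf hg; rewrite normrM E2 (_ : K * L * _ = (K * expR S) * (L * expR S)); last by ring.
  exact: ler_pM.
have uu := pr _ _ _ _ B0 B1 (U_bnd 0 y SS) (U_bnd 1 y SS).
have vv := pr _ _ _ _ B0 B1 (V_bnd 0 y SS) (V_bnd 1 y SS).
have u2 := pr _ _ _ _ B0 B0 (U_bnd 0 y SS) (U_bnd 0 y SS).
have v2 := pr _ _ _ _ B0 B0 (V_bnd 0 y SS) (V_bnd 0 y SS).
have Y2 : Y S y <= 2 * e.
  rewrite /Y; have := le_trans (ler_norm _) u2; have := le_trans (ler_norm _) v2.
  move: h2; rewrite expr2; lra.
have PsiB : - (2 * e) `^ q <= Psi S y.
  rewrite /Psi mulN1r -[leLHS]add0r lerD //; first by rewrite mulr_ge0 ?powR_ge0 // ltW.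
  rewrite lerN2; apply: ge0_ler_powR; [exact: ltW|rewrite nnegrE ltW //; exact: Y_gt0|by rewrite nnegrE mulr_ge0 // ltW|exact: Y2].
have xq := npow_le q1_le0 (X_ge S y).
have yq := npow_le q1_le0 (le_trans (X_ge S y) (Y_ge S y)).
have PsB : `|Ps S y| <= (2 * A * q + 4 * q) * e `^ (q - 1) * (BB 0 * BB 1 + 1) * expR (2 * S).
  apply: (le_trans (ler_normD _ _)); rewrite mulN1r normrN.
  set D := expR (2 * S); have D0 : 0 < D by exact: expR_gt0.
  have e1 : 0 <= e `^ (q - 1) := powR_ge0 _ _.
  have T1 : `|A * (q * X S y `^ (q - 1) * (2 * (U 0 S y * U 1 S y)))| <= A * (q * e `^ (q - 1) * (2 * (BB 0 * BB 1 * D))).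
    rewrite !normrM (ger0_norm (ltW A0)) (ger0_norm (ltW q0)) (ger0_norm (powR_ge0 _ _)) (ger0_norm (ler0n _ 2)) -normrM.
    by apply: ler_pM; rewrite ?mulr_ge0 ?powR_ge0 ?(ltW A0) ?(ltW q0) //; apply: ler_pM; rewrite ?mulr_ge0 ?powR_ge0 ?(ltW q0) //;
      [rewrite ler_pM2l|rewrite ler_pM2l].
  have T2 : `|q * Y S y `^ (q - 1) * (2 * (U 0 S y * U 1 S y + V 0 S y * V 1 S y))| <= q * e `^ (q - 1) * (2 * (2 * (BB 0 * BB 1 * D))).
    rewrite normrM (normrM q) (ger0_norm (ltW q0)) (ger0_norm (powR_ge0 _ _)) normrM (ger0_norm (ler0n _ 2)).
    apply: ler_pM; rewrite ?mulr_ge0 ?powR_ge0 ?(ltW q0) //; first by rewrite ler_pM2l.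
    rewrite ler_pM2l //; apply: (le_trans (ler_normD _ _)); move: uu vv; rewrite -/D; lra.
  apply: (le_trans (lerD T1 T2)).
  have -> : A * (q * e `^ (q - 1) * (2 * (BB 0 * BB 1 * D))) + q * e `^ (q - 1) * (2 * (2 * (BB 0 * BB 1 * D))) =
    (2 * A * q + 4 * q) * e `^ (q - 1) * (BB 0 * BB 1) * D by ring.
  rewrite ler_wpM2r ?(ltW D0) // ler_wpM2l ?lerDl // !mulr_ge0 // addr_ge0 // !mulr_ge0 // ltW //.
rewrite opprD lerD //.
have : `|- S * Ps S y| <= eta.
  apply: le_trans h1; rewrite normrM ger0_norm ?oppr_ge0 // -mulrA ler_wpM2l ?oppr_ge0 //.
  by rewrite mulrC.
by rewrite ler_norml => /andP[].
Qed.

End Harmonic.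

(* The inner radius of the annulus tends to 0. *)
Lemma stein_eps s (q A e eta : R) : (forall u, u \in s -> 0 < u.2) -> 2^-1 < q -> q <= 1 ->
  A * (4 * q - 2) = 4 -> 0 < e -> 0 < eta ->
  - (2 * pi * (eta + (2 * e) `^ q)) <= Rintegral mu TT (fun y => Psi s q A e 0 y).
Proof.
move=> sp q2 q1 AE e0 eta0.
have q0 : 0 < q by apply: lt_trans q2; rewrite invr_gt0.
have A0 : 0 < A.
  have h4 : 0 < 4 * q - 2 by lra.
  by rewrite -(pmulr_lgt0 A h4) AE.
pose C0 := (2 * A * q + 4 * q) * e `^ (q - 1) * (BB s 0 * BB s 1 + 1).
have B0 := BB_ge0 sp 0; have B1 := BB_ge0 sp 1.
have C00 : 0 <= C0 by rewrite !mulr_ge0 ?powR_ge0 // addr_ge0 ?mulr_ge0 // ltW.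
(* For n = t + 1 both n exp (-2 n) and exp (-2 n) are at most 1 / n; the two summands of t make 1 /
   n small enough for the two hypotheses of [boundary_ge]. *)
pose t := C0 / eta + 2 * BB s 0 ^+ 2 / e.
have t1 : 0 <= C0 / eta by rewrite divr_ge0 // ltW.
have t2 : 0 <= 2 * BB s 0 ^+ 2 / e by rewrite divr_ge0 ?mulr_ge0 ?sqr_ge0 // ltW.
pose n := t + 1; have n0 : 0 < n by rewrite /n /t; lra.
have En : n <= expR n by have := expR_ge1Dx n; lra.
have S0 : - n < 0 by rewrite oppr_lt0.
have E2 : expR (2 * - n) = (expR n)^-1 * (expR n)^-1.
  by rewrite -expRN -expRD; congr expR; ring.
have Ei : (expR n)^-1 <= n^-1 by rewrite lef_pV2 ?posrE ?expR_gt0.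
have Ei0 : 0 < (expR n)^-1 by rewrite invr_gt0 expR_gt0.
have h1 : - - n * expR (2 * - n) * C0 <= eta.
  rewrite opprK E2.
  have : n * ((expR n)^-1 * (expR n)^-1) <= n^-1.
    rewrite mulrA (le_trans _ Ei) // ler_piMl ?(ltW Ei0) // ler_pdivrMr ?expR_gt0 // mul1r //.
  move=> h; apply: (@le_trans _ _ (n^-1 * C0)); first exact: ler_wpM2r.
  rewrite mulrC ler_pdivrMr // -ler_pdivrMl // mulrC /n /t; lra.
have h2 : 2 * BB s 0 ^+ 2 * expR (2 * - n) <= e.
  have e1 : expR (2 * - n) <= n^-1.
    rewrite E2 (le_trans _ Ei) // ler_piMl ?(ltW Ei0) //.
    by rewrite -expRN -expR0 ler_expR oppr_le0 ltW.
  apply: (@le_trans _ _ (2 * BB s 0 ^+ 2 * n^-1)); first by rewrite ler_wpM2l ?mulr_ge0 ?sqr_ge0.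
  rewrite ler_pdivrMr // -ler_pdivrMl // mulrC /n /t; lra.
have cP : mu.-integrable TT (EFin \o (fun y => Psi s q A e 0 y)) by apply: cts_TT; exact: Psi_cts.
have cB : continuous (fun y => - - n * Ps s q A e (- n) y + Psi s q A e (- n) y).
  by apply: ctsD; [apply: ctsM; [exact: ctsC|exact: Ps_cts2]|exact: Psi_cts].
have := green_int sp q2 q1 AE e0 S0.
rewrite RintegralB; [|exact: measurable_circ|exact: cP|exact: cts_TT]; rewrite subr_ge0; apply: le_trans.
have -> : - (2 * pi * (eta + (2 * e) `^ q)) = Rintegral mu TT (fun=> - (eta + (2 * e) `^ q)).
  by rewrite Rintegral_cst; [rewrite [X in fine X]mu_circ /=; ring|exact: measurable_circ].
apply: le_Rintegral.
- exact: measurable_circ.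
- by apply: cts_TT; exact: ctsC.
- exact: cts_TT.
by move=> y _; exact: boundary_ge.
Qed.

End Stein.

(** * From Stein's function to the projection of trigonometric polynomials *)

Section Riesz.
Variable R : realType.
Local Notation C := R[i].
Local Notation mu := (@lebesgue_measure R).
Local Notation TT := (@circ R).
Implicit Types (z w : C) (p q : R) (f g h : R -> C).
Local Opaque cabs cexp powR lebesgue_measure circ.

Lemma integrable_cabs_pow p f : Lp p f -> mu.-integrable TT (EFin \o (fun x => cabs (f x) `^ p)).
Proof.
move=> hf; apply/integrableP; split; first exact: measurable_lp (Lp_meas hf).
have := Lp_lty hf; rewrite lpi_def; congr (_ < _)%E; apply: eq_integral => x _ /=.
by rewrite ger0_norm ?powR_ge0.
Qed.
Lemma nrm_powR_Rint p f : 0 < p -> Lp p f -> nrm p f `^ p = Rintegral mu TT (fun x => cabs (f x) `^ p).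
Proof. by move=> p0 hf; have := lpiE p0 hf; rewrite lpi_def /Rintegral => ->. Qed.

Lemma powR2 (x q : R) : 0 <= x -> (x * x) `^ q = x `^ (2 * q).
Proof. by move=> x0; rewrite powRrM -expr2 powR_mulrn. Qed.
Lemma powR_le_sum (a b q : R) : 0 <= a -> 0 <= b -> 0 <= q -> (a + b) `^ q <= 2 `^ q * (a `^ q + b `^ q).
Proof.
move=> a0 b0 q0; wlog ab : a b a0 b0 / a <= b => [H|].
  by have [ab|/ltW ba] := leP a b; [exact: H|rewrite addrC (addrC (a `^ q)); exact: H].
apply: (@le_trans _ _ ((2 * b) `^ q)).
  by apply: ge0_ler_powR; rewrite ?nnegrE ?addr_ge0 ?mulr_ge0 //; lra.
by rewrite powRM // ler_wpM2l ?powR_ge0 // lerDr powR_ge0.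
Qed.

Lemma powR_le_inv (a b p : R) : 0 < p -> 0 <= a -> 0 <= b -> a `^ p <= b `^ p -> a <= b.
Proof.
move=> p0 a0 b0 h; rewrite leNgt; apply/negP => lt.
by have := gt0_ltr_powR p0 b0 a0 lt; rewrite ltNge h.
Qed.

(** The regularized inequality holds with an error proportional to k, and k tends to 0. The factor
    2^q is the price of separating e from |Re F|^2 in [X]. *)
Lemma stein p : 1 < p -> p <= 2 -> exists2 K, 0 <= K & forall s : seq (C * int),
  (forall u, u \in s -> 0 < u.2) -> nrm p (tp s) <= K * nrm p (fun x => (complex.Re (tp s x))%:C%C : C).
Proof.
move=> p1 p2; have p0 : 0 < p by lra.
pose q := p / 2; pose A := 4 / (4 * q - 2).
have q2 : 2^-1 < q by rewrite /q; lra.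
have q1 : q <= 1 by rewrite /q; lra.
have q0 : 0 < q by rewrite /q; lra.
have d0 : 0 < 4 * q - 2 by rewrite /q; lra.
have AE : A * (4 * q - 2) = 4 by rewrite /A divfK // gt_eqF.
have A0 : 0 < A by rewrite divr_gt0.
have qp : 2 * q = p by rewrite /q; field.
exists ((A * 2 `^ q) `^ p^-1); first exact: powR_ge0.
move=> s sp; set f := fun x => (complex.Re (tp s x))%:C%C.
have hF : Lp p (tp s) by exact: Lp_tp.
have mf : cmeas f by apply: cmeas_real; exact: (cmeas_tp s).1.
have hf : Lp p f.
  by apply: (@Lp_le _ p 1 (tp s)) => // x _; rewrite mul1r /f cabs_real Re_le_cabs.
have K0 : 0 <= A * 2 `^ q by rewrite mulr_ge0 ?powR_ge0 // ltW.
apply: (powR_le_inv p0); rewrite ?nrm_ge0 ?mulr_ge0 ?powR_ge0 ?nrm_ge0 //.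
rewrite powRM ?nrm_ge0 ?powR_ge0 // -powRrM mulVf ?gt_eqF // powRr1 //.
set K := A * 2 `^ q.
have key k : 0 < k -> nrm p (tp s) `^ p <= K * nrm p f `^ p + k * (2 * pi * (K + 1 + 2 `^ q)).
  (* With e^q = k and eta = k both error terms of [stein_eps] are multiples of k. *)
  move=> k0; pose e := k `^ q^-1.
  have e0 : 0 < e by exact: powR_gt0.
  have eq_ : e `^ q = k by rewrite /e -powRrM mulVf ?gt_eqF // powRr1 // ltW.
  have := stein_eps sp q2 q1 AE e0 k0.
  rewrite powRM ?(ltW e0) // eq_.
  have cX : continuous (fun y => X s e 0 y `^ q) by apply: cXp2.
  have cY : continuous (fun y => Y s e 0 y `^ q) by apply: cYp2.
  have iX := cts_TT cX; have iY := cts_TT cY; have mT := @measurable_circ R.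
  have -> : Rintegral mu TT (fun y => Psi s q A e 0 y) =
     A * Rintegral mu TT (fun y => X s e 0 y `^ q) - Rintegral mu TT (fun y => Y s e 0 y `^ q).
    rewrite -RintegralZl // -RintegralB //; last by apply: cts_TT; apply: ctsM => //; exact: ctsC.
    by apply: eq_Rintegral => y _; rewrite /Psi mulN1r.
  have EU y : complex.Re (tp s y) = U s 0 0 y by rewrite UV_tp.
  have hY : nrm p (tp s) `^ p <= Rintegral mu TT (fun y => Y s e 0 y `^ q).
    rewrite nrm_powR_Rint //; apply: le_Rintegral => //; first exact: integrable_cabs_pow.
    move=> y _; rewrite -qp -powR2 ?cabs_ge0 //; apply: ge0_ler_powR.
    - exact: ltW.
    - by rewrite nnegrE mulr_ge0 ?cabs_ge0.
    - by rewrite nnegrE ltW //; exact: Y_gt0.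
    - by rewrite -expr2 cabs_sqr UV_tp /= /Y !expr2 lerDl ltW.
  have hX : Rintegral mu TT (fun y => X s e 0 y `^ q) <= 2 `^ q * (nrm p f `^ p + 2 * pi * k).
    have -> : 2 `^ q * (nrm p f `^ p + 2 * pi * k) = Rintegral mu TT (fun y => 2 `^ q * (cabs (f y) `^ p + k)).
      have ip := integrable_cabs_pow hf.
      have ik : mu.-integrable TT (EFin \o (fun=> k)) by apply: cts_TT; exact: ctsC.
      rewrite RintegralZl //; last first.
        rewrite (_ : _ \o _ = (fun x => (EFin \o (fun x => cabs (f x) `^ p)%R) x + (EFin \o (fun=> k)) x)%E); last by apply/funext.
        by apply: integrableD.
      rewrite RintegralD // Rintegral_cst // [X in fine X]mu_circ /= nrm_powR_Rint //; ring.
    apply: le_Rintegral => //.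
      have ip := integrable_cabs_pow hf.
      have ik : mu.-integrable TT (EFin \o (fun=> k)) by apply: cts_TT; exact: ctsC.
      rewrite (_ : _ \o _ = (fun x => (2 `^ q)%:E * ((EFin \o (fun x => cabs (f x) `^ p)%R) x + (EFin \o (fun=> k)) x))%E); last by apply/funext.
      by apply: integrableZl => //; exact: integrableD.
    move=> y _; rewrite /f cabs_real EU -eq_ -qp -powR2 ?normr_ge0 //.
    rewrite -normrM -expr2 ger0_norm ?sqr_ge0 // /X; apply: powR_le_sum; rewrite ?sqr_ge0 ?ltW //.
  have := ler_wpM2l (ltW A0) hX; rewrite mulrA -/K; move: hY; lra.
have D0 : 0 < 2 * pi * (K + 1 + 2 `^ q).
  by rewrite mulr_gt0 ?pi2_gt0 // ltr_wpDr ?powR_ge0 // ltr_wpDl.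
apply/ler_addgt0Pr => k k0.
have := key (k / (2 * pi * (K + 1 + 2 `^ q))) (divr_gt0 k0 D0).
by rewrite divfK // gt_eqF.
Qed.

(** Spectral cut-offs of lists of terms; [nngf] is the Riesz projection on trigonometric
    polynomials. *)
Definition posf (s : seq (C * int)) := [seq u <- s | 0 < u.2].
Definition nngf (s : seq (C * int)) := [seq u <- s | 0 <= u.2].
Definition zerf (s : seq (C * int)) := [seq u <- s | u.2 == 0].
Definition negf (s : seq (C * int)) := [seq u <- s | u.2 < 0].

Lemma tp_split s x : tp s x = tp (nngf s) x + tp (negf s) x.
Proof.
elim: s => [|u s IH]; first by rewrite /= tp_nil addr0.
rewrite tp_cons IH /nngf /negf /=; case: (ltP u.2 0) => h.
  by rewrite tp_cons; ring.
by rewrite tp_cons; ring.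
Qed.
Lemma nngf_split s x : tp (nngf s) x = tp (posf s) x + tp (zerf s) x.
Proof.
elim: s => [|u s IH]; first by rewrite /= tp_nil addr0.
rewrite /nngf /posf /zerf /= le_eqVlt (eq_sym 0) -/(nngf s) -/(posf s) -/(zerf s).
case: eqVneq => [u0|n0] /=; first by rewrite u0 ltxx !tp_cons IH; ring.
by case: ltP => h /=; rewrite ?tp_cons IH; ring.
Qed.
Lemma zerf_fc s x : tp (zerf s) x = fc (tp s) 0.
Proof.
rewrite fc_tp; elim: s => [|u s IH]; first by rewrite tp_nil big_nil.
rewrite big_cons /zerf /=; case: eqVneq => [u0|_] /=; last by rewrite IH mulr0 add0r.
by rewrite tp_cons IH u0 tpow0.
Qed.
Lemma fc_nngf s n : fc (tp (nngf s)) n = if 0 <= n then fc (tp s) n else 0.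
Proof.
rewrite !fc_tp; elim: s => [|u s IH]; first by rewrite /= !big_nil; case: ifP.
rewrite /nngf /= big_cons -/(nngf s); case: ifPn => u0; rewrite ?big_cons IH.
  case: ifPn => n0 //; case: eqVneq => [un|_]; last by rewrite mulr0 addr0.
  by rewrite -un u0 in n0.
case: ifPn => n0 //; case: eqVneq => [un|_]; last by rewrite mulr0 add0r.
by rewrite un n0 in u0.
Qed.
Lemma posf_cat s t : posf (s ++ t) = posf s ++ posf t. Proof. exact: filter_cat. Qed.
Lemma nngf_cat s t : nngf (s ++ t) = nngf s ++ nngf t. Proof. exact: filter_cat. Qed.
Lemma negf_cat s t : negf (s ++ t) = negf s ++ negf t. Proof. exact: filter_cat. Qed.
Lemma posf_tpZ z s : posf (tpZ z s) = tpZ z (posf s). Proof. by rewrite /posf /tpZ filter_map. Qed.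
Lemma nngf_tpZ z s : nngf (tpZ z s) = tpZ z (nngf s). Proof. by rewrite /nngf /tpZ filter_map. Qed.
Lemma negf_tpZ z s : negf (tpZ z s) = tpZ z (negf s). Proof. by rewrite /negf /tpZ filter_map. Qed.
Lemma negf_tpC s : negf (tpC s) = tpC (posf s).
Proof. by rewrite /negf /tpC filter_map; congr map; apply: eq_filter => u /=; rewrite oppr_lt0. Qed.
Lemma posf_tpC s : posf (tpC s) = tpC (negf s).
Proof. by rewrite /posf /tpC filter_map; congr map; apply: eq_filter => u /=; rewrite oppr_gt0. Qed.

Definition tpRe (s : seq (C * int)) : seq (C * int) := tpZ (2^-1) (s ++ tpC s).
Lemma tpReE s x : tp (tpRe s) x = (complex.Re (tp s x))%:C%C.
Proof. by rewrite tpZE tp_cat tpCE ReJ_add mulrC. Qed.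

(** The negative part of a real polynomial is the conjugate of its positive part, so twice the real
    part of the latter is the polynomial without its mean. *)
Lemma tpRe_pos s x : (complex.Re (tp (posf (tpRe s)) x))%:C%C = 2^-1 * (tp (tpRe s) x - fc (tp (tpRe s)) 0).
Proof.
have E : tp (negf (tpRe s)) x = ((tp (posf (tpRe s)) x)^*)%C.
  rewrite /tpRe negf_tpZ posf_tpZ negf_cat posf_cat negf_tpC posf_tpC !tpZE !tp_cat !tpCE rmorphM rmorphD.
  rewrite /= conjcK (_ : _ * _ = (2^-1 : C)^*%C * ((tp (posf s) x)^*%C + tp (negf s) x)) //.
  by rewrite conjc_inv conjc_nat addrC.
rewrite ReJ_add -E [in RHS]tp_split nngf_split zerf_fc; ring.
Qed.

Lemma posf_gt0 s u : u \in posf s -> 0 < u.2.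
Proof. by rewrite mem_filter => /andP[]. Qed.

Lemma fc_le_nrm p f n : 1 <= p -> Lp p f -> cabs (fc f n) <= (2 * pi)^-1 * (2 * pi) `^ (1 - p^-1) * nrm p f.
Proof.
move=> p1 hf; have [h1 h2] := Lp_inL1 p1 hf.
rewrite (le_trans (cabs_fc_le n h1)) // -mulrA ler_wpM2l //.
by rewrite invr_ge0 ltW // pi2_gt0.
Qed.

Definition cnrm p : R := nrm p (fun=> 1 : C).

Lemma nrm_cst p z : 0 < p -> nrm p (fun=> z) = cabs z * cnrm p.
Proof.
move=> p0; rewrite /cnrm -nrmZ //; last exact: Lp_cst.
by congr nrm; apply/funext => x; rewrite mulr1.
Qed.

Definition riesz_tp p := exists2 K, 0 <= K & forall s : seq (C * int), nrm p (tp (nngf s)) <= K * nrm p (tp s).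

(** Stein's inequality bounds the positive part of a real polynomial. A complex one is Re s + i Re
    (-i s), and the mean is added back separately. *)
Lemma riesz_tp_le2 p : 1 < p -> p <= 2 -> riesz_tp p.
Proof.
move=> p1 p2; have p0 : 0 < p by lra.
have p1' : 1 <= p by exact: ltW.
have [K K0 HK] := stein p1 p2.
pose c := (2 * pi)^-1 * (2 * pi) `^ (1 - p^-1) : R.
have c0 : 0 <= c by rewrite mulr_ge0 ?powR_ge0 // invr_ge0 ltW // pi2_gt0.
pose L := K * (2^-1 * (1 + c * cnrm p)).
have cn0 : 0 <= cnrm p := nrm_ge0 _ _.
have L0 : 0 <= L.
  apply: mulr_ge0 => //; apply: mulr_ge0; first by rewrite invr_ge0.
  by apply: addr_ge0 => //; exact: mulr_ge0.
have one s : nrm p (tp (posf (tpRe s))) <= L * nrm p (tp s).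
  apply: (le_trans (HK _ (@posf_gt0 _))); rewrite /L -mulrA ler_wpM2l //.
  have -> : (fun x => (complex.Re (tp (posf (tpRe s)) x))%:C%C) = (fun x => 2^-1 * (tp (tpRe s) x - fc (tp (tpRe s)) 0)).
    by apply/funext => x; rewrite tpRe_pos.
  have h1 : Lp p (tp (tpRe s)) by exact: Lp_tp.
  have h2 : Lp p (fun=> fc (tp (tpRe s)) 0) by exact: Lp_cst.
  rewrite nrmZ //; last exact: LpB.
  have -> : cabs (2^-1 : C) = 2^-1 by rewrite cabsV -(rmorph_nat (real_complex R)) cabs_real ger0_norm.
  rewrite -mulrA ler_wpM2l ?invr_ge0 //.
  have nr : nrm p (tp (tpRe s)) <= nrm p (tp s).
    rewrite -[leRHS]mul1r; apply: (nrm_le_ae p0 ler01 (cmeas_tp _) (Lp_tp s p0) _).2.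
    by apply: ae_forall => x _; rewrite tpReE cabs_real mul1r Re_le_cabs.
  apply: (le_trans (nrmB p1' h1 h2)); rewrite mulrDl mul1r lerD //.
  rewrite nrm_cst // mulrAC ler_wpM2r // (le_trans (fc_le_nrm 0 p1' h1)) // ler_wpM2l //.
exists (2 * L + c * cnrm p); first by apply: addr_ge0; exact: mulr_ge0.
move=> s; pose s' := tpZ (- 'i%C) s.
have E : tp (nngf s) = (fun x => (tp (posf (tpRe s)) x + 'i%C * tp (posf (tpRe s')) x) + fc (tp s) 0).
  apply/funext => x; rewrite nngf_split zerf_fc; congr (_ + _).
  rewrite /tpRe /s' !posf_tpZ !tpZE !posf_cat !tp_cat !posf_tpC negf_tpZ posf_tpZ !tpCE !tpZE rmorphM rmorphN /=.
  have -> : - (complex.Complex 0 (-1)) = 'i%C :> C by simpc.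
  set a := tp (posf s) x; set b := ((tp (negf s) x)^*)%C.
  transitivity (2^-1 * (a + b) + 2^-1 * (- ('i%C * 'i%C) * a + ('i%C * 'i%C) * b)); last by ring.
  have -> : 'i%C * 'i%C = -1 :> C by simpc.
  by field.
have h1 : Lp p (tp (posf (tpRe s))) by exact: Lp_tp.
have h2 : Lp p (fun x => 'i%C * tp (posf (tpRe s')) x) by apply: LpZ => //; exact: Lp_tp.
have h3 : Lp p (fun=> fc (tp s) 0) by exact: Lp_cst.
rewrite E; apply: (le_trans (nrmD p1' (LpD p1' h1 h2) h3)); rewrite mulrDl lerD //.
  apply: (le_trans (nrmD p1' h1 h2)); rewrite -mulrA mulr_natl mulr2n lerD // ?one //.
  rewrite nrmZ //; last exact: Lp_tp.
  rewrite cabs_i mul1r (le_trans (one s')) // ler_wpM2l //.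
  have -> : tp s' = (fun x => - 'i%C * tp s x) by apply/funext => x; rewrite tpZE.
  by rewrite nrmZ ?cabsN ?cabs_i ?mul1r //; exact: Lp_tp.
rewrite nrm_cst // mulrAC ler_wpM2r // fc_le_nrm //; exact: Lp_tp.
Qed.

End Riesz.

(** * The decomposition L^p = H^p + J H^p *)
Section Decomposition.
Variable R : realType.
Local Notation C := R[i].
Local Notation mu := (@lebesgue_measure R).
Local Notation TT := (@circ R).
Implicit Types (z w : C) (p q : R) (f g h : R -> C).
Local Opaque cabs cexp powR lebesgue_measure circ.

Lemma Lp1 p f : 1 <= p -> Lp p f -> Lp 1 f.
Proof. by move=> p1 hf; have [] := Lp_inL1 p1 hf. Qed.

Lemma le_geo0 (x M : R) : (forall k, x <= M / 2 ^+ k) -> x <= 0.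
Proof.
move=> h; rewrite leNgt; apply/negP => x0.
have := upper_nthrootP (leqnn (Num.bound (M / x))).
rewrite ltr_pdivrMr // => hk; have := h (Num.bound (M / x)).
by rewrite ler_pdivlMr ?exprn_gt0 // mulrC leNgt hk.
Qed.

Lemma conj_expP p : 1 < p -> [/\ 1 < conj_exp p, p^-1 + (conj_exp p)^-1 = 1 & conj_exp (conj_exp p) = p].
Proof.
move=> p1; have p0 : p != 0 by lra.
have p10 : p - 1 != 0 by lra.
have q1 : 1 < p / (p - 1) by rewrite ltr_pdivlMr; lra.
split => //; rewrite /conj_exp; first by field; apply/andP.
have -> : p / (p - 1) - 1 = (p - 1)^-1 by field.
by field.
Qed.

(* The extremal test function is |f|^(p-2) times the conjugate of f. *)
Lemma dual_norm p f (B : R) : 1 < p -> 0 <= B -> Lp p f ->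
  (forall g, cmeas g -> Lp (conj_exp p) g -> cabs (ci (fun x => f x * g x)) <= B * nrm (conj_exp p) g) ->
  nrm p f <= B.
Proof.
move=> p1 B0 hf H.
have p0 : 0 < p by lra.
have [q1 pq _] := conj_expP p1; set q := conj_exp p in H q1 pq.
have q0 : 0 < q by lra.
have mf := Lp_meas hf.
pose g := fun x => (cabs (f x) `^ (p - 2))%:C%C * (f x)^*%C.
have mg : cmeas g.
  apply: cmeasM; last exact: cmeas_conj.
  by apply: cmeas_real; apply: measurable_powR_fun; exact: cmeas_cabs.
have q_eq : (p - 1) * q = p by rewrite /q /conj_exp mulrC divfK //; lra.
have cg x : cabs (g x) = cabs (f x) `^ (p - 1).
  rewrite /g cabsM cabs_real cabs_conj ger0_norm ?powR_ge0 //.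
  have [->|n0] := eqVneq (cabs (f x)) 0; first by rewrite mulr0 powR0 //; lra.
  rewrite -{2}[cabs (f x)]powRr1 ?cabs_ge0 // -powRD ?n0 ?implybT //; congr (_ `^ _); ring.
have E1 : lpi q g = lpi p f.
  by rewrite !lpi_def; apply: eq_integral => x _; rewrite cg -powRrM q_eq.
have Eg x : f x * g x = (cabs (f x) `^ p)%:C%C.
  rewrite /g mulrCA -cabs_sqrC -rmorphM /=; congr (_ %:C)%C.
  have [->|n0] := eqVneq (cabs (f x)) 0; first by rewrite expr0n mulr0 powR0 //; lra.
  rewrite -[_ ^+ 2]powR_mulrn ?cabs_ge0 // -powRD ?n0 ?implybT //; congr (_ `^ _); ring.
have cfg x : cabs (f x * g x) = cabs (f x) `^ p.
  by rewrite Eg cabs_real ger0_norm ?powR_ge0.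
have E2 : lpi 1 (fun x => f x * g x) = lpi p f.
  by rewrite !lpi_def; apply: eq_integral => x _; rewrite cfg powRr1 ?powR_ge0.
have hg : Lp q g by apply: LpI => //; rewrite E1; exact: Lp_lty.
have hfg : Lp 1 (fun x => f x * g x).
  by apply: LpI; [exact: cmeasM|rewrite E2; exact: Lp_lty].
have I0 : 0 <= fine (lpi p f) by rewrite fine_ge0 ?lpi_ge0.
have := H g mg hg; rewrite -nrm1_pos //; last by move=> x; rewrite cfg.
rewrite cabs_real ger0_norm ?nrm_ge0 // !nrm_def E1 E2 invr1 powRr1 //.
set I := fine _ in I0 *; have [->|nI] := eqVneq I 0.
  by rewrite !powR0 ?invr_neq0 ?gt_eqF.
have Ip : 0 < I `^ q^-1 by rewrite powR_gt0 // lt_neqAle eq_sym nI.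
by rewrite -{1}[I](powRr1 I0) -pq powRD ?nI ?implybT // ler_pM2r.
Qed.

Definition Hp p f := Lp p f /\ forall n : int, n < 0 -> fc f n = 0.

Lemma HpP p f : Hp p f <-> inHp p f.
Proof.
rewrite /Hp /inHp LpE; split=> -[h1 h2]; split=> // n n0.
  by rewrite -fcE h2.
by rewrite fcE h2.
Qed.

Lemma Hp_Lp p f : Hp p f -> Lp p f. Proof. by case. Qed.
Lemma Hp_meas p f : Hp p f -> cmeas f. Proof. by case=> /Lp_meas. Qed.
Lemma Hp0 p : 0 < p -> Hp p (fun=> 0).
Proof.
move=> p0; split; first exact: Lp0.
move=> n _; rewrite (_ : (fun=> 0) = (fun x => 0 * (fun=> 0 : C) x)); last by apply/funext => x; rewrite mul0r.
by rewrite fcZ ?mul0r //; exact: Lp0.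
Qed.
Lemma HpD p f g : 1 <= p -> Hp p f -> Hp p g -> Hp p (fun x => f x + g x).
Proof.
move=> p1 [hf f0] [hg g0]; split; first exact: LpD.
by move=> n n0; rewrite fcD ?f0 ?g0 ?addr0 //; exact: (Lp1 p1).
Qed.
Lemma HpZ p z f : 1 <= p -> Hp p f -> Hp p (fun x => z * f x).
Proof.
move=> p1 [hf f0]; split; first by apply: LpZ => //; lra.
by move=> n n0; rewrite fcZ ?f0 ?mulr0 //; exact: (Lp1 p1).
Qed.
Lemma HpN p f : 1 <= p -> Hp p f -> Hp p (fun x => - f x).
Proof.
move=> p1 [hf f0]; split; first by apply: LpN => //; lra.
by move=> n n0; rewrite fcN ?f0 ?oppr0 //; exact: (Lp1 p1).
Qed.
Lemma HpB p f g : 1 <= p -> Hp p f -> Hp p g -> Hp p (fun x => f x - g x).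
Proof. by move=> p1 hf hg; apply: HpD => //; exact: HpN. Qed.
Lemma Hp_ext p f g : 0 < p -> cmeas g -> aeq f g -> Hp p f -> Hp p g.
Proof.
move=> p0 mg fg [hf f0]; split; first exact: Lp_ext fg hf.
by move=> n n0; rewrite -(f0 n n0); apply: fc_ext => //; [exact: Lp_meas hf|exact: aeq_sym].
Qed.
Lemma Hp_Mtpow p (n : nat) f : 1 <= p -> Hp p f -> Hp p (fun x => tpow n x * f x).
Proof.
move=> p1 [hf f0]; split; first by apply: Lp_Mtpow => //; lra.
by move=> m m0; rewrite fc_Mtpow f0 //; lia.
Qed.
Lemma Hp_tpow p (n : nat) : 1 <= p -> Hp p (tpow n : R -> C).
Proof.
move=> p1; split; first by apply: Lp_tpow; lra.
by move=> m m0; rewrite fc_tpow; case: eqP => // h; move: m0; rewrite -h.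
Qed.
Lemma Hp_one p : 1 <= p -> Hp p (fun=> 1 : C).
Proof.
by move=> /(Hp_tpow 0); rewrite (_ : tpow 0%:Z = (fun=> 1 : C)) //; apply/funext => x; rewrite tpow0.
Qed.
Lemma Hp_sum p (I : Type) (r : seq I) (F : I -> R -> C) : 1 <= p ->
  (forall i, Hp p (F i)) -> Hp p (fun x => \sum_(i <- r) F i x).
Proof.
move=> p1 hF; elim: r => [|i r IH].
  by rewrite (_ : (fun x => _) = (fun=> 0)); [apply: Hp0; lra|apply/funext => x; rewrite big_nil].
rewrite (_ : (fun x => _) = (fun x => F i x + \sum_(j <- r) F j x)); first exact: HpD.
by apply/funext => x; rewrite big_cons.
Qed.

Lemma fc_lim p (v : nat -> R -> C) f (M : R) z n : 1 <= p -> (forall k, Lp p (v k)) -> Lp p f ->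
  (forall k, nrm p (fun x => f x - v k x) <= M / 2 ^+ k) -> (forall k, fc (v k) n = z) -> fc f n = z.
Proof.
move=> p1 hv hf hM hz; apply/eqP; rewrite -subr_eq0 -cabs_eq0 eq_le cabs_ge0 andbT.
pose c := (2 * pi)^-1 * (2 * pi) `^ (1 - p^-1) : R.
have c0 : 0 <= c by rewrite mulr_ge0 ?powR_ge0 // invr_ge0 ltW // pi2_gt0.
apply: (@le_geo0 _ (c * M)) => k; rewrite -(hz k) -fcB; [|exact: (Lp1 p1)|exact: (Lp1 p1)].
rewrite -mulrA.
by rewrite (le_trans (fc_le_nrm n p1 (LpB p1 hf (hv k)))) // ler_wpM2l.
Qed.

Definition riesz p := exists2 K, 0 <= K & forall h, Lp p h ->
  exists f, [/\ Hp p f, Hp p (Jop (fun x => h x - f x)) & nrm p f <= K * nrm p h].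

(** Polynomials approximating h with geometric errors are projected and their increments summed.
    With e the norm of h, the increments have norms at most 3 K e / 2^k, hence their sum has norm at
    most 6 K e, within the constant 8 K. *)
Lemma riesz_of_tp p : 1 <= p -> riesz_tp p -> riesz p.
Proof.
move=> p1 [K K0 HK]; have p0 : 0 < p by lra.
exists (8 * K) => [|h hh]; first by rewrite mulr_ge0.
have [e0|e0] := eqVneq (nrm p h) 0.
  exists (fun=> 0); split; first exact: Hp0.
  - have h0 : aeq (fun=> 0) (Jop (fun x => h x - 0)).
      apply: aeq_sym; have := aeq_Jop (nrm_eq0 p0 hh e0).
      by apply: ae_imp => x _; rewrite /Jop subr0 mulr0.
    apply: Hp_ext h0 (Hp0 p0) => //; apply: cmeas_Jop; apply: cmeasB; first exact: Lp_meas hh.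
    exact: cmeas_cst.
  - by rewrite nrm0 // e0 mulr0.
set e := nrm p h in e0 *; have {}e0 : 0 < e by rewrite lt_neqAle eq_sym e0 nrm_ge0.
(* The errors are proportional to the norm of h, so that the final bound is too; this is why norm 0
   was treated apart. *)
have ek k : 0 < e / 2 ^+ k by rewrite divr_gt0 // exprn_gt0.
pose s k := projT1 (cid (dense_Lp p1 hh (ek k))).
have hs k : nrm p (fun x => h x - tp (s k) x) < e / 2 ^+ k by rewrite /s; case: cid.
have ht k : Lp p (tp (s k) : R -> C) by exact: Lp_tp.
have hd k : Lp p (fun x => h x - tp (s k) x) by exact: LpB.
pose u k : R -> C := if k is j.+1 then tp (nngf (s j.+1 ++ tpZ (-1) (s j))) else tp (nngf (s 0%N)).
have hu k : Lp p (u k) by case: k => [|k]; exact: Lp_tp.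
have ub k : nrm p (u k) <= (3 * K * e) / 2 ^+ k.
  case: k => [|k] /=.
    rewrite expr0 divr1 (le_trans (HK _)) // (mulrC 3) -mulrA ler_wpM2l //.
    have -> : tp (s 0%N) = (fun x => h x - (h x - tp (s 0%N) x)) by apply/funext => x; ring.
    apply: (le_trans (nrmB p1 hh (hd _))); have := hs 0%N; rewrite expr0 divr1 -/e; lra.
  rewrite (le_trans (HK _)) // (mulrC 3) -!mulrA ler_wpM2l //.
  have -> : tp (s k.+1 ++ tpZ (-1) (s k)) = (fun x => (h x - tp (s k) x) - (h x - tp (s k.+1) x)).
    by apply/funext => x; rewrite tp_cat tpZE; ring.
  apply: (le_trans (nrmB p1 (hd _) (hd _))).
  have h1 := hs k; have h2 := hs k.+1.
  have E : e / 2 ^+ k = 2 * (e / 2 ^+ k.+1) by rewrite exprS; field; rewrite expf_neq0.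
  rewrite E in h1; move: h1 h2; set b := e / _; lra.
have su n x : \sum_(k < n.+1) u k x = tp (nngf (s n)) x.
  elim: n => [|n IH]; first by rewrite big_ord_recl big_ord0 addr0.
  rewrite big_ord_recr /= IH nngf_cat nngf_tpZ tp_cat tpZE; ring.
have [f [hf nf _]] := Lp_series p1 hu ub.
have nf' n : nrm p (fun x => f x - tp (nngf (s n)) x) <= (3 * K * e) / 2 ^+ n.
  have := nf n.+1; rewrite (_ : (fun x => f x - _) = (fun x => f x - tp (nngf (s n)) x)); last first.
    by apply/funext => x; rewrite su.
  by move/le_trans; apply; rewrite exprS le_eqVlt; apply/orP; left; apply/eqP; field; rewrite expf_neq0.
have hn k : Lp p (tp (nngf (s k)) : R -> C) by exact: Lp_tp.
exists f; split.
- split=> // n n0; apply: (fc_lim p1 hn hf nf') => k.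
  by rewrite fc_nngf leNgt n0.
- have hhf : Lp p (fun x => h x - f x) by exact: LpB.
  split; first exact: Lp_Jop.
  move=> n n0; rewrite fc_Jop; last exact: (Lp1 p1).
  apply: (@fc_lim p (fun k x => tp (s k) x - tp (nngf (s k)) x) _ (e + 3 * K * e)) => //.
  + by move=> k; exact: LpB.
  + move=> k; have -> : (fun x => h x - f x - (tp (s k) x - tp (nngf (s k)) x)) =
        (fun x => (h x - tp (s k) x) - (f x - tp (nngf (s k)) x)) by apply/funext => x; ring.
    by rewrite (le_trans (nrmB p1 (hd k) (LpB p1 hf (hn k)))) // mulrDl lerD // ltW.
  + move=> k; rewrite (fcB _ (Lp1 p1 (ht k)) (Lp1 p1 (hn k))) fc_nngf ifT ?subrr //; lia.
- have := nf 0%N; rewrite (_ : (fun x => f x - _) = f); last first.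
    by apply/funext => x; rewrite big_ord0 subr0.
  move=> /le_trans; apply; rewrite expr0 divr1 -/e !mulrA.
  have := mulr_ge0 K0 (ltW e0); rewrite -!mulrA; set t := K * e; lra.
Qed.

(** In the bilinear pairing the transpose of P is the projection onto nonpositive frequencies, which
    is P for the conjugate exponent between two reflections; that exponent is below 2. *)
Lemma riesz_tp_dual p : 2 < p -> riesz (conj_exp p) -> riesz_tp p.
Proof.
move=> p2 [K K0 HK]; have p1 : 1 < p by lra.
have [q1 pq _] := conj_expP p1; set q := conj_exp p in HK q1 pq.
have q1' : 1 <= q by exact: ltW.
have p1' : 1 <= p by exact: ltW.
have p0 : 0 < p by lra.
have q0 : 0 < q by lra.
exists K => // s; apply: dual_norm => //; [by rewrite mulr_ge0 ?nrm_ge0|exact: Lp_tp|].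
move=> g mg hg; rewrite -/q in hg *.
have [f [[hf f0] [hk k0] nf]] := HK _ (Lp_tilde hg).
have hw : Lp q (tilde f) by exact: Lp_tilde.
have w0 n : 0 < n -> fc (tilde f) n = 0 by move=> n0; rewrite fc_tilde ?f0 ?oppr_lt0 //; exact: (Lp1 q1').
have hr : Lp q (fun x => g x - tilde f x) by exact: LpB.
have r0 n : n <= 0 -> fc (fun x => g x - tilde f x) n = 0.
  move=> n0; have hd : Lp 1 (fun x => tilde g x - f x) by exact: (Lp1 q1' (LpB q1' (Lp_tilde hg) hf)).
  have := k0 (n - 1); rewrite fc_Jop // -[X in fc X n]tildeK fc_tilde.
    rewrite (_ : -1 - (n - 1) = - n); last by ring.
    rewrite (_ : tilde (fun x => g x - tilde f x) = (fun x => tilde g x - f x)).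
      by apply; lia.
    by apply/funext => x; rewrite -{2}(tildeK f).
  by apply: Lp_tilde; apply: (Lp1 q1').
have E : ci (fun x => tp (nngf s) x * g x) = ci (fun x => tp s x * tilde f x).
  under [X in ci X = _]eq_fun do rewrite mulrC.
  under [X in _ = ci X]eq_fun do rewrite mulrC.
  rewrite (ci_Mtp _ (Lp1 q1' hg)) (ci_Mtp _ (Lp1 q1' hw)); congr (_ * _).
  rewrite [LHS]big_filter big_mkcond; apply: eq_bigr => u _; case: ifPn => u0.
    congr (_ * _); apply/eqP; by rewrite -subr_eq0 -(fcB _ (Lp1 q1' hg) (Lp1 q1' hw)) r0 ?eqxx // oppr_le0 u0.
  by rewrite w0 ?mulr0 // oppr_gt0 ltNge.
rewrite E; have [h1 h2] := hoelder_Lp p0 q0 pq (Lp_tp s p0) hw.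
rewrite (le_trans (cabs_ci_le h1)) // (le_trans h2) // mulrAC mulrC ler_wpM2r ?nrm_ge0 //.
rewrite (nrm_tilde _ (Lp_meas hf)) (le_trans nf) //.
by rewrite (nrm_tilde _ mg).
Qed.

Theorem rieszP_Lp p : 1 < p -> riesz p.
Proof.
move=> p1; apply: riesz_of_tp; first exact: ltW.
have [p2|p2] := leP p 2; first exact: riesz_tp_le2.
apply: riesz_tp_dual => //; have [q1 _ _] := conj_expP p1.
apply: riesz_of_tp; [exact: ltW|apply: riesz_tp_le2 => //].
by rewrite /conj_exp ler_pdivrMr; lra.
Qed.

End Decomposition.

(** * Open mapping theorem *)
Section OpenMapping.
Variables (R : realType) (X Y : lmodType R[i]).
Local Notation C := R[i].
(** The spaces are subspaces of ambient vector spaces, with seminorms instead of norms: functions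
    equal almost everywhere are not identified, so [nY y = 0] replaces y = 0. Completeness is the
    summability of geometrically bounded series. *)
Variables (DX : X -> Prop) (nX : X -> R) (DY : Y -> Prop) (nY : Y -> R) (T : X -> Y) (B : R).
Local Opaque cabs.
Hypotheses (DX0 : DX 0) (DXB : forall x y, DX x -> DX y -> DX (x - y)) (DXZ : forall z x, DX x -> DX (z *: x)).
Hypotheses (nX_ge0 : forall x, 0 <= nX x) (nX0 : nX 0 = 0) (nXB : forall x y, DX x -> DX y -> nX (x - y) <= nX x + nX y)
  (nXZ : forall z x, DX x -> nX (z *: x) = cabs z * nX x).
Hypotheses (DY0 : DY 0) (DYB : forall x y, DY x -> DY y -> DY (x - y)) (DYZ : forall z x, DY x -> DY (z *: x)).
Hypotheses (nY_ge0 : forall x, 0 <= nY x) (nYB : forall x y, DY x -> DY y -> nY (x - y) <= nY x + nY y)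
  (nYZ : forall z x, DY x -> nY (z *: x) = cabs z * nY x).
Hypothesis cX : forall (u : nat -> X) (K : R), (forall n, DX (u n)) -> (forall n, nX (u n) <= K / 2 ^+ n) ->
  exists2 x, DX x & forall n, nX (x - \sum_(k < n) u k) <= 2 * K / 2 ^+ n.
Hypothesis cY : forall (u : nat -> Y) (K : R), (forall n, DY (u n)) -> (forall n, nY (u n) <= K / 2 ^+ n) ->
  exists2 x, DY x & forall n, nY (x - \sum_(k < n) u k) <= 2 * K / 2 ^+ n.
Hypotheses (TD : forall x, DX x -> DY (T x)) (TB : forall x y, DX x -> DX y -> T (x - y) = T x - T y)
  (TZ : forall z x, DX x -> T (z *: x) = z *: T x) (Tbnd : forall x, DX x -> nY (T x) <= B * nX x).
Hypothesis T_onto : forall y, DY y -> exists2 x, DX x & nY (y - T x) = 0.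

Let DXN x : DX x -> DX (- x). Proof. by move=> h; rewrite -sub0r; exact: DXB. Qed.
Let DXD x y : DX x -> DX y -> DX (x + y). Proof. by move=> h k; rewrite -[y]opprK; apply: DXB => //; exact: DXN. Qed.
Let DYN x : DY x -> DY (- x). Proof. by move=> h; rewrite -sub0r; exact: DYB. Qed.
Let DYD x y : DY x -> DY y -> DY (x + y). Proof. by move=> h k; rewrite -[y]opprK; apply: DYB => //; exact: DYN. Qed.
Let T0 : T 0 = 0. Proof. by rewrite -(subrr 0) TB // subrr. Qed.
Let cabsN1 : cabs (-1 : C) = 1. Proof. by rewrite cabsN cabs1. Qed.
Let nYN x : DY x -> nY (- x) = nY x. Proof. by move=> h; rewrite -scaleN1r nYZ // cabsN1 mul1r. Qed.
Let nXN x : DX x -> nX (- x) = nX x. Proof. by move=> h; rewrite -scaleN1r nXZ // cabsN1 mul1r. Qed.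
Let nYD x y : DY x -> DY y -> nY (x + y) <= nY x + nY y.
Proof. by move=> h k; rewrite -{1}[y]opprK (le_trans (nYB h (DYN k))) // nYN. Qed.

(* [P n M y] says that the seminorm inf_x (|x| + n |y - T x|) of [y] is at most [M]; the gliding hump below is the
   uniform boundedness principle for these seminorms, and never mentions the infimum. *)
Let P (n : nat) (M : R) (y : Y) := exists2 x, DX x & nX x + n%:R * nY (y - T x) <= M.

Let P_le n M M' y : M <= M' -> P n M y -> P n M' y.
Proof. by move=> h [x hx xM]; exists x => //; exact: le_trans h. Qed.

Let P_nY n y : P n (n%:R * nY y) y.
Proof. by exists 0 => //; rewrite nX0 add0r T0 subr0. Qed.

Let PB n M M' y y' : DY y -> DY y' -> P n M y -> P n M' y' -> P n (M + M') (y - y').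
Proof.
move=> hy hy' [x hx xM] [x' hx' xM']; exists (x - x'); first exact: DXB.
have -> : y - y' - T (x - x') = (y - T x) - (y' - T x').
  by rewrite TB // opprD addrACA [in RHS]opprD.
apply: le_trans (lerD xM xM'); rewrite addrACA lerD ?nXB // -mulrDr ler_wpM2l //.
by apply: nYB; apply: DYB => //; exact: TD.
Qed.

Let PZ n M z y : DY y -> P n M y -> P n (cabs z * M) (z *: y).
Proof.
move=> hy [x hx xM]; exists (z *: x); first exact: DXZ.
rewrite TZ // -scalerBr nXZ // nYZ; last by apply: DYB => //; exact: TD.
by rewrite mulrCA -mulrDr ler_wpM2l // cabs_ge0.
Qed.

(** A witness against the bound M / r is rescaled to a vector v of norm r. If s + v and s - v both
    had seminorm at most M, so would v, half of their difference. *)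
Let hump : ~ (exists2 K, 0 <= K & forall n y, DY y -> P n (K * nY y) y) ->
  forall (s : Y) (r M : R), DY s -> 0 < r -> 0 <= M -> exists nu : nat * Y, [/\ DY nu.2, nY nu.2 = r & ~ P nu.1 M (s + nu.2)].
Proof.
move=> nB s r M hs r0 M0; have K0 : 0 <= M / r by rewrite divr_ge0 // ltW.
have [n [w [hw nP]]] : exists n w, DY w /\ ~ P n (M / r * nY w) w.
  apply: contrapT => h; apply: nB; exists (M / r) => // n y hy; apply: contrapT => np.
  by apply: h; exists n, y.
have w0 : 0 < nY w.
  rewrite lt_neqAle nY_ge0 andbT eq_sym; apply/eqP => e; apply: nP.
  by apply: P_le (P_nY n w); rewrite e !mulr0.
pose l := r / nY w; have l0 : 0 < l by rewrite divr_gt0.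
pose v := l%:C%C *: w; have hv : DY v by exact: DYZ.
have cl : cabs (l%:C%C : C) = l by rewrite cabs_real gtr0_norm.
have nv : nY v = r by rewrite nYZ // cl divfK // gt_eqF.
have nPv : ~ P n M v.
  move=> h; apply: nP; have := PZ (l^-1)%:C%C hv h.
  rewrite scalerA -rmorphM /= mulVf ?gt_eqF // scale1r; apply: P_le.
  by rewrite cabs_real gtr0_norm ?invr_gt0 // /l invf_div mulrC mulrA mulrAC.
have [h|h] := pselect (P n M (s + v)); last by exists (n, v).
exists (n, - v); split => /=; [exact: DYN|by rewrite nYN|].
move=> h'; apply: nPv.
have := PZ (2^-1) (DYB (DYD hs hv) (DYD hs (DYN hv))) (PB (DYD hs hv) (DYD hs (DYN hv)) h h').
have -> : s + v - (s - v) = 2%:R *: v by rewrite opprD opprK addrACA subrr add0r scaler_nat mulr2n.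
rewrite scalerA mulVf ?pnatr_eq0 // scale1r; apply: P_le.
have -> : cabs (2^-1 : C) = 2^-1 by rewrite cabsV -(rmorph_nat (real_complex R)) cabs_real ger0_norm.
by rewrite -mulr2n -[M *+ 2]mulr_natl mulrA mulVf ?mul1r.
Qed.

Let unif_bnd : exists2 K, 0 <= K & forall n y, DY y -> P n (K * nY y) y.
Proof.
apply: contrapT => nB.
pose St := {sr : Y * R | DY sr.1 /\ 0 < sr.2}.
have H (j : nat) (t : St) : exists nu : nat * Y,
    [/\ DY nu.2, nY nu.2 = (sval t).2 & ~ P nu.1 (j%:R + 2) ((sval t).1 + nu.2)].
  by case: t => -[s r] /= [hs hr]; apply: hump => //; rewrite addr_ge0.
pose pick j t := projT1 (cid (H j t)).
have hpick j t : [/\ DY (pick j t).2, nY (pick j t).2 = (sval t).2 & ~ P (pick j t).1 (j%:R + 2) ((sval t).1 + (pick j t).2)].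
  by rewrite /pick; case: cid.
(* The next radius is divided by 2 (n_j + 1), so that all later humps together change the seminorm
   number n_j by at most 1 and cannot undo hump j. *)
have nxtP j (t : St) : DY ((sval t).1 + (pick j t).2) /\ 0 < (sval t).2 / (2 * (pick j t).1.+1%:R).
  have [h _ _] := hpick j t; case: t h => -[s r] /= [hs hr] h; split; first exact: DYD.
  by rewrite divr_gt0 // mulr_gt0.
pose nxt j t : St := exist _ (_, _) (nxtP j t).
have st0 : DY (0 : Y) /\ (0 : R) < 1 by split.
pose st := fix F j : St := if j is i.+1 then nxt i (F i) else exist _ (0, 1) st0.
pose s j := (sval (st j)).1; pose r j := (sval (st j)).2.
pose n j := (pick j (st j)).1; pose u j := (pick j (st j)).2.
have sS j : s j.+1 = s j + u j by [].
have rS j : r j.+1 = r j / (2 * (n j).+1%:R) by [].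
have r0 j : 0 < r j by rewrite /r; case: (st j) => -[? ?] /= [].
have hs j : DY (s j) by rewrite /s; case: (st j) => -[? ?] /= [].
have hu j : DY (u j) by have [] := hpick j (st j).
have nu j : nY (u j) = r j by have [] := hpick j (st j).
have nPj j : ~ P (n j) (j%:R + 2) (s j.+1) by have [] := hpick j (st j).
have rhalf j : r j.+1 <= r j / 2.
  rewrite rS ler_wpM2l ?(ltW (r0 j)) // lef_pV2 ?posrE ?mulr_gt0 //.
  by rewrite ler_peMr // ler1n.
have rgeo j : r j <= 1 / 2 ^+ j.
  elim: j => [|j IH]; first by rewrite /r /= expr0 divr1.
  apply: (le_trans (rhalf j)); rewrite exprSr invfM mulrA ler_wpM2r ?invr_ge0 //.
have ss j : s j = \sum_(k < j) u k.
  by elim: j => [|j IH]; [rewrite big_ord0|rewrite big_ord_recr /= -IH].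
have [y hy ylim] : exists2 y, DY y & forall j, nY (y - s j) <= 2 * 1 / 2 ^+ j.
  have [y hy yl] := cY hu (fun j => eq_ind_r (fun x => x <= _) (rgeo j) (nu j)).
  by exists y => // j; rewrite ss.
have tele j k : nY (s (j + k)%N - s j) <= 2 * r j - 2 * r (j + k)%N.
  elim: k => [|k IH]; first by rewrite addn0 !subrr -(scale0r 0) nYZ // cabs0 mul0r.
  rewrite addnS sS addrAC; apply: (le_trans (nYD (DYB (hs _) (hs _)) (hu _))).
  by rewrite nu; have := rhalf (j + k)%N; move: IH; lra.
have tail j : nY (y - s j) <= 2 * r j.
  rewrite -subr_le0; apply: (@le_geo0 _ _ 2) => k.
  have -> : y - s j = (y - s (j + k)%N) + (s (j + k)%N - s j) by rewrite addrA subrK.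
  rewrite lerBlDr; apply: (le_trans (nYD (DYB hy (hs _)) (DYB (hs _) (hs _)))).
  apply: lerD; last by have := tele j k; have := r0 (j + k)%N; lra.
  apply: (le_trans (ylim _)); rewrite mulr1 ler_wpM2l // lef_pV2 ?posrE ?exprn_gt0 //.
  by rewrite ler_eXn2l ?ltr1n // leq_addl.
have [x hx xy] := T_onto hy.
(* A preimage x of the limit y bounds all its seminorms by |x| < j, which contradicts hump j. *)
pose j := (Num.trunc (nX x)).+1.
have Pj : P (n j) j%:R y.
  exists x => //; rewrite xy mulr0 addr0 ltW //; exact: truncnS_gt.
apply: (nPj j); have -> : s j.+1 = y - (y - s j.+1) by rewrite opprB addrC subrK.
apply: PB => //; first exact: DYB.
apply: P_le (P_nY _ _); apply: (@le_trans _ _ ((n j)%:R * (2 * r j.+1))); first by rewrite ler_wpM2l.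
rewrite rS; have r1 : r j <= 1 by apply: (le_trans (rgeo j)); rewrite ler_pdivrMr ?exprn_gt0 // mul1r exprn_ege1 // ler1n.
have n0 : 0 < (n j).+1%:R :> R by [].
have -> : (n j)%:R * (2 * (r j / (2 * (n j).+1%:R))) = (n j)%:R / (n j).+1%:R * r j by field; rewrite gt_eqF.
have h1 : (n j)%:R / (n j).+1%:R <= 1 :> R by rewrite ler_pdivrMr // mul1r ler_nat.
have h2 : 0 <= (n j)%:R / (n j).+1%:R :> R by rewrite divr_ge0.
have h3 := ler_pM h2 (ltW (r0 j)) h1 r1; by rewrite (le_trans h3) // mulr1 ler1n.
Qed.

Lemma open_mapping : exists2 K, 0 <= K & forall y, DY y -> exists x, [/\ DX x, nY (y - T x) = 0 & nX x <= K * nY y].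
Proof.
have [K K0 HK] := unif_bnd; exists (2 * K) => [|y hy]; first by rewrite mulr_ge0.
(* For N >= 2 K the seminorm number N yields an x with |x| <= K |y| that leaves a remainder of norm
   at most |y| / 2; iteration sums a geometric series. *)
pose N := (Num.trunc (2 * K)).+1.
have NK : 2 * K <= N%:R by rewrite ltW // truncnS_gt.
have N0 : 0 < N%:R :> R by [].
have H (t : {y | DY y}) : exists x, [/\ DX x, nX x <= K * nY (sval t) & nY (sval t - T x) <= nY (sval t) / 2].
  case: t => w hw /=; have [x hx h] := HK N w hw; exists x; split=> //.
    apply: le_trans h; rewrite lerDl mulr_ge0 //.
  have h2 : N%:R * nY (w - T x) <= K * nY w by apply: le_trans h; rewrite lerDr.
  have h3 : K * nY w <= N%:R / 2 * nY w by rewrite ler_wpM2r //; move: NK; lra.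
  by rewrite -(ler_pM2l N0) (le_trans h2) // (le_trans h3) // mulrAC mulrA.
pose pick t := projT1 (cid (H t)).
have hpick t : [/\ DX (pick t), nX (pick t) <= K * nY (sval t) & nY (sval t - T (pick t)) <= nY (sval t) / 2].
  by rewrite /pick; case: cid.
have nxtP (t : {y | DY y}) : DY (sval t - T (pick t)).
  by have [h _ _] := hpick t; apply: DYB; [case: t h|exact: TD].
pose st := fix F j : {y | DY y} := if j is i.+1 then exist _ _ (nxtP (F i)) else exist _ y hy.
pose w j := sval (st j); pose u j := pick (st j).
have hw j : DY (w j) by rewrite /w; case: (st j).
have wS j : w j.+1 = w j - T (u j) by [].
have hu j : DX (u j) by have [] := hpick (st j).
have wgeo j : nY (w j) <= nY y / 2 ^+ j.
  elim: j => [|j IH]; first by rewrite expr0 divr1.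
  have [_ _] := hpick (st j); rewrite -/(u j) -/(w j) -wS => /le_trans; apply.
  by rewrite exprSr invfM mulrA ler_wpM2r ?invr_ge0.
have ugeo j : nX (u j) <= K * nY y / 2 ^+ j.
  by have [_ h _] := hpick (st j); rewrite (le_trans h) // -mulrA ler_wpM2l // wgeo.
have [x hx xl] := cX hu ugeo.
have hsum j : DX (\sum_(k < j) u k) by elim: j => [|j IH]; [rewrite big_ord0|rewrite big_ord_recr /=; exact: DXD].
have wE j : w j = y - T (\sum_(k < j) u k).
  elim: j => [|j IH]; first by rewrite big_ord0 T0 subr0.
  rewrite wS IH big_ord_recr /= -addrA -opprD; congr (_ - _).
  rewrite -[X in _ = T (_ + X)]opprK (TB (hsum j) (DXN (hu j))) -(sub0r (u j)) (TB DX0 (hu j)).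
  by rewrite T0 sub0r opprK.
exists x; split=> //; last by have := xl 0%N; rewrite big_ord0 subr0 expr0 divr1 mulrA.
apply/eqP; rewrite eq_le nY_ge0 andbT; apply: (@le_geo0 _ _ (nY y + `|B| * (2 * (K * nY y)))) => j.
have -> : y - T x = w j - T (x - \sum_(k < j) u k).
  by rewrite wE TB // opprB addrA subrK.
apply: (le_trans (nYB (hw j) (TD (DXB hx (hsum j))))); rewrite mulrDl lerD //.
apply: (le_trans (Tbnd (DXB hx (hsum j)))).
apply: (@le_trans _ _ (`|B| * nX (x - \sum_(k < j) u k))); first by rewrite ler_wpM2r // ler_norm.
by rewrite -mulrA ler_wpM2l // (le_trans (xl j)).
Qed.

End OpenMapping.

(** * Products in H^1 *)
Section Hardy.
Variable R : realType.
Local Notation C := R[i].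
Local Notation mu := (@lebesgue_measure R).
Local Notation TT := (@circ R).
Implicit Types (z w : C) (p q : R) (f g h k : R -> C).
Local Opaque cabs cexp powR lebesgue_measure circ.

Lemma cabs_le_eps z (M : R) : (forall e : R, 0 < e -> cabs z <= e * M) -> z = 0.
Proof.
move=> h; apply/eqP; rewrite -cabs_eq0 eq_le cabs_ge0 andbT.
have M0 : 0 <= M by have := h 1 ltr01; rewrite mul1r; exact: le_trans (cabs_ge0 _).
apply/ler_addgt0Pr => e e0; rewrite add0r.
have M1 : 0 < M + 1 by lra.
apply: (le_trans (h (e / (M + 1)) (divr_gt0 e0 M1))).
by rewrite mulrAC ler_pdivrMr // ler_pM2l //; lra.
Qed.

Lemma fc_uniq f g : Lp 1 f -> Lp 1 g -> (forall n, fc f n = fc g n) -> aeq f g.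
Proof.
move=> hf hg e; have := @L1_uniq _ (fun x => f x - g x) (LpB (lexx 1) hf hg).
move=> H; apply: ae_imp (H _) => [x _ /eqP|n]; first by rewrite subr_eq0 => /eqP.
by rewrite fcB // e subrr.
Qed.

Lemma fc0 n : fc (fun=> 0 : C) n = 0.
Proof.
rewrite (_ : (fun=> 0) = (fun x => 0 * (fun=> 0 : C) x)); last by apply/funext => x; rewrite mul0r.
by rewrite fcZ ?mul0r //; exact: Lp0.
Qed.

Lemma fc_cst z n : fc (fun=> z) n = z * (n == 0)%:R.
Proof.
rewrite (_ : (fun=> z) = (fun x => z * tpow 0 x)); last by apply/funext => x; rewrite tpow0 mulr1.
by rewrite fcZ ?fc_tpow 1?eq_sym //; exact: Lp_tpow.
Qed.

Lemma Hp1 p f : 1 <= p -> Hp p f -> Hp 1 f.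
Proof. by move=> p1 [hf f0]; split => //; exact: (Lp1 p1). Qed.

Lemma fc_Jop_Hp k n : Hp 1 k -> 0 <= n -> fc (Jop k) n = 0.
Proof. by move=> [hk k0] n0; rewrite fc_Jop // k0 //; lia. Qed.

(** The spectra are disjoint: f has no negative frequencies and J k no others. *)
Lemma Hp_Jop_eq0 f k : Hp 1 f -> Hp 1 k -> aeq f (Jop k) -> aeq f (fun=> 0).
Proof.
move=> [hf f0] hk e; have [hk1 _] := hk; apply: L1_uniq => // n.
have [n0|n0] := ltP n 0; first exact: f0.
rewrite (fc_ext n (Lp_meas hf) (Lp_meas (Lp_Jop hk1)) e); exact: fc_Jop_Hp.
Qed.

(** The analytic part of f - s is f - P s, and the projection constant controls its norm. *)
Lemma dense_Hp p f (e : R) : 1 < p -> Hp p f -> 0 < e -> exists s, nrm p (fun x => f x - tp (nngf s) x) < e.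
Proof.
move=> p1 [hf f0] e0; have p1' : 1 <= p by exact: ltW.
have p0 : 0 < p by lra.
have [K K0 HK] := rieszP_Lp p1.
have K1 : 0 < K + 1 by lra.
have [s hs] := dense_Lp p1' hf (divr_gt0 e0 K1); exists s.
have hd : Lp p (fun x => f x - tp s x) by apply: LpB => //; exact: Lp_tp.
have [a [[ha a0] [hk k0] na]] := HK _ hd.
have hn : Lp p (fun x => f x - tp (nngf s) x) by apply: LpB => //; exact: Lp_tp.
have E : aeq (fun x => f x - tp (nngf s) x) a.
  apply: fc_uniq; [exact: (Lp1 p1')|exact: (Lp1 p1')|move=> n].
  rewrite (fcB _ (Lp1 p1' hf) (Lp_tp _ ltr01)) fc_nngf; case: ifPn => n0.
    have h1 := Lp1 p1' (LpB p1' hd ha).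
    have := k0 (-1 - n); rewrite fc_Jop // (fcB _ (Lp1 p1' hd) (Lp1 p1' ha)) (fcB _ (Lp1 p1' hf) (Lp_tp _ ltr01)).
    rewrite (_ : -1 - (-1 - n) = n); last by ring.
    by move=> H; apply/eqP; rewrite -subr_eq0 H //; lia.
  by rewrite -ltNge in n0; rewrite f0 // a0 // subr0.
rewrite (nrm_ext p0 (Lp_meas hn) (Lp_meas ha) E) (le_lt_trans na) //.
move: hs; rewrite ltr_pdivlMr // => hs; apply: le_lt_trans hs.
by rewrite mulrC ler_wpM2l ?nrm_ge0 //; lra.
Qed.

Lemma fc_tpM s g n : Lp 1 g -> fc (fun x => tp s x * g x) n = \sum_(u <- s) u.1 * fc g (n - u.2).
Proof.
move=> hg; elim: s => [|u s IH].
  rewrite big_nil (_ : (fun x => _) = (fun=> 0)) ?fc0 //.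
  by apply/funext => x; rewrite tp_nil mul0r.
rewrite big_cons -IH -fc_Mtpow -fcZ; last by exact: Lp_Mtpow.
rewrite -fcD; last 2 first.
- by apply: LpZ => //; exact: Lp_Mtpow.
- by have [] := LpM_bnd ltr01 (cmeas_tp s) (ae_forall (fun x _ => tp_bnd s x)) hg.
by congr fc; apply/funext => x; rewrite tp_cons mulrDl mulrA.
Qed.

(** For polynomial f both claims are read off the coefficients, and the defect [D] is continuous in
    f by Hoelder. The multiplicativity of the mean is what later evaluates signatures. *)
Lemma Hp_mul p f g : 1 < p -> Hp p f -> Hp (conj_exp p) g ->
  Hp 1 (fun x => f x * g x) /\ fc (fun x => f x * g x) 0 = fc f 0 * fc g 0.
Proof.
move=> p1 hf hg; have [hfp _] := hf; have [hgq g0] := hg.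
have [q1 pq _] := conj_expP p1; set q := conj_exp p in hgq q1 pq.
have p0 : 0 < p by lra.
have q0 : 0 < q by lra.
have p1' := ltW p1; have q1' := ltW q1.
have hM u : Lp p u -> Lp 1 (fun x => u x * g x) /\ nrm 1 (fun x => u x * g x) <= nrm p u * nrm q g.
  by move=> hu; exact: hoelder_Lp.
have key n : n <= 0 -> fc (fun x => f x * g x) n = (n == 0)%:R * (fc f 0 * fc g 0).
  move=> n0; pose D u := fc (fun x => u x * g x) n - (n == 0)%:R * (fc u 0 * fc g 0).
  pose c := (2 * pi)^-1 * (2 * pi) `^ (1 - p^-1) : R.
  apply/eqP; rewrite -subr_eq0; apply/eqP; rewrite -/(D f).
  apply: (@cabs_le_eps _ ((2 * pi)^-1 * nrm q g + c * cabs (fc g 0))) => e e0.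
  have [s hs] := dense_Hp p1 hf e0; set v := tp (nngf s) in hs.
  have hv : Lp p v by exact: Lp_tp.
  have hd : Lp p (fun x => f x - v x) by exact: LpB.
  have Dv : D v = 0.
    rewrite /D /v fc_tpM ?fc_tp; last exact: (Lp1 q1').
    apply/eqP; rewrite subr_eq0; apply/eqP; rewrite big_distrl big_distrr /=.
    rewrite /nngf !big_filter; apply: eq_bigr => u u0.
    have [un|un] := eqVneq u.2 0; first rewrite un subr0 mulr1.
      case: eqVneq => [->|nn]; first by rewrite mul1r.
      by rewrite g0 ?mulr0 ?mul0r // lt_neqAle nn.
    have u1 : 0 < u.2 by rewrite lt_neqAle eq_sym un.
    rewrite /= g0 ?mulr0 ?mul0r ?mulr0 //; move: n0 u1; clear; lia.
  have -> : D f = D (fun x => f x - v x).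
    rewrite /D (fcB 0 (Lp1 p1' hfp) (Lp1 p1' hv)) -[LHS]subr0 -Dv /D.
    rewrite (_ : (fun x => (f x - v x) * g x) = (fun x => f x * g x - v x * g x)); last by apply/funext => x; rewrite mulrBl.
    by rewrite (fcB n (hM _ hfp).1 (hM _ hv).1); ring.
  rewrite /D; apply: (le_trans (cabsB _ _)); rewrite mulrDr; apply: lerD.
    apply: (le_trans (cabs_fc_le n (hM _ hd).1)); rewrite mulrCA ler_wpM2l ?invr_ge0 ?(ltW (pi2_gt0 R)) //.
    by apply: (le_trans (hM _ hd).2); rewrite ler_wpM2r ?nrm_ge0 // ltW.
  have h1 : cabs (fc (fun x => f x - v x) 0 * fc g 0) <= e * (c * cabs (fc g 0)).
    rewrite cabsM mulrA ler_wpM2r ?cabs_ge0 // (le_trans (fc_le_nrm 0 p1' hd)) // mulrC ler_wpM2r ?ltW //.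
    by rewrite mulr_gt0 ?powR_gt0 ?invr_gt0 ?pi2_gt0.
  case: (n == 0); first by rewrite mul1r.
  by rewrite mul0r cabs0 (le_trans _ h1) ?cabs_ge0.
split; last by rewrite key // eqxx mul1r.
split=> [|n n0]; first exact: (hM _ hfp).1.
by rewrite key ?ltW // lt_eqF // mul0r.
Qed.

End Hardy.

(** * Toeplitz equations *)
Section ToeplitzRelation.
Variable R : realType.
Local Notation C := R[i].
Local Notation mu := (@lebesgue_measure R).
Local Notation TT := (@circ R).
Implicit Types (z w : C) (p q : R) (f g h k y : R -> C).
Local Opaque cabs cexp powR lebesgue_measure circ.

Lemma aeqD f f' g g' : aeq f f' -> aeq g g' -> aeq (fun x => f x + g x) (fun x => f' x + g' x).
Proof. by apply: ae_imp2 => x _ -> ->. Qed.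
Lemma aeqM f f' g g' : aeq f f' -> aeq g g' -> aeq (fun x => f x * g x) (fun x => f' x * g' x).
Proof. by apply: ae_imp2 => x _ -> ->. Qed.
Lemma aeqZ z f f' : aeq f f' -> aeq (fun x => z * f x) (fun x => z * f' x).
Proof. by apply: ae_imp => x _ ->. Qed.
Lemma aeq_sum (I : Type) (r : seq I) (F G : I -> R -> C) : (forall i, aeq (F i) (G i)) ->
  aeq (fun x => \sum_(i <- r) F i x) (fun x => \sum_(i <- r) G i x).
Proof.
move=> h; elim: r => [|i r IH]; first by apply: aeq_eq => x; rewrite !big_nil.
by apply: ae_imp2 (h i) IH => x _ e1 e2; rewrite !big_cons e1 e2.
Qed.

Lemma fc_lincomb n (e : 'I_n -> R -> C) (c : 'I_n -> C) m : (forall i, Lp 1 (e i)) ->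
  fc (lincomb e c) m = \sum_(i < n) c i * fc (e i) m.
Proof.
move=> he; rewrite /lincomb; elim: n e c he => [|n IH] e c he.
  by rewrite big_ord0 (_ : (fun x => _) = (fun=> 0)) ?fc0 //; apply/funext => x; rewrite big_ord0.
rewrite big_ord_recl /= -(IH (fun i => e (lift ord0 i))) // -fcZ // -fcD.
- by congr fc; apply/funext => x; rewrite big_ord_recl.
- exact: LpZ.
- by apply: (Lp_sum (index_enum _) (lexx 1) _).1 => i; exact: LpZ.
Qed.

Lemma Lp_lincomb p n (e : 'I_n -> R -> C) (c : 'I_n -> C) : 1 <= p -> (forall i, Lp p (e i)) -> Lp p (lincomb e c).
Proof. by move=> p1 he; apply: (Lp_sum (index_enum _) p1 _).1 => i; apply: LpZ => //; lra. Qed.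
Lemma Hp_lincomb p n (e : 'I_n -> R -> C) (c : 'I_n -> C) : 1 <= p -> (forall i, Hp p (e i)) -> Hp p (lincomb e c).
Proof. by move=> p1 he; apply: Hp_sum => // i; exact: HpZ. Qed.

Lemma row_free_ker (F : fieldType) N n (A : 'M[F]_(N, n)) : (forall v : 'rV_N, v *m A = 0 -> v = 0) -> row_free A.
Proof.
move=> h; rewrite -kermx_eq0; apply/eqP/row_matrixP => i; rewrite row0; apply: h.
by rewrite -row_mul mulmx_ker row0.
Qed.

Definition ae_free N (F : 'I_N -> R -> C) := forall c, aeq (lincomb F c) (fun=> 0) -> forall i, c i = 0.

(** Linear algebra modulo almost everywhere equality: the matrix of the coefficients of F in terms
    of G has trivial left kernel, so its rank N is at most n. *)
Lemma free_le_span N n (F : 'I_N -> R -> C) (G : 'I_n -> R -> C) :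
  (forall i, exists c, aeq (F i) (lincomb G c)) -> ae_free F -> (N <= n)%N.
Proof.
move=> hF freeF; pose A i := sval (cid (hF i)).
have hA i : aeq (F i) (lincomb G (A i)) by rewrite /A; case: cid.
have : row_free (\matrix_(i < N, l < n) A i l).
  apply: row_free_ker => v hv; apply/rowP => i; rewrite mxE.
  apply: (freeF (fun i => v 0 i)).
  apply: (@aeq_trans _ (fun x => \sum_(i < N) v 0 i * lincomb G (A i) x)).
    by apply: aeq_sum => j; apply: aeqZ.
  apply: aeq_eq => x; rewrite /lincomb.
  under eq_bigr do rewrite big_distrr /=; rewrite exchange_big /=; apply: big1 => l _.
  have /rowP /(_ l) := hv; rewrite !mxE => H.
  under eq_bigr do rewrite mulrA; rewrite -big_distrl /=.
  rewrite (_ : \sum_i _ = 0) ?mul0r // -[RHS]H; apply: eq_bigr => j _; by rewrite mxE.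
by rewrite /row_free => /eqP <-; exact: rank_leq_col.
Qed.

Lemma JopD f g x : Jop (fun x => f x + g x) x = Jop f x + Jop g x.
Proof. by rewrite /Jop mulrDr. Qed.
Lemma JopN f x : Jop (fun x => - f x) x = - Jop f x.
Proof. by rewrite /Jop mulrN. Qed.
Lemma JopZ z f x : Jop (fun x => z * f x) x = z * Jop f x.
Proof. by rewrite /Jop mulrCA. Qed.
Lemma Jop0 x : Jop (fun=> 0) x = 0 :> C.
Proof. by rewrite /Jop mulr0. Qed.
Lemma JopM f g x : Jop (fun x => f x * g x) x = tilde f x * Jop g x.
Proof. by rewrite /Jop /tilde mulrCA. Qed.
Lemma Jop_tpowM j k x : Jop (fun x => tpow j x * k x) x = tpow (- j) x * Jop k x.
Proof. by rewrite JopM /tilde tpow_reflect. Qed.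

Lemma Jop_of_neg p h : 1 <= p -> Lp p h -> (forall n, 0 <= n -> fc h n = 0) -> Hp p (Jop h).
Proof.
move=> p1 hh h0; split; first exact: Lp_Jop.
by move=> n n0; rewrite fc_Jop ?h0 //; [lia|exact: (Lp1 p1)].
Qed.

Lemma decomp p h : 1 < p -> Lp p h -> exists f k, [/\ Hp p f, Hp p k & forall x, h x = f x + Jop k x].
Proof.
move=> p1 hh; have [K _ HK] := rieszP_Lp p1; have [f [hf hk _]] := HK h hh.
by exists f, (Jop (fun x => h x - f x)); split=> // x; rewrite JopK addrC subrK.
Qed.

Lemma Hp_div p m f : 1 <= p -> Hp p f -> (forall j : nat, (j < m)%N -> fc f j = 0) ->
  Hp p (fun x => tpow (- (m : int)) x * f x).
Proof.
move=> p1 [hf f0] fm; split; first by apply: Lp_Mtpow => //; lra.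
move=> n n0; rewrite fc_Mtpow opprK; have [h|h] := ltP (n + m%:Z) 0; first exact: f0.
by have := fm `|(n + m%:Z)%R|%N; rewrite gez0_abs //; apply; lia.
Qed.

Definition monom m : 'I_m -> R -> C := fun j => tpow j.

Lemma Lp_monom p m (j : 'I_m) : 0 < p -> Lp p (monom j). Proof. exact: Lp_tpow. Qed.
Lemma Hp_monom p m (j : 'I_m) : 1 <= p -> Hp p (monom j). Proof. exact: Hp_tpow. Qed.

Lemma fc_poly m (c : 'I_m -> C) (i : 'I_m) : fc (lincomb (@monom m) c) i = c i.
Proof.
rewrite fc_lincomb => [|j]; last exact: Lp_monom.
rewrite (bigD1 i) //= /monom fc_tpow eqxx mulr1 big1 ?addr0 // => j ji.
by rewrite fc_tpow eqz_nat (inj_eq val_inj) (negbTE ji) mulr0.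
Qed.
Lemma fc_poly0 m (c : 'I_m -> C) (n : int) : n < 0 \/ m%:Z <= n -> fc (lincomb (@monom m) c) n = 0.
Proof.
move=> h; rewrite fc_lincomb => [|j]; last exact: Lp_monom.
apply: big1 => j _; rewrite /monom fc_tpow; case: eqP => [e|_]; last by rewrite mulr0.
by exfalso; move: (ltn_ord j) h; rewrite -e; clear; lia.
Qed.

(** The factor t^m carries only the frequencies -m, ..., -1 across 0; they become a polynomial of
    degree below m, and the rest stays in J H^p. *)
Lemma tpowM_Jop p m k : 1 <= p -> Hp p k -> exists2 k', Hp p k' &
  aeq (fun x => tpow m%:Z x * Jop k x) (fun x => lincomb (@monom m) (fun j => fc (fun x => tpow m%:Z x * Jop k x) j) x + Jop k' x).
Proof.
move=> p1 hk; set h := fun x => tpow m%:Z x * Jop k x.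
have p0 : 0 < p by lra.
have hh : Lp p h by apply: Lp_Mtpow => //; apply: Lp_Jop; exact: Hp_Lp hk.
set s := lincomb _ _; have hs : Lp p s by apply: Lp_lincomb => // j; exact: Lp_monom.
exists (Jop (fun x => h x - s x)); last by apply: aeq_eq => x; rewrite JopK addrC subrK.
apply: Jop_of_neg => //; first exact: LpB.
move=> n n0; rewrite (fcB _ (Lp1 p1 hh) (Lp1 p1 hs)); have [nm|nm] := ltP n m%:Z.
  have H : (`|n| < m)%N by lia.
  have -> : n = Ordinal H :> int by rewrite /= gez0_abs.
  by rewrite fc_poly subrr.
rewrite fc_poly0; last by right.
by rewrite subr0 /h fc_Mtpow (fc_Jop_Hp (Hp1 p1 hk)) // subr_ge0.
Qed.

Lemma Linf_mul g : inLinf g -> exists2 M, 0 <= M & forall p f, 0 < p -> Lp p f ->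
  Lp p (fun x => g x * f x) /\ nrm p (fun x => g x * f x) <= M * nrm p f.
Proof. by move=> [mg [M hM]]; exists `|M| => // p f p0 hf; exact: LpM_bnd. Qed.

Lemma Linf_tpow g n : inLinf g -> inLinf (fun x => g x * tpow n x).
Proof.
move=> [mg [M hM]]; split; first by apply: cmeasM => //; exact: cmeas_tpow.
by exists M; apply: ae_imp hM => x _; rewrite cabsM cabs_tpow mulr1.
Qed.

(* [Tsol p g f y] encodes T(g) f = y: the difference g f - y lies in J H^p, the range of Q. *)
Definition Tsol p g f y := exists2 k, Hp p k & aeq (fun x => g x * f x) (fun x => y x + Jop k x).

Lemma Tsol_ext p g f f' y y' : aeq f f' -> aeq y y' -> Tsol p g f y -> Tsol p g f' y'.
Proof.
move=> e1 e2 [k hk e]; exists k => //.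
apply: aeq_trans (aeqM (aeq_refl g) (aeq_sym e1)) _.
exact: aeq_trans e (aeqD e2 (aeq_refl _)).
Qed.
Lemma TsolD p g f f' y y' : 1 <= p -> Tsol p g f y -> Tsol p g f' y' ->
  Tsol p g (fun x => f x + f' x) (fun x => y x + y' x).
Proof.
move=> p1 [k hk e] [k' hk' e']; exists (fun x => k x + k' x); first exact: HpD.
by apply: ae_imp2 e e' => x _ h h'; rewrite mulrDr h h' JopD addrACA.
Qed.
Lemma TsolZ p g z f y : 1 <= p -> Tsol p g f y -> Tsol p g (fun x => z * f x) (fun x => z * y x).
Proof.
move=> p1 [k hk e]; exists (fun x => z * k x); first exact: HpZ.
by apply: ae_imp e => x _ h; rewrite mulrCA h JopZ mulrDr.
Qed.
Lemma TsolB p g f f' y y' : 1 <= p -> Tsol p g f y -> Tsol p g f' y' ->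
  Tsol p g (fun x => f x - f' x) (fun x => y x - y' x).
Proof.
move=> p1 h h'; have := TsolD p1 h (TsolZ (-1) p1 h').
by apply: Tsol_ext; apply: aeq_eq => x; rewrite mulN1r.
Qed.
Lemma Tsol0 p g : 0 < p -> Tsol p g (fun=> 0) (fun=> 0).
Proof. by move=> p0; exists (fun=> 0); [exact: Hp0|apply: aeq_eq => x; rewrite mulr0 Jop0 addr0]. Qed.
Lemma Tsol_lincomb p g n (e y : 'I_n -> R -> C) c : 1 <= p -> (forall i, Tsol p g (e i) (y i)) ->
  Tsol p g (lincomb e c) (lincomb y c).
Proof.
move=> p1 h; rewrite /lincomb; elim: (index_enum _) => [|i r IH].
  by apply: Tsol_ext (@Tsol0 p g _) => [||]; [apply: aeq_eq => x; rewrite big_nil|apply: aeq_eq => x; rewrite big_nil|lra].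
apply: Tsol_ext (TsolD p1 (TsolZ (c i) p1 (h i)) IH) => //; by apply: aeq_eq => x; rewrite big_cons.
Qed.
Lemma Tsol_tpow p g n f y : Tsol p (fun x => g x * tpow n x) f y <-> Tsol p g (fun x => tpow n x * f x) y.
Proof. by split=> -[k hk e]; exists k => //; apply: ae_imp e => x _ <-; rewrite mulrA. Qed.

Definition Tbij p g := (forall y, Hp p y -> exists2 f, Hp p f & Tsol p g f y) /\
  (forall f, Hp p f -> Tsol p g f (fun=> 0) -> aeq f (fun=> 0)).

Lemma Hp_complete p (u : nat -> R -> C) (K : R) : 1 <= p -> (forall n, Hp p (u n)) ->
  (forall n, nrm p (u n) <= K / 2 ^+ n) ->
  exists2 f, Hp p f & forall n, nrm p (fun x => f x - \sum_(k < n) u k x) <= 2 * K / 2 ^+ n.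
Proof.
move=> p1 hu hK; have [f [hf nf _]] := Lp_series p1 (fun n => (hu n).1) hK.
exists f => //; split=> // n n0.
have hS (k : nat) : Hp p (fun x => \sum_(i < k) u i x) by apply: Hp_sum => // i; exact: hu.
have hS0 (k : nat) : fc (fun x => \sum_(i < k) u i x) n = 0 by have [_ ->] := hS k.
have hS1 (k : nat) : Lp p (fun x => \sum_(i < k) u i x) by have [] := hS k.
exact: (@fc_lim R p (fun (k : nat) x => \sum_(i < k) u i x) f (2 * K) 0 n p1 hS1 hf nf hS0).
Qed.

(** * Open mapping theorem for Toeplitz equations *)

Section Open.
Variables (p : R) (g : R -> C) (m : nat) (q : 'I_m -> R -> C).
Hypotheses (p1 : 1 < p) (hg : inLinf g) (hq : forall i, Lp p (q i)).

Let U : lmodType C := (R -> C^o)%type.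
Let X : lmodType C := (U * U * U)%type.
Let DX (x : X) := [/\ Hp p x.1.1, Hp p x.1.2 & Hp p x.2].
Let nX (x : X) : R := Num.max (nrm p x.1.1) (Num.max (nrm p x.1.2) (nrm p x.2)).
Let T (x : X) : U := fun t => g t * x.1.1 t - Jop x.1.2 t + lincomb q (fun i => fc x.2 i) t.

(** The multipliers of the q i are encoded as the first m Fourier coefficients of some u in H^p,
    which keeps all components in one complete space; they are bounded by the norm of u. *)
Lemma Toeplitz_open :
  (forall h, Lp p h -> exists f k u, [/\ Hp p f, Hp p k, Hp p u &
      aeq h (fun t => g t * f t - Jop k t + lincomb q (fun i => fc u i) t)]) ->
  exists2 K, 0 <= K & forall h, Lp p h -> exists f k u, [/\ Hp p f, Hp p k, Hp p u,
      aeq h (fun t => g t * f t - Jop k t + lincomb q (fun i => fc u i) t) &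
      nrm p f <= K * nrm p h /\ nrm p u <= K * nrm p h].
Proof.
have p0 : 0 < p := lt_trans ltr01 p1.
have p1' := ltW p1.
move=> onto; have [M M0 HM] := Linf_mul hg.
have mulg f : Lp p f -> Lp p (fun x => g x * f x) /\ nrm p (fun x => g x * f x) <= M * nrm p f by exact: HM.
pose cc := (2 * pi)^-1 * (2 * pi) `^ (1 - p^-1) : R.
have nXle x (K : R) : (nX x <= K) = [&& nrm p x.1.1 <= K, nrm p x.1.2 <= K & nrm p x.2 <= K].
  by rewrite /nX !ge_max.
have le1 x : nrm p x.1.1 <= nX x by rewrite /nX le_max lexx.
have le2 x : nrm p x.1.2 <= nX x by rewrite /nX !le_max lexx orbT.
have le3 x : nrm p x.2 <= nX x by rewrite /nX !le_max lexx !orbT.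
have hT x : DX x -> Lp p (T x).
  case=> -[h1 _] [h2 _] _; apply: LpD => //; last exact: Lp_lincomb.
  by apply: LpB => //; [exact: (mulg _ _).1|exact: Lp_Jop].
have sc1 z (x : X) : (z *: x).1.1 = (fun t => z * x.1.1 t) by [].
have sc2 z (x : X) : (z *: x).1.2 = (fun t => z * x.1.2 t) by [].
have sc3 z (x : X) : (z *: x).2 = (fun t => z * x.2 t) by [].
have sumE (u : nat -> X) n : \sum_(k < n) u k =
    ((fun t => \sum_(k < n) (u k).1.1 t, fun t => \sum_(k < n) (u k).1.2 t), fun t => \sum_(k < n) (u k).2 t) :> X.
  elim: n => [|n IH].
    by rewrite big_ord0; congr (_, _, _); apply/funext => t; rewrite big_ord0.
  by rewrite big_ord_recr /= IH; congr (_, _, _); apply/funext => t; rewrite big_ord_recr.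
have := @open_mapping R X U DX nX (Lp p) (nrm p) T (M + 1 + \sum_(i < m) cc * nrm p (q i)).
case.
- by split; exact: Hp0.
- by move=> x y [? ? ?] [? ? ?]; split; exact: HpB.
- by move=> z x [? ? ?]; rewrite /DX sc1 sc2 sc3; split; exact: HpZ.
- by move=> x; rewrite (le_trans _ (le1 x)) ?nrm_ge0.
- by rewrite /nX !nrm0 // !maxxx.
- move=> x y [[? _] [? _] [? _]] [[? _] [? _] [? _]]; rewrite nXle.
  apply/and3P; split; by apply: (le_trans (nrmB p1' _ _)) => //; rewrite lerD.
- move=> z x [[? _] [? _] [? _]]; rewrite /nX sc1 sc2 sc3 !maxr_pMr ?cabs_ge0 //.
  by congr (Num.max _ (Num.max _ _)); apply: nrmZ.
- exact: Lp0.
- by move=> x y; exact: LpB.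
- by move=> z x; exact: LpZ.
- by move=> x; exact: nrm_ge0.
- by move=> x y; exact: nrmB.
- by move=> z x; exact: nrmZ.
- move=> u K hu nu.
  have [f hf nf] := @Hp_complete p (fun n => (u n).1.1) K p1' (fun n => let: And3 a _ _ := hu n in a) (fun n => le_trans (le1 _) (nu n)).
  have [k hk nk] := @Hp_complete p (fun n => (u n).1.2) K p1' (fun n => let: And3 _ a _ := hu n in a) (fun n => le_trans (le2 _) (nu n)).
  have [v hv nv] := @Hp_complete p (fun n => (u n).2) K p1' (fun n => let: And3 _ _ a := hu n in a) (fun n => le_trans (le3 _) (nu n)).
  exists ((f, k), v) => [//|n]; rewrite sumE nXle; apply/and3P; split; [exact: nf|exact: nk|exact: nv].
- move=> u K hu nu; have [f [hf nf _]] := Lp_series p1' hu nu; exists f => // n.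
  rewrite (_ : \sum_(k < n) u k = (fun t => \sum_(k < n) u k t)); first exact: nf.
  by elim: n => [|n IH]; [rewrite big_ord0; apply/funext => t; rewrite big_ord0|rewrite big_ord_recr /= IH; apply/funext => t; rewrite big_ord_recr].
- exact: hT.
- move=> x y [_ _ [h3 _]] [_ _ [h3' _]]; apply/funext => t; rewrite /T /=.
  rewrite -[RHS]/(_ - _) /lincomb /= (_ : \sum_i _ = \sum_(i < m) (fc x.2 i * q i t - fc y.2 i * q i t)).
    rewrite big_split /= sumrN /Jop /= -[(x.1.1 - y.1.1) t]/(x.1.1 t - y.1.1 t) -[(x.1.2 - y.1.2) _]/(x.1.2 _ - y.1.2 _); ring.
  by apply: eq_bigr => i _; rewrite -mulrBl -(fcB _ (Lp1 p1' h3) (Lp1 p1' h3')).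
- move=> z x [_ _ [h3 _]]; apply/funext => t; rewrite /T /=.
  rewrite -[RHS]/(z * _) /lincomb /= (_ : \sum_i _ = \sum_(i < m) z * (fc x.2 i * q i t)).
    rewrite -big_distrr /= /Jop /= -[(z *: x.1.1) t]/(z * x.1.1 t) -[(z *: x.1.2) _]/(z * x.1.2 _); ring.
  by apply: eq_bigr => i _; rewrite mulrA -(fcZ _ _ (Lp1 p1' h3)).
- move=> x [[h1 _] [h2 _] [h3 _]].
  have [a1 b1] := mulg _ h1.
  have a2 : Lp p (Jop x.1.2) by exact: Lp_Jop.
  rewrite /T; apply: (le_trans (nrmD p1' (LpB p1' a1 a2) (Lp_lincomb _ p1' hq))).
  rewrite mulrDl; apply: lerD.
    rewrite mulrDl mul1r; apply: (le_trans (nrmB p1' a1 a2)); apply: lerD.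
      by apply: (le_trans b1); rewrite ler_wpM2l.
    by rewrite (nrm_Jop _ (Lp_meas h2)).
  have hz (i : 'I_m) : Lp p (fun t => fc x.2 i * q i t) by apply: LpZ.
  apply: (le_trans (Lp_sum (index_enum _) p1' hz).2); rewrite big_distrl /=; apply: ler_sum => i _.
  rewrite nrmZ // mulrAC ler_wpM2r ?nrm_ge0 // (le_trans (fc_le_nrm i p1' h3)) // ler_wpM2l //.
  by rewrite mulr_ge0 ?powR_ge0 // invr_ge0 ltW // pi2_gt0.
- move=> h hh; have [f [k [u [hf hk hu e]]]] := onto h hh.
  exists ((f, k), u) => //; rewrite -(nrm0 p0).
  apply: nrm_ext; [exact: p0|apply: cmeasB; [exact: Lp_meas hh|apply: Lp_meas; exact: hT]|exact: (cmeas_cst 0)|].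
  by apply: ae_imp e => t _ e; rewrite -[LHS]/(h t - T _ t) e subrr.
move=> K K0 HK; exists K => // h hh; have [[[f k] u] [[hf hk hu] e n]] := HK h hh.
exists f, k, u; split=> //; last by split; apply: le_trans n; [exact: (le1 (f, k, u))|exact: (le3 (f, k, u))].
have hd : Lp p (fun t => h t - T (f, k, u) t) by apply: LpB => //; exact: hT.
by apply: ae_imp (nrm_eq0 p0 hd e) => t _ /eqP; rewrite subr_eq0 => /eqP.
Qed.
End Open.

(** Boundedness of the inverse. The right-hand side h may be any function of L^p, because [Tsol]
    sees only its analytic part. *)
Lemma Tbij_bnd p g : 1 < p -> inLinf g -> Tbij p g ->
  exists2 K, 0 <= K & forall h f, Lp p h -> Hp p f -> Tsol p g f h -> nrm p f <= K * nrm p h.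
Proof.
move=> p1 hg [on inj]; have p1' := ltW p1; have p0 : 0 < p by lra.
have E0 (u t : R -> C) x : lincomb (fun i : 'I_0 => u) (fun i => fc t i) x = 0 by rewrite /lincomb big_ord0.
have [|K K0 HK] := @Toeplitz_open p g 0 (fun _ _ => 0) p1 hg (fun _ => Lp0 _).
  move=> h hh; have [y [k [hy hk e]]] := decomp p1 hh; have [f hf [k' hk' e']] := on y hy.
  exists f, (fun x => k' x - k x), (fun=> 0); split=> //; [exact: HpB|exact: Hp0|].
  apply: ae_imp e' => x _ e'; rewrite E0 addr0 e' JopD JopN e; ring.
exists K => // h f hh hf [k hk e].
have [f' [k' [u [hf' hk' _ e' [n _]]]]] := HK h hh.
rewrite (_ : nrm p f = nrm p f') //; apply: nrm_ext => //; [exact: Hp_meas hf|exact: Hp_meas hf'|].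
have : aeq (fun x => f x - f' x) (fun=> 0).
  apply: inj; first exact: HpB.
  exists (fun x => k x - k' x); first exact: HpB.
  by apply: ae_imp2 e e' => x _ e e'; rewrite mulrBr e JopD JopN e' E0; ring.
by apply: ae_imp => x _ /eqP; rewrite subr_eq0 => /eqP.
Qed.

End ToeplitzRelation.

(** * Reduction to index zero *)
Section IndexShift.
Variable R : realType.
Local Notation C := R[i].
Local Notation mu := (@lebesgue_measure R).
Local Notation TT := (@circ R).
Implicit Types (z w : C) (p : R) (f g h y : R -> C).
Local Opaque cabs cexp powR lebesgue_measure circ.

Definition Tker p g (k : nat) (e : 'I_k -> R -> C) :=
  [/\ forall i, Hp p (e i) /\ Tsol p g (e i) (fun=> 0), ae_free e &
      forall f, Hp p f -> Tsol p g f (fun=> 0) -> exists c, aeq f (lincomb e c)].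

Definition Tcok p g (m : nat) (q : 'I_m -> R -> C) :=
  [/\ forall i, Hp p (q i),
      forall f c, Hp p f -> Tsol p g f (lincomb q c) -> forall i, c i = 0 &
      forall h, Hp p h -> exists f c, Hp p f /\ Tsol p g f (fun x => h x - lincomb q c x)].

Definition Tinj p g := forall f, Hp p f -> Tsol p g f (fun=> 0) -> aeq f (fun=> 0).

(* A nonzero kernel element whose first [k] coefficients vanish would yield [k + 1] independent kernel elements
   t^-k f, ..., t^-1 f, f. *)
Lemma kernel_low_coef p g k (e : 'I_k -> R -> C) f : 1 <= p -> Tker p g e -> Hp p f -> Tsol p g f (fun=> 0) ->
  (forall j : nat, (j < k)%N -> fc f j = 0) -> aeq f (fun=> 0).
Proof.
move=> p1 [_ _ espan] [hf f0] [kk hkk ek] fk; have p0 : 0 < p by lra.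
have [//|nf] := pselect (aeq f (fun=> 0)); exfalso.
have exN : exists n : nat, fc f n != 0.
  apply: contrapT => h; apply: nf; apply: (L1_uniq (Lp1 p1 hf)) => n.
  have [n0|n0] := ltP n 0; first exact: f0.
  have -> : n = `|n|%N by rewrite gez0_abs.
  by apply/eqP; apply: contrapT => /negP h'; apply: h; exists `|n|%N.
case: (ex_minnP exN) => N fN minN.
have small (n : int) : n < N%:Z -> fc f n = 0.
  move=> nN; have [n0|n0] := ltP n 0; first exact: f0.
  have E : n = `|n|%N by rewrite gez0_abs.
  apply/eqP; apply: contrapT => /negP h; rewrite E in h nN; have := minN _ h.
  by rewrite leqNgt; move: nN; rewrite ltz_nat => ->.
have kN : (k <= N)%N by rewrite leqNgt; apply/negP => h; move: fN; rewrite fk ?eqxx.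
pose F (j : 'I_k.+1) : R -> C := fun x => tpow (j%:Z - k%:Z) x * f x.
have fcF j n : fc (F j) n = fc f (n - (j%:Z - k%:Z)) by rewrite /F fc_Mtpow.
have hF j : Hp p (F j).
  split; first exact: Lp_Mtpow.
  move=> n n0; rewrite fcF small //; have := ltn_ord j; lia.
have freeF : ae_free F.
  move=> c hc.
  have E (i : nat) : \sum_(j < k.+1) c j * fc f (N%:Z + i%:Z - j%:Z) = 0.
    have h1 := fun j => Lp1 p1 (Hp_Lp (hF j)).
    have := fc_ext (N%:Z + i%:Z - k%:Z) (Lp_meas (Lp_lincomb c (lexx 1) h1)) (cmeas_cst 0) hc.
    rewrite fc0 fc_lincomb // => H; rewrite -[RHS]H; apply: eq_bigr => j _; rewrite fcF; congr (_ * fc _ _); ring.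
  (* The lowest frequencies of the [F j] are distinct, N + j - k, so the system is triangular with
     diagonal entry [fc f N]. *)
  have ind (n : nat) : forall i : 'I_k.+1, (i < n)%N -> c i = 0.
    elim: n => // n IH i; rewrite ltnS leq_eqVlt => /predU1P[ein|]; last exact: IH.
    have := E i; rewrite (bigD1 i) //= big1 ?addr0 ?addrK.
      by move=> /eqP; rewrite mulf_eq0 (negbTE fN) orbF => /eqP.
    move=> j ji; have [h|h] := ltnP j i; first by rewrite IH ?mul0r // -ein.
    rewrite small ?mulr0 //; have : (i < j)%N by rewrite ltn_neqAle h andbT eq_sym ji.
    by lia.
  by move=> i; apply: (ind i.+1).
have : (k.+1 <= k)%N.
  apply: free_le_span freeF => i; apply: espan => //.
  exists (fun x => tpow (k%:Z - i%:Z) x * kk x).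
    have -> : k%:Z - i%:Z = (k - i)%N :> int by rewrite subzn // -ltnS.
    exact: Hp_Mtpow.
  apply: ae_imp ek => x _; rewrite /F add0r Jop_tpowM opprB mulrCA => ->.
  by rewrite add0r.
by rewrite ltnn.
Qed.

(** T(g t^k) = T(g) T(t^k). On the range of T(t^k), where the first k coefficients vanish, T(g) is
    injective, and every f can be moved into it by a kernel element, so no value of T(g) is lost. *)
Lemma shift_ker p g k (e : 'I_k -> R -> C) m (q : 'I_m -> R -> C) : 1 <= p -> Tker p g e -> Tcok p g q ->
  Tinj p (fun x => g x * tpow k x) /\ Tcok p (fun x => g x * tpow k x) q.
Proof.
move=> p1 ke [hq qfree qspan]; have p0 : 0 < p by lra.
have [he efree espan] := ke.
split.
  move=> f hf /Tsol_tpow hT.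
  have h : aeq (fun x => tpow k x * f x) (fun=> 0).
    apply: (kernel_low_coef p1 ke _ hT); first exact: Hp_Mtpow.
    by move=> j jk; rewrite fc_Mtpow; have [_ ->] := hf => //; rewrite subr_lt0 ltz_nat.
  by apply: ae_imp h => x _ /eqP; rewrite mulf_eq0 (negbTE (tpow_neq0 _ _)) => /eqP.
split=> //.
  by move=> f c hf /Tsol_tpow hT; apply: qfree hT; exact: Hp_Mtpow.
move=> h hh; have [f [c [hf hT]]] := qspan h hh.
(* A kernel element with k vanishing low coefficients is 0, so this square matrix is invertible: a
   kernel element can be prescribed by its first k coefficients. *)
pose A := \matrix_(i < k, j < k) fc (e i) j.
have rfA : row_free A.
  apply: row_free_ker => v hv; apply/rowP => i; rewrite mxE.
  apply: (efree (fun i => v 0 i)); apply: (kernel_low_coef p1 ke).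
  - by apply: Hp_lincomb => // j; have [] := he j.
  - have := Tsol_lincomb (fun i => v 0 i) p1 (fun i => (he i).2).
    by apply: Tsol_ext; [exact: aeq_refl|apply: aeq_eq => x; rewrite /lincomb big1 // => l _; rewrite mulr0].
  - move=> j jk; rewrite fc_lincomb => [|l]; last by have [[/(Lp1 p1)]] := he l.
    have /rowP/(_ (Ordinal jk)) := hv; rewrite !mxE => H; rewrite -[RHS]H.
    by apply: eq_bigr => l _; rewrite !mxE.
have uA : A \in unitmx by rewrite -row_free_unit.
pose v := (\row_j fc f (j : 'I_k)) *m invmx A.
have vA : v *m A = \row_j fc f j by rewrite /v mulmxKV.
pose n := lincomb e (fun i => v 0 i).
have hn : Hp p n by apply: Hp_lincomb => // j; have [] := he j.
have hd : Hp p (fun x => f x - n x) by exact: HpB.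
exists (fun x => tpow (- k%:Z) x * (f x - n x)), c; split.
  apply: Hp_div => // j jk; rewrite (fcB _ (Lp1 p1 hf.1) (Lp1 p1 hn.1)) /n fc_lincomb => [|l].
    have /rowP/(_ (Ordinal jk)) := vA; rewrite !mxE /= => H; rewrite -H.
    by apply/eqP; rewrite subr_eq0; apply/eqP/eq_bigr => l _; rewrite !mxE.
  by have [[/(Lp1 p1)]] := he l.
apply/Tsol_tpow; have hn0 : Tsol p g n (fun=> 0).
  have := Tsol_lincomb (fun i => v 0 i) p1 (fun i => (he i).2).
  by apply: Tsol_ext; [exact: aeq_refl|apply: aeq_eq => x; rewrite /lincomb big1 // => l _; rewrite mulr0].
apply: Tsol_ext (TsolB p1 hT hn0); apply: aeq_eq => x; last by rewrite subr0.
by rewrite tpowN mulrA mulfV ?mul1r ?tpow_neq0.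
Qed.

(** * Polynomials and the range of a Toeplitz operator *)

Section PolyRange.
Variables (p : R) (g : R -> C) (m : nat) (q : 'I_m -> R -> C).
Hypotheses (p1 : 1 < p) (hg : inLinf g) (gq : Tcok p g q).

Let p1' : 1 <= p. Proof. exact: ltW. Qed.
Let p0 : 0 < p. Proof. exact: lt_trans ltr01 p1. Qed.

Let W N y := exists f (d : 'I_N -> C), Hp p f /\ Tsol p g f (fun x => y x - lincomb (@monom R N) d x).

Let W_ext N y y' : (forall x, y x = y' x) -> W N y -> W N y'.
Proof. by move=> e [f [d [hf hT]]]; exists f, d; split=> //; apply: Tsol_ext hT; [exact: aeq_refl|apply: aeq_eq => x; rewrite e]. Qed.
Let WD N y y' : W N y -> W N y' -> W N (fun x => y x + y' x).
Proof.
move=> [f [d [hf hT]]] [f' [d' [hf' hT']]]; exists (fun x => f x + f' x), (fun i => d i + d' i); split; first exact: HpD.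
apply: Tsol_ext (TsolD p1' hT hT'); first exact: aeq_refl.
apply: aeq_eq => x; rewrite /lincomb; under [in RHS]eq_bigr do rewrite mulrDl.
by rewrite big_split /= opprD addrACA.
Qed.
Let WZ N z y : W N y -> W N (fun x => z * y x).
Proof.
move=> [f [d [hf hT]]]; exists (fun x => z * f x), (fun i => z * d i); split; first exact: HpZ.
apply: Tsol_ext (TsolZ z p1' hT); first exact: aeq_refl.
apply: aeq_eq => x; rewrite /lincomb mulrBr big_distrr /=; congr (_ - _).
by apply: eq_bigr => i _; rewrite mulrA.
Qed.
Let W_T N f y : Hp p f -> Tsol p g f y -> W N y.
Proof.
move=> hf hT; exists f, (fun=> 0); split=> //; apply: Tsol_ext hT; first exact: aeq_refl.
by apply: aeq_eq => x; rewrite /lincomb big1 ?subr0 // => i _; rewrite mul0r.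
Qed.
Let W_sum N n (e : 'I_n -> R -> C) c : (forall i, c i = 0 \/ W N (e i)) -> W N (lincomb e c).
Proof.
move=> h; rewrite /lincomb; elim: (index_enum _) => [|i r IH].
  apply: W_ext (W_T N (Hp0 p0) (Tsol0 g p0)) => x; by rewrite big_nil.
apply: (@W_ext N (fun x => c i * e i x + \sum_(j <- r) c j * e j x)) => [x|]; first by rewrite big_cons.
case: (h i) => [->|hi]; last by apply: WD => //; exact: WZ.
by apply: W_ext IH => x; rewrite mul0r add0r.
Qed.

(** A polynomial of exact degree N < m in the range would express t^N by lower powers modulo the
    range, and then every polynomial would lie in [W N], the range plus the polynomials of degree
    below N. A functional killing the range and these N monomials would vanish on the dense set of
    polynomials, hence everywhere, although the codimension m exceeds N. *)
Lemma poly_range (c : 'I_m -> C) f : Hp p f -> Tsol p g f (lincomb (@monom R m) c) -> forall i, c i = 0.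
Proof.
move=> hf hT i0; apply/eqP; apply: contrapT => /negP ci0.
case: (@arg_maxnP _ i0 (fun i => c i != 0) (fun i => i : nat) ci0) => N cN maxN.
have c0 (i : 'I_m) : (N < i)%N -> c i = 0.
  by move=> Ni; apply/eqP; apply: contrapT => /negP h; have : (i <= N)%N := maxN i h; rewrite leqNgt Ni.
(* Multiplying the equation by t^(n-N) gives t^n as its leading term; all other terms, including the
   polynomial [gam] released from J H^p, have lower degree. *)
have Wt : forall n : nat, W N (tpow n).
  elim/ltn_ind => n IH; have [nN|nN] := ltnP n N.
    exists (fun=> 0), (fun j => (j == Ordinal nN)%:R); split; first exact: Hp0.
    apply: Tsol_ext (Tsol0 g p0); first exact: aeq_refl.
    apply: aeq_eq => x; rewrite /lincomb (bigD1 (Ordinal nN)) //= eqxx mul1r big1 ?addr0 ?subrr //.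
    by move=> j /negbTE ->; rewrite mul0r.
  set j := (n - N)%N; have [kk hk ek] := hT.
  have [k' hk' ek'] := tpowM_Jop j p1' hk.
  pose gam := fun i : 'I_j => fc (fun x => tpow j%:Z x * Jop kk x) i.
  have hTj : Tsol p g (fun x => tpow j x * f x) (fun x => lincomb (fun (i : 'I_m) => tpow (i + j)%N) c x + lincomb (@monom R j) gam x).
    exists k' => //; apply: ae_imp2 ek ek' => x _ e e'; rewrite mulrCA e mulrDr e' addrA; congr (_ + _ + _).
    by rewrite /lincomb big_distrr; apply: eq_bigr => i _; rewrite /= mulrCA /monom -tpowD addnC PoszD.
  pose e (i : 'I_m) : R -> C := tpow (i + j)%N.
  have H1 : W N (fun x => lincomb e c x + lincomb (@monom R j) gam x).
    by apply: W_T hTj; exact: Hp_Mtpow.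
  have H2 : W N (lincomb (@monom R j) (fun i => - gam i)).
    apply: W_sum => i; right; apply: IH; have := ltn_ord i; rewrite /j; lia.
  have H3 : W N (lincomb e (fun i => if i == N then 0 else - c i)).
    apply: W_sum => i; case: eqP => [_|/eqP iN]; first by left.
    have [h|h] := ltnP N i; first by left; rewrite c0 ?oppr0.
    have iN' : (i < N)%N by rewrite ltn_neqAle h andbT; apply: contra iN => /eqP/val_inj->.
    by right; apply: IH; rewrite /j; lia.
  apply: W_ext (WZ (c N)^-1 (WD H1 (WD H2 H3))) => x.
  have -> : lincomb (@monom R j) (fun i => - gam i) x = - lincomb (@monom R j) gam x.
    by rewrite /lincomb -sumrN; apply: eq_bigr => i _; rewrite mulNr.
  rewrite addrA addrK /lincomb -big_split /= (bigD1 N) //= eqxx mul0r addr0 big1 ?addr0.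
    by rewrite mulKf // /e subnKC.
  by move=> i /negbTE ->; rewrite mulNr subrr.
have Wtp s : (forall u, u \in s -> 0 <= u.2) -> W N (tp s).
  elim: s => [|u s IH] hs; first by apply: W_ext (W_T N (Hp0 p0) (Tsol0 g p0)) => x; rewrite tp_nil.
  apply: (@W_ext N (fun x => u.1 * tpow u.2 x + tp s x)) => [x|]; first by rewrite tp_cons.
  apply: WD; last by apply: IH => v vs; apply: hs; rewrite inE vs orbT.
  apply: WZ; have -> : u.2 = `|u.2|%N by rewrite gez0_abs // hs // mem_head.
  exact: Wt.
have [hq qfree qspan] := gq.
have co (j : 'I_N) : exists fc' : (R -> C) * ('I_m -> C), Hp p fc'.1 /\ Tsol p g fc'.1 (fun x => monom j x - lincomb q fc'.2 x).
  by have [f' [c' h]] := qspan _ (Hp_monom j p1'); exists (f', c').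
pose FF j := (sval (cid (co j))).1; pose CC j := (sval (cid (co j))).2.
have hFF j : Hp p (FF j) by rewrite /FF; case: cid => x [].
have hCC j : Tsol p g (FF j) (fun x => monom j x - lincomb q (CC j) x) by rewrite /FF /CC; case: cid => x [].
(* The functional is v applied to the coordinates modulo the range with respect to q; it is nonzero
   and kills N monomials because m > N. *)
have [v [v0 vB]] : exists v : 'rV[C]_m, v != 0 /\ v *m (\matrix_(l < m, j < N) CC j l) = 0.
  apply: contrapT => h.
  have : row_free (\matrix_(l < m, j < N) CC j l).
    by apply: row_free_ker => v hv; apply/eqP; apply: contrapT => /negP v0; apply: h; exists v.
  by rewrite /row_free => /eqP e; have := rank_leq_col (\matrix_(l < m, j < N) CC j l); rewrite e leqNgt ltn_ord.
have Wv y : W N y -> exists f' c', [/\ Hp p f', Tsol p g f' (fun x => y x - lincomb q c' x) & \sum_l v 0 l * c' l = 0].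
  move=> [f' [d [hf' hT']]]; exists (fun x => f' x + lincomb FF d x), (fun l => \sum_j d j * CC j l); split.
  - by apply: HpD => //; exact: Hp_lincomb.
  - apply: Tsol_ext (TsolD p1' hT' (Tsol_lincomb d p1' hCC)); first exact: aeq_refl.
    apply: aeq_eq => x; rewrite /lincomb; under [X in _ + X = _]eq_bigr do rewrite mulrBr.
    rewrite big_split /= sumrN addrA subrK; congr (_ - _).
    under [LHS]eq_bigr do rewrite big_distrr /=; rewrite exchange_big /=; apply: eq_bigr => l _.
    by rewrite big_distrl /=; apply: eq_bigr => j _; rewrite mulrA.
  - under eq_bigr do rewrite big_distrr /=; rewrite exchange_big /= big1 // => j _.
    have /rowP/(_ j) := vB; rewrite !mxE => H.
    transitivity (d j * 0); last by rewrite mulr0.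
    by rewrite -[X in _ = _ * X]H big_distrr /=; apply: eq_bigr => l _; rewrite mxE mulrCA.
have [|K K0 HK] := @Toeplitz_open R p g m q p1 hg (fun i => Hp_Lp (hq i)).
  move=> h hh; have [y [kk [hy hk e]]] := decomp p1 hh; have [f' [c' [hf' [k1 hk1 e1]]]] := qspan y hy.
  exists f', (fun x => k1 x - kk x), (lincomb (@monom R m) c'); split=> //; first exact: HpB.
    by apply: Hp_lincomb => // j; exact: Hp_monom.
  apply: ae_imp e1 => x _ e1; rewrite e1 e JopD JopN (_ : lincomb q _ x = lincomb q c' x); first by ring.
  by apply: eq_bigr => i _; rewrite fc_poly.
apply: (negP v0); apply/eqP/rowP => i; rewrite mxE.
pose cc := (2 * pi)^-1 * (2 * pi) `^ (1 - p^-1) : R.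
have cc0 : 0 <= cc by rewrite mulr_ge0 ?powR_ge0 // invr_ge0 ltW // pi2_gt0.
apply: (@cabs_le_eps _ _ (\sum_l cabs (v 0 l) * (cc * K))) => ep ep0.
have [s hs] := dense_Hp p1 (hq i) ep0; set h := fun x => _ in hs.
have hh : Lp p h by apply: LpB => //; [exact: Hp_Lp (hq i)|exact: Lp_tp].
have [f' [kk [u [hf' hk hu e [_ nu]]]]] := HK h hh.
have [f2 [c2 [hf2 hT2 vc2]]] : exists f' c', [/\ Hp p f', Tsol p g f' (fun x => tp (nngf s) x - lincomb q c' x) & \sum_l v 0 l * c' l = 0].
  by apply: Wv; apply: Wtp => w; rewrite mem_filter => /andP[].
have hT1 : Tsol p g f' (fun x => h x - lincomb q (fun l => fc u l) x).
  by exists kk => //; apply: ae_imp e => x _ ->; ring.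
(* Coordinates modulo the range are unique: those of q i, a Kronecker delta, are the sum of those of
   h, small with h by the open mapping theorem, and of those of the polynomial, which v
   annihilates. *)
have E l : (l == i)%:R - fc u l - c2 l = 0.
  apply: (qfree (fun x => f' x + f2 x) (fun l => (l == i)%:R - fc u l - c2 l)); first exact: HpD.
  apply: Tsol_ext (TsolD p1' hT1 hT2); first exact: aeq_refl.
  apply: aeq_eq => x; rewrite /h /lincomb.
  transitivity (q i x - \sum_(l < m) fc u l * q l x - \sum_(l < m) c2 l * q l x); first by ring.
  rewrite -!sumrN; under [in RHS]eq_bigr do rewrite !mulrBl.
  rewrite !big_split /= !sumrN; congr (_ - _ - _).
  rewrite (bigD1 i) //= eqxx mul1r big1 ?addr0 // => l' /negbTE ->; by rewrite mul0r.
have -> : v 0 i = \sum_l v 0 l * fc u l.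
  transitivity (\sum_l v 0 l * (fc u l + c2 l)).
    rewrite (bigD1 i) //= big1 ?addr0 => [|l li].
      by have := E i; rewrite eqxx -addrA -opprD => /eqP; rewrite subr_eq0 => /eqP <-; rewrite mulr1.
    by have := E l; rewrite (negbTE li) -addrA -opprD => /eqP; rewrite subr_eq0 => /eqP <-; rewrite mulr0.
  under eq_bigr do rewrite mulrDr; by rewrite big_split /= vc2 addr0.
apply: (le_trans (cabs_sum _ _ _)); rewrite big_distrr /=; apply: ler_sum => l _.
rewrite cabsM mulrCA ler_wpM2l ?cabs_ge0 // (le_trans (fc_le_nrm l p1' hu.1)) // mulrCA ler_wpM2l //.
by apply: (le_trans nu); rewrite mulrC ler_wpM2r // ltW.
Qed.

(** A solution of T(g t^-m) f = 0 gives T(g) f a polynomial of degree below m, hence 0. Conversely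
    the m monomials span a complement of the range, so t^m y equals T(g) f plus such a polynomial,
    and division by t^m moves that polynomial into J H^p. *)
Lemma shift_cok : Tinj p g -> Tbij p (fun x => g x * tpow (- m%:Z) x).
Proof.
move=> inj; have [hq qfree qspan] := gq.
split; last first.
  move=> f hf [k hk e].
  have [k' hk' e'] := tpowM_Jop m p1' hk.
  pose c := fun i : 'I_m => fc (fun x => tpow m%:Z x * Jop k x) i.
  have hT : Tsol p g f (lincomb (@monom R m) c).
    exists k' => //; apply: ae_imp2 e e' => x _ e <-.
    have : g x * tpow (- m%:Z) x * f x = Jop k x by rewrite e add0r.
    by move=> <-; have t0 := tpow_neq0 m%:Z x; rewrite tpowN; field.
  have c0 := poly_range hf hT; apply: inj => //; apply: Tsol_ext hT; first exact: aeq_refl.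
  by apply: aeq_eq => x; rewrite /lincomb big1 // => i _; rewrite c0 mul0r.
have co (j : 'I_m) : exists fc' : (R -> C) * ('I_m -> C), Hp p fc'.1 /\ Tsol p g fc'.1 (fun x => monom j x - lincomb q fc'.2 x).
  by have [f' [c' h]] := qspan _ (Hp_monom j p1'); exists (f', c').
pose FF j := (sval (cid (co j))).1; pose CC j := (sval (cid (co j))).2.
have hFF j : Hp p (FF j) by rewrite /FF; case: cid => x [].
have hCC j : Tsol p g (FF j) (fun x => monom j x - lincomb q (CC j) x) by rewrite /FF /CC; case: cid => x [].
have combE (v : 'rV[C]_m) x : lincomb (fun (j : 'I_m) x => monom j x - lincomb q (CC j) x) (fun j => v 0 j) x =
    lincomb (@monom R m) (fun j => v 0 j) x - lincomb q (fun l => (v *m (\matrix_(j < m, l < m) CC j l)) 0 l) x.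
  rewrite /lincomb; under eq_bigr do rewrite mulrBr.
  rewrite big_split /= sumrN; congr (_ - _); under [LHS]eq_bigr do rewrite big_distrr /=.
  rewrite exchange_big /=; apply: eq_bigr => l _; rewrite mxE big_distrl /=.
  by apply: eq_bigr => j _; rewrite mxE mulrA.
have rf : row_free (\matrix_(j < m, l < m) CC j l).
  apply: row_free_ker => v hv; apply/rowP => i; rewrite mxE.
  apply: (@poly_range (fun i => v 0 i) (lincomb FF (fun j => v 0 j))); first exact: Hp_lincomb.
  apply: Tsol_ext (Tsol_lincomb (fun j => v 0 j) p1' hCC); first exact: aeq_refl.
  apply: aeq_eq => x; rewrite combE hv /lincomb [X in _ - X]big1 ?subr0 // => l _; by rewrite mxE mul0r.
have uA : (\matrix_(j < m, l < m) CC j l) \in unitmx by rewrite -row_free_unit.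
move=> y hy; have hy' : Hp p (fun x => tpow m%:Z x * y x) by exact: Hp_Mtpow.
have [f [c [hf hT]]] := qspan _ hy'.
pose v := (\row_l c l) *m invmx (\matrix_(j < m, l < m) CC j l).
have vA : v *m (\matrix_(j < m, l < m) CC j l) = \row_l c l by rewrite /v mulmxKV.
have [k hk e] := TsolB p1' hT (Tsol_lincomb (fun j => v 0 j) p1' hCC).
exists (fun x => f x - lincomb FF (fun j => v 0 j) x); first by apply: HpB => //; exact: Hp_lincomb.
pose s := lincomb (@monom R m) (fun j => - v 0 j).
have hs : Lp p s by apply: Lp_lincomb => // j; exact: Lp_monom.
have hks : Lp p (fun x => tpow (- m%:Z) x * s x) by exact: Lp_Mtpow.
exists (fun x => Jop (fun x => tpow (- m%:Z) x * s x) x + tpow m%:Z x * k x).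
  apply: HpD => //; last exact: Hp_Mtpow.
  apply: Jop_of_neg => // n n0; rewrite fc_Mtpow fc_poly0 //; right; lia.
apply: ae_imp e => x _ e; rewrite JopD Jop_tpowM JopK.
rewrite [g x * _]mulrC -mulrA e combE vA.
have -> : lincomb q (fun l => (\row_l c l) 0 l) x = lincomb q c x by apply: eq_bigr => l _; rewrite mxE.
have -> : s x = - lincomb (@monom R m) (fun j => v 0 j) x by rewrite /s /lincomb -sumrN; apply: eq_bigr => l _; rewrite mulNr.
rewrite tpowN; have t0 := tpow_neq0 m%:Z x; by field.
Qed.

End PolyRange.

Lemma Tbij_of_index p g k (e : 'I_k -> R -> C) m (q : 'I_m -> R -> C) : 1 < p -> inLinf g ->
  Tker p g e -> Tcok p g q -> Tbij p (fun x => g x * tpow (k%:Z - m%:Z) x).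
Proof.
move=> p1 hg hk hm; have [inj hc] := shift_ker (ltW p1) hk hm.
have := shift_cok p1 (Linf_tpow k hg) hc inj.
by under eq_fun do rewrite -mulrA -tpowD.
Qed.

End IndexShift.

(** * Wiener-Hopf factorization *)
Section WienerHopf.
Variable R : realType.
Local Notation C := R[i].
Local Notation mu := (@lebesgue_measure R).
Local Notation TT := (@circ R).
Implicit Types (z w : C) (p q : R) (f g h y : R -> C) (s : seq (C * int)).
Local Opaque cabs cexp powR lebesgue_measure circ.

Lemma ci_fc0 f : ci f = (2 * pi)%:C%C * fc f 0.
Proof.
rewrite fc_def mulrA -rmorphM /= mulfV ?gt_eqF ?pi2_gt0 // mul1r.
by congr ci; apply/funext => x; rewrite oppr0 tpow0 mulr1.
Qed.

Lemma tilde_Jop f x : tilde (Jop f) x = tpow 1 x * f x.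
Proof. by rewrite -{2}(tildeK f) /tilde Jop_tpow tpow_reflect opprK. Qed.

Lemma Linf_bounded g : inLinf g -> exists g' (M : R), [/\ 0 <= M, cmeas g', aeq g g' & forall x, TT x -> cabs (g' x) <= M].
Proof.
move=> [mg [M0 hM0]]; pose M := `|M0|; pose A := TT `&` [set x | cabs (g x) <= M].
have mA : measurable A by exact: measurable_cabs_le.
pose F x := g x * (\1_A x)%:C%C.
have FE x : TT x -> F x = if cabs (g x) <= M then g x else 0.
  move=> cx; rewrite /F indicE; case: ifPn => h.
    by rewrite mem_set ?mulr1.
  by rewrite memNset ?mulr0 // => -[_]; rewrite /= (negbTE h).
exists F, M; split.
- exact: normr_ge0.
- by apply: cmeasM => //; apply: cmeas_real; apply: measurable_funTS; exact: measurable_indic.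
- by apply: ae_imp hM0 => x cx h; rewrite FE // (le_trans h) // ler_norm.
- by move=> x cx; rewrite FE //; case: ifPn => //; rewrite cabs0 normr_ge0.
Qed.

Definition nonneg s := forall u, u \in s -> 0 <= u.2.

Lemma nonneg_nngf s : nonneg (nngf s).
Proof. by move=> u; rewrite mem_filter => /andP[]. Qed.

Lemma Hp_tpM p s f : 1 <= p -> nonneg s -> Hp p f -> Hp p (fun x => tp s x * f x).
Proof.
move=> p1 hs [hf f0]; have p0 : 0 < p by lra.
split; first by have [] := LpM_bnd p0 (cmeas_tp s) (ae_forall (fun x _ => tp_bnd s x)) hf.
move=> n n0; rewrite (fc_tpM _ _ (Lp1 p1 hf)) big_seq big1 // => u us; rewrite f0 ?mulr0 //.
by rewrite subr_lt0 (lt_le_trans n0) // hs.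
Qed.
Lemma Hp_tp p s : 1 <= p -> nonneg s -> Hp p (tp s : R -> C).
Proof.
move=> p1 hs; have := Hp_tpM p1 hs (Hp_tpow 0 p1).
by rewrite (_ : (fun x => _) = tp s) //; apply/funext => x; rewrite tpow0 mulr1.
Qed.

Lemma Tsol_neg p g f y k : 1 <= p -> Hp p k -> Tsol p g f y -> Tsol p g f (fun x => y x + Jop k x).
Proof.
move=> p1 hk [k' hk' e]; exists (fun x => k' x - k x); first exact: HpB.
by apply: ae_imp e => x _ ->; rewrite JopD JopN; ring.
Qed.

Lemma Jop_negf p s : 1 <= p -> Hp p (Jop (tp (negf s))).
Proof.
move=> p1; apply: Jop_of_neg => //; first by apply: Lp_tp; lra.
move=> n n0; rewrite fc_tp big_seq big1 // => u; rewrite mem_filter => /andP[u0 _].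
case: eqP => [e|_]; last by rewrite mulr0.
by move: u0; rewrite e ltNge n0.
Qed.

Lemma Hp_Jop_tilde p f : 1 <= p -> Hp p f -> Hp p (Jop (fun x => tilde f x - fc f 0)).
Proof.
move=> p1 [hf f0]; have p0 : 0 < p by lra.
apply: Jop_of_neg => // [|n n0]; first by apply: LpB => //; [exact: Lp_tilde|exact: Lp_cst].
rewrite (fcB _ (Lp1 p1 (Lp_tilde hf)) (Lp_cst _ ltr01)) fc_tilde ?fc_cst; last exact: (Lp1 p1).
have [->|nn] := eqVneq n 0; first by rewrite oppr0 mulr1 subrr.
by rewrite mulr0 subr0 f0 // oppr_lt0 lt_neqAle eq_sym nn.
Qed.

(** * Factorization of a symbol with bijective Toeplitz operator *)

Section Factor.
Variables (p : R) (g : R -> C).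
Hypotheses (p1 : 1 < p) (hg : inLinf g) (gg : aeq (fun x => g x * tilde g x) (fun=> 1)) (bij : Tbij p g).

Let p1' : 1 <= p. Proof. exact: ltW. Qed.
Let p0 : 0 < p. Proof. exact: lt_trans ltr01 p1. Qed.

(** Let g phi = 1 + J k. Reflecting and multiplying by g, with g g~ = 1, gives g chi = phi~ for chi
    = 1 + t k, so T(g) chi is the constant sg = phi^(0) and chi = sg phi by injectivity. The means
    give sg sg = 1, the reflection gives 1 + J k = sg phi~. *)
Lemma symmetric_solution : exists sg phi, [/\ sg * sg = 1, Hp p phi, fc phi 0 = sg & aeq (fun x => g x * phi x) (fun x => sg * tilde phi x)].
Proof.
have [on inj] := bij.
have H1 := Hp_one p1'.
have [phi hphi [k hk e]] := on _ H1; have [hphi1 phi0] := hphi.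
pose sg := fc phi 0; pose chi := fun x => 1 + tpow 1 x * k x.
have hchi : Hp p chi by apply: HpD => //; exact: (Hp_Mtpow 1).
have e1 : aeq (fun x => g x * chi x) (tilde phi).
  have := aeq_tilde e; apply: ae_imp2 gg => x _ ggx.
  rewrite /tilde -/(tilde g x) -/(tilde phi x) -/(tilde (Jop k) x) tilde_Jop -/(chi x) => <-.
  by rewrite mulrA ggx mul1r.
have hT : Tsol p g chi (fun=> sg).
  exists (Jop (fun x => tilde phi x - sg)); first exact: Hp_Jop_tilde.
  by apply: ae_imp e1 => x _ ->; rewrite JopK addrC subrK.
have hT' : Tsol p g (fun x => sg * phi x) (fun=> sg).
  have := TsolZ sg p1' (ex_intro2 _ _ k hk e : Tsol p g phi (fun=> 1)).
  by apply: Tsol_ext; [exact: aeq_refl|apply: aeq_eq => x; rewrite mulr1].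
have E : aeq chi (fun x => sg * phi x).
  have : aeq (fun x => chi x - sg * phi x) (fun=> 0).
    apply: inj; first by apply: HpB => //; exact: HpZ.
    by apply: Tsol_ext (TsolB p1' hT hT'); [exact: aeq_refl|apply: aeq_eq => x; rewrite subrr].
  by apply: ae_imp => x _ /eqP; rewrite subr_eq0 => /eqP.
exists sg, phi; split=> //.
- have : fc chi 0 = 1.
    rewrite /chi (fcD _ (Lp_cst _ ltr01) (Lp1 p1' (Lp_Mtpow 1 p0 hk.1))) fc_cst fc_Mtpow.
    by have [_ ->] := hk; rewrite ?addr0 ?mulr1.
  have m2 : cmeas (fun x => sg * phi x) by apply: (@Hp_meas _ p); exact: HpZ.
  by rewrite (fc_ext 0 (Hp_meas hchi) m2 E) (fcZ _ _ (Lp1 p1' hphi1)).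
- apply: ae_imp2 e (aeq_tilde E) => x _ ->; rewrite /tilde -/(tilde phi x) => <-.
  by rewrite /chi tpow_reflect -[k (2 * pi - x)]/(tilde k x) Jop_tpow.
Qed.

Variables (sg : C) (phi : R -> C).
Hypotheses (sg2 : sg * sg = 1) (hphi : Hp p phi) (phi0 : fc phi 0 = sg)
  (gphi : aeq (fun x => g x * phi x) (fun x => sg * tilde phi x)).

Let cabs_sg : cabs sg = 1.
Proof.
have /eqP : cabs sg ^+ 2 = 1 by rewrite expr2 -cabsM sg2 cabs1.
by rewrite sqrf_eq1 => /orP[/eqP//|/eqP h]; have := cabs_ge0 sg; rewrite h; lra.
Qed.

Let S y := exists2 s, nonneg s & Tsol p g (fun x => phi x * tp s x) y.

Let SD y y' : S y -> S y' -> S (fun x => y x + y' x).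
Proof.
move=> [s hs h] [s' hs' h']; exists (s ++ s'); first by move=> u; rewrite mem_cat => /orP[/hs|/hs'].
apply: Tsol_ext (TsolD p1' h h'); last exact: aeq_refl.
by apply: aeq_eq => x; rewrite tp_cat mulrDr.
Qed.
Let SZ z y : S y -> S (fun x => z * y x).
Proof.
move=> [s hs h]; exists (tpZ z s); first by move=> u /mapP[v /hs ? ->].
apply: Tsol_ext (TsolZ z p1' h); last exact: aeq_refl.
by apply: aeq_eq => x; rewrite tpZE mulrCA.
Qed.
Let S_ext y y' : (forall x, y x = y' x) -> S y -> S y'.
Proof. by move=> e [s hs h]; exists s => //; apply: Tsol_ext h; [exact: aeq_refl|exact: aeq_eq]. Qed.
Let S0 : S (fun=> 0).
Proof.
exists [::] => //; apply: Tsol_ext (Tsol0 g p0); last exact: aeq_refl.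
by apply: aeq_eq => x; rewrite tp_nil mulr0.
Qed.

(** By g phi = sg phi~, and as sg phi~ has mean 1, T(g)(phi t^n) is t^n plus lower powers: a
    triangular system. *)
Lemma solve_poly s : nonneg s -> S (tp s).
Proof.
have [hphi1 phineg] := hphi.
have St : forall n : nat, S (tpow n).
  elim/ltn_ind => n IH.
  pose k0 := Jop (fun x => tilde phi x - sg).
  have hk0 : Hp p k0 by rewrite /k0 -phi0; exact: Hp_Jop_tilde.
  have [k' hk' e'] := tpowM_Jop n p1' hk0.
  pose gam := fun i : 'I_n => fc (fun x => tpow n%:Z x * Jop k0 x) i.
  have H1 : S (fun x => tpow n x + sg * lincomb (@monom R n) gam x).
    exists [:: (1, n%:Z)]; first by move=> u; rewrite inE => /eqP ->.
    exists (fun x => sg * k' x); first exact: HpZ.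
    apply: ae_imp2 gphi e' => x _ e1 e2; rewrite /tp big_seq1 /= mul1r mulrA e1.
    have e3 : tpow n x * (tilde phi x - sg) = lincomb (@monom R n) gam x + Jop k' x.
      by rewrite -[tilde phi x - sg]/((fun x => tilde phi x - sg) x) -(JopK (fun x => tilde phi x - sg)).
    transitivity (sg * sg * tpow n x + sg * (tpow n x * (tilde phi x - sg))); first by ring.
    by rewrite e3 sg2 mul1r JopZ; ring.
  have H2 : S (lincomb (@monom R n) gam).
    rewrite /lincomb; elim: (index_enum _) => [|i r IHr].
      by apply: S_ext S0 => x; rewrite big_nil.
    apply: (@S_ext (fun x => gam i * tpow i x + \sum_(j <- r) gam j * monom j x)) => [x|]; first by rewrite big_cons.
    by apply: SD => //; apply: SZ; apply: IH; exact: ltn_ord.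
  by apply: S_ext (SD H1 (SZ (- sg) H2)) => x; rewrite mulNr addrK.
elim: s => [|u s IH] hs; first by apply: S_ext S0 => x; rewrite tp_nil.
apply: (@S_ext (fun x => u.1 * tpow u.2 x + tp s x)) => [x|]; first by rewrite tp_cons.
apply: SD; last by apply: IH => v vs; apply: hs; rewrite inE vs orbT.
apply: SZ; have -> : u.2 = `|u.2|%N by rewrite gez0_abs // hs // mem_head.
exact: St.
Qed.

Let tilde_phi_neg s : Hp p (Jop (fun x => tilde phi x * tp (negf s) x)).
Proof.
have [hphi1 phineg] := hphi.
have h : Lp p (fun x => tp (negf s) x * tilde phi x).
  by have [] := LpM_bnd p0 (cmeas_tp (negf s)) (ae_forall (fun x _ => tp_bnd _ x)) (Lp_tilde hphi1).
rewrite (_ : (fun x => tilde phi x * _) = (fun x => tp (negf s) x * tilde phi x)); last by apply/funext => x; rewrite mulrC.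
apply: Jop_of_neg => // n n0; rewrite fc_tpM; last by apply: (Lp1 p1'); exact: Lp_tilde.
rewrite big_seq big1 // => u; rewrite mem_filter => /andP[u0 _].
rewrite fc_tilde ?phineg ?mulr0 //; last exact: (Lp1 p1').
by rewrite oppr_lt0 subr_gt0 (lt_le_trans u0).
Qed.

(* With w the analytic part of s h~, the function phi w solves T(g)(phi w) = P(psi h~), and its mean is that of s h~
   up to the sign. *)
Lemma pairing_poly : exists2 K, 0 <= K & forall (M : R) s psi (h : seq (C * int)), 0 <= M -> nonneg s -> nonneg h ->
  (forall x, cabs (tp psi x : C) <= M) -> Tsol p g (fun x => phi x * tp s x) (tp psi) ->
  cabs (ci (fun x => tp s x * tilde (tp h) x)) <= K * M * nrm p (tp h : R -> C).
Proof.
have [K K0 HK] := Tbij_bnd p1 hg bij; have [hphi1 phineg] := hphi.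
pose cc := (2 * pi)^-1 * (2 * pi) `^ (1 - p^-1) : R.
have cc0 : 0 <= cc by rewrite mulr_ge0 ?powR_ge0 // invr_ge0 ltW // pi2_gt0.
exists (2 * pi * (cc * K)); first by apply: mulr_ge0; [exact: ltW (pi2_gt0 R)|exact: mulr_ge0].
move=> M s psi h M0 hs hh hM [k hk e].
pose t := tpM s (tpJ h); have tE x : tp t x = tp s x * tilde (tp h) x by rewrite tpME tpJE.
pose f x := phi x * tp (nngf t) x.
have fE : f = (fun x => tp (nngf t) x * phi x) by apply/funext => x; rewrite /f mulrC.
have hf : Hp p f by rewrite fE; apply: Hp_tpM => //; exact: nonneg_nngf.
have bpsi : Lp p (fun x => tp psi x * tilde (tp h) x) /\ nrm p (fun x => tp psi x * tilde (tp h) x) <= `|M| * nrm p (tilde (tp h)).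
  by apply: LpM_bnd => //; [exact: cmeas_tp|exact: ae_forall|apply: Lp_tilde; exact: Lp_tp].
have hT : Tsol p g f (fun x => tp psi x * tilde (tp h) x).
  exists (fun x => tp h x * k x - sg * Jop (fun x => tilde phi x * tp (negf t) x) x).
    by apply: HpB => //; [exact: Hp_tpM|apply: HpZ].
  apply: ae_imp2 e gphi => x _ e1 e2.
  rewrite JopD JopN JopZ JopK JopM /f mulrA e2.
  have -> : tp (nngf t) x = tp s x * tilde (tp h) x - tp (negf t) x by rewrite -tE (tp_split t) addrK.
  transitivity ((sg * tilde phi x * tp s x) * tilde (tp h) x - sg * tilde phi x * tp (negf t) x); first by ring.
  have e3 : sg * tilde phi x * tp s x = tp psi x + Jop k x by rewrite -e2 -mulrA.
  by rewrite e3; ring.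
have nf := HK _ f bpsi.1 hf hT.
have f0 : fc f 0 = sg * fc (tp t) 0.
  rewrite fE (fc_tpM _ _ (Lp1 p1' hphi1)) (fc_tp t) mulr_sumr /nngf big_filter big_mkcond /=.
  apply: eq_bigr => u _; case: ifPn => u0.
    rewrite sub0r; have [->|nn] := eqVneq u.2 0; first by rewrite oppr0 phi0 mulr1 mulrC.
    by rewrite phineg ?mulr0 // oppr_lt0 lt_neqAle eq_sym nn.
  by rewrite (_ : (u.2 == 0) = false) ?mulr0 //; apply/negbTE; apply: contra u0 => /eqP ->.
rewrite (_ : (fun x => _) = tp t); last by apply/funext => x; rewrite tE.
rewrite ci_fc0 cabsM cabs_real gtr0_norm ?pi2_gt0 //.
set N := nrm p (tp h); have -> : 2 * pi * (cc * K) * M * N = 2 * pi * (cc * (K * (M * N))) by ring.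
rewrite ler_wpM2l ?(ltW (pi2_gt0 R)) //.
have -> : cabs (fc (tp t) 0 : C) = cabs (fc f 0) by rewrite f0 cabsM cabs_sg mul1r.
apply: (le_trans (fc_le_nrm 0 p1' hf.1)); rewrite ler_wpM2l //.
apply: (le_trans nf); rewrite ler_wpM2l //.
by apply: (le_trans bpsi.2); rewrite ger0_norm // nrm_tilde //; exact: cmeas_tp.
Qed.

Let q := conj_exp p.
Let q1 : 1 < q. Proof. by have [] := conj_expP p1. Qed.
Let qK : conj_exp q = p. Proof. by have [] := conj_expP p1. Qed.
Let pq : p^-1 + q^-1 = 1. Proof. by have [] := conj_expP p1. Qed.
Let q0 : 0 < q. Proof. exact: lt_trans ltr01 q1. Qed.
Let q1' : 1 <= q. Proof. exact: ltW. Qed.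

(** Duality with L^p: the part J k of the reflected test function pairs to 0 with s, and its
    analytic part is approximated by polynomials, where [pairing_poly] applies. The bound depends on
    s only through the sup norm of psi. *)
Lemma quotient_bounded : exists2 K, 0 <= K & forall (M : R) s psi, 0 <= M -> nonneg s ->
  (forall x, cabs (tp psi x : C) <= M) -> Tsol p g (fun x => phi x * tp s x) (tp psi) ->
  nrm q (tp s : R -> C) <= K * M.
Proof.
have [K K0 HK] := pairing_poly; have [L L0 HL] := rieszP_Lp p1.
exists (K * L); first exact: mulr_ge0.
move=> M s psi M0 hs hM hT; apply: dual_norm => //.
- by rewrite !mulr_ge0.
- exact: Lp_tp.
move=> chi mchi; rewrite qK => hchi.
have [h [hh hk nh]] := HL _ (Lp_tilde hchi); set k := Jop _ in hk.
have hsq : Lp q (tilde (tp s) : R -> C) by apply: Lp_tilde; exact: Lp_tp.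
have hM' u : Lp p u -> Lp 1 (fun x => u x * tilde (tp s) x) /\ nrm 1 (fun x => u x * tilde (tp s) x) <= nrm p u * nrm q (tilde (tp s) : R -> C).
  by move=> hu; exact: hoelder_Lp.
have E : ci (fun x => tp s x * chi x) = ci (fun x => h x * tilde (tp s) x).
  have hsc : Lp 1 (fun x => tp s x * chi x).
    by have [] := LpM_bnd ltr01 (cmeas_tp s) (ae_forall (fun x _ => tp_bnd s x)) (Lp1 p1' hchi).
  rewrite -(ci_tilde hsc).
  have hsk : Hp 1 (fun x => tp s x * k x) by apply: Hp_tpM => //; exact: (Hp1 p1').
  have -> : tilde (fun x => tp s x * chi x) = (fun x => h x * tilde (tp s) x + Jop (fun x => tp s x * k x) x).
    apply/funext => x; rewrite JopM /k JopK -[LHS]/(tilde (tp s) x * tilde chi x); ring.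
  rewrite ciD; [|exact: (hM' _ hh.1).1|by apply: Lp_Jop; exact: hsk.1].
  by rewrite [X in _ + X = _]ci_fc0 fc_Jop_Hp // mulr0 addr0.
rewrite E -mulrA -mulrA; apply: (@le_trans _ _ (K * (M * nrm p h))); last first.
  by rewrite ler_wpM2l // (mulrC L) -mulrA ler_wpM2l // (le_trans nh) // nrm_tilde.
apply/ler_addgt0Pr => ep ep0.
pose D := nrm q (tilde (tp s) : R -> C) + K * M + 1.
have D0 : 0 < D by rewrite ltr_wpDl // addr_ge0 ?nrm_ge0 // mulr_ge0.
have [v hv] := dense_Hp p1 hh (divr_gt0 ep0 D0); set w := nngf v in hv.
have hw : Lp p (tp w : R -> C) by exact: Lp_tp.
have hd : Lp p (fun x => h x - tp w x) by apply: LpB => //; exact: hh.1.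
have -> : (fun x => h x * tilde (tp s) x) = (fun x => (h x - tp w x) * tilde (tp s) x + tp w x * tilde (tp s) x).
  by apply/funext => x; ring.
rewrite ciD; [|exact: (hM' _ hd).1|exact: (hM' _ hw).1].
apply: (le_trans (cabsD _ _)).
have h1 : cabs (ci (fun x => (h x - tp w x) * tilde (tp s) x)) <= nrm p (fun x => h x - tp w x) * nrm q (tilde (tp s) : R -> C).
  exact: le_trans (cabs_ci_le (hM' _ hd).1) (hM' _ hd).2.
have h2 : cabs (ci (fun x => tp w x * tilde (tp s) x)) <= K * M * nrm p (tp w : R -> C).
  have -> : (fun x => tp w x * tilde (tp s) x) = tilde (fun x => tp s x * tilde (tp w) x).
    by apply/funext => x; rewrite -{1}(tildeK (tp w)) /tilde mulrC.
  rewrite ci_tilde; last first.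
    rewrite (_ : (fun x => tp s x * _) = tilde (fun x => tp w x * tilde (tp s) x)); first by apply: Lp_tilde; exact: (hM' _ hw).1.
    by apply/funext => x; rewrite -{1}(tildeK (tp s)) /tilde mulrC.
  by apply: HK hT => //; exact: nonneg_nngf.
have h3 : nrm p (tp w : R -> C) <= nrm p h + nrm p (fun x => h x - tp w x).
  have Ew : tp w = (fun x => h x - (h x - tp w x)) by apply/funext => x; ring.
  by apply: (le_trans _ (nrmB p1' hh.1 hd)); rewrite -Ew.
apply: (le_trans (lerD h1 (le_trans h2 (ler_wpM2l (mulr_ge0 K0 M0) h3)))).
rewrite mulrDr -mulrA addrCA lerD // -mulrA; move: hv; rewrite ltr_pdivlMr // => hv.
apply: le_trans (ltW hv); rewrite /D; set a := nrm p _; have a0 : 0 <= a by exact: nrm_ge0.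
by rewrite !mulrDr mulr1 [K * (M * a)]mulrA (mulrC (K * M)) lerDl.
Qed.

(** Bounded polynomials psi tending to g give polynomials s with T(g)(phi s) = P psi. Since T(g) 1 =
    P g, the products phi s tend to 1 in L^p, and almost everywhere by the geometric rate. The
    uniform L^q bound on s passes to the limit 1/phi by Fatou. *)
Lemma inverse_factor : Hp q (fun x => (phi x)^-1) /\ {ae mu, forall x, TT x -> phi x != 0}.
Proof.
have [g' [M [M0 mg' gg' hM]]] := Linf_bounded hg.
have [K K0 HK] := Tbij_bnd p1 hg bij.
have [B B0 HB] := quotient_bounded.
have hg'L : Lp p g' by exact: Lp_bndT hM.
have hphi1 := hphi.1.
have ex (n : nat) : exists s, [/\ nonneg s, nrm q (tp s : R -> C) <= B * (2 * M) &
    nrm p (fun x => phi x * tp s x - 1) <= K / 2 ^+ n].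
  have e0 : 0 < 1 / 2 ^+ n :> R by rewrite divr_gt0 // exprn_gt0.
  have [psi [psiM hpsi]] := dense_bnd p1' mg' hM e0.
  have [s hs hT] := solve_poly (nonneg_nngf (s := psi)).
  have hT' : Tsol p g (fun x => phi x * tp s x) (tp psi).
    apply: Tsol_ext (Tsol_neg p1' (Jop_negf psi p1') hT); first exact: aeq_refl.
    by apply: aeq_eq => x; rewrite JopK -tp_split.
  exists s; split=> //; first by apply: HB hT' => //; exact: mulr_ge0.
  have hps : Hp p (fun x => phi x * tp s x).
    rewrite (_ : (fun x => _) = (fun x => tp s x * phi x)); last by apply/funext => x; rewrite mulrC.
    exact: Hp_tpM.
  have H1 := Hp_one p1'.
  have hT1 : Tsol p g (fun=> 1) g'.
    exists (fun=> 0); first exact: Hp0.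
    by apply: ae_imp gg' => x _ ->; rewrite mulr1 Jop0 addr0.
  have hd : Lp p (fun x => tp psi x - g' x) by apply: LpB => //; exact: Lp_tp.
  apply: (le_trans (HK _ _ hd (HpB p1' hps H1) (TsolB p1' hT' hT1))); rewrite ler_wpM2l //.
  rewrite -nrmN (_ : (fun x => _) = (fun x => g' x - tp psi x)); last by apply/funext => x; rewrite opprB.
  by rewrite ltW // -(mul1r (2 ^+ n)^-1).
pose s n := sval (cid (ex n)).
have s_nn n : nonneg (s n) by rewrite /s; case: cid => x [].
have s_q n : nrm q (tp (s n) : R -> C) <= B * (2 * M) by rewrite /s; case: cid => x [].
have s_p n : nrm p (fun x => phi x * tp (s n) x - 1) <= K / 2 ^+ n by rewrite /s; case: cid => x [].
have hps n : Lp p (fun x => phi x * tp (s n) x).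
  rewrite (_ : (fun x => _) = (fun x => tp (s n) x * phi x)); last by apply/funext => x; rewrite mulrC.
  exact: (Hp_tpM p1' (s_nn n) hphi).1.
have L1p : Lp p (fun=> 1 : C) by exact: Lp_cst.
have cv : aecvg (fun n x => phi x * tp (s n) x) (fun=> 1).
  apply: (@aecvg_fast _ _ _ ((2 * pi) `^ (1 - p^-1) * K)) => [n||n].
  - exact: (Lp1 p1').
  - exact: Lp_cst.
  - by apply: (le_trans (Lp_inL1 p1' (LpB p1' (hps n) L1p)).2); rewrite -mulrA ler_wpM2l ?powR_ge0.
(* At a zero of phi the distance of phi s to 1 would be constantly 1. *)
have nz : {ae mu, forall x, TT x -> phi x != 0}.
  apply: ae_imp cv => x _ h; apply/eqP => px.
  have : (fun n : nat => cabs (phi x * tp (s n) x - 1)) = (fun=> 1) by apply/funext => n; rewrite px mul0r sub0r cabsN cabs1.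
  move=> E; rewrite E in h; have h1 : (fun=> 1 : R) @ (\oo : set_system nat) --> (1 : R) by exact: cvg_cst.
  have e10 : (0 : R) = 1 by apply: (cvg_unique _ h h1); exact: norm_hausdorff.
  by have := oner_neq0 R; rewrite -e10 eqxx.
have cv' : aecvg (fun n => tp (s n)) (fun x => (phi x)^-1).
  apply: ae_imp2 cv nz => x _ h nx.
  have -> : (fun n : nat => cabs (tp (s n) x - (phi x)^-1)) = (fun n : nat => cabs (phi x)^-1 * cabs (phi x * tp (s n) x - 1)).
    by apply/funext => n; rewrite -cabsM mulrBr mulKf // mulr1.
  by rewrite -(mulr0 (cabs (phi x)^-1)); apply: cvgMr.
have mphi : cmeas (fun x => (phi x)^-1) by apply: cmeasV; exact: Lp_meas hphi1.
have [he _] : Lp q (fun x => (phi x)^-1) /\ nrm q (fun x => (phi x)^-1) <= B * (2 * M).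
  by apply: (@fatou_Lp _ q _ _ _ q0 _ _ s_q mphi cv'); [rewrite !mulr_ge0|move=> n; exact: Lp_tp].
split=> //; split=> // n n0.
have hs1 k : Lp 1 (tp (s k) : R -> C) by exact: Lp_tp.
apply: (@fc_lim _ 1 (fun k : nat => tp (s k)) _ (nrm q (fun x => (phi x)^-1) * K) 0 n (lexx 1) hs1 (Lp1 q1' he)) => k; last first.
  by have [_ ->] := Hp_tp (lexx 1) (s_nn k).
(* s - 1/phi is 1/phi times phi s - 1, hence tends to 0 in L^1; this carries the vanishing of
   negative coefficients over to 1/phi. *)
have [a1 a2] := hoelder_Lp q0 p0 (etrans (addrC _ _) pq) he (LpB p1' (hps k) L1p).
rewrite -nrmN (nrm_ext ltr01 _ _ (g := fun x => (phi x)^-1 * (phi x * tp (s k) x - 1))).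
- by apply: (le_trans a2); rewrite -mulrA ler_wpM2l ?nrm_ge0.
- by apply: cmeasN; apply: cmeasB => //; exact: cmeas_tp.
- exact: Lp_meas a1.
- by apply: ae_imp nz => x _ nx; rewrite opprB mulrBr mulKf // mulr1.
Qed.

End Factor.

End WienerHopf.

(** * The Riesz projection and the signature *)
Section Projection.
Variable R : realType.
Local Notation C := R[i].
Local Notation mu := (@lebesgue_measure R).
Local Notation TT := (@circ R).
Implicit Types (z w : C) (p q : R) (f g h y a b : R -> C).
Local Opaque cabs cexp powR lebesgue_measure circ.

(** [rieszP] chooses a function by its Fourier coefficients; these determine it almost everywhere,
    so any decomposition y + J k computes it. *)
Lemma rieszP_eq h y k : Lp 1 h -> Hp 1 y -> Hp 1 k -> aeq h (fun x => y x + Jop k x) ->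
  Lp 1 (rieszP h) /\ aeq (rieszP h) y.
Proof.
move=> hh hy hk e; have [hy1 y0] := hy; have [hk1 _] := hk.
have hyh n : 0 <= n -> fc y n = fc h n.
  move=> n0; rewrite (fc_ext n (Lp_meas hh) (Lp_meas (LpD (lexx 1) hy1 (Lp_Jop hk1))) e).
  by rewrite (fcD _ hy1 (Lp_Jop hk1)) fc_Jop_Hp // addr0.
have := @epsilon_spec _ (inhabits (fun _ => 0 : C)) (fun g => inLp 1 g /\ (forall n : int, n < 0 -> fhat g n = 0) /\
              (forall n : int, 0 <= n -> fhat (fun x => h x - g x) n = 0)).
rewrite -/(rieszP h); case.
  exists y; split; first by rewrite -LpE.
  split=> n n0; first by rewrite -fcE y0.
  by rewrite -fcE (fcB _ hh hy1) hyh ?subrr.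
rewrite -LpE => hr [r0 rh]; split=> //; apply: fc_uniq => // n.
have [n0|n0] := ltP n 0; first by rewrite y0 // fcE r0.
by have := rh n n0; rewrite -fcE (fcB _ hh hr) hyh // => /eqP; rewrite subr_eq0 => /eqP.
Qed.

Lemma Top_Tsol p g f : 1 < p -> inLinf g -> Hp p f -> exists y, [/\ Hp p y, Tsol p g f y & aeq (Top g f) y].
Proof.
move=> p1 hg [hf _]; have p0 : 0 < p by lra.
have [M _ HM] := Linf_mul hg; have [hgf _] := HM _ _ p0 hf.
have [y [k [hy hk e]]] := decomp p1 hgf.
exists y; split=> //; first by exists k => //; exact: aeq_eq.
have p1' := ltW p1.
by have [] := rieszP_eq (Lp1 p1' hgf) (Hp1 p1' hy) (Hp1 p1' hk) (aeq_eq e).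
Qed.

Lemma Tsol_uniq p g f y y' : 1 <= p -> Hp p y -> Hp p y' -> Tsol p g f y -> Tsol p g f y' -> aeq y y'.
Proof.
move=> p1 hy hy' [k hk e] [k' hk' e'].
have : aeq (fun x => y x - y' x) (fun=> 0).
  apply: (@Hp_Jop_eq0 _ _ (fun x => k' x - k x)); [exact: (Hp1 p1 (HpB p1 hy hy'))|exact: (Hp1 p1 (HpB p1 hk' hk))|].
  apply: ae_imp2 e e' => x _ -> e; rewrite JopD JopN; have -> : y x = (y x + Jop k x) - Jop k x by rewrite addrK.
  by rewrite e; ring.
by apply: ae_imp => x _ /eqP; rewrite subr_eq0 => /eqP.
Qed.

Lemma Top_iff p g f y : 1 < p -> inLinf g -> Hp p f -> Hp p y -> aeq (Top g f) y <-> Tsol p g f y.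
Proof.
move=> p1 hg hf hy; have [y' [hy' hT e]] := Top_Tsol p1 hg hf; split=> [e'|hT'].
  by apply: Tsol_ext hT; [exact: aeq_refl|exact: aeq_trans (aeq_sym e) e'].
exact: aeq_trans e (Tsol_uniq (ltW p1) hy' hy hT hT').
Qed.

Lemma lincombN n (e : 'I_n -> R -> C) c x : lincomb e (fun i => - c i) x = - lincomb e c x.
Proof. by rewrite /lincomb -sumrN; apply: eq_bigr => i _; rewrite mulNr. Qed.

Lemma fredholm_Tbij p g kappa : 1 < p -> inLinf g -> fredholm p (Top g) kappa -> Tbij p (fun x => g x * tpow kappa x).
Proof.
move=> p1 hg [_ [k [m [[e [he [efree espan]]] [[q [hq [qfree qspan]]] ->]]]]]; have p0 : 0 < p by lra.
have p1' := ltW p1.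
apply: (@Tbij_of_index _ p g k e m q p1 hg).
- split=> //.
    by move=> i; have [/HpP h1 h2] := he i; split=> //; apply/(Top_iff p1 hg h1 (Hp0 p0)).
  by move=> f hf hT; apply: espan; [exact/HpP|apply/(Top_iff p1 hg hf (Hp0 p0))].
- split; first by move=> i; apply/HpP.
    move=> f c hf hT i; apply: oppr_inj; rewrite oppr0.
    have hqc : Hp p (lincomb q c) by apply: Hp_lincomb => // j; exact/HpP.
    apply: (qfree f (fun i => - c i)); first exact/HpP.
    by apply: ae_imp ((Top_iff p1 hg hf hqc).2 hT) => x _ ->; rewrite lincombN subrr.
  move=> h /HpP hh; have [f [c [hf hT]]] := qspan h hh; exists f, c; split; first exact/HpP.
  have hqc : Hp p (lincomb q c) by apply: Hp_lincomb => // j; exact/HpP.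
  apply/(Top_iff p1 hg).
  - exact/HpP.
  - by apply: HpB => //; exact/HpP.
  - by apply: ae_imp hT => x _ ->; rewrite addrK.
Qed.

(* [THsol p a b f y] encodes (T(a) + H(b)) f = y. *)
Definition THsol p a b f y := exists2 k, Hp p k & aeq (fun x => a x * f x + b x * Jop f x) (fun x => y x + Jop k x).

Lemma THop_THsol p a b f : 1 < p -> inLinf a -> inLinf b -> Hp p f ->
  exists y, [/\ Hp p y, THsol p a b f y & aeq (THop a b f) y].
Proof.
move=> p1 ha hb hf; have p0 : 0 < p by lra.
have p1' := ltW p1; have [hf1 _] := hf.
have [y1 [hy1 [k1 hk1 e1] E1]] := Top_Tsol p1 ha hf.
have hJ := Lp_Jop hf1.
have [M _ HM] := Linf_mul hb; have [hbJ _] := HM _ _ p0 hJ.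
have [y2 [k2 [hy2 hk2 e2]]] := decomp p1 hbJ.
(* The analytic part of J f is 0, so Q J f = J f and H(b) f = P(b J f). *)
have [hr r0] : Lp 1 (rieszP (Jop f)) /\ aeq (rieszP (Jop f)) (fun=> 0).
  apply: (@rieszP_eq _ _ f); [exact: (Lp1 p1')|exact: Hp0|exact: (Hp1 p1')|].
  by apply: aeq_eq => x; rewrite add0r.
have hQ : Lp 1 (Qop (Jop f)) by apply: LpB => //; exact: (Lp1 p1').
have EQ : aeq (Qop (Jop f)) (Jop f) by apply: ae_imp r0 => x _; rewrite /Qop => ->; rewrite subr0.
have [hbQ _] := HM _ _ ltr01 hQ.
have [_ E2] : Lp 1 (Hop b f) /\ aeq (Hop b f) y2.
  apply: (@rieszP_eq _ _ k2 hbQ (Hp1 p1' hy2) (Hp1 p1' hk2)).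
  by apply: ae_imp EQ => x _ ->; exact: e2.
exists (fun x => y1 x + y2 x); split; first exact: HpD.
  exists (fun x => k1 x + k2 x); first exact: HpD.
  by apply: ae_imp e1 => x _ ->; rewrite e2 JopD addrACA.
exact: aeqD.
Qed.

Lemma THsol_uniq p a b f y y' : 1 <= p -> Hp p y -> Hp p y' -> THsol p a b f y -> THsol p a b f y' -> aeq y y'.
Proof.
move=> p1 hy hy' [k hk e] [k' hk' e'].
apply: (@Tsol_uniq p (fun=> 1) (fun x => a x * f x + b x * Jop f x) y y' p1 hy hy').
  by exists k => //; apply: ae_imp e => x _ <-; rewrite mul1r.
by exists k' => //; apply: ae_imp e' => x _ <-; rewrite mul1r.
Qed.

Lemma THop_iff p a b f y : 1 < p -> inLinf a -> inLinf b -> Hp p f -> Hp p y ->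
  aeq (THop a b f) y <-> THsol p a b f y.
Proof.
move=> p1 ha hb hf hy; have [y' [hy' hT e]] := THop_THsol p1 ha hb hf; split=> [e'|hT'].
  case: hT => k hk h; exists k => //; apply: aeq_trans h _.
  by apply: aeqD; [exact: aeq_trans (aeq_sym e) e'|exact: aeq_refl].
exact: aeq_trans e (THsol_uniq (ltW p1) hy' hy hT hT').
Qed.

Lemma invertible_THsol p a b : 1 < p -> inLinf a -> inLinf b -> invertible_Hp p (THop a b) ->
  (forall y, Hp p y -> exists2 f, Hp p f & THsol p a b f y) /\
  (forall f, Hp p f -> THsol p a b f (fun=> 0) -> aeq f (fun=> 0)).
Proof.
move=> p1 ha hb [on inj]; have p0 : 0 < p by lra.
split=> [y hy|f hf hT].
  have [f /HpP hf e] := on y ((HpP _ _).1 hy); exists f => //; exact/(THop_iff p1 ha hb).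
apply: inj; first exact/HpP.
by apply/(THop_iff p1 ha hb hf (Hp0 p0)).
Qed.

(* The Wiener-Hopf factorization g = sg t^-n phi~ / phi, with g_+ = 1 / phi and g_- = sg phi~. *)
Definition WH p g (n : int) (sg : C) (phi : R -> C) :=
  [/\ sg * sg = 1, Hp p phi, fc phi 0 = sg & Hp (conj_exp p) (fun x => (phi x)^-1)] /\
  [/\ {ae mu, forall x, TT x -> phi x != 0},
      aeq g (fun x => sg * tpow (- n) x * tilde phi x * (phi x)^-1) &
      Tbij p (fun x => g x * tpow n x)].

(** t^n times its reflection is 1, so g t^n inherits g g~ = 1 and the results for a bijective T(g
    t^n) apply. *)
Lemma WH_exists p g n : 1 < p -> inLinf g -> aeq (fun x => g x * tilde g x) (fun=> 1) ->
  Tbij p (fun x => g x * tpow n x) -> exists sg phi, WH p g n sg phi.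
Proof.
move=> p1 hg gg bij; have hg0 := Linf_tpow n hg.
have gg0 : aeq (fun x => (g x * tpow n x) * tilde (fun x => g x * tpow n x) x) (fun=> 1).
  apply: ae_imp gg => x _ e; rewrite /tilde tpow_reflect tpowN -/(tilde g x).
  have t0 := tpow_neq0 n x; rewrite -[RHS]e; by field.
have [sg [phi [sg2 hphi phi0 e]]] := symmetric_solution p1 gg0 bij.
have [he nz] := inverse_factor p1 hg0 bij sg2 hphi phi0 e.
exists sg, phi; split; first by split.
split=> //; apply: ae_imp2 e nz => x _ e nx.
apply: (mulIf (tpow_neq0 n x)); apply: (mulIf nx); rewrite e tpowN.
by have t0 := tpow_neq0 n x; field; apply/andP.
Qed.

Lemma WH_shift p g n sg phi j : WH p g n sg phi -> WH p (fun x => g x * tpow (- j) x) (n + j) sg phi.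
Proof.
move=> [h [nz e bij]]; split=> //; split=> //.
  by apply: ae_imp e => x _ ->; rewrite opprD tpowD; ring.
rewrite (_ : (fun x => _) = (fun x => g x * tpow n x)) //.
by apply/funext => x; rewrite -mulrA -tpowD addrCA addNr addr0.
Qed.

Lemma not_ae_false : ~ {ae mu, forall x, TT x -> False}.
Proof.
move=> h; have : aeq (fun=> 1 : C) (fun=> 0) by apply: ae_imp h.
move=> e; have := fc_ext 0 (cmeas_cst 1) (cmeas_cst 0) e; rewrite !fc_cst mul0r mulr1.
by move/eqP; rewrite oner_eq0.
Qed.

Lemma WH_sg_neq0 p g n sg phi : WH p g n sg phi -> sg != 0.
Proof. by move=> [[e _ _ _] _]; apply/eqP => h; move/eqP: e; rewrite h mulr0 eq_sym oner_eq0. Qed.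

Lemma Hpbar_tilde p f : 1 <= p -> inHpbar p f -> Hp p (tilde f).
Proof.
move=> p1 [hf f0]; rewrite -LpE in hf; split; first exact: Lp_tilde.
by move=> n n0; rewrite fc_tilde; [rewrite fcE f0 // oppr_gt0|exact: (Lp1 p1)].
Qed.
Lemma tilde_Hpbar p f : 1 <= p -> Hp p f -> inHpbar p (tilde f).
Proof.
move=> p1 [hf f0]; split; first by rewrite -LpE; exact: Lp_tilde.
by move=> n n0; rewrite -fcE fc_tilde ?f0 ?oppr_lt0 //; exact: (Lp1 p1).
Qed.

(** The delicate condition is the boundedness of psi -> phi P(psi / phi). Let f solve T(g t^n) f =
    P(g t^n psi). Dividing g t^n (f - psi) = J k by sg phi~ shows f / phi - psi / phi = sg J(k /
    phi), so the operator sends psi to f, and the bounded inverse applies. *)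
Lemma WH_fact p g n sg phi : 1 < p -> inLinf g -> WH p g n sg phi ->
  wh_fact p g (fun x => sg * tilde phi x) (- n) (fun x => (phi x)^-1) /\ fhat (fun x => sg * tilde phi x) 0 = 1.
Proof.
move=> p1 hg wh; have sg0 := WH_sg_neq0 wh; case: wh => -[sg2 hphi phi0 he] [nz e bij].
have p1' := ltW p1; have p0 : 0 < p by lra.
have [q1 pq _] := conj_expP p1; have q1' := ltW q1; have q0 : 0 < conj_exp p by lra.
have E1 : (fun x => sg * tilde phi x) = tilde (fun x => sg * phi x) by [].
split; last first.
  by rewrite -fcE E1 fc_tilde ?oppr0; [rewrite fcZ ?phi0 //; exact: (Lp1 p1' hphi.1)|apply: LpZ => //; exact: (Lp1 p1' hphi.1)].
split; first by apply: ae_imp e => x _ ->; ring.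
split; first exact/HpP.
split; first by apply/HpP; rewrite (_ : (fun x => _) = phi) //; apply/funext => x; rewrite invrK.
split; first by rewrite E1; apply: tilde_Hpbar => //; exact: HpZ.
split.
  rewrite (_ : (fun x => _) = tilde (fun x => sg^-1 * (phi x)^-1)); last by apply/funext => x; rewrite invfM.
  by apply: tilde_Hpbar => //; exact: HpZ.
have hg0 := Linf_tpow n hg.
have [K K0 HK] := Tbij_bnd p1 hg0 bij; have [M M0 HM] := Linf_mul hg0.
exists (K * M); first exact: mulr_ge0.
move=> N c; set psi := trigpol N c.
have hpsi : Lp p psi.
  by apply: (Lp_sum _ p1' _).1 => i; apply: LpZ => //; exact: Lp_tpow.
have [hgpsi ngpsi] := HM _ _ p0 hpsi.
have [y [k1 [hy hk1 e1]]] := decomp p1 hgpsi.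
have [f hf hT] := bij.1 y hy.
have hT' : Tsol p (fun x => g x * tpow n x) f (fun x => g x * tpow n x * psi x).
  by apply: Tsol_ext (Tsol_neg p1' hk1 hT); [exact: aeq_refl|apply: aeq_eq => x; rewrite e1].
have nf : nrm p f <= K * M * nrm p psi.
  by apply: (le_trans (HK _ _ hgpsi hf hT')); rewrite -mulrA ler_wpM2l.
case: hT' => k hk ek.
have [hef _] := Hp_mul p1 hf he; have [hek _] := Hp_mul p1 hk he.
have hepsi : Lp 1 (fun x => (phi x)^-1 * psi x).
  have [h _] := hoelder_Lp p0 q0 pq hpsi he.1.
  by rewrite (_ : (fun x => _) = (fun x => psi x * (phi x)^-1)) //; apply/funext => x; rewrite mulrC.
have [hr er] : Lp 1 (rieszP (fun x => (phi x)^-1 * psi x)) /\ aeq (rieszP (fun x => (phi x)^-1 * psi x)) (fun x => f x * (phi x)^-1).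
  apply: (@rieszP_eq _ _ (fun x => - sg * (k x * (phi x)^-1)) hepsi hef); first exact: HpZ.
  have nzt : {ae mu, forall x, TT x -> tilde phi x != 0} := ae_reflect nz.
  apply: ae_imp2 nzt (ae_and (ae_and ek e) nz) => x _ tx [[ekx ex] nx].
  rewrite JopZ (_ : Jop (fun x => k x * _) x = Jop k x * (tilde phi x)^-1); last by rewrite /Jop mulrA.
  have t0 := tpow_neq0 n x.
  have h1 : sg * tilde phi x * (phi x)^-1 * f x = sg * tilde phi x * (phi x)^-1 * psi x + Jop k x.
    move: ekx; rewrite ex tpowN; move=> h; rewrite (_ : _ * f x = sg * (tpow n x)^-1 * tilde phi x * (phi x)^-1 * tpow n x * f x); last by field; apply/andP.
    by rewrite h; field; apply/andP.
  apply: (mulfI (mulf_neq0 sg0 tx)).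
  transitivity (sg * tilde phi x * (phi x)^-1 * f x - Jop k x); first by rewrite h1; ring.
  transitivity (sg * tilde phi x * (phi x)^-1 * f x - sg * sg * Jop k x); first by rewrite sg2 mul1r.
  by field; apply/andP.
have mF : cmeas (fun x => ((phi x)^-1)^-1 * rieszP (fun x => (phi x)^-1 * psi x) x).
  by apply: cmeasM; [apply: cmeasV; exact: Hp_meas he|exact: Lp_meas hr].
have eF : aeq f (fun x => ((phi x)^-1)^-1 * rieszP (fun x => (phi x)^-1 * psi x) x).
  by apply: ae_imp2 er nz => x _ -> nx; rewrite invrK mulrC divfK.
have hF := Lp_ext p0 mF eF hf.1.
rewrite -!lpi_lpint; apply: (le_trans (lpi_le p0 hF (B := K * M * nrm p psi) _)).
  by rewrite -(nrm_ext p0 (Hp_meas hf) mF eF).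
by rewrite (lpiE p0 hpsi) -EFinM lee_fin powRM ?nrm_ge0 ?mulr_ge0.
Qed.

(** The frequencies of u are nonnegative, those of t^L v are at most L < 0. *)
Lemma fact_eq0 (u v : R -> C) L : Hp 1 u -> Hp 1 (tilde v) -> L < 0 -> aeq u (fun x => tpow L x * v x) -> aeq u (fun=> 0).
Proof.
move=> [hu u0] [hv v0] L0 e; apply: L1_uniq => // n.
have [n0|n0] := ltP n 0; first exact: u0.
have hv' : Lp 1 v by rewrite -(tildeK v); exact: Lp_tilde.
have ht : Lp 1 (fun x => tpow L x * v x) by exact: Lp_Mtpow.
rewrite (fc_ext n (Lp_meas hu) (Lp_meas ht) e) fc_Mtpow -(tildeK v) fc_tilde // v0 //.
by rewrite oppr_lt0 subr_gt0 (lt_le_trans L0).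
Qed.

(** Uniqueness of the factorization, against the one chosen by [epsilon]. Comparison gives phi g_+ =
    t^L sg phi~ / g_- with L = -n - m; both signs of L are excluded, the positive one by inverting
    the identity. For L = 0 the means give sg g_+(0) = 1. *)
Lemma fsig_WH p g n sg phi : 1 < p -> inLinf g -> WH p g n sg phi -> fsig p g = sg.
Proof.
move=> p1 hg wh; have [hw hw0] := WH_fact p1 hg wh; have sg0 := WH_sg_neq0 wh.
rewrite /fsig; set P := (X in epsilon _ X); set t := epsilon _ P.
have : P t.
  apply: epsilon_spec.
  by exists ((fun x => sg * tilde phi x), - n, (fun x => (phi x)^-1)).
rewrite /P; case: t => -[gm m] gp /= [[e [hgp [hgpV [hgm [hgmV _]]]]] gm0].
case: wh => -[sg2 hphi phi0 he] [nz eg bij].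
have p1' := ltW p1; have p0 : 0 < p by lra.
have [q1 pq qK] := conj_expP p1; have q1' := ltW q1; have q0 : 0 < conj_exp p by lra.
move/HpP in hgp; move/HpP in hgpV.
have tgm := Hpbar_tilde p1' hgm; have tgmV := Hpbar_tilde q1' hgmV.
have nzt : {ae mu, forall x, TT x -> tilde phi x != 0} := ae_reflect nz.
have E : {ae mu, forall x, TT x -> [/\ gm x != 0, gp x != 0, phi x != 0, tilde phi x != 0 &
    gm x * tpow m x * gp x = sg * tpow (- n) x * tilde phi x * (phi x)^-1]}.
  apply: ae_imp2 (ae_and e eg) (ae_and nz nzt) => x _ [-> e'] [nx tx].
  have : gm x * tpow m x * gp x != 0 by rewrite e' !mulf_neq0 ?tpow_neq0 ?invr_neq0.
  by rewrite !mulf_eq0 !negb_or -andbA => /and3P[].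
have [hu u0] := Hp_mul p1 hphi hgp.
have [hu' _] := Hp_mul p1 hgpV he.
have hsphi : Hp p (fun x => sg * phi x) by exact: HpZ.
have [hv v0] := Hp_mul p1 hsphi tgmV.
have heV : Hp (conj_exp p) (fun x => sg^-1 * (phi x)^-1) by exact: HpZ.
have [hv' _] := Hp_mul p1 tgm heV.
pose L := - n - m.
have Lge0 : ~ L < 0.
  move=> L0; have := @fact_eq0 _ (tilde (fun x => sg * phi x * tilde (fun x => (gm x)^-1) x)) L hu.
  rewrite tildeK => /(_ hv L0) h; apply: not_ae_false.
  have E' := E; apply: ae_imp2 E' (h _) => [x _ [g1 g2 g3 _ _] /eqP|].
    by rewrite mulf_eq0 (negbTE g2) (negbTE g3).
  apply: ae_imp E => x _ [g1 g2 g3 g4 g5].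
  rewrite -[tilde _ x]/(sg * tilde phi x * tilde (tilde (fun x => (gm x)^-1)) x) tildeK.
  have t1 := tpow_neq0 m x; have t2 := tpow_neq0 n x; rewrite /L tpowD !tpowN.
  apply: (mulfI (mulf_neq0 g1 t1)).
  transitivity (phi x * (gm x * tpow m x * gp x)); first by ring.
  by rewrite g5 tpowN; field; rewrite t1 t2 g1 g3.
have Lle0 : ~ 0 < L.
  move=> L0; have L0' : - L < 0 by rewrite oppr_lt0.
  have := @fact_eq0 _ (tilde (fun x => tilde gm x * (sg^-1 * (phi x)^-1))) (- L) hu'.
  rewrite tildeK => /(_ hv' L0') h; apply: not_ae_false.
  have E' := E; apply: ae_imp2 E' (h _) => [x _ [g1 g2 g3 _ _] /eqP|].
    by rewrite mulf_eq0 !invr_eq0 (negbTE g2) (negbTE g3).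
  apply: ae_imp E => x _ [g1 g2 g3 g4 g5].
  rewrite -[tilde _ x]/(tilde (tilde gm) x * (sg^-1 * (tilde phi x)^-1)) tildeK.
  have t1 := tpow_neq0 m x; have t2 := tpow_neq0 n x; rewrite /L opprD !opprK tpowD.
  apply: (mulfI g2).
  transitivity ((tpow n x / (sg * tilde phi x)) * (gm x * tpow m x * gp x)); last by field; rewrite sg0 g4.
  by rewrite g5 tpowN; field; rewrite t2 g2 g3 g4 sg0.
have L0 : L = 0 by case: (ltgtP L 0).
(* Means being multiplicative, the normalization of g_- fixes that of 1 / g_- as well. *)
have X1 : fc (tilde (fun x => (gm x)^-1)) 0 = 1.
  have [_ h] := Hp_mul p1 tgm tgmV.
  have e1 : aeq (fun x => tilde gm x * tilde (fun x => (gm x)^-1) x) (fun=> 1).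
    have := ae_reflect E; apply: ae_imp => x _ [g1 _ _ _ _]; exact: mulfV.
  have hm : cmeas (fun x => tilde gm x * tilde (fun x => (gm x)^-1) x).
    by apply: cmeasM; [exact: Hp_meas tgm|exact: Hp_meas tgmV].
  move: h; rewrite (fc_ext 0 hm (cmeas_cst 1) e1) fc_cst mulr1 => ->.
  rewrite (_ : fc (tilde gm) 0 = 1) ?mul1r //.
  have hgm1 : Lp 1 gm by rewrite -(tildeK gm); apply: Lp_tilde; exact: (Lp1 p1' tgm.1).
  by rewrite -gm0 -fcE fc_tilde ?oppr0.
have e2 : aeq (fun x => phi x * gp x) (tilde (fun x => sg * phi x * tilde (fun x => (gm x)^-1) x)).
  apply: ae_imp E => x _ [g1 g2 g3 g4 g5].
  rewrite -[tilde _ x]/(sg * tilde phi x * tilde (tilde (fun x => (gm x)^-1)) x) tildeK.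
  have nm : m = - n by move: L0; rewrite /L => /eqP; rewrite subr_eq0 => /eqP.
  have t1 := tpow_neq0 m x; apply: (mulfI (mulf_neq0 g1 t1)).
  transitivity (phi x * (gm x * tpow m x * gp x)); first by ring.
  by rewrite g5 -nm; field; rewrite g1 g3.
have := fc_ext 0 (Hp_meas hu) (Lp_meas (Lp_tilde hv.1)) e2.
rewrite (fc_tilde _ hv.1) oppr0 v0 u0 X1 mulr1 (fcZ _ _ (Lp1 p1' hphi.1)) phi0 sg2 => h.
by apply: (mulfI sg0); rewrite -fcE h sg2.
Qed.

End Projection.

(** * Matching pairs *)
Section MatchingPairs.
Variable R : realType.
Local Notation C := R[i].
Local Notation mu := (@lebesgue_measure R).
Local Notation TT := (@circ R).
Implicit Types (z w : C) (p q : R) (f g h y a b c d : R -> C).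
Local Opaque cabs cexp powR lebesgue_measure circ.

Definition matching_data a b c d :=
  [/\ inLinf a, inLinf b, inLinf (fun x => (b x)^-1) & {ae mu, forall x, TT x -> b x != 0}] /\
  [/\ aeq a (fun x => c x * b x), aeq a (fun x => d x * tilde b x),
      aeq (fun x => c x * tilde c x) (fun=> 1) & aeq (fun x => d x * tilde d x) (fun=> 1)].

Lemma LinfM f g : inLinf f -> inLinf g -> inLinf (fun x => f x * g x).
Proof.
move=> [mf [M hM]] [mg [N hN]]; split; first exact: cmeasM.
exists (M * N); apply: ae_imp2 hM hN => x _ h1 h2; rewrite cabsM.
by apply: ler_pM; rewrite ?cabs_ge0.
Qed.
Lemma Linf_tilde f : inLinf f -> inLinf (tilde f).
Proof. by move=> [mf [M hM]]; split; [exact: cmeas_tilde|exists M; exact: ae_reflect hM]. Qed.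

(** Invertibility of b comes from the matching relation: |b| |b~| = |a| |a~| >= del^2 and |b~| <= N
    give |b| >= del^2 / N. *)
Lemma matching_dataP a b : matching a b ->
  [/\ matching_data a b (subc a b) (subd a b), inLinf (subc a b) & inLinf (subd a b)].
Proof.
move=> [[ha [del del0 hdel]] [hb ab]].
have [ma [M hM]] := ha; have [mb [N hN]] := hb.
have lb : {ae mu, forall x, TT x -> 0 < N /\ del * del / N <= cabs (b x)}.
  have hdel' := ae_reflect hdel; have hN' := ae_reflect hN.
  apply: ae_imp2 (ae_and ab hN') (ae_and hdel hdel') => x _ [e n] [d1 d2].
  have h : del * del <= cabs (b x) * cabs (tilde b x).
    by rewrite -cabsM -e cabsM ler_pM // ltW.
  have h0 : 0 < cabs (b x) * cabs (tilde b x) by rewrite (lt_le_trans _ h) // mulr_gt0.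
  have bt0 : 0 < cabs (tilde b x).
    by rewrite lt_neqAle cabs_ge0 andbT eq_sym; apply/eqP => e0; move: h0; rewrite e0 mulr0 ltxx.
  have N0 : 0 < N by exact: lt_le_trans n.
  split=> //; rewrite ler_pdivrMr //; apply: (le_trans h); rewrite ler_wpM2l ?cabs_ge0 //.
have bnz : {ae mu, forall x, TT x -> b x != 0}.
  by apply: ae_imp lb => x _ [N0 h]; rewrite -cabs_gt0 (lt_le_trans _ h) // divr_gt0 // mulr_gt0.
have hbV : inLinf (fun x => (b x)^-1).
  split; first exact: cmeasV.
  exists (del * del / N)^-1; apply: ae_imp lb => x _ [N0 h].
  have dn : 0 < del * del / N by rewrite divr_gt0 // mulr_gt0.
  by rewrite cabsV lef_pV2 ?posrE // (lt_le_trans dn).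
have hc : inLinf (subc a b) by exact: LinfM.
have hd : inLinf (subd a b) by exact: (LinfM ha (Linf_tilde hbV)).
have anz : {ae mu, forall x, TT x -> a x != 0}.
  by apply: ae_imp hdel => x _ h; rewrite -cabs_gt0 (lt_le_trans del0).
have btnz : {ae mu, forall x, TT x -> tilde b x != 0} := ae_reflect bnz.
split=> //; split=> //; split.
- by apply: ae_imp bnz => x _ nb; rewrite /subc divfK.
- by apply: ae_imp btnz => x _ nb; rewrite /subd divfK.
- apply: ae_imp2 ab (ae_and bnz btnz) => x _ e [n1 n2].
  rewrite -[tilde (subc a b) x]/(tilde a x / tilde b x) /subc mulf_div e mulfV // mulf_neq0 //.
- apply: ae_imp2 ab (ae_and bnz btnz) => x _ e [n1 n2].
  rewrite -[tilde (subd a b) x]/(tilde a x / tilde (tilde b) x) tildeK /subd mulf_div e (mulrC (tilde b x)) mulfV // mulf_neq0 //.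
Qed.

(** Reflection turns t^n into t^-n, so the factors cancel in d = a / b~ and add up in c = a / b. *)
Lemma matching_data_shift a b c d n : matching_data a b c d ->
  matching_data (fun x => a x * tpow (- n) x) (fun x => b x * tpow n x) (fun x => c x * tpow (- (n + n)) x) d.
Proof.
move=> [[ha hb hbV nb] [e1 e2 e3 e4]]; split; split.
- exact: Linf_tpow.
- exact: Linf_tpow.
- rewrite (_ : (fun x => _) = (fun x => (b x)^-1 * tpow (- n) x)); first exact: Linf_tpow.
  by apply/funext => x; rewrite invfM tpowN.
- by apply: ae_imp nb => x _ h; rewrite mulf_neq0 ?tpow_neq0.
- apply: ae_imp e1 => x _ ->; rewrite tpowN tpowN tpowD.
  by have t0 := tpow_neq0 n x; field.
- apply: ae_imp e2 => x _ ->; rewrite /tilde tpow_reflect; ring.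
- apply: ae_imp e3 => x _ <-; rewrite /tilde tpow_reflect opprK tpowN.
  by have t0 := tpow_neq0 (n + n) x; field.
- exact: e4.
Qed.

Definition kerS p g (ep : C) f := Hp p f /\ aeq (fun x => g x * f x) (fun x => ep * Jop f x).

Definition TH a b f := fun x => a x * f x + b x * Jop f x.

Lemma TH_lincomb a b n (e : 'I_n -> R -> C) v x : TH a b (lincomb e v) x = lincomb (fun i => TH a b (e i)) v x.
Proof.
rewrite /TH /lincomb /Jop !big_distrr /= -big_split /=; apply: eq_bigr => i _.
ring.
Qed.

(* The range of TH consists of functions v with d J v = v; this is where the matching condition enters. *)
Lemma TH_symm a b c d f : matching_data a b c d ->
  aeq (fun x => d x * Jop (TH a b f) x) (TH a b f).
Proof.
move=> [_ [_ e2 _ e4]]; have e2' := aeq_tilde e2.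
apply: ae_imp2 (ae_and e2 e2') e4 => x _ [h2 h2'] h4.
rewrite /TH JopD (JopM a) (JopM b) JopK h2'.
rewrite -[tilde (fun x => d x * _) x]/(tilde d x * tilde (tilde b) x) tildeK.
transitivity ((d x * tilde d x) * b x * Jop f x + d x * tilde b x * f x); first by ring.
by rewrite h4 -h2; ring.
Qed.

(** * Kernel equations in terms of c and d *)

Section Pair.
Variables (p : R) (a b c d : R -> C).
Hypotheses (p1 : 1 < p) (md : matching_data a b c d).

Let p1' : 1 <= p. Proof. exact: ltW. Qed.
Let p0 : 0 < p. Proof. exact: lt_trans ltr01 p1. Qed.

(** This is d J v = v at v = J k, where J v = k. *)
Lemma kernel_symm f k : aeq (TH a b f) (Jop k) -> aeq (fun x => d x * k x) (fun x => 1 * Jop k x).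
Proof.
move=> e; have e' := aeq_Jop e; have s := TH_symm f md.
apply: ae_imp2 (ae_and e e') s => x _ [h h'].
by rewrite h' JopK mul1r => ->.
Qed.

Lemma kernel_zero f : aeq (TH a b f) (fun=> 0) -> aeq (fun x => c x * f x) (fun x => -1 * Jop f x).
Proof.
move=> e; case: md => -[_ _ _ nb] [e1 _ _ _].
apply: ae_imp2 (ae_and e e1) nb => x _ [h h1] nx; apply: (mulIf nx).
apply/eqP; rewrite -subr_eq0; apply/eqP; rewrite -h /TH h1; ring.
Qed.

Lemma kernel_minus f : aeq (fun x => c x * f x) (fun x => -1 * Jop f x) -> aeq (TH a b f) (fun=> 0).
Proof.
case: md => _ [e1 _ _ _] e; apply: ae_imp2 e e1 => x _ h h1.
rewrite /TH h1; transitivity (b x * (c x * f x + Jop f x)); first by ring.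
by rewrite h; ring.
Qed.

(* u = b^-1 J h satisfies c J u = u, so a solution of c f0 + J f1 = u also solves c f1 + J f0 = u, and the mean of f0
   and f1 solves c f + J f = u. *)
Lemma kernel_lift h : (forall y, Hp p y -> exists2 f, Hp p f & Tsol p c f y) -> kerS p d 1 h ->
  exists2 f, Hp p f & aeq (TH a b f) (Jop h).
Proof.
move=> on [[hh h0] eh]; case: md => -[_ _ hbV nb] [e1 e2 e3 _].
have [M _ HM] := Linf_mul hbV.
have [hu _] := HM _ _ p0 (Lp_Jop hh); set u := fun x => _ in hu.
have [y [k0 [hy hk0 eu]]] := decomp p1 hu.
have [f0 hf0 [k1 hk1 ec]] := on y hy.
pose f1 := fun x => k0 x - k1 x; have hf1 : Hp p f1 by exact: HpB.
have E1 : aeq u (fun x => c x * f0 x + Jop f1 x).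
  by apply: ae_imp ec => x _ h1; rewrite h1 /f1 JopD JopN eu; ring.
have Eu : aeq u (fun x => c x * Jop u x).
  have btnz : {ae mu, forall x, TT x -> tilde b x != 0} := ae_reflect nb.
  apply: ae_imp2 (ae_and eh nb) (ae_and (ae_and e1 e2) btnz)
    => x _ [h1 nx] [[a1 a2] ntx].
  rewrite /u JopM JopK -[tilde (fun x => (b x)^-1) x]/((tilde b x)^-1).
  have -> : c x = d x * tilde b x / b x by rewrite -a2 a1 mulfK.
  rewrite -[Jop h x]mul1r -h1; field; apply/andP; split=> //.
have E2 : aeq u (fun x => Jop f0 x + c x * f1 x).
  apply: ae_imp2 (ae_and Eu (aeq_Jop E1)) e3 => x _ [-> ->] h3.
  rewrite JopD JopM JopK; transitivity ((c x * tilde c x) * Jop f0 x + c x * f1 x); first by ring.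
  by rewrite h3 mul1r.
exists (fun x => 2^-1 * (f0 x + f1 x)); first by apply: HpZ => //; exact: HpD.
apply: ae_imp2 (ae_and E1 E2) (ae_and e1 nb) => x _ [h1 h2] [a1 nx].
rewrite /TH JopZ JopD a1.
transitivity (b x * (2^-1 * ((c x * f0 x + Jop f1 x) + (Jop f0 x + c x * f1 x)))); first by ring.
rewrite -h1 -h2 (_ : 2^-1 * (u x + u x) = u x); last by field.
by rewrite /u mulVKf.
Qed.

End Pair.

Lemma WH_e0 p g n sg phi : 1 < p -> WH p g n sg phi -> fc (fun x => (phi x)^-1) 0 = sg.
Proof.
move=> p1 wh; have sg0 := WH_sg_neq0 wh; case: wh => -[sg2 hphi phi0 he] [nz _ _].
have [hm h] := Hp_mul p1 hphi he.
have e : aeq (fun x => phi x * (phi x)^-1) (fun=> 1) by apply: ae_imp nz => x _ nx; rewrite mulfV.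
move: h; rewrite (fc_ext 0 (Hp_meas hm) (cmeas_cst 1) e) fc_cst mulr1 phi0 => h.
by apply: (mulfI sg0); rewrite -h sg2.
Qed.

(** In g t^n f = t^n y + J k the factor t^n cancels, and t^-n J k = J (t^n k) stays in J H^p because
    n >= 0. *)
Lemma WH_onto p g n sg phi : 1 < p -> 0 <= n -> WH p g n sg phi ->
  forall y, Hp p y -> exists2 f, Hp p f & Tsol p g f y.
Proof.
move=> p1 n0 [_ [_ _ [on _]]] y hy; have p1' := ltW p1.
have En : n = `|n|%N by rewrite gez0_abs.
have hy' : Hp p (fun x => tpow n x * y x) by rewrite En; exact: Hp_Mtpow.
have [f hf [k hk e]] := on _ hy'; exists f => //.
exists (fun x => tpow n x * k x); first by rewrite En; exact: Hp_Mtpow.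
apply: ae_imp e => x _ e; apply: (mulIf (tpow_neq0 n x)).
transitivity (g x * tpow n x * f x); first by ring.
by rewrite e Jop_tpowM tpowN; have t0 := tpow_neq0 n x; field.
Qed.

(** * The equation g f = ep J f and symmetric polynomials *)

Section Palindromes.
Variables (p : R) (g : R -> C) (kap : int) (sg : C) (phi : R -> C) (ep : C).
Hypotheses (p1 : 1 < p) (wh : WH p g kap sg phi) (ep2 : ep * ep = 1).
Let tau := ep * sg.
Let p1' : 1 <= p. Proof. exact: ltW. Qed.

(** With w = f / phi the factorization turns the equation into w = tau t^(kap-1) w~. As w is
    analytic, the symmetry confines its spectrum to 0, ..., kap - 1. *)
Lemma kerS_palindrome f : kerS p g ep f -> [/\ Hp 1 (fun x => f x * (phi x)^-1),
  aeq f (fun x => phi x * (f x * (phi x)^-1)) &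
  forall n, fc (fun x => f x * (phi x)^-1) n = tau * fc (fun x => f x * (phi x)^-1) (kap - 1 - n)].
Proof.
move=> [hf e]; have sg0 := WH_sg_neq0 wh; case: wh => -[sg2 hphi phi0 he] [nz eg _].
have [hw _] := Hp_mul p1 hf he; set w := fun x => _ in hw *.
have nzt : {ae mu, forall x, TT x -> tilde phi x != 0} := ae_reflect nz.
split=> //; first by apply: ae_imp nz => x _ nx; rewrite mulrC divfK.
have E : aeq w (fun x => tau * (tpow (kap - 1) x * tilde w x)).
  apply: ae_imp2 (ae_and e eg) (ae_and nz nzt) => x _ [h1 h2] [n1 n2].
  rewrite -[tilde w x]/(tilde f x * (tilde phi x)^-1) tpowD.
  have t0 := tpow_neq0 kap x; apply: (mulfI (mulf_neq0 (mulf_neq0 sg0 (tpow_neq0 (- kap) x)) n2)).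
  transitivity (g x * f x); first by rewrite h2 /w; ring.
  rewrite h1 Jop_tpow /tau tpowN -[X in X * _]mul1r -sg2; field; by apply/andP.
move=> n; have hwt : Lp 1 (fun x => tpow (kap - 1) x * tilde w x) by apply: Lp_Mtpow => //; apply: Lp_tilde; exact: hw.1.
rewrite (fc_ext n (Hp_meas hw) (Lp_meas (LpZ tau ltr01 hwt)) E) fcZ // fc_Mtpow fc_tilde ?hw.1 //; last exact: hw.1.
by rewrite opprB.
Qed.

(** For kap <= 0 the symmetry n -> kap - 1 - n sends every nonnegative frequency to a negative
    one. *)
Lemma kerS_trivial f : kap <= 0 -> kerS p g ep f -> aeq f (fun=> 0).
Proof.
move=> k0 hf; have [hw ew hs] := kerS_palindrome hf; have [hw1 w0] := hw.
have : aeq (fun x => f x * (phi x)^-1) (fun=> 0).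
  apply: L1_uniq => // n; have [n0|n0] := ltP n 0; first exact: w0.
  rewrite hs w0 ?mulr0 //; lia.
by move=> h; apply: ae_imp2 ew h => x _ h1 h2; rewrite h1 h2 mulr0.
Qed.

Variable m : nat.
Hypothesis kapm : kap = m.

(* The dimension of {s_0, ..., s_(k-1) | s_j = t s_(k-1-j)} for t = 1 or -1. *)
Definition pal_dim (k : nat) (t : C) : nat := if t == 1 then uphalf k else k./2.

(** The symmetrized monomial. When 2 i + 1 = m its terms have the same frequency: it is 2 t^i for
    tau = 1 and 0 for tau = -1, which is where the two dimensions differ. *)
Definition pal (i : nat) : R -> C := fun x => tpow i x + tau * tpow (m%:Z - 1 - i%:Z) x.

Lemma pal_kerS i : (i < m)%N -> kerS p g ep (fun x => pal i x * phi x).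
Proof.
move=> im; have sg0 := WH_sg_neq0 wh; case: wh => -[sg2 hphi phi0 he] [nz eg _].
have Em : m%:Z - 1 - i%:Z = (m.-1 - i)%N by lia.
split.
  rewrite (_ : (fun x => _) = (fun x => tpow i x * phi x + tau * (tpow (m.-1 - i)%N x * phi x))).
    by apply: HpD => //; [exact: Hp_Mtpow|apply: HpZ => //; exact: Hp_Mtpow].
  by apply/funext => x; rewrite /pal Em; ring.
apply: ae_imp2 eg nz => x _ h nx.
have -> : g x * (pal i x * phi x) = sg * tpow (- m%:Z) x * tilde phi x * pal i x.
  by rewrite h kapm; field.
rewrite JopM Jop_tpow.
have -> : tilde (pal i) x = tpow (- i%:Z) x + tau * tpow (- (m%:Z - 1 - i%:Z)) x by rewrite /tilde /pal !tpow_reflect.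
transitivity (tilde phi x * (sg * tpow (- m%:Z + i%:Z) x + sg * tau * tpow (-1 - i%:Z) x)).
  by rewrite /pal (_ : -1 - i%:Z = - m%:Z + (m%:Z - 1 - i%:Z)) ?tpowD; [ring|lia].
transitivity (tilde phi x * (ep * tpow (-1 - i%:Z) x + ep * tau * tpow (- m%:Z + i%:Z) x)); last first.
  by rewrite (_ : - m%:Z + i%:Z = -1 - (m%:Z - 1 - i%:Z)) ?tpowD; [ring|lia].
have -> : sg * tau = ep by rewrite /tau mulrCA sg2 mulr1.
have -> : ep * tau = sg by rewrite /tau mulrA ep2 mul1r.
by rewrite addrC.
Qed.

Lemma fc_pal i n : fc (pal i) n = (i%:Z == n)%:R + tau * (m%:Z - 1 - i%:Z == n)%:R.
Proof.
by rewrite /pal fcD ?fcZ ?fc_tpow //; try apply: LpZ => //; exact: Lp_tpow.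
Qed.

Lemma Lp_pal i : Lp 1 (pal i).
Proof. by apply: LpD => //; [exact: Lp_tpow|apply: LpZ => //; exact: Lp_tpow]. Qed.

Lemma sum_delta N (v : nat -> C) (P : pred nat) (j : nat) : (forall i, (i < N)%N -> P i = (i == j)) ->
  \sum_(i < N) v i * (P i)%:R = if (j < N)%N then v j else 0.
Proof.
move=> hP; case: ifPn => jN.
  rewrite (bigD1 (Ordinal jN)) //= hP // eqxx mulr1 big1 ?addr0 // => i /negbTE ij.
  by rewrite hP //; move: ij; rewrite -(inj_eq val_inj) /= => ->; rewrite mulr0.
rewrite big1 // => i _; rewrite hP //; case: eqP => [e|_]; last by rewrite mulr0.
by move: jN; rewrite -e ltn_ord.
Qed.

Let N := pal_dim m tau.

Let tau2 : tau * tau = 1.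
Proof. by case: wh => -[sg2 _ _ _] _; rewrite /tau mulrACA ep2 sg2 mulr1. Qed.

Let tau_pm : tau != 1 -> tau = -1.
Proof. by move=> t1; have /eqP := tau2; rewrite -expr2 sqrf_eq1 (negbTE t1) => /eqP. Qed.

Let N2 : (2 * N <= m.+1)%N /\ (m <= (2 * N).+1)%N.
Proof. rewrite /N /pal_dim; case: ifP => _; split; lia. Qed.
Let Nmid i : tau != 1 -> (i < N)%N -> (2 * i).+1 != m.
Proof. rewrite /N /pal_dim => /negbTE -> h; apply/eqP; lia. Qed.
Let Nmid1 i : tau == 1 -> (2 * i).+1 = m -> (i < N)%N.
Proof. rewrite /N /pal_dim => -> h; lia. Qed.
Let Nlt i : (i < N)%N -> (i < m)%N.
Proof. by move=> h; have [h1 _] := N2; lia. Qed.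

Lemma fc_palsum (v : nat -> C) (j : nat) : (j < m)%N ->
  fc (lincomb (fun i : 'I_N => pal i) (fun i => v i)) j =
  (if (j < N)%N then v j else 0) + tau * (if (m.-1 - j < N)%N then v (m.-1 - j)%N else 0).
Proof.
move=> jm; rewrite fc_lincomb => [|i]; last exact: Lp_pal.
under eq_bigr do rewrite fc_pal mulrDr mulrCA.
rewrite big_split /= -big_distrr /=.
rewrite (@sum_delta _ v (fun i => i%:Z == j%:Z) j) => [|i _]; last by rewrite eqz_nat.
by rewrite (@sum_delta _ v (fun i => m%:Z - 1 - i%:Z == j%:Z) (m.-1 - j)) // => i iN; have := Nlt iN; lia.
Qed.

Lemma kerS_basis : exists F : 'I_N -> R -> C, [/\ forall i, kerS p g ep (F i), ae_free F &
  forall f, kerS p g ep f -> exists v, aeq f (lincomb F v)].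
Proof.
have [nz] : {ae mu, forall x, TT x -> phi x != 0} /\ True by case: wh => _ [].
move=> _; pose F (i : 'I_N) x := pal i x * phi x.
have FE v x : lincomb F v x = lincomb (fun i : 'I_N => pal i) v x * phi x.
  by rewrite /lincomb big_distrl; apply: eq_bigr => i _; rewrite /= mulrA.
exists F; split.
- by move=> i; apply: pal_kerS; exact: Nlt.
- move=> v hv i; pose v' (j : nat) := if insub j is Some j' then v j' else 0.
  have vE (j : 'I_N) : v' j = v j by rewrite /v' valK.
  have e0 : aeq (lincomb (fun i : 'I_N => pal i) v) (fun=> 0).
    by apply: ae_imp2 hv nz => x _; rewrite FE => /eqP + /negbTE nx; rewrite mulf_eq0 nx orbF => /eqP.
  have := fc_ext i (Lp_meas (Lp_lincomb v (lexx 1) (fun i : 'I_N => Lp_pal i))) (cmeas_cst 0) e0.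
  rewrite fc0 (_ : lincomb _ v = lincomb (fun i : 'I_N => pal i) (fun i => v' i)); last first.
    by apply/funext => x; apply: eq_bigr => j _; rewrite vE.
  have iN := ltn_ord i; have im := Nlt iN; rewrite fc_palsum // iN vE.
  have [h1 h2] := N2; have [mid|nmid] := eqVneq (2 * i).+1 m.
    have t1 : tau == 1 by apply: contrapT => /negP t; have := Nmid t iN; rewrite mid eqxx.
    rewrite (_ : (m.-1 - i)%N = i); last by lia.
    by rewrite iN vE (eqP t1) mul1r -mulr2n => /eqP; rewrite mulrn_eq0 => /eqP.
  rewrite ifF ?mulr0 ?addr0 //; apply/negbTE; rewrite -leqNgt; move/eqP: nmid; lia.
- move=> f hf; have [hw ew hs] := kerS_palindrome hf; have [hw1 w0] := hw.
  set w := fun x => _ in hw ew hs hw1 w0.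
  (* The middle basis element is 2 t^i, hence the division by 2. *)
  pose v (i : nat) := if (2 * i).+1 == m then fc w i / 2 else fc w i.
  exists (fun i => v i); apply: aeq_trans ew _.
  suff E : aeq w (lincomb (fun i : 'I_N => pal i) (fun i => v i)).
    by apply: ae_imp E => x _ Ex; rewrite FE -Ex /w mulrC.
  apply: fc_uniq => // [|n]; first by apply: Lp_lincomb => // i; exact: Lp_pal.
  have [n0|n0] := ltP n 0.
    rewrite w0 // fc_lincomb => [|i]; last exact: Lp_pal.
    by rewrite big1 // => i _; rewrite fc_pal; have := Nlt (ltn_ord i); case: eqP => [|_]; case: eqP => [|_]; rewrite ?mulr0 ?addr0 ?mulr0 //; lia.
  have [mn|nm] := leP m%:Z n.
    rewrite hs w0 ?mulr0; last by rewrite kapm; lia.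
    rewrite fc_lincomb => [|i]; last exact: Lp_pal.
    by rewrite big1 // => i _; rewrite fc_pal; have := Nlt (ltn_ord i); case: eqP => [|_]; case: eqP => [|_]; rewrite ?mulr0 ?addr0 ?mulr0 //; lia.
  have En : n = `|n|%N by rewrite gez0_abs.
  move: En; set j := `|n|%N => En; rewrite En.
  have jm : (j < m)%N by rewrite /j; lia.
  rewrite fc_palsum //; have [h1 h2] := N2.
  have sj : fc w j = tau * fc w (m.-1 - j)%N.
    by rewrite hs kapm; congr (_ * fc w _); lia.
  have [mid|nmid] := eqVneq (2 * j).+1 m.
    have jj : (m.-1 - j)%N = j by lia.
    rewrite jj; have [t1|t1] := boolP (tau == 1).
      by rewrite (Nmid1 t1 mid) (eqP t1) mul1r /v mid eqxx -splitr.
    rewrite ifF; last by apply/negbTE/negP => jN; have := Nmid t1 jN; rewrite mid eqxx.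
    rewrite mulr0 addr0; move: sj; rewrite jj (tau_pm t1) mulN1r => /eqP.
    by rewrite -addr_eq0 -mulr2n mulrn_eq0 => /eqP.
  have nmid' : (2 * (m.-1 - j)).+1 != m by apply/eqP; move/eqP: nmid; lia.
  have [lt|ge] := ltnP (2 * j).+1 m.
    rewrite ifT; last by lia.
    rewrite ifF ?mulr0 ?addr0 /v ?(negbTE nmid) //; lia.
  rewrite ifF; last by move/eqP: nmid; lia.
  rewrite ifT; last by move/eqP: nmid; lia.
  by rewrite add0r /v (negbTE nmid') -sj.
Qed.

End Palindromes.

Lemma free_neq0 n (F : 'I_n -> R -> C) i : ae_free F -> ~ aeq (F i) (fun=> 0).
Proof.
move=> fr h; have H := fr (fun j => (j == i)%:R) _ i.
have : (i == i)%:R = 0 :> C; last by move/eqP; rewrite eqxx oner_eq0.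
apply: H; apply: ae_imp h => x _ h.
by rewrite /lincomb (bigD1 i) //= eqxx mul1r h add0r big1 // => j /negbTE ->; rewrite mul0r.
Qed.

(** * Consequences of invertibility *)

Section Invertible.
Variables (p : R) (a b c d : R -> C) (k1 k2 : int) (sc sd : C) (phic phid : R -> C).
Hypotheses (p1 : 1 < p) (md : matching_data a b c d)
  (whc : WH p c k1 sc phic) (whd : WH p d k2 sd phid)
  (on : forall y, Hp p y -> exists2 f, Hp p f & THsol p a b f y)
  (inj : forall f, Hp p f -> THsol p a b f (fun=> 0) -> aeq f (fun=> 0)).

Let p1' : 1 <= p. Proof. exact: ltW. Qed.
Let p0 : 0 < p. Proof. exact: lt_trans ltr01 p1. Qed.
Let m1m1 : -1 * -1 = 1 :> C. Proof. by rewrite mulrNN mulr1. Qed.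

(** A space of symmetric polynomials of length at least 2 is nonzero for either sign, while for
    length 1 it may be trivial; hence the bound 1. For k2 the element is lifted from J H^p, which
    uses that T(c) is onto. *)
Lemma inj_le1 : 0 <= k1 -> k1 <= 1 /\ k2 <= 1.
Proof.
move=> k10; split; rewrite leNgt; apply/negP => k2'.
  have E : k1 = `|k1|%N by rewrite gez0_abs.
  have [F [hF fr _]] := kerS_basis p1 whc m1m1 E.
  have N0 : (0 < pal_dim `|k1|%N (-1 * sc)%R)%N by rewrite /pal_dim; case: ifP => _; lia.
  apply: (@free_neq0 _ F (Ordinal N0) fr); have [h1 h2] := hF (Ordinal N0).
  apply: inj => //; exists (fun=> 0); first exact: Hp0.
  by apply: ae_imp (kernel_minus md h2) => x _ h; rewrite Jop0 addr0.
have E : k2 = `|k2|%N by lia.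
have [F [hF fr _]] := kerS_basis p1 whd (mulr1 1) E.
have N0 : (0 < pal_dim `|k2|%N (1 * sd)%R)%N by rewrite /pal_dim; case: ifP => _; lia.
apply: (@free_neq0 _ F (Ordinal N0) fr); have hh := hF (Ordinal N0).
have [f hf e] := kernel_lift p1 md (WH_onto p1 k10 whc) hh.
have f0 : aeq f (fun=> 0).
  apply: inj => //; exists (F (Ordinal N0)); first exact: hh.1.
  by apply: ae_imp e => x _ h; rewrite add0r.
apply: ae_imp2 (aeq_Jop e) (ae_and f0 (aeq_Jop f0)) => x _; rewrite JopK => <- [fx jx].
by rewrite /TH JopD (JopM a) (JopM b) JopK fx jx /Jop !mulr0 addr0.
Qed.

(* For kappa2 <= -2 the constant 1 is not in the range, and for kappa1 <= -2 neither is P(b + a t^-1). *)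
Lemma onto_ge : k2 <= 0 -> -1 <= k2 /\ -1 <= k1.
Proof.
move=> k20; have [q1 _ _] := conj_expP p1; have q1' := ltW q1.
split; rewrite leNgt; apply/negP => kk.
  have e0 := WH_e0 p1 whd; have sd0 := WH_sg_neq0 whd; case: whd => -[sd2 hphi phi0 he] [nz eg _].
  have H1 := Hp_one p1'.
  have [f hf [k hk e]] := on H1.
  have [hke _] := Hp_mul p1 hk he; have he1 := Hp1 q1' he.
  have nzt : {ae mu, forall x, TT x -> tilde phid x != 0} := ae_reflect nz.
  (* The identity d J v = v at v = 1 + J k, divided by phi~. The mean of the left-hand side is that
     of 1/phi, which is sd; on the right it involves the coefficients of 1/phi at k2 + 1 and of
     k/phi at k2, both negative frequencies as k2 <= -2. *)
  pose L x := tilde (fun x => (phid x)^-1) x + Jop (fun x => k x * (phid x)^-1) x.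
  pose Rr x := sd * (tpow (- k2) x * (tpow (-1) x * (phid x)^-1 + k x * (phid x)^-1)).
  have hL1 : Lp 1 (tilde (fun x => (phid x)^-1)) by apply: Lp_tilde; exact: he1.1.
  have hL2 : Lp 1 (Jop (fun x => k x * (phid x)^-1)) by apply: Lp_Jop; exact: hke.1.
  have hR1 : Lp 1 (fun x => tpow (-1) x * (phid x)^-1) by apply: Lp_Mtpow => //; exact: he1.1.
  have hR2 : Lp 1 (fun x => tpow (- k2) x * (tpow (-1) x * (phid x)^-1 + k x * (phid x)^-1)).
    by apply: Lp_Mtpow => //; apply: LpD => //; exact: hke.1.
  have E : aeq L Rr.
    apply: ae_imp2 (ae_and (ae_and e (aeq_Jop e)) (TH_symm f md)) (ae_and eg (ae_and nz nzt)) => x _ [[h h'] s] [hd [px tx]].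
    have {}s : d x * (Jop (fun x => 1) x + k x) = 1 + Jop k x.
      by rewrite -h -[RHS]s; congr (_ * _); rewrite [RHS]h' JopD JopK.
    have j1 : Jop (fun=> 1) x = tpow (-1) x :> C by rewrite Jop_tpow /tilde mulr1.
    rewrite j1 hd in s; rewrite /L /Rr (_ : Jop (fun x => k x * _) x = Jop k x * (tilde phid x)^-1); last by rewrite /Jop mulrA.
    rewrite -[tilde _ x]/((tilde phid x)^-1).
    transitivity ((1 + Jop k x) / tilde phid x); first by rewrite mulrDl mul1r.
    by rewrite -s; field; apply/andP.
  have := fc_ext 0 (Lp_meas (LpD (lexx 1) hL1 hL2)) (Lp_meas (LpZ sd ltr01 hR2)) E.
  rewrite (fcD _ hL1 hL2) fc_tilde ?oppr0 ?e0; last exact: he1.1.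
  rewrite fc_Jop_Hp // addr0 (fcZ _ _ hR2) fc_Mtpow (fcD _ hR1 hke.1) fc_Mtpow.
  rewrite [fc (fun x => (phid x)^-1) _]he1.2; last by lia.
  rewrite hke.2; last by lia.
  by rewrite addr0 mulr0 => /eqP; rewrite (negbTE sd0).
have e0 := WH_e0 p1 whc; have sc0 := WH_sg_neq0 whc.
have md' := md; case: md' => -[ha hb hbV nb] [c1 c2 c3 c4].
have hv0 : Lp p (fun x => b x + a x * tpow (-1) x).
  have Lp_of h : inLinf h -> Lp p h by move=> [mh [M hM]]; have [] := Lp_bnd p0 mh hM.
  by apply: LpD => //; apply: Lp_of => //; exact: Linf_tpow.
have [y [k0 [hy hk0 ev]]] := decomp p1 hv0.
have [f hf [k hk e]] := on hy.
(* The function b + a t^-1 is a f + b J f at f = t^-1, which lies outside H^p. It has the symmetry d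
   J v = v, so h inherits d h = J h and vanishes because k2 <= 0. *)
pose h x := k x - k0 x; have hh : Hp p h by exact: HpB.
have Eh : aeq (TH a b f) (fun x => b x + a x * tpow (-1) x + Jop h x).
  by apply: ae_imp e => x _ e; rewrite /TH e ev /h JopD JopN; ring.
have hker : kerS p d 1 h.
  split=> //; have c2' := aeq_tilde c2.
  apply: ae_imp2 (ae_and (ae_and Eh (aeq_Jop Eh)) (TH_symm f md)) (ae_and (ae_and c2 c2') c4) => x _ [[h1 h2] s] [[a2 a2'] a4].
  move: s; rewrite h2 h1 !JopD JopK => s.
  have jb : Jop b x = tpow (-1) x * tilde b x by rewrite Jop_tpow.
  have ja : Jop (fun x => a x * tpow (-1) x) x = tilde d x * b x.
    rewrite JopM Jop_tpow a2' -[tilde (fun x => d x * _) x]/(tilde d x * tilde (tilde b) x) tildeK /tilde tpow_reflect opprK.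
    by rewrite mulrA -mulrA -tpowD addNr tpow0 mulr1.
  rewrite mul1r; rewrite jb ja in s.
  have : d x * (tpow (-1) x * tilde b x + tilde d x * b x + h x) = d x * tilde b x * tpow (-1) x + (d x * tilde d x) * b x + d x * h x by ring.
  rewrite s -a2 a4 mul1r [a x * _ + b x]addrC => /addrI; by [].
have h0 := kerS_trivial p1 whd k20 hker.
case: whc => -[sc2 hphi phi0 he] [nz eg _].
have [hfe _] := Hp_mul p1 hf he; have he1 := Hp1 q1' he.
have nzt : {ae mu, forall x, TT x -> tilde phic x != 0} := ae_reflect nz.
(* Now c f + J f = 1 + c t^-1, divided by phi~. On the left the mean is 0, as k1 < 0; on the right
   it is sc plus a coefficient of 1/phi at k1 + 1 < 0. *)
pose L x := sc * (tpow (- k1) x * (f x * (phic x)^-1)) + Jop (fun x => f x * (phic x)^-1) x.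
pose Rr x := tilde (fun x => (phic x)^-1) x + sc * (tpow (- k1 - 1) x * (phic x)^-1).
have hL1 : Lp 1 (fun x => tpow (- k1) x * (f x * (phic x)^-1)) by apply: Lp_Mtpow => //; exact: hfe.1.
have hL2 : Lp 1 (Jop (fun x => f x * (phic x)^-1)) by apply: Lp_Jop; exact: hfe.1.
have hR1 : Lp 1 (tilde (fun x => (phic x)^-1)) by apply: Lp_tilde; exact: he1.1.
have hR2 : Lp 1 (fun x => tpow (- k1 - 1) x * (phic x)^-1) by apply: Lp_Mtpow => //; exact: he1.1.
have E : aeq L Rr.
  apply: ae_imp2 (ae_and (ae_and Eh (aeq_Jop h0)) (ae_and c1 nb)) (ae_and (ae_and eg nzt) nz) => x _ [[h1 h2] [a1 nx]] [[ex tx] px].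
  rewrite /L /Rr (_ : Jop (fun x => f x * _) x = Jop f x * (tilde phic x)^-1); last by rewrite /Jop mulrA.
  rewrite -[tilde (fun x => _^-1) x]/((tilde phic x)^-1).
  have E1 : c x * f x + Jop f x = 1 + c x * tpow (-1) x.
    apply: (mulfI nx); transitivity (TH a b f x); first by rewrite /TH a1; ring.
    by rewrite h1 h2 Jop0 addr0 a1; ring.
  apply: (mulIf tx); rewrite tpowD.
  transitivity (c x * f x + Jop f x); first by rewrite ex; field; apply/andP.
  by rewrite E1 ex; field; apply/andP.
have := fc_ext 0 (Lp_meas (LpD (lexx 1) (LpZ sc ltr01 hL1) hL2)) (Lp_meas (LpD (lexx 1) hR1 (LpZ sc ltr01 hR2))) E.
rewrite (fcD _ (LpZ sc ltr01 hL1) hL2) (fcD _ hR1 (LpZ sc ltr01 hR2)) (fcZ _ _ hL1) (fcZ _ _ hR2) !fc_Mtpow.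
rewrite fc_tilde ?oppr0 ?e0; last exact: he1.1.
rewrite fc_Jop_Hp // hfe.2; last by lia.
rewrite he1.2; last by lia.
by rewrite !mulr0 !addr0 => /esym/eqP; rewrite (negbTE sc0).
Qed.

(** The kernel [K] of the left factor gets two bases: [F], made of solutions for c t^(-2n) and of
    lifts of solutions for d, and [e], dual to the first n Fourier coefficients. *)
Lemma dim_count (n m1 m2 : nat) : k1 + (n%:Z + n%:Z) = m1 -> k2 = m2 ->
  n = (pal_dim m1 (-1 * sc)%R + pal_dim m2 (1 * sd)%R)%N.
Proof.
move=> e1 e2; have md' := matching_data_shift n md.
have whc' := WH_shift (n%:Z + n%:Z) whc.
set a' := fun x => a x * tpow (- n%:Z) x in md'; set b' := fun x => b x * tpow n x in md'.
set c' := fun x => c x * tpow _ x in md' whc'.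
have [Fc [hFc frc spc]] := kerS_basis p1 whc' m1m1 e1.
have [Fd [hFd frd spd]] := kerS_basis p1 whd (mulr1 1) e2.
set Nc := pal_dim m1 _ in Fc hFc frc spc *; set Nd := pal_dim m2 _ in Fd hFd frd spd *.
(* Lifting needs T(c') onto, which holds because its index k1 + 2 n is the natural number m1. *)
have onc := WH_onto p1 (eq_ind_r (fun z : int => 0 <= z) (isT : 0 <= m1%:Z) e1) whc'.
have lift j : exists f, Hp p f /\ aeq (TH a' b' f) (Jop (Fd j)).
  by have [f h1 h2] := kernel_lift p1 md' onc (hFd j); exists f.
pose Lf j := sval (cid (lift j)).
have hLf j : Hp p (Lf j) by rewrite /Lf; case: cid => x [].
have eLf j : aeq (TH a' b' (Lf j)) (Jop (Fd j)) by rewrite /Lf; case: cid => x [].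
pose K f := Hp p f /\ exists2 k, Hp p k & aeq (TH a' b' f) (Jop k).
have THs f x : TH a' b' (fun x => tpow n x * f x) x = TH a b f x.
  rewrite /TH /a' /b' Jop_tpowM tpowN; have t0 := tpow_neq0 n%:Z x; by field.
(* Such an f is t^n times an element of H^p killed by T(a) + H(b); injectivity makes elements of [K]
   determined by their first n coefficients. *)
have K0 f : K f -> (forall j : nat, (j < n)%N -> fc f j = 0) -> aeq f (fun=> 0).
  move=> [hf [k hk e]] f0; have hg := Hp_div p1' hf f0.
  have E x : f x = tpow n x * (tpow (- n%:Z) x * f x) by rewrite mulrA -tpowD addrN tpow0 mul1r.
  have : aeq (fun x => tpow (- n%:Z) x * f x) (fun=> 0).
    apply: inj => //; exists k => //; apply: ae_imp e => x _ <-; rewrite add0r -[LHS]/(TH a b _ x) -THs.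
    by congr (TH _ _ _ x); apply/funext => t; rewrite -E.
  by apply: ae_imp => x _ h; rewrite E h mulr0.
pose F (i : 'I_(Nc + Nd)) := match fintype.split i with inl i => Fc i | inr j => Lf j end.
have FE v x : lincomb F v x = lincomb Fc (fun i => v (lshift Nd i)) x + lincomb Lf (fun j => v (rshift Nc j)) x.
  rewrite /lincomb big_split_ord /=; congr (_ + _); apply: eq_bigr => i _; rewrite /F.
    by case: split_ordP => j /eqP; rewrite ?eq_lrshift // (inj_eq (@lshift_inj _ _)) => /eqP ->.
  by case: split_ordP => j /eqP; rewrite ?eq_rlshift // (inj_eq (@rshift_inj _ _)) => /eqP ->.
have THlc n' (e : 'I_n' -> R -> C) (y : 'I_n' -> R -> C) v : (forall i, aeq (TH a' b' (e i)) (y i)) -> aeq (TH a' b' (lincomb e v)) (lincomb y v).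
  move=> h; apply: (@aeq_trans _ (lincomb (fun i => TH a' b' (e i)) v)).
    by apply: aeq_eq => x; exact: TH_lincomb.
  by apply: aeq_sum => i; apply: aeqZ.
have THD f g x : TH a' b' (fun x => f x + g x) x = TH a' b' f x + TH a' b' g x.
  by rewrite /TH JopD; ring.
have KFc i : aeq (TH a' b' (Fc i)) (fun=> 0) by apply: (kernel_minus md'); exact: (hFc i).2.
have JL v x : Jop (lincomb Fd v) x = lincomb (fun i => Jop (Fd i)) v x.
  by rewrite /lincomb /Jop big_distrr; apply: eq_bigr => i _; rewrite /= mulrCA.
have THF v : aeq (TH a' b' (lincomb F v)) (Jop (lincomb Fd (fun j => v (rshift Nc j)))).
  have h1 := THlc _ _ _ (fun i => v (lshift Nd i)) KFc.
  have h2 := THlc _ _ _ (fun j => v (rshift Nc j)) eLf.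
  rewrite (_ : lincomb F v = (fun x => lincomb Fc (fun i => v (lshift Nd i)) x + lincomb Lf (fun j => v (rshift Nc j)) x)).
    apply: ae_imp2 h1 h2 => x _ e1' e2'; rewrite THD e1' e2' JL (_ : lincomb (fun=> fun=> 0) _ x = 0) ?add0r //.
    by rewrite /lincomb big1 // => i _; rewrite mulr0.
  by apply/funext => x; exact: FE.
have hFd1 v : Hp p (lincomb Fd v) by apply: Hp_lincomb => // j; exact: (hFd j).1.
have hF i : Hp p (F i) by rewrite /F; case: fintype.split => j; [exact: (hFc j).1|exact: hLf].
have KF i : K (F i).
  split=> //; exists (lincomb Fd (fun j => (rshift Nc j == i)%:R)) => //.
  apply: aeq_trans (THF (fun l => (l == i)%:R)); apply: aeq_eq => x; congr (TH _ _ _ x); apply/funext => t.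
  by rewrite /lincomb (bigD1 i) //= eqxx mul1r big1 ?addr0 // => l /negbTE ->; rewrite mul0r.
(* Applying T(a') + H(b') to a vanishing combination isolates the d part, since the c part goes to
   0. *)
have freeF : ae_free F.
  move=> v hv.
  have hJ : aeq (lincomb Fd (fun j => v (rshift Nc j))) (fun=> 0).
    have h := THF v; apply: ae_imp2 (aeq_Jop h) (ae_and hv (aeq_Jop hv)) => x _; rewrite JopK => <- [fx jx].
    by rewrite /TH JopD (JopM a') (JopM b') JopK fx jx /Jop !mulr0 addr0.
  have vd := frd _ hJ.
  have vc : forall i, v (lshift Nd i) = 0.
    apply: frc; apply: ae_imp hv => x _; rewrite FE [X in _ + X](_ : _ = 0) ?addr0 //.
    by rewrite /lincomb big1 // => j _; rewrite vd mul0r.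
  by move=> i; case: (split_ordP i) => j ->.
have spanF f : K f -> exists v, aeq f (lincomb F v).
  move=> [hf [k hk e]]; have hkS : kerS p d 1 k by split=> //; exact: (kernel_symm md' e).
  have [vd evd] := spd k hkS.
  have hfl : Hp p (fun x => f x - lincomb Lf vd x) by apply: HpB => //; exact: Hp_lincomb.
  have h0 : aeq (TH a' b' (fun x => f x - lincomb Lf vd x)) (fun=> 0).
    have h2 := THlc _ _ _ vd eLf.
    apply: ae_imp2 e (ae_and h2 (aeq_Jop evd)) => x _ h [h' j].
    have -> : TH a' b' (fun x => f x - lincomb Lf vd x) x = TH a' b' f x - TH a' b' (lincomb Lf vd) x.
      by rewrite /TH JopD JopN; ring.
    by rewrite h h' j JL subrr.
  have [vc evc] := spc _ (conj hfl (kernel_zero md' h0)).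
  exists (fun i => match fintype.split i with inl i => vc i | inr j => vd j end).
  apply: ae_imp evc => x _ /eqP; rewrite subr_eq => /eqP ->; rewrite FE; congr (_ + _); apply: eq_bigr => i _; congr (_ * _).
    by case: split_ordP => j /eqP; rewrite ?eq_lrshift // (inj_eq (@lshift_inj _ _)) => /eqP ->.
  by case: split_ordP => j /eqP; rewrite ?eq_rlshift // (inj_eq (@rshift_inj _ _)) => /eqP ->.
(* Surjectivity of T(a) + H(b) supplies f with the same image as t^i under the left factor; t^i -
   t^n f is then in [K] with the first n coefficients of t^i. *)
have dual (i : 'I_n) : exists e, K e /\ forall j : nat, (j < n)%N -> fc e j = (i == j :> nat)%:R.
  have hi : Hp p (tpow i : R -> C) by exact: Hp_tpow.
  have [[ha' hb' _ _] _] := md'.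
  have hTH : Lp p (TH a' b' (tpow i)).
    have [M _ HM] := Linf_mul ha'; have [M' _ HM'] := Linf_mul hb'.
    by apply: LpD => //; [exact: (HM _ _ p0 hi.1).1|exact: (HM' _ _ p0 (Lp_Jop hi.1)).1].
  have [y [k [hy hk ey]]] := decomp p1 hTH; have [f hf [k' hk' ef]] := on hy.
  have htf : Hp p (fun x => tpow n x * f x) by exact: Hp_Mtpow.
  exists (fun x => tpow i x - tpow n x * f x); split.
    split; first exact: HpB.
    exists (fun x => k x - k' x); first exact: HpB.
    apply: ae_imp ef => x _ h.
    have -> : TH a' b' (fun x => tpow i x - tpow n x * f x) x = TH a' b' (tpow i) x - TH a' b' (fun x => tpow n x * f x) x.
      by rewrite /TH JopD JopN; ring.
    by rewrite THs ey -[TH a b f x]/(a x * f x + b x * Jop f x) h JopD JopN; ring.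
  move=> j jn; rewrite (fcB _ (Lp1 p1' hi.1) (Lp1 p1' htf.1)) fc_tpow fc_Mtpow hf.2 ?subr0 ?eqz_nat //.
  by rewrite subr_lt0 ltz_nat.
pose e i := sval (cid (dual i)).
have Ke i : K (e i) by rewrite /e; case: cid => x [].
have ce i (j : 'I_n) : fc (e i) j = (i == j)%:R.
  by rewrite /e; case: cid => x [_ h] /=; rewrite h.
have he1 i : Lp 1 (e i) by apply: (Lp1 p1'); exact: (Ke i).1.1.
have fcl v (j : 'I_n) : fc (lincomb e v) j = v j.
  rewrite fc_lincomb // (bigD1 j) //= ce eqxx mulr1 big1 ?addr0 // => i ij.
  by rewrite ce (negbTE ij) mulr0.
have freee : ae_free e.
  move=> v hv j; rewrite -fcl (fc_ext j (Lp_meas (Lp_lincomb v (lexx 1) he1)) (cmeas_cst 0) hv).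
  by rewrite fc0.
have spane f : K f -> exists v, aeq f (lincomb e v).
  move=> Kf; have [hf [k hk ek]] := Kf; exists (fun i => fc f i).
  have hl : Hp p (lincomb e (fun i => fc f i)) by apply: Hp_lincomb => // i; exact: (Ke i).1.
  pose ke i := s2val (cid2 (Ke i).2).
  have hke i : Hp p (ke i) by rewrite /ke; case: cid2.
  have eke i : aeq (TH a' b' (e i)) (Jop (ke i)) by rewrite /ke; case: cid2.
  have : aeq (fun x => f x - lincomb e (fun i => fc f i) x) (fun=> 0).
    apply: K0 => [|j jn].
      split; first exact: HpB.
      exists (fun x => k x - lincomb ke (fun i => fc f i) x); first by apply: HpB => //; exact: Hp_lincomb.
      apply: ae_imp2 ek (THlc _ _ _ (fun i => fc f i) eke) => x _ h h'.
      have -> : TH a' b' (fun x => f x - lincomb e (fun i => fc f i) x) x = TH a' b' f x - TH a' b' (lincomb e (fun i => fc f i)) x.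
        by rewrite /TH JopD JopN; ring.
      rewrite h h' JopD JopN; congr (_ - _).
      by rewrite /lincomb /Jop big_distrr; apply: eq_bigr => i _; rewrite /= mulrCA.
    by rewrite (fcB _ (Lp1 p1' hf.1) (Lp1 p1' hl.1)) (fcl _ (Ordinal jn)) subrr.
  by apply: ae_imp => x _ /eqP; rewrite subr_eq0 => /eqP.
apply/eqP; rewrite eqn_leq; apply/andP; split.
  by apply: (free_le_span _ freee) => i; apply: spanF.
by apply: (free_le_span _ freeF) => i; apply: spane.
Qed.

End Invertible.

End MatchingPairs.

(** * Parity and signs *)

Section Signs.
Variable R : realType.
Local Notation C := R[i].

Lemma sg_cases (s : C) : s * s = 1 -> s = 1 \/ s = -1.
Proof.
by move=> h; have /eqP := h; rewrite -expr2 sqrf_eq1 => /orP[/eqP|/eqP]; [left|right].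
Qed.

Lemma pal_dim_even k (t : C) : ~~ odd k -> (2 * pal_dim k t)%N = k.
Proof. by move=> ok; rewrite /pal_dim; case: ifP => _; lia. Qed.

(** For odd k the two dimensions are (k + 1)/2 and (k - 1)/2, so the sign itself is the correction;
    the identity is stated in C, where signatures live. *)
Lemma pal_dim_odd k (t : C) : t * t = 1 -> odd k -> (2 * pal_dim k t)%N%:Z%:~R = k%:Z%:~R + t :> C.
Proof.
have n11 : (-1 == 1 :> C) = false by rewrite -subr_eq0 -opprD oppr_eq0 -(natrD _ 1 1) pnatr_eq0.
move=> /sg_cases[->|->] ok; rewrite /pal_dim ?eqxx ?n11.
  by rewrite (_ : (2 * uphalf k)%N = k.+1) ?intS ?rmorphD /= 1?addrC //; lia.
by apply/eqP; rewrite -subr_eq opprK -(intrD _ _ 1) -PoszD (_ : (2 * k./2 + 1)%N = k) //; lia.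
Qed.

End Signs.

Theorem theorem4p2 (R : realType) (p : R) (a b : R -> R[i]) (kappa1 kappa2 : int) :
  1 < p ->
  in_FTH p a b kappa1 kappa2 ->
  invertible_Hp p (THop a b) ->
  ((kappa2 <= kappa1 \/ 0 <= kappa1 * kappa2) ->
     `|kappa1| <= 1 /\ `|kappa2| <= 1) /\
  (kappa1 < 0 -> 0 < kappa2 ->
     (~~ odd `|kappa1|%N -> ~~ odd `|kappa2|%N -> kappa2 = - kappa1) /\
     (odd `|kappa1|%N -> ~~ odd `|kappa2|%N ->
        kappa2%:~R = - kappa1%:~R + fsig p (subc a b) :> R[i]) /\
     (~~ odd `|kappa1|%N -> odd `|kappa2|%N ->
        kappa2%:~R = - kappa1%:~R - fsig p (subd a b) :> R[i]) /\
     (odd `|kappa1|%N -> odd `|kappa2|%N ->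
        kappa2%:~R = - kappa1%:~R + fsig p (subc a b) - fsig p (subd a b) :> R[i])).
Proof.
move=> p1 [hm [fr1 fr2]] hinv.
have [md hc hd] := matching_dataP hm.
have [[ha hb _ _] [_ _ cc dd]] := md.
have [on inj] := invertible_THsol p1 ha hb hinv.
have [sc [phic whc]] := WH_exists p1 hc cc (fredholm_Tbij p1 hc fr1).
have [sd [phid whd]] := WH_exists p1 hd dd (fredholm_Tbij p1 hd fr2).
rewrite (fsig_WH p1 hc whc) (fsig_WH p1 hd whd).
have sc2 : sc * sc = 1 by case: whc => -[].
have sd2 : sd * sd = 1 by case: whd => -[].
have le1 := inj_le1 p1 md whc whd inj.
have ge1 := onto_ge p1 md whc whd on.
split.
  move=> h; suff : [/\ kappa1 <= 1, -1 <= kappa1, kappa2 <= 1 & -1 <= kappa2].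
    by move=> [h1 h2 h3 h4]; rewrite !ler_norml h1 h2 h3 h4.
  (* Of the four sign patterns, kappa1 < 0 < kappa2 is the one that both alternatives exclude. *)
  have [k10|k10] := leP 0 kappa1; have [k20|k20] := leP kappa2 0.
  - by have [h1 h2] := le1 k10; have [h3 h4] := ge1 k20; split.
  - by have [h1 h2] := le1 k10; split=> //; lia.
  - by have [h3 h4] := ge1 k20; split=> //; lia.
  - by exfalso; case: h => h; [lia|nia].
move=> k10 k20; have E2 : kappa2 = `|kappa2|%N by lia.
have cnt (n m1 : nat) := @dim_count R p a b (subc a b) (subd a b) kappa1 kappa2 sc sd phic phid p1 md whc whd on inj n m1 `|kappa2|%N.
(* The least n with kappa1 + 2 n >= 0; for even kappa1 the shifted index is 0 and c contributes
   nothing to the count. *)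
have ev : ~~ odd `|kappa1|%N -> exists n : nat, kappa1 = - (2 * n)%N%:Z /\ n = pal_dim `|kappa2|%N sd.
  move=> o1; exists (`|kappa1|./2)%N; split; first lia.
  have := cnt (`|kappa1|./2)%N 0%N _ E2; rewrite mul1r {1}/pal_dim if_same add0n; apply; lia.
have od : odd `|kappa1|%N -> exists n : nat, kappa1 = 1 - (2 * n)%N%:Z /\ n = (pal_dim 1 (- sc) + pal_dim `|kappa2|%N sd)%N.
  move=> o1; exists (uphalf `|kappa1|)%N; split; first lia.
  have := cnt (uphalf `|kappa1|)%N 1%N _ E2; rewrite mul1r mulN1r; apply; lia.
(* Length 1 leaves the constants, which survive exactly for the sign -sc = 1. *)
have d1 : (2 * pal_dim 1 (- sc))%N%:Z%:~R = 1 - sc :> R[i].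
  by rewrite pal_dim_odd // mulrNN.
split; [|split; [|split]].
- move=> o1 o2; have [n [-> en]] := ev o1; by rewrite opprK E2 {1}en (pal_dim_even sd o2).
- move=> o1 o2; have [n [-> en]] := od o1.
  rewrite en mulnDr PoszD rmorphB rmorphD /= d1 (pal_dim_even sd o2) -E2; ring.
- move=> o1 o2; have [n [-> en]] := ev o1.
  by rewrite rmorphN /= opprK en pal_dim_odd // -E2 addrK.
- move=> o1 o2; have [n [-> en]] := od o1.
  rewrite en mulnDr PoszD rmorphB rmorphD /= d1 pal_dim_odd // -E2; ring.
Qed.
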